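(* Let $n,m\ge1$, $\mu>0$, $\nu>-1$, $D_{n,m}(\mu)=\{(z,w)\in\mathbb{C}^n\times\mathbb{C}^m:\|w\|^2<e^{-\mu\|z\|^2}\}$, $\Phi(z,w)=\nu\mu\|z\|^2-\ln\left(e^{-\mu\|z\|^2}-\|w\|^2\right)$ and $\omega(\mu;\nu)=\frac{\sqrt{-1}}{2\pi}\partial\bar\partial\Phi$. For $\alpha>m+n$, the Bergman (reproducing) kernel of the weighted Hilbert space $$\mathcal{H}_\alpha=\left\{f\in\mathrm{Hol}(D_{n,m}(\mu)):\int_{D_{n,m}(\mu)}|f|^2e^{-\alpha\Phi}\frac{\omega(\mu;\nu)^{m+n}}{(n+m)!}<\infty\right\}$$ is given on the diagonal by $$K_\alpha(z,w,\bar z,\bar w)=(\alpha-m-n)_{m+n}\,e^{\mu(\nu+1)\alpha\|z\|^2}\sum_{q\in\mathbb{N}^m}\psi(\alpha,|q|)\frac{\Gamma(|q|+\alpha)}{\Gamma(\alpha)\prod_{i=1}^m\Gamma(q_i+1)}\tilde w^q\overline{\tilde w^q},$$ where $\tilde w=e^{\frac{\mu}{2}\|z\|^2}w$, $(\alpha)_k=\frac{\Gamma(\alpha+k)}{\Gamma(\alpha)}$, $\psi(\alpha,|q|)=\frac{\Gamma(\alpha-m-n)\chi(\alpha,|q|)}{\Gamma(\alpha+|q|)}$ and $$\chi(\alpha,|q|)=\frac{[(\nu+1)\alpha+|q|]^n}{\sum_{d=0}^n\binom{n}{d}\nu^{n-d}\frac{\Gamma(\alpha-m-d)}{\Gamm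a(\alpha-d+|q|)}}.$$
   Context: $\mathbb{N}$ includes $0$; for $q\in\mathbb{N}^m$, $|q|=\sum q_i$ and $\tilde w^q=\prod_j\tilde w_j^{q_j}$; $\mathrm{Hol}$ denotes holomorphic functions; $\|\cdot\|$ is the standard Hermitian norm; $\nu^0=1$. *)

(* Defs.v *)
From HB Require Import structures.
From mathcomp Require Import all_boot all_order all_algebra.
From mathcomp Require Import all_classical all_reals all_analysis.
From mathcomp Require Import complex.
Set Implicit Arguments. Unset Strict Implicit. Unset Printing Implicit Defensive.
Import Order.TTheory GRing.Theory Num.Theory.
Import numFieldNormedType.Exports.
Local Open Scope ring_scope.
Local Open Scope classical_set_scope.

Section BergmanDefs.
Variable R : realType.

Definition C : numFieldType := R[i].
Definition rc (r : R) : C := Complex r 0.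
Definition cre (c : C) : R := complex.Re (c : R[i]).
Definition cim (c : C) : R := complex.Im (c : R[i]).
Definition cconj (c : C) : C := conjc (c : R[i]).
Definition abs2 (c : C) : R := cre c ^+ 2 + cim c ^+ 2.
Definition sqn k (v : 'rV[C]_k) : R := \sum_(j < k) abs2 (v ord0 j).

(* Gamma function, Gamma(x) = int_0^oo t^(x-1) e^(-t) dt  (used for x > 0) *)
Definition Gamma (x : R) : R :=
  fine (\int[lebesgue_measure]_(t in `]0%R, +oo[) ((t `^ (x - 1)) * expR (- t))%:E)%E.
Definition poch (a : R) (k : nat) : R := Gamma (a + k%:R) / Gamma a.

Variables (n m : nat) (mu nu : R).
Local Notation N := (n + m)%N.

Definition Dnm : set 'rV[C]_N :=
  [set p | sqn (rsubmx p : 'rV[C]_m) < expR (- mu * sqn (lsubmx p : 'rV[C]_n))].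

Definition Phi (p : 'rV[C]_N) : R :=
  nu * mu * sqn (lsubmx p : 'rV[C]_n)
  - ln (expR (- mu * sqn (lsubmx p : 'rV[C]_n)) - sqn (rsubmx p : 'rV[C]_m)).

Definition toC k (u : 'rV[R]_k * 'rV[R]_k) : 'rV[C]_k :=
  \row_j (Complex (u.1 ord0 j) (u.2 ord0 j) : C).

(* d/dz_j d/dzbar_l F = 1/4 (F_{x_j x_l} + F_{y_j y_l} + i (F_{x_j y_l} - F_{y_j x_l})) *)
Definition ddbar k (F : 'rV[R]_k * 'rV[R]_k -> R) (j l : 'I_k)
    (u : 'rV[R]_k * 'rV[R]_k) : C :=
  let ex (i : 'I_k) := ((delta_mx ord0 i : 'rV[R]_k), (0 : 'rV[R]_k)) in
  let ey (i : 'I_k) := ((0 : 'rV[R]_k), (delta_mx ord0 i : 'rV[R]_k)) in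
  rc (4^-1) *
  (Complex ('D_(ex j) ('D_(ex l) F) u + 'D_(ey j) ('D_(ey l) F) u)
           ('D_(ex j) ('D_(ey l) F) u - 'D_(ey j) ('D_(ex l) F) u) : C).

(* density of omega^k / k! w.r.t. Lebesgue measure, omega = (i/2pi) ddbar F:
   omega^k/k! = det(d_j dbar_l F) / pi^k  d(Lebesgue) *)
Definition voldens k (F : 'rV[R]_k * 'rV[R]_k -> R) (u : 'rV[R]_k * 'rV[R]_k) : R :=
  cre (\det (\matrix_(j, l) ddbar F j l u)) / pi ^+ k.

Definition updr k (x : 'rV[R]_k) (i : nat) (t : R) : 'rV[R]_k :=
  \row_j (if (j : nat) == i then t else x ord0 j).
Fixpoint iint k (r : nat) (g : 'rV[R]_k -> \bar R) (x : 'rV[R]_k) : \bar R :=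
  match r with
  | 0 => g x
  | r'.+1 => (\int[lebesgue_measure]_t iint r' g (updr x r' t))%E
  end.
(* Lebesgue integral over R^k (Tonelli: iterated integrals), for nonneg. g *)
Definition intR k (g : 'rV[R]_k -> \bar R) : \bar R := iint k g 0.
Definition intC k (g : 'rV[R]_k * 'rV[R]_k -> \bar R) : \bar R :=
  intR (fun a => intR (fun b => g (a, b))).
Definition intCr k (h : 'rV[R]_k * 'rV[R]_k -> R) : R :=
  fine (intC (fun u => (Num.max (h u) 0)%:E)) - fine (intC (fun u => (Num.max (- h u) 0)%:E)).

Variable alpha : R.

Definition wgt (u : 'rV[R]_N * 'rV[R]_N) : R :=
  \1_Dnm (toC u) * (expR (- alpha * Phi (toC u)) * voldens (fun v => Phi (toC v)) u).

Definition holo_on (f : 'rV[C]_N -> C) (A : set 'rV[C]_N) : Prop :=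
  forall p, A p -> differentiable f p.

Definition normH2 (f : 'rV[C]_N -> C) : \bar R :=
  intC (fun u => (abs2 (f (toC u)) * wgt u)%:E).

Definition inH (f : 'rV[C]_N -> C) : Prop :=
  holo_on f Dnm /\ (normH2 f < +oo)%E.

Definition innerH (f g : 'rV[C]_N -> C) : C :=
  Complex (intCr (fun u => cre (f (toC u) * cconj (g (toC u))) * wgt u))
          (intCr (fun u => cim (f (toC u) * cconj (g (toC u))) * wgt u)).

Definition is_repr_kernel (K : 'rV[C]_N -> 'rV[C]_N -> C) : Prop :=
  (forall y, Dnm y -> inH (fun x => K x y)) /\
  (forall f, inH f -> forall y, Dnm y -> f y = innerH f (fun x => K x y)).

Definition chi (k : nat) : R :=
  ((nu + 1) * alpha + k%:R) ^+ n /
  (\sum_(d < n.+1) 'C(n, d)%:R * nu ^+ (n - d)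
      * (Gamma (alpha - m%:R - d%:R) / Gamma (alpha - d%:R + k%:R))).
Definition psi (k : nat) : R :=
  Gamma (alpha - m%:R - n%:R) * chi k / Gamma (alpha + k%:R).

Definition qabs (q : 'I_m -> nat) : nat := (\sum_(i < m) q i)%N.

Definition kterm (p : 'rV[C]_N) (q : 'I_m -> nat) : C :=
  let z : 'rV[C]_n := lsubmx p in
  let w : 'rV[C]_m := rsubmx p in
  let wt := fun i => rc (expR (mu / 2 * sqn z)) * w ord0 i in
  let wq := \prod_(i < m) wt i ^+ q i in
  rc (psi (qabs q) *
      (Gamma ((qabs q)%:R + alpha) / (Gamma alpha * \prod_(i < m) Gamma ((q i)%:R + 1))))
  * (wq * cconj wq).

Definition kpartial (p : 'rV[C]_N) (K : nat) : C :=
  \sum_(q : {ffun 'I_m -> 'I_K.+1} | (qabs (fun i => (q i : nat)) <= K)%N)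
     kterm p (fun i => (q i : nat)).

Definition kformula_is (p : 'rV[C]_N) (v : C) : Prop :=
  (fun K => rc (poch (alpha - m%:R - n%:R) (m + n)
                * expR (mu * (nu + 1) * alpha * sqn (lsubmx p : 'rV[C]_n)))
            * kpartial p K) @ \oo --> v.

End BergmanDefs.

(* Main.v *)
(** Split a holomorphic function on [D_{n,m}(mu)] into its parts homogeneous of degree [s] in [w].
    The density of [e^{-alpha Phi} omega^{n+m} / (n+m)!] depends on [w] only through
    [e^{mu |z|^2} |w|^2]; its moments are Beta integrals, and they are the denominators in [chi].
    Hence on the part of degree [s] the norm is a multiple of a Gaussian (Fock space) norm, whose
    weight in [z] has parameter [lam s = mu ((nu+1) alpha + s)].  In a Fock space the reproducing
    property reduces, after a translation, to the mean value property on circles, which gives on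
    degree [s] the kernel [hcoef s * <w, b>^s * e^{lam s <z, a>}].  Parts of different degrees are
    orthogonal by rotation invariance in [w], so the kernel of the whole space is the sum over [s].
    It converges locally uniformly and, by a weighted Cauchy-Schwarz inequality, also in the
    Hilbert space; on the diagonal the multinomial theorem turns it into the sum over [q]. *)

Require Import Defs.
From HB Require Import structures.
From mathcomp Require Import all_boot all_order all_algebra.
From mathcomp Require Import all_classical all_reals all_analysis.
From mathcomp Require Import measurable_realfun complex.
From mathcomp Require Import ring lra.
Import Order.TTheory GRing.Theory Num.Theory.
Import numFieldNormedType.Exports.
Local Open Scope ring_scope.
Local Open Scope classical_set_scope.
Set Implicit Arguments. Unset Strict Implicit. Unset Printing Implicit Defensive.

(** * Iterated Lebesgue integrals *)

(** The integrals of the statement are iterated integrals over row vectors, and holomorphy is bare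
    differentiability at each point of the domain; these two facts shape the proof. First, every
    iterated integral is rewritten as one integral over some sigma-finite space, which gives
    Tonelli, Fubini and linearity. The changes of variables reduce to translations, dilations and
    shears: a complex rotation is a product of three shears. Second, derivatives are not known to be
    continuous, so the mean value property rests on Goursat's bisection, carried from rectangles to
    circles by the exponential, and measurability of a holomorphic function comes from its values on
    finer and finer grids. The homogeneous parts of [f] are circle averages; they enter through
    their mean value property, inherited from [f] by exchanging two circle averages. Inner products
    are treated through the real part of the integrand, and the imaginary part follows by replacing
    [f] with [- i f]. The tail of the kernel series is bounded in norm at a geometric rate, and so
    is the Taylor remainder of [f] along [w]. *)

Section Lebesgue1.
Context {R : realType}.
Local Notation leb := (@lebesgue_measure R).
Local Open Scope ereal_scope.

(** Lebesgue measure is determined by its values on half-open intervals, and a translation keeps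
    their lengths. *)
Lemma lebesgue_measure_shift (c : R) (A : set R) : measurable A ->
  pushforward leb ((fun x => x + c)%R : _ -> measurableTypeR R) A = leb A.
Proof.
move=> mA; apply/esym/lebesgue_measure_unique => //=.
  exact: measurable_funD.
move=> mphi _ [[a b]] /= _ <-; rewrite /pushforward.
have -> : ((fun x => x + c)%R : _ -> measurableTypeR R) @^-1` `]a, b]%classic = `](a - c)%R, (b - c)%R]%classic.
  by apply/seteqP; split => x /=; rewrite !in_itv/= => /andP[? ?]; apply/andP; split; lra.
rewrite !lebesgue_measure_itv/= !lte_fin ltrD2r; case: ifPn => // _.
by rewrite -!EFinB opprD addrACA opprK addNr addr0.
Qed.

Lemma lebesgue_measure_dilation (c : {nonneg R}) (A : set R) : (0 < c%:num)%R -> measurable A ->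
  pushforward (mscale c leb) ((fun x => c%:num * x)%R : _ -> measurableTypeR R) A = leb A.
Proof.
move=> c0 mA; apply/esym/lebesgue_measure_unique => //=.
  exact: measurable_funM.
move=> mphi _ [[a b]] /= _ <-; rewrite /pushforward /mscale/=.
have -> : ((fun x => c%:num * x)%R : _ -> measurableTypeR R) @^-1` `]a, b]%classic = `](c%:num^-1 * a)%R, (c%:num^-1 * b)%R]%classic.
  apply/seteqP; split => x /=; rewrite !in_itv/= => /andP[h1 h2]; apply/andP; split.
  - by rewrite ltr_pdivrMl.
  - by rewrite ler_pdivlMl.
  - by rewrite -ltr_pdivrMl.
  - by rewrite -ler_pdivlMl.
rewrite !lebesgue_measure_itv/= !lte_fin ltr_pM2l ?invr_gt0//; case: ifPn => // _; last by rewrite mule0.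
by rewrite -!EFinB -EFinM mulrBr !mulrA divff ?gt_eqF// !mul1r.
Qed.

Lemma ge0_integral_shift (c : R) (f : R -> \bar R) :
  measurable_fun setT f -> (forall x, 0 <= f x) ->
  \int[leb]_x f (x + c)%R = \int[leb]_x f x.
Proof.
move=> mf f0; pose phi : R -> measurableTypeR R := fun x => (x + c)%R.
have mphi : measurable_fun setT phi by exact: measurable_funD.
transitivity (\int[pushforward leb phi]_x f x).
  by rewrite ge0_integral_pushforward.
by apply: eq_measure_integral => //= A mA _; exact: lebesgue_measure_shift.
Qed.

Lemma ge0_integral_scale (c : R) (f : R -> \bar R) : (0 < c)%R ->
  measurable_fun setT f -> (forall x, 0 <= f x) ->
  \int[leb]_x f (c * x)%R = (c^-1)%:E * \int[leb]_x f x.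
Proof.
move=> c0 mf f0; pose phi : R -> measurableTypeR R := fun x => (c * x)%R.
have mphi : measurable_fun setT phi by exact: measurable_funM.
pose k := NngNum (ltW c0).
have -> : \int[leb]_x f x = \int[pushforward (mscale k leb) phi]_x f x.
  by apply: eq_measure_integral => //= A mA _; apply/esym/lebesgue_measure_dilation.
rewrite ge0_integral_pushforward// preimage_setT ge0_integral_mscale//=.
  by rewrite muleA -EFinM mulVf ?gt_eqF// mul1e.
exact: (measurableT_comp mf mphi).
Qed.

End Lebesgue1.

(* [m1 \x m2] already carries a canonical sigma-finite structure, but only for subprobabilities. *)
Section SigmaFiniteProduct.
Context d1 d2 (T1 : measurableType d1) (T2 : measurableType d2) (R : realType).
Variables (m1 : {sigma_finite_measure set T1 -> \bar R})
  (m2 : {sigma_finite_measure set T2 -> \bar R}).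
Local Open Scope ereal_scope.

Definition sfprod : set (T1 * T2) -> \bar R := m1 \x m2.

HB.instance Definition _ := Measure.on sfprod.

(** The two exhaustions are taken increasing, so that a point with coordinates in [F n] and [G k]
    lies in the product of index [maxn n k]. *)
Lemma sfprod_sigma_finite : sigma_finite setT sfprod.
Proof.
have /sigma_finiteP[F [TF ndF Foo]] := sigma_finiteT m1.
have /sigma_finiteP[G [TG ndG Goo]] := sigma_finiteT m2.
exists (fun n => F n `*` G n).
  rewrite -setXTT TF TG predeqE => -[x y]; split.
    move=> [/= [n _ Fnx] [k _ Gky]]; exists (maxn n k) => //; split.
    - by move: x Fnx; exact/subsetPset/ndF/leq_maxl.
    - by move: y Gky; exact/subsetPset/ndG/leq_maxr.
  by move=> [n _ []/= ? ?]; split; exists n.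
move=> k; have [mF fF] := Foo k; have [mG fG] := Goo k.
split; first exact: measurableX.
by rewrite /sfprod product_measure1E// lte_mul_pinfty// ge0_fin_numE.
Qed.

HB.instance Definition _ := Measure_isSigmaFinite.Build _ _ _ sfprod sfprod_sigma_finite.

End SigmaFiniteProduct.

Section IteratedLebesgue.
Context {R : realType}.
Local Notation leb := (@lebesgue_measure R).
Local Open Scope ereal_scope.

(* Measurability is tested along measurable families of points: the space of
   row vectors carries no sigma-algebra. *)
Definition rmeas d (T : measurableType d) k (u : T -> 'rV[R]_k) :=
  forall j, measurable_fun setT (fun t => u t ord0 j).

(** Substitute for Borel measurability. Quantifying over all measurable spaces allows product spaces
    as parameters, as Tonelli's theorem requires. *)
Definition rgood k (g : 'rV[R]_k -> \bar R) :=
  forall d (T : measurableType d) (u : T -> 'rV[R]_k), rmeas u ->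
    measurable_fun setT (g \o u).

Lemma rmeas_updr d (T : measurableType d) k r (u : T -> 'rV[R]_k) (y : T -> R) :
  rmeas u -> measurable_fun setT y -> rmeas (fun t => updr (u t) r (y t)).
Proof.
move=> mu my j; have [e|ne] := eqVneq (j : nat) r.
  by apply: eq_measurable_fun my => t _; rewrite mxE e eqxx.
by apply: eq_measurable_fun (mu j) => t _; rewrite mxE (negbTE ne).
Qed.

Lemma rmeas_cst d (T : measurableType d) k (x : 'rV[R]_k) : rmeas (fun _ : T => x).
Proof. by move=> j; exact: measurable_cst. Qed.

Lemma iint_ge0 k r (g : 'rV[R]_k -> \bar R) : (forall x, 0 <= g x) ->
  forall x, 0 <= iint r g x.
Proof.
by move=> g0; elim: r => [|r IH] x //=; apply: integral_ge0 => y _; exact: IH.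
Qed.

(** The new integration variable joins the parameter space, and Tonelli's theorem gives
    measurability of the partial integral. *)
Lemma iint_good k r (g : 'rV[R]_k -> \bar R) : rgood g -> (forall x, 0 <= g x) ->
  rgood (iint r g).
Proof.
move=> gg g0; elim: r => [|r IH] //= d T u mu.
apply: (@measurable_fun_fubini_tonelli_F _ _ _ _ _ leb
  (fun z : T * R => iint r g (updr (u z.1) r z.2))); last by move=> z; exact: iint_ge0.
apply: (IH _ _ (fun z : T * R => updr (u z.1) r z.2)).
apply: rmeas_updr => [j|]; last exact: measurable_snd.
exact: (measurableT_comp (mu j) measurable_fst).
Qed.

Lemma iint_slice_measurable k r (g : 'rV[R]_k -> \bar R) x i : rgood g -> (forall x, 0 <= g x) ->
  measurable_fun setT (fun y : R => iint r g (updr x i y)).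
Proof.
move=> gg g0; apply: (iint_good r gg g0 (u := fun y : R => updr x i y)).
by apply: rmeas_updr; [exact: rmeas_cst | exact: measurable_id].
Qed.

Lemma eq_iint k r (g h : 'rV[R]_k -> \bar R) : g =1 h -> iint r g =1 iint r h.
Proof. by move=> gh; elim: r => [|r IH] x //=; apply: eq_integral => y _; exact: IH. Qed.

Lemma iint_rep k r : exists d (T : measurableType d)
  (P : {sigma_finite_measure set T -> \bar R}) (U : T -> nat -> R),
  (forall i, measurable_fun setT (fun t => U t i)) /\
  forall g : 'rV[R]_k -> \bar R, rgood g -> (forall x, 0 <= g x) -> forall x,
    iint r g x = \int[P]_t g (\row_j (if (j < r)%N then U t j else x ord0 j)).
Proof.
elim: r => [|r [d [T [P [U [mU IH]]]]]].
  (* With no integration left, a point mass returns the value of [g] at [x]. *)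
  exists _, unit, (\d_tt : {measure set unit -> \bar R}), (fun _ _ => 0%R); split.
    by move=> i; exact: measurable_cst.
  move=> g gg g0 x; rewrite integral_dirac//=.
  rewrite diracE mem_set// mul1e; congr g; apply/rowP => j; by rewrite mxE.
(* The second factor carries coordinate [r], which [iint] integrates outermost. *)
exists _, (T * measurableTypeR R)%type, (sfprod P leb), (fun z i => if i == r then z.2 else U z.1 i); split.
  move=> i; case: eqP => _; first exact: measurable_snd.
  exact: (measurableT_comp (mU i) measurable_fst).
move=> g gg g0 x /=.
pose G (z : T * R) := g (\row_j (if (j < r)%N then U z.1 j else (updr x r z.2) ord0 j)).
have mG : measurable_fun setT G.
  apply: (gg _ _ (fun z : T * R => \row_j (if (j < r)%N then U z.1 j else (updr x r z.2) ord0 j))) => j.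
  under eq_fun do rewrite mxE.
  case: (j < r)%N; first exact: (measurableT_comp (mU j) measurable_fst).
  exact: (@rmeas_updr _ _ k r (fun=> x) snd (rmeas_cst x) measurable_snd j).
transitivity (\int[leb]_y \int[P]_t G (t, y)).
  by apply: eq_integral => y _; exact: IH.
rewrite -(@fubini_tonelli _ _ _ _ _ P leb G mG (fun z => g0 _)).
rewrite -[LHS](@fubini_tonelli1 _ _ _ _ _ P leb G mG (fun z => g0 _)).
apply: eq_integral => z _; congr g; apply/rowP => j; rewrite !mxE ltnS [(j <= r)%N]leq_eqVlt.
by case: (eqVneq (j : nat) r) => [e|ne] /=; rewrite ?e ?ltnn.
Qed.

Lemma intR_rep k : exists d (T : measurableType d)
  (P : {sigma_finite_measure set T -> \bar R}) (U : T -> 'rV[R]_k),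
  rmeas U /\ forall g : 'rV[R]_k -> \bar R, rgood g -> (forall x, 0 <= g x) ->
    intR g = \int[P]_t g (U t).
Proof.
have [d [T [P [U [mU H]]]]] := iint_rep k k.
exists d, T, P, (fun t => \row_j U t j); split.
  by move=> j; under eq_fun do rewrite mxE; exact: mU.
move=> g gg g0; rewrite /intR H//; apply: eq_integral => t _; congr g.
by apply/rowP => j; rewrite !mxE ltn_ord.
Qed.

Lemma iint_shift k r (g : 'rV[R]_k -> \bar R) (c : 'rV[R]_k) : (r <= k)%N ->
  rgood g -> (forall x, 0 <= g x) ->
  forall x, iint r (fun y => g (y + c)%R) x = iint r g (x + c)%R.
Proof.
move=> + gg g0; elim: r => [|r IH] //= rk x.
rewrite -[RHS](ge0_integral_shift (c ord0 (Ordinal rk)))//.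
- apply: eq_integral => y _; rewrite IH ?(ltnW rk)//; congr iint.
  apply/rowP => j; rewrite !mxE; case: eqP => // e; congr (_ + c _ _)%R; exact: val_inj.
- exact: iint_slice_measurable.
- by move=> y; exact: iint_ge0.
Qed.

Lemma iint_scale k r (g : 'rV[R]_k -> \bar R) (c : R) : (0 < c)%R ->
  rgood g -> (forall x, 0 <= g x) ->
  forall x, iint r (fun y => g (c *: y)%R) x = (c^-1 ^+ r)%:E * iint r g (c *: x)%R.
Proof.
move=> c0 gg g0; elim: r => [|r IH] x /=; first by rewrite mul1e.
transitivity (\int[leb]_t ((c^-1 ^+ r)%:E * iint r g (updr (c *: x)%R r (c * t)%R))).
  apply: eq_integral => y _; rewrite IH; congr (_ * iint _ _ _).
  by apply/rowP => j; rewrite !mxE; case: eqP.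
rewrite (ge0_integral_scale (f := fun t => (c^-1 ^+ r)%:E * iint r g (updr (c *: x)%R r t)))//.
- rewrite ge0_integralZl//.
  + by rewrite muleA -EFinM -exprS.
  + exact: iint_slice_measurable.
  + by move=> y _; exact: iint_ge0.
  + by rewrite lee_fin exprn_ge0// invr_ge0 ltW.
- by apply: measurable_funeM; exact: iint_slice_measurable.
- by move=> y; apply: mule_ge0; [rewrite lee_fin exprn_ge0// invr_ge0 ltW | exact: iint_ge0].
Qed.

Lemma intR_shift k (g : 'rV[R]_k -> \bar R) (c : 'rV[R]_k) :
  rgood g -> (forall x, 0 <= g x) -> intR (fun y => g (y + c)%R) = intR g.
Proof.
move=> gg g0; have [d [T [P [U [mU H]]]]] := iint_rep k k.
rewrite /intR iint_shift// !H//; apply: eq_integral => t _; congr g.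
by apply/rowP => j; rewrite !mxE ltn_ord.
Qed.

Lemma intR_scale k (g : 'rV[R]_k -> \bar R) (c : R) : (0 < c)%R ->
  rgood g -> (forall x, 0 <= g x) -> intR (fun y => g (c *: y)%R) = (c^-1 ^+ k)%:E * intR g.
Proof. by move=> c0 gg g0; rewrite /intR iint_scale// scaler0. Qed.

(** Coordinate [r] is integrated outside those of smaller index, so the first [n] coordinates form
    the inner integral. *)
Lemma intR_prod n m (g : 'rV[R]_(n + m) -> \bar R) :
  rgood g -> (forall x, 0 <= g x) ->
  intR g = intR (fun y : 'rV[R]_m => intR (fun x : 'rV[R]_n => g (row_mx x y))).
Proof.
move=> gg g0; rewrite /intR.
have H1 r : (r <= n)%N -> forall (x : 'rV[R]_n) (y : 'rV[R]_m),
    iint r g (row_mx x y) = iint r (fun x => g (row_mx x y)) x.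
  elim: r => [|r IH] //= rn x y; apply: eq_integral => t _.
  rewrite -IH ?(ltnW rn)//; congr iint; apply/rowP => j; rewrite !mxE.
  case: splitP => i ->; first by rewrite mxE.
  by rewrite gtn_eqF// ltn_addr.
have H2 r : (r <= m)%N -> forall (x : 'rV[R]_n) (y : 'rV[R]_m),
    iint (n + r) g (row_mx x y) = iint r (fun y => iint n g (row_mx x y)) y.
  elim: r => [|r IH] rm x y; first by rewrite addn0.
  rewrite addnS /=; apply: eq_integral => t _.
  rewrite -IH ?(ltnW rm)//; congr iint; apply/rowP => j; rewrite !mxE.
  case: splitP => i ->; last by rewrite mxE eqn_add2l.
  by rewrite ltn_eqF// ltn_addr.
by rewrite -[X in iint _ _ X]row_mx0 H2//; apply: eq_iint => y; rewrite H1.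
Qed.

(** Each integration contributes [sqrt pi]; the coordinates not yet integrated stay as parameters,
    hence the sum over [r <= j]. *)
Lemma iint_gauss k r (x : 'rV[R]_k) : (r <= k)%N ->
  iint r (fun y => (expR (- \sum_j (y ord0 j) ^+ 2))%:E) x =
  (Num.sqrt pi ^+ r * expR (- \sum_(j < k | (r <= j)%N) (x ord0 j) ^+ 2))%:E.
Proof.
elim: r x => [|r IH] x rk /=; first by rewrite expr0 mul1r.
transitivity (\int[leb]_t ((Num.sqrt pi ^+ r *
   expR (- \sum_(j < k | (r < j)%N) (x ord0 j) ^+ 2))%:E * (gauss_fun t)%:E)).
  apply: eq_integral => t _; rewrite IH ?(ltnW rk)// -EFinM -mulrA -expRD; congr (_ * expR _)%:E.
  rewrite (bigD1 (Ordinal rk))//= mxE eqxx opprD addrC; congr (- _ + - _)%R.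
  apply: eq_big => [j|j /andP[h1 h2]].
    by rewrite ltn_neqAle eq_sym andbC -(inj_eq val_inj) eq_sym.
  by rewrite mxE; case: eqP => // e; case/negP: h2; apply/eqP; exact: val_inj.
rewrite ge0_integralZl//=.
- by rewrite integralT_gauss -EFinM exprS; congr EFin; ring.
- by apply/measurable_EFinP; exact: measurable_gauss_fun.
- by move=> t _; rewrite lee_fin gauss_fun_ge0.
Qed.

End IteratedLebesgue.

(** * Integration over complex coordinate spaces and its invariances *)

Section ComplexLebesgue.
Context {R : realType}.
Local Notation C := (C R).
Local Open Scope ereal_scope.

(** The reparametrisation [p] in the hypothesis lets the representing space of [intR_rep] be
    adjoined to the parameters. *)
Lemma measurable_intR d (T : measurableType d) k (F : T -> 'rV[R]_k -> \bar R) :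
  (forall t x, 0 <= F t x) ->
  (forall d' (T' : measurableType d') (p : T' -> T) (u : T' -> 'rV[R]_k),
     measurable_fun setT p -> rmeas u -> measurable_fun setT (fun t => F (p t) (u t))) ->
  measurable_fun setT (fun t => intR (F t)).
Proof.
move=> F0 mF; have [d' [S [P [U [mU HU]]]]] := @intR_rep R k.
under eq_fun => t do (rewrite HU//; last by move=> d2 T2 u mu; exact: (mF _ _ (fun=> t) u (measurable_cst _) mu)).
apply: (@measurable_fun_fubini_tonelli_F _ _ _ _ _ P (fun z : T * S => F z.1 (U z.2))) => //.
apply: (mF _ _ fst (U \o snd)); first exact: measurable_fst.
by move=> j; exact: (measurableT_comp (mU j) measurable_snd).
Qed.

Lemma intR_swap k l (F : 'rV[R]_k -> 'rV[R]_l -> \bar R) :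
  (forall x y, 0 <= F x y) ->
  (forall d (T : measurableType d) (u : T -> 'rV[R]_k) (v : T -> 'rV[R]_l),
     rmeas u -> rmeas v -> measurable_fun setT (fun t => F (u t) (v t))) ->
  intR (fun x => intR (F x)) = intR (fun y => intR (fun x => F x y)).
Proof.
move=> F0 mF.
have [d1 [S1 [P1 [U1 [mU1 HU1]]]]] := @intR_rep R k.
have [d2 [S2 [P2 [U2 [mU2 HU2]]]]] := @intR_rep R l.
have gx x : rgood (F x) by move=> d T v mv; exact: (mF _ _ (fun=> x) v (rmeas_cst x) mv).
have gy y : rgood (F^~ y) by move=> d T u mu; exact: (mF _ _ u (fun=> y) mu (rmeas_cst y)).
rewrite HU1; last by move=> x; exact: iint_ge0.
  rewrite HU2; last by move=> y; exact: iint_ge0.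
    under eq_integral do rewrite HU2//.
    under [RHS]eq_integral do rewrite HU1//.
    apply: (fubini_tonelli (fun z : S1 * S2 => F (U1 z.1) (U2 z.2))) => //.
    apply: mF => j; first exact: (measurableT_comp (mU1 j) measurable_fst).
    exact: (measurableT_comp (mU2 j) measurable_snd).
  move=> d T v mv; apply: (@measurable_intR _ _ _ (fun t x => F x (v t))) => // d' T' p u mp mu.
  by apply: mF => // j; exact: (measurableT_comp (mv j) mp).
move=> d T u mu; apply: (@measurable_intR _ _ _ (fun t y => F (u t) y)) => // d' T' p v mp mv.
by apply: mF => // j; exact: (measurableT_comp (mu j) mp).
Qed.

Definition cmeas d (T : measurableType d) k (u : T -> 'rV[C]_k) :=
  forall j, measurable_fun setT (fun t => cre (u t ord0 j)) /\
            measurable_fun setT (fun t => cim (u t ord0 j)).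

Definition cgood k (g : 'rV[C]_k -> \bar R) :=
  forall d (T : measurableType d) (u : T -> 'rV[C]_k), cmeas u ->
    measurable_fun setT (fun t => g (u t)).

Definition lebC k (g : 'rV[C]_k -> \bar R) : \bar R := intC (fun u => g (toC u)).

Lemma cmeas_cst d (T : measurableType d) k (x : 'rV[C]_k) : cmeas (fun _ : T => x).
Proof. by move=> j; split; exact: measurable_cst. Qed.

Lemma cmeas_comp d (T : measurableType d) d' (T' : measurableType d') k
    (u : T -> 'rV[C]_k) (p : T' -> T) :
  cmeas u -> measurable_fun setT p -> cmeas (fun t => u (p t)).
Proof. by move=> mu mp j; split; [exact: (measurableT_comp (mu j).1 mp) | exact: (measurableT_comp (mu j).2 mp)]. Qed.

Lemma cmeas_toC d (T : measurableType d) k (u v : T -> 'rV[R]_k) :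
  rmeas u -> rmeas v -> cmeas (fun t => toC (u t, v t)).
Proof.
move=> mu mv j; split; [apply: eq_measurable_fun (mu j)|apply: eq_measurable_fun (mv j)];
  by move=> t _; rewrite mxE.
Qed.

Lemma rmeas_comp d (T : measurableType d) d' (T' : measurableType d') k
    (u : T -> 'rV[R]_k) (p : T' -> T) :
  rmeas u -> measurable_fun setT p -> rmeas (fun t => u (p t)).
Proof. by move=> mu mp j; exact: (measurableT_comp (mu j) mp). Qed.

(** Two copies of the representation of [intR], for the real and for the imaginary parts, combined
    in a product measure. *)
Lemma lebC_rep k : exists d (T : measurableType d)
  (P : {sigma_finite_measure set T -> \bar R}) (Z : T -> 'rV[C]_k),
  cmeas Z /\ forall g : 'rV[C]_k -> \bar R, cgood g -> (forall x, 0 <= g x) ->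
    lebC g = \int[P]_t g (Z t).
Proof.
have [d [S [P [U [mU HU]]]]] := @intR_rep R k.
exists _, (S * S)%type, (sfprod P P), (fun z => toC (U z.1, U z.2)).
have mZ : cmeas (fun z : S * S => toC (U z.1, U z.2)).
  by apply: cmeas_toC; apply: rmeas_comp mU _; [exact: measurable_fst | exact: measurable_snd].
split=> // g gg g0; rewrite /lebC /intC HU; last by move=> x; exact: iint_ge0.
  under eq_integral => t _ do (rewrite HU//; last by move=> d' T' v mv; exact: (gg _ _ _ (cmeas_toC (rmeas_cst _) mv))).
  by rewrite -[LHS](@fubini_tonelli1 _ _ _ _ _ P P (fun z : S * S => g (toC (U z.1, U z.2))))//; exact: gg.
move=> d' T u mu; apply: (@measurable_intR _ _ _ (fun t b => g (toC (u t, b)))) => // d2 T2 p v mp mv.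
by apply: gg; apply: cmeas_toC => //; exact: rmeas_comp mu mp.
Qed.

Lemma lebC_ge0 k (g : 'rV[C]_k -> \bar R) : (forall x, 0 <= g x) -> 0 <= lebC g.
Proof. by move=> g0; apply: iint_ge0 => x; exact: iint_ge0. Qed.

Lemma eq_lebC k (g h : 'rV[C]_k -> \bar R) : g =1 h -> lebC g = lebC h.
Proof. by move=> gh; apply: eq_iint => a; apply: eq_iint => b; exact: gh. Qed.

Lemma lebCZl k (g : 'rV[C]_k -> \bar R) (c : R) : (0 <= c)%R -> cgood g -> (forall x, 0 <= g x) ->
  lebC (fun x => c%:E * g x) = c%:E * lebC g.
Proof.
move=> c0 gg g0; have [d [T [P [Z [mZ H]]]]] := lebC_rep k.
rewrite !H//.
- by rewrite ge0_integralZl//; exact: gg.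
- by move=> d' T' u mu; apply: measurable_funeM; exact: gg.
- by move=> x; rewrite mule_ge0// lee_fin.
Qed.

Lemma le_lebC k (g h : 'rV[C]_k -> \bar R) : cgood g -> cgood h -> (forall x, 0 <= g x) ->
  (forall x, g x <= h x) -> lebC g <= lebC h.
Proof.
move=> gg gh g0 gleh; have [d [T [P [Z [mZ H]]]]] := lebC_rep k.
have h0 x : 0 <= h x by exact: le_trans (gleh x).
rewrite !H//; apply: ge0_le_integral => //; by [exact: gg | exact: gh].
Qed.

Lemma measurable_lebC d (T : measurableType d) k (F : T -> 'rV[C]_k -> \bar R) :
  (forall t x, 0 <= F t x) ->
  (forall d' (T' : measurableType d') (p : T' -> T) (u : T' -> 'rV[C]_k),
     measurable_fun setT p -> cmeas u -> measurable_fun setT (fun t => F (p t) (u t))) ->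
  measurable_fun setT (fun t => lebC (F t)).
Proof.
move=> F0 mF; apply: (@measurable_intR _ _ _ (fun t a => intR (fun b => F t (toC (a, b))))) => [t x|d' T' p u mp mu].
  exact: iint_ge0.
apply: (@measurable_intR _ _ _ (fun t b => F (p t) (toC (u t, b)))) => // d2 T2 q v mq mv.
by apply: mF; [exact: measurableT_comp | apply: cmeas_toC => //; exact: rmeas_comp mu mq].
Qed.

Lemma rgood_intR_toC k (g : 'rV[C]_k -> \bar R) : cgood g -> (forall x, 0 <= g x) ->
  rgood (fun a => intR (fun b => g (toC (a, b)))).
Proof.
move=> gg g0 d' T u mu; apply: (@measurable_intR _ _ _ (fun t b => g (toC (u t, b)))) => // d2 T2 p v mp mv.
by apply: gg; apply: cmeas_toC => //; exact: rmeas_comp mu mp.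
Qed.

Lemma rgood_toCl k (g : 'rV[C]_k -> \bar R) a : cgood g -> rgood (fun b => g (toC (a, b))).
Proof. by move=> gg d T v mv; apply: (gg _ _ (fun t => toC (a, v t))); exact: cmeas_toC (rmeas_cst _) mv. Qed.

Lemma rgood_toCr k (g : 'rV[C]_k -> \bar R) b : cgood g -> rgood (fun a => g (toC (a, b))).
Proof. by move=> gg d T v mv; apply: (gg _ _ (fun t => toC (v t, b))); exact: cmeas_toC mv (rmeas_cst _). Qed.

Lemma lebC_shift k (g : 'rV[C]_k -> \bar R) (c : 'rV[C]_k) : cgood g -> (forall x, 0 <= g x) ->
  lebC (fun z => g (z + c)%R) = lebC g.
Proof.
move=> gg g0; pose ca : 'rV[R]_k := \row_j cre (c ord0 j); pose cb : 'rV[R]_k := \row_j cim (c ord0 j).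
have E a b : (toC (a, b) + c)%R = toC (a + ca, b + cb)%R.
  by apply/rowP => j; rewrite !mxE /=; case: (c ord0 j) => x y /=.
transitivity (intR (fun a => intR (fun b => g (toC ((a + ca)%R, b))))).
  apply: eq_iint => a; rewrite -(intR_shift cb (rgood_toCl _ gg))//.
  by apply: eq_iint => b; rewrite E.
apply: (intR_shift (g := fun a => intR (fun b => g (toC (a, b))))); last by move=> x; exact: iint_ge0.
move=> d' T u mu; apply: (@measurable_intR _ _ _ (fun t b => g (toC (u t, b)))) => // d2 T2 p v mp mv.
by apply: gg; apply: cmeas_toC => //; exact: rmeas_comp mu mp.
Qed.

Lemma lebC_swap k (g : 'rV[C]_k -> \bar R) : cgood g -> (forall x, 0 <= g x) ->
  lebC g = intR (fun b => intR (fun a => g (toC (a, b)))).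
Proof.
move=> gg g0; apply: (intR_swap (F := fun a b => g (toC (a, b)))) => // d T u v mu mv.
exact: (gg _ _ _ (cmeas_toC mu mv)).
Qed.

Lemma lebC_scale k (g : 'rV[C]_k -> \bar R) (c : R) : (0 < c)%R -> cgood g -> (forall x, 0 <= g x) ->
  lebC (fun z => g (rc c *: z)%R) = (c^-1 ^+ (2 * k))%:E * lebC g.
Proof.
move=> c0 gg g0; have ci0 : (0 <= c^-1 ^+ k)%R by rewrite exprn_ge0// invr_ge0 ltW.
have E (a b : 'rV[R]_k) : (rc c *: toC (a, b))%R = toC (c *: a, c *: b)%R.
  by apply/rowP => j; rewrite !mxE /= /rc; apply/eqP; rewrite eq_complex /= !mul0r subr0 addr0 !eqxx.
transitivity (intR (fun a => (c^-1 ^+ k)%:E * intR (fun b => g (toC ((c *: a)%R, b))))).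
  apply: eq_iint => a; rewrite -(intR_scale c0 (rgood_toCl _ gg))//.
  by apply: eq_iint => b; rewrite E.
have h0 x : 0 <= intR (fun b => g (toC (x, b))) by exact: iint_ge0.
rewrite (intR_scale (g := fun a => (c^-1 ^+ k)%:E * intR (fun b => g (toC (a, b)))) c0).
- have [d [S [P [U [mU HU]]]]] := @intR_rep R k.
  rewrite HU.
  + rewrite ge0_integralZl//; last by apply: (rgood_intR_toC gg g0).
    rewrite -(HU (fun a => intR (fun b => g (toC (a, b)))) (rgood_intR_toC gg g0))//.
    by rewrite muleA -EFinM -exprD mul2n addnn.
  + by move=> d' T u mu; apply: measurable_funeM; exact: (rgood_intR_toC gg g0 mu).
  + by move=> x; rewrite mule_ge0// lee_fin.
- by move=> d' T u mu; apply: measurable_funeM; exact: (rgood_intR_toC gg g0 mu).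
- by move=> x; rewrite mule_ge0// lee_fin.
Qed.

(** Shears are translations in one real block with the other block frozen, so they preserve [lebC];
    rotations are factored into them below. *)
Definition shear_re k (s : R) (z : 'rV[C]_k) : 'rV[C]_k :=
  \row_j Complex (cre (z ord0 j) + s * cim (z ord0 j))%R (cim (z ord0 j)).
Definition shear_im k (s : R) (z : 'rV[C]_k) : 'rV[C]_k :=
  \row_j Complex (cre (z ord0 j)) (cim (z ord0 j) + s * cre (z ord0 j))%R.

Lemma cmeas_shear_re d (T : measurableType d) k s (u : T -> 'rV[C]_k) : cmeas u -> cmeas (fun t => shear_re s (u t)).
Proof.
move=> mu j; split; under eq_fun do rewrite mxE /=; last exact: (mu j).2.
by apply: measurable_funD; [exact: (mu j).1 | apply: measurable_funM; [exact: measurable_cst | exact: (mu j).2]].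
Qed.

Lemma cmeas_shear_im d (T : measurableType d) k s (u : T -> 'rV[C]_k) : cmeas u -> cmeas (fun t => shear_im s (u t)).
Proof.
move=> mu j; split; under eq_fun do rewrite mxE /=; first exact: (mu j).1.
by apply: measurable_funD; [exact: (mu j).2 | apply: measurable_funM; [exact: measurable_cst | exact: (mu j).1]].
Qed.

Lemma lebC_shear_im k s (g : 'rV[C]_k -> \bar R) : cgood g -> (forall x, 0 <= g x) ->
  lebC (fun z => g (shear_im s z)) = lebC g.
Proof.
move=> gg g0; apply: eq_iint => a; rewrite -(intR_shift (s *: a) (rgood_toCl a gg))//.
by apply: eq_iint => b; congr g; apply/rowP => j; rewrite !mxE.
Qed.

(** The exchange of integrals makes the real parts innermost; for fixed imaginary part the shear is
    then a translation. *)
Lemma lebC_shear_re k s (g : 'rV[C]_k -> \bar R) : cgood g -> (forall x, 0 <= g x) ->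
  lebC (fun z => g (shear_re s z)) = lebC g.
Proof.
move=> gg g0; rewrite !lebC_swap//; last by move=> d T u mu; apply: gg; exact: cmeas_shear_re.
apply: eq_iint => b; rewrite -(intR_shift (s *: b) (rgood_toCr b gg))//.
by apply: eq_iint => a; congr g; apply/rowP => j; rewrite !mxE.
Qed.

Lemma cmeas_scale d (T : measurableType d) k (c : T -> C) (u : T -> 'rV[C]_k) :
  measurable_fun setT (fun t => cre (c t)) -> measurable_fun setT (fun t => cim (c t)) ->
  cmeas u -> cmeas (fun t => c t *: u t)%R.
Proof.
move=> m1 m2 mu j; have [h1 h2] := mu j; split.
  apply: (@eq_measurable_fun _ _ _ _ _ (fun t => cre (c t) * cre (u t ord0 j) - cim (c t) * cim (u t ord0 j))%R).
    by move=> t _; rewrite mxE /cre /cim; case: (c t) => ? ?; case: (u t ord0 j).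
  by apply: measurable_funB; exact: measurable_funM.
apply: (@eq_measurable_fun _ _ _ _ _ (fun t => cre (c t) * cim (u t ord0 j) + cim (c t) * cre (u t ord0 j))%R).
  by move=> t _; rewrite mxE /cre /cim; case: (c t) => ? ?; case: (u t ord0 j).
by apply: measurable_funD; exact: measurable_funM.
Qed.

Lemma cmeasD d (T : measurableType d) k (u v : T -> 'rV[C]_k) :
  cmeas u -> cmeas v -> cmeas (fun t => u t + v t)%R.
Proof.
move=> mu mv j; split.
  apply: (@eq_measurable_fun _ _ _ _ _ (fun t => cre (u t ord0 j) + cre (v t ord0 j))%R).
    by move=> t _; rewrite mxE /cre; case: (u t ord0 j) => ? ?; case: (v t ord0 j).
  by apply: measurable_funD; [exact: (mu j).1|exact: (mv j).1].
apply: (@eq_measurable_fun _ _ _ _ _ (fun t => cim (u t ord0 j) + cim (v t ord0 j))%R).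
  by move=> t _; rewrite mxE /cim; case: (u t ord0 j) => ? ?; case: (v t ord0 j).
by apply: measurable_funD; [exact: (mu j).2|exact: (mv j).2].
Qed.

(** The rotation by [c + i s] is the product of three shears of parameters [- t], [s], [- t], where
    [t = s / (1 + c)] is the tangent of half the angle; hence the exclusion of [c = -1]. *)
Lemma lebC_rot_gen k (u : C) (g : 'rV[C]_k -> \bar R) : abs2 u = 1%R -> cre u != (-1)%R ->
  cgood g -> (forall x, 0 <= g x) ->
  lebC (fun z => g (u *: z)%R) = lebC g.
Proof.
case: u => c s; rewrite /abs2 /cre /cim /= => u1 c1 gg g0.
pose t := (s / (1 + c))%R.
have d0 : (1 + c != 0)%R by apply: contra c1 => /eqP h; apply/eqP; lra.
rewrite -(lebC_shear_re (- t) gg g0).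
rewrite -(lebC_shear_im s (g := fun z => g (shear_re (- t) z))) //; last first.
  by move=> d T v mv; apply: gg; exact: cmeas_shear_re.
rewrite -(lebC_shear_re (- t) (g := fun z => g (shear_re (- t) (shear_im s z)))) //; last first.
  by move=> d T v mv; apply: gg; apply: cmeas_shear_re; exact: cmeas_shear_im.
apply: eq_lebC => z; congr g; apply/rowP => j; rewrite !mxE /=.
case: (z ord0 j) => x y /=.
have tE : (t * (1 + c) = s)%R by rewrite /t divfK.
have ts : (1 - s * t = c)%R.
  rewrite /t; apply: (mulIf d0); rewrite mulrBl mul1r mulrA divfK//.
  have -> : (s * s = (1 - c) * (1 + c))%R by rewrite -expr2; lra.
  by ring.
transitivity (Complex (c * x - s * y)%R (c * y + s * x)%R); first by [].
congr Complex.
  transitivity (x * (1 - s * t) - y * (t * (1 + (1 - s * t))))%R; last by ring.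
  by rewrite ts tE; ring.
transitivity (y * (1 - s * t) + s * x)%R; last by ring.
by rewrite ts; ring.
Qed.

(** The remaining case [u = -1] is two rotations by [i]. *)
Lemma lebC_rot k (u : C) (g : 'rV[C]_k -> \bar R) : abs2 u = 1%R ->
  cgood g -> (forall x, 0 <= g x) ->
  lebC (fun z => g (u *: z)%R) = lebC g.
Proof.
move=> u1 gg g0; have [c1|c1] := eqVneq (cre u) (-1)%R; last exact: lebC_rot_gen.
have s0 : cim u = 0%R.
  by apply/eqP; rewrite -sqrf_eq0; apply/eqP; move: u1; rewrite /abs2 c1; lra.
pose i : C := Complex 0%R 1%R.
have i1 : abs2 i = 1%R by rewrite /abs2 /= expr0n expr1n add0r.
have ci : cre i != (-1)%R by rewrite /=; apply/eqP; lra.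
have gi : cgood (fun z => g (i *: z)%R).
  by move=> d T v mv; apply: gg; apply: cmeas_scale => //; exact: measurable_cst.
rewrite -(lebC_rot_gen i1 ci gg g0) -(lebC_rot_gen i1 ci gi)//.
apply: eq_lebC => z; congr g; rewrite scalerA; congr (_ *: _)%R.
move: c1 s0; rewrite /cre /cim; case: u {u1} => a b /= -> ->.
by apply/eqP; rewrite eq_complex /= !mul0r !mulr0 !mulr1 sub0r addr0 !eqxx.
Qed.

Lemma lebC_gauss k : lebC (fun z : 'rV[C]_k => (expR (- sqn z))%:E) = (pi ^+ k)%:E.
Proof.
have E (a b : 'rV[R]_k) : expR (- sqn (toC (a, b))) =
    (expR (- \sum_j (a ord0 j) ^+ 2) * expR (- \sum_j (b ord0 j) ^+ 2))%R.
  rewrite -expRD -opprD -big_split /=; congr (expR (- _)).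
  by apply: eq_bigr => j _; rewrite mxE.
have G : intR (fun a : 'rV[R]_k => (expR (- \sum_j (a ord0 j) ^+ 2))%:E) = (Num.sqrt pi ^+ k)%:E.
  rewrite /intR iint_gauss// big1 ?oppr0 ?expR0 ?mulr1// => i.
  by rewrite leqNgt ltn_ord.
have gg : rgood (fun b : 'rV[R]_k => (expR (- \sum_j (b ord0 j) ^+ 2))%:E).
  move=> d T u mu; apply/measurable_EFinP; apply: measurableT_comp => //.
  apply: measurableT_comp => //; apply: measurable_sum => j.
  by apply: measurable_funX; exact: mu.
have [d [S [P [U [mU HU]]]]] := @intR_rep R k.
have Z c : (0 <= c)%R -> intR (fun b : 'rV[R]_k => c%:E * (expR (- \sum_j (b ord0 j) ^+ 2))%:E) =
   c%:E * (Num.sqrt pi ^+ k)%:E.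
  move=> c0; rewrite -G !HU//.
  - by rewrite ge0_integralZl//; exact: gg.
  - by move=> d' T' u mu; apply: measurable_funeM; exact: gg.
  - by move=> x; rewrite -EFinM lee_fin mulr_ge0// expR_ge0.
transitivity (intR (fun a : 'rV[R]_k => (Num.sqrt pi ^+ k)%:E * (expR (- \sum_j (a ord0 j) ^+ 2))%:E)).
  apply: eq_iint => a; rewrite -muleC -(Z _ (expR_ge0 _)).
  by apply: eq_iint => b; rewrite E EFinM.
rewrite Z ?exprn_ge0 ?sqrtr_ge0// -EFinM -exprMn -expr2 sqr_sqrtr//.
exact: pi_ge0.
Qed.

Lemma cmeas_row_mx d (T : measurableType d) n m (u : T -> 'rV[C]_n) (v : T -> 'rV[C]_m) :
  cmeas u -> cmeas v -> cmeas (fun t => row_mx (u t) (v t)).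
Proof.
move=> mu mv j; split; under eq_fun do rewrite mxE.
  by case: (fintype.split j) => i; [exact: (mu i).1 | exact: (mv i).1].
by case: (fintype.split j) => i; [exact: (mu i).2 | exact: (mv i).2].
Qed.

(** By definition all real parts are integrated outside all imaginary parts. Three exchanges of
    integrals regroup the four real blocks into those of [z] outside those of [w]. *)
Lemma lebC_row_mx n m (g : 'rV[C]_(n + m) -> \bar R) : cgood g -> (forall x, 0 <= g x) ->
  lebC g = lebC (fun z : 'rV[C]_n => lebC (fun w : 'rV[C]_m => g (row_mx z w))).
Proof.
move=> gg g0.
pose h (a : 'rV[R]_n) (a' : 'rV[R]_m) (b : 'rV[R]_n) (b' : 'rV[R]_m) := g (row_mx (toC (a, b)) (toC (a', b'))).
have h0 a a' b b' : 0 <= h a a' b b' by exact: g0.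
have mh d (T : measurableType d) a a' b b' : rmeas a -> rmeas a' -> rmeas b -> rmeas b' ->
   measurable_fun setT (fun t : T => h (a t) (a' t) (b t) (b' t)).
  by move=> ma ma' mb mb'; apply: (gg _ _ (fun t => row_mx _ _)); apply: cmeas_row_mx; exact: cmeas_toC.
have hE a a' b b' : g (toC (row_mx a a', row_mx b b')) = h a a' b b'.
  by congr g; apply/rowP => j; rewrite !mxE /=; case: (fintype.split j) => i; rewrite !mxE.
rewrite /lebC /intC intR_prod; first last.
- by move=> x; exact: iint_ge0.
- exact: rgood_intR_toC.
transitivity (intR (fun a' => intR (fun a => intR (fun b' => intR (fun b => h a a' b b'))))).
  apply: eq_iint => a'; apply: eq_iint => a.
  rewrite intR_prod; first by apply: eq_iint => b'; apply: eq_iint => b; rewrite hE.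
    exact: rgood_toCl.
  by move=> x; exact: g0.
transitivity (intR (fun a' => intR (fun a => intR (fun b => intR (fun b' => h a a' b b'))))).
  apply: eq_iint => a'; apply: eq_iint => a.
  apply: (intR_swap (F := fun b' b => h a a' b b')) => // d T u v mu mv.
  by apply: mh => //; exact: rmeas_cst.
rewrite (intR_swap (F := fun a' a => intR (fun b => intR (fun b' => h a a' b b')))); first last.
- move=> d T u v mu mv.
  apply: (measurable_intR (F := fun t b => intR (fun b' => h (v t) (u t) b b'))) => [t x|d1 T1 p1 b mp1 mb].
    exact: iint_ge0.
  apply: (measurable_intR (F := fun t b' => h (v (p1 t)) (u (p1 t)) (b t) b')) => // d2 T2 p2 b' mp2 mb'.
  by apply: mh => //; [apply: rmeas_comp mv _|apply: rmeas_comp mu _|exact: rmeas_comp mb mp2];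
    exact: measurableT_comp.
- by move=> x y; apply: iint_ge0 => b; exact: iint_ge0.
apply: eq_iint => a.
rewrite (intR_swap (F := fun a' b => intR (fun b' => h a a' b b'))) //.
- by move=> x y; exact: iint_ge0.
- move=> d T u v mu mv.
  apply: (measurable_intR (F := fun t b' => h a (u t) (v t) b')) => // d2 T2 p2 b' mp2 mb'.
  by apply: mh => //; [exact: rmeas_comp mu mp2|exact: rmeas_comp mv mp2].
Qed.

End ComplexLebesgue.

(** * Gamma and Beta integrals *)

Section GammaBeta.
Context {R : realType}.
Local Notation leb := (@lebesgue_measure R).
Local Open Scope ereal_scope.

(** Extension by zero to the whole line, where translations and dilations act. *)
Definition pos (f : R -> R) (x : R) : R := if (0 < x)%R then f x else 0%R.

Lemma measurable_pos (f : R -> R) : measurable_fun setT f -> measurable_fun setT (pos f).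
Proof.
move=> mf; apply: measurable_fun_if => //.
- by apply: measurable_fun_ltr; [exact: measurable_cst | exact: measurable_id].
- exact: measurable_funS mf.
Qed.

Lemma pos_ge0 (f : R -> R) : (forall x, (0 < x)%R -> (0 <= f x)%R) -> forall x, (0 <= pos f x)%R.
Proof. by move=> f0 x; rewrite /pos; case: ifPn => // /f0. Qed.

Lemma integral_pos (f : R -> R) :
  \int[leb]_(x in `]0%R, +oo[) (f x)%:E = \int[leb]_x (pos f x)%:E.
Proof.
rewrite integral_mkcond; apply: eq_integral => x _; rewrite patchE /pos.
by rewrite mem_setE in_itv /= andbT; case: ifP.
Qed.

(** Kept in the extended reals, so that identities can precede convergence. *)
Definition gammaI (a : R) : \bar R := \int[leb]_x (pos (fun t => t `^ (a - 1) * expR (- t))%R x)%:E.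

Lemma GammaE a : Gamma a = fine (gammaI a).
Proof. by rewrite /Gamma integral_pos. Qed.

Lemma measurable_gamma_fun (a : R) : measurable_fun setT (fun t : R => t `^ (a - 1) * expR (- t))%R.
Proof.
apply: measurable_funM; first exact: measurable_powR.
by apply: measurableT_comp => //; exact: measurable_oppr.
Qed.

Lemma gamma_fun_ge0 (a : R) x : (0 <= pos (fun t => t `^ (a - 1) * expR (- t))%R x)%R.
Proof. by apply: pos_ge0 => {}x x0; rewrite mulr_ge0 ?powR_ge0 ?expR_ge0. Qed.

Definition betaf (a b : R) (t : R) : R :=
  if (0 < t < 1)%R then (t `^ (a - 1) * (1 - t) `^ (b - 1))%R else 0%R.

Lemma betaf_ge0 a b x : (0 <= betaf a b x)%R.
Proof. by rewrite /betaf; case: ifP => // _; rewrite mulr_ge0 ?powR_ge0. Qed.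

Lemma measurable_betaf a b : measurable_fun setT (betaf a b).
Proof.
apply: measurable_fun_if => //.
- apply: measurable_and.
    by apply: measurable_fun_ltr; [exact: measurable_cst | exact: measurable_id].
  by apply: measurable_fun_ltr; [exact: measurable_id | exact: measurable_cst].
- apply: measurable_funM.
    by apply: measurable_funS (measurable_powR (a - 1)).
  apply: (@measurable_funS _ _ _ _ setT) => //.
  apply: (measurableT_comp (measurable_powR (b - 1))).
  by apply: measurable_funB; [exact: measurable_cst | exact: measurable_id].
Qed.

Definition betaI (a b : R) : \bar R := \int[leb]_x (betaf a b x)%:E.

(* [x^{a-1} e^{-x} y^{b-1} e^{-y}] in the coordinates [s = x + y], [p = x / s] *)
Lemma gamma_beta (a b : R) : gammaI a * gammaI b = gammaI (a + b) * betaI a b.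
Proof.
pose ga x : R := pos (fun t => t `^ (a - 1) * expR (- t))%R x.
pose gb x : R := pos (fun t => t `^ (b - 1) * expR (- t))%R x.
pose gc x : R := pos (fun t => t `^ (a + b - 1) * expR (- t))%R x.
have mga : measurable_fun setT ga by apply: measurable_pos; exact: measurable_gamma_fun.
have mgb : measurable_fun setT gb by apply: measurable_pos; exact: measurable_gamma_fun.
have mgc : measurable_fun setT gc by apply: measurable_pos; exact: measurable_gamma_fun.
(* The second variable is already the sum [s], reached from [y] by a translation for fixed [x]. *)
pose H (z : R * R) : \bar R := (ga z.1 * gb (z.2 - z.1))%:E.
have H0 z : 0 <= H z by rewrite lee_fin mulr_ge0// gamma_fun_ge0.
have mH : measurable_fun setT H.
  apply/measurable_EFinP; apply: measurable_funM.
    exact: (measurableT_comp mga measurable_fst).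
  apply: (measurableT_comp mgb); apply: measurable_funB; [exact: measurable_snd|exact: measurable_fst].
transitivity (\int[leb]_x \int[leb]_y H (x, y)).
  transitivity (\int[leb]_x ((ga x)%:E * gammaI b)).
    rewrite muleC -ge0_integralZl//.
    - by apply: eq_integral => x _; rewrite muleC.
    - exact/measurable_EFinP.
    - by move=> x _; rewrite lee_fin gamma_fun_ge0.
    - by apply: integral_ge0 => x _; rewrite lee_fin gamma_fun_ge0.
  apply: eq_integral => x _.
  have gx : 0 <= (ga x)%:E by rewrite lee_fin gamma_fun_ge0.
  have gy y : setT y -> 0 <= (gb y)%:E by rewrite lee_fin gamma_fun_ge0.
  transitivity (\int[leb]_y ((ga x)%:E * (gb y)%:E)).
    exact: (esym (@ge0_integralZl _ _ _ leb setT measurableT (fun y => (gb y)%:E) ((measurable_EFinP _ _).2 mgb) _ gy gx)).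
  transitivity (\int[leb]_y H (x, y + x)%R); first by apply: eq_integral => y _; rewrite /H /= addrK EFinM.
  exact: (ge0_integral_shift x (f := fun y => H (x, y)) (measurableT_comp mH (pair1_measurable x)) (fun y => H0 _)).
rewrite (@fubini_tonelli _ _ _ _ _ leb leb H mH H0).
rewrite /gammaI muleC -ge0_integralZl//; first last.
- by apply: integral_ge0 => x _; rewrite lee_fin betaf_ge0.
- by move=> y _; rewrite lee_fin gamma_fun_ge0.
- exact/measurable_EFinP.
apply: eq_integral => s _; rewrite muleC.
have [s0|s0] := ltP 0%R s; last first.
  rewrite /pos ltNge s0 /= mul0e; apply: integral0_eq => x _.
  rewrite /H /ga /gb /pos /=; case: ifPn => x0; last by rewrite mul0r.
  by rewrite subr_gt0 ltNge (le_trans s0 (ltW x0)) /= mulr0.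
have mb : measurable_fun setT (fun x => (betaf a b x)%:E) by apply/measurable_EFinP; exact: measurable_betaf.
have := @ge0_integral_scale R (s^-1)%R (fun x => (betaf a b x)%:E) _ mb (fun x => _ : 0 <= (betaf a b x)%:E).
rewrite invr_gt0 => /(_ s0) -/(_ (fun x => betaf_ge0 a b x)).
rewrite invrK => E.
have -> : betaI a b = (s^-1)%:E * \int[leb]_x (betaf a b (s^-1 * x))%:E.
  by rewrite E muleA -EFinM mulVf ?gt_eqF// mul1e.
rewrite muleA -EFinM -ge0_integralZl//; first last.
- by rewrite lee_fin mulr_ge0// ?gamma_fun_ge0 ?invr_ge0 ?ltW.
- by move=> x _; rewrite lee_fin betaf_ge0.
- apply/measurable_EFinP; apply: (measurableT_comp (measurable_betaf a b)).
  by apply: measurable_funM.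
apply: eq_integral => x _; rewrite /H /= -EFinM; congr EFin.
rewrite /ga /gb /gc /pos /betaf s0 subr_gt0 pmulr_rgt0 ?invr_gt0// ltr_pdivrMl// mulr1.
case: (ltP 0%R x) => x0 /=; last by rewrite mul0r mulr0.
case: (ltP x s) => xs /=; last by rewrite !mulr0.
have sx0 : (0 < s - x)%R by rewrite subr_gt0.
have -> : (1 - s^-1 * x = s^-1 * (s - x))%R by rewrite mulrBr mulVf ?gt_eqF.
rewrite !powRM ?invr_ge0 ?ltW// -!powR_inv1 ?ltW// -!powRrM.
have -> : (- s = - x + - (s - x))%R by ring.
rewrite expRD.
have S : (s `^ (a + b - 1) * s `^ (-1) * s `^ (-1 * (a - 1)) * s `^ (-1 * (b - 1)) = 1)%R.
  by rewrite /powR (gt_eqF s0) -!expRD -[RHS]expR0; congr expR; ring.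
rewrite -[LHS]mul1r -[X in (X * _)%R = _]S; ring.
Qed.

(** For [b < 1] the integrand is singular at [0]: the fundamental theorem of calculus is applied on
    segments away from [0], followed by monotone convergence. *)
Lemma integral_powR01 (b : R) : (0 < b)%R ->
  betaI b 1 = (b^-1)%:E.
Proof.
move=> b0.
pose f (t : R) := (t `^ (b - 1))%R.
pose F (t : R) := (b^-1 * t `^ b)%R.
(* With [k.+2] every left end is strictly below [1], so no segment degenerates. *)
pose e (k : nat) : R := (k.+2%:R^-1)%R.
have e0 k : (0 < e k)%R by rewrite invr_gt0 ltr0n.
have e1 k : (e k < 1)%R by rewrite invf_lt1 ?ltr1n ?ltr0n.
have mf : measurable_fun setT (fun t => (f t)%:E) by apply/measurable_EFinP; exact: measurable_powR.
have I k : \int[leb]_(t in `[e k, 1%R]) (f t)%:E = (b^-1 - b^-1 * (e k) `^ b)%:E.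
  have dF (t : R) : (0 < t)%R -> is_derive t 1%R F (f t).
    move=> t0; have := is_derive1_powR b t0 => H.
    have -> : f t = (b^-1 *: (b * t `^ (b - 1) : R^o))%R.
      by rewrite /GRing.scale /= mulrA mulVf ?gt_eqF// mul1r.
    exact: is_deriveZ.
  have cF (t : R) : (0 < t)%R -> {for t, continuous F}.
    by move=> t0; apply: differentiable_continuous; apply/derivable1_diffP; have [] := dF t t0.
  have cf (t : R) : (0 < t)%R -> {for t, continuous f}.
    move=> t0; apply: differentiable_continuous; apply/derivable1_diffP.
    by have [] := is_derive1_powR (b - 1) t0.
  rewrite (continuous_FTC2 (e1 k) (F := F)).
  - by rewrite /F powR1 mulr1 -EFinB.
  - apply: continuous_in_subspaceT => t; rewrite inE /= in_itv /= => /andP[et _].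
    by apply: cf; exact: lt_le_trans et.
  - split.
    + move=> t; rewrite in_itv /= => /andP[et _].
      by have [] := dF t (lt_trans (e0 k) et).
    + by apply: cvg_at_right_filter; exact: cF.
    + by apply: cvg_at_left_filter; exact: cF.
  - move=> t; rewrite in_itv /= => /andP[et _].
    by rewrite derive1E; apply: derive_val; exact: dF (lt_trans (e0 k) et).
have E : betaI b 1 = \int[leb]_(t in \bigcup_k `[e k, 1%R]) (f t)%:E.
  have -> : \bigcup_k `[e k, 1%R]%classic = `]0%R, 1%R]%classic :> set R.
    apply/seteqP; split => [t [k _] /=|t /=]; rewrite !in_itv /=.
      by move=> /andP[h ->]; rewrite (lt_le_trans (e0 k) h).
    move=> /andP[t0 t1]; exists (Num.truncn (t^-1)) => //=; rewrite in_itv /= t1 andbT /e.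
    rewrite -[leRHS]invrK lef_pV2 ?posrE ?invr_gt0 ?ltr0n//.
    by apply: ltW; apply: lt_trans (truncnS_gt _) _; rewrite ltr_nat.
  rewrite -(@integral_itv_bndo_bndc _ _ 1%R); last exact: measurable_funS mf.
  rewrite /betaI integral_mkcond [RHS]integral_mkcond; apply: eq_integral => t _.
  rewrite !patchE mem_setT mem_setE in_itv /= /betaf subrr.
  by case: ifP => // /andP[t0 t1]; rewrite powRr0 mulr1.
have h1 : (\int[leb]_(t in `[e k, 1%R]) (f t)%:E) @[k --> \oo] --> \int[leb]_(t in \bigcup_k `[e k, 1%R]) (f t)%:E.
  apply: ge0_nondecreasing_set_cvg_integral => //.
  - move=> k l kl; apply/subsetPset => t /=; rewrite !in_itv /= => /andP[h ->]; rewrite andbT.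
    by apply: le_trans h; rewrite /e lef_pV2 ?posrE ?ltr0n// ler_nat !ltnS.
  - by move=> k; exact: measurable_funS mf.
  - by move=> k t _; rewrite lee_fin powR_ge0.
rewrite E -(cvg_lim _ h1)//; apply/cvg_lim => //.
rewrite (_ : (fun k => _) = (fun k => (b^-1 - b^-1 * (e k) `^ b)%:E)); last by apply/funext.
apply: cvg_EFin; first by apply: nearW.
rewrite [X in _ --> X](_ : _ = (b^-1 - b^-1 * 0)%R); last by rewrite mulr0 subr0.
apply: cvgB; first exact: cvg_cst.
apply: cvgM; first exact: cvg_cst.
apply/cvgr0Pnorm_lt => eps eps0.
have d0 : (0 < eps `^ (b^-1))%R by rewrite powR_gt0.
near=> k.
rewrite ger0_norm ?powR_ge0//.
have -> : eps = ((eps `^ (b^-1)) `^ b)%R by rewrite -powRrM mulVf ?gt_eqF// powRr1// ltW.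
apply: gt0_ltr_powR => //; rewrite ?nnegrE ?ltW//.
rewrite /e invf_plt ?posrE ?ltr0n//.
apply: lt_trans (truncnS_gt _) _; rewrite ltr_nat ltnS.
by near: k; exact: nbhs_infty_ge.
Unshelve. all: by end_near.
Qed.

(** This is the total mass of the exponential distribution of rate [1]. *)
Lemma gammaI1 : gammaI 1 = 1.
Proof.
rewrite -(@integral_exponential_pdf R 1%R)//.
rewrite /gammaI -integral_pos (@integral_itv_obnd_cbnd _ _ _ (fun x => (x `^ (1 - 1) * expR (- x))%:E)).
  rewrite integral_mkcond; apply: eq_integral => x _; rewrite patchE mem_setE in_itv /= andbT.
  case: ifPn => x0; first by rewrite exponential_pdfE// subrr powRr0 mul1r mulN1r mul1r.
  by rewrite lt0_exponential_pdf// ltNge.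
apply/measurable_EFinP; apply: (@measurable_funS _ _ _ _ setT) => //; exact: measurable_gamma_fun.
Qed.

Lemma gammaI_ge0 a : 0 <= gammaI a.
Proof. by apply: integral_ge0 => x _; rewrite lee_fin gamma_fun_ge0. Qed.

(** The case of second parameter [1] in [gamma_beta], where both extra factors are known. *)
Lemma gammaI_rec (b : R) : (0 < b)%R -> gammaI (b + 1) = b%:E * gammaI b.
Proof.
move=> b0; have E : gammaI b = gammaI (b + 1) * (b^-1)%:E.
  apply: etrans (esym (etrans (congr1 (fun z => gammaI b * z) gammaI1) (mule1 _))) _.
  exact: etrans (gamma_beta b 1) (congr1 (fun z => gammaI (b + 1) * z) (integral_powR01 b0)).
by rewrite [X in _ = _ * X]E muleCA -EFinM mulfV ?gt_eqF// mule1.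
Qed.

Lemma gammaI_nat (k : nat) : gammaI k.+1%:R = k`!%:R%:E.
Proof.
elim: k => [|k IH]; first by rewrite gammaI1.
by rewrite -addn1 natrD gammaI_rec ?ltr0n// IH -EFinM -natrM factS.
Qed.

Lemma measurable_gamma_posE a : measurable_fun setT (fun x => (pos (fun t : R => t `^ (a - 1) * expR (- t))%R x)%:E).
Proof. by apply/measurable_EFinP; apply: measurable_pos; exact: measurable_gamma_fun. Qed.

Lemma gammaI_lty (a : R) : (0 < a)%R -> gammaI a < +oo.
Proof.
(* The recursion raises the exponent to [a > 0]; there [t ^ a] is at most [1 + t ^ k] with [k] an
   integer above [a], and both terms have finite integrals. *)
move=> a0; suff : gammaI (a + 1) < +oo.
  rewrite gammaI_rec//; case: (gammaI a) (gammaI_ge0 a) => [x| |]//= _.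
    by move=> _; rewrite ltry.
  by rewrite gt0_muley ?lte_fin.
pose k := (Num.truncn a).+1.
have ak : (a <= k%:R)%R by apply: ltW; exact: truncnS_gt.
apply: (@le_lt_trans _ _ (gammaI 1 + gammaI k.+1%:R)); last by rewrite gammaI1 gammaI_nat ltry.
rewrite /gammaI -ge0_integralD//; first last.
- exact: measurable_gamma_posE.
- by move=> x _; rewrite lee_fin gamma_fun_ge0.
- exact: measurable_gamma_posE.
- by move=> x _; rewrite lee_fin gamma_fun_ge0.
apply: ge0_le_integral => //.
- by move=> x _; rewrite lee_fin gamma_fun_ge0.
- exact: measurable_gamma_posE.
- by apply: emeasurable_funD; exact: measurable_gamma_posE.
move=> x _; rewrite -EFinD lee_fin /pos; case: ifPn => [x0|]; last by rewrite addr0.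
rewrite -mulrDl ler_wpM2r ?expR_ge0// subrr powRr0 addrK -natr1 addrK powR_mulrn ?(ltW x0)//.
have [x1|x1] := leP x 1%R.
  apply: (@le_trans _ _ 1%R); last by rewrite lerDl exprn_ge0 ?ltW.
  apply: (@le_trans _ _ (1 `^ a)%R); last by rewrite powR1.
  by apply: ge0_ler_powR => //; rewrite ?nnegrE ?ler01 ?(ltW a0) ?(ltW x0).
rewrite -powR_mulrn ?(ltW x0)//; apply: (@le_trans _ _ (x `^ k%:R)%R); last by rewrite lerDr.
by apply: ler_powR => //; exact: ltW.
Qed.

Lemma gammaI_EFin (a : R) : (0 < a)%R -> gammaI a = (Gamma a)%:E.
Proof. by move=> a0; rewrite GammaE fineK// ge0_fin_numE ?gammaI_lty// gammaI_ge0. Qed.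

Lemma Gamma_nat (k : nat) : Gamma (k.+1%:R : R) = k`!%:R%R.
Proof. by rewrite GammaE gammaI_nat. Qed.

Lemma Gamma_rec (b : R) : (0 < b)%R -> Gamma (b + 1) = (b * Gamma b)%R.
Proof. by move=> b0; apply: EFin_inj; rewrite EFinM -!gammaI_EFin ?addr_gt0// gammaI_rec. Qed.

(** After one step of the recursion the integrand is at least [exp (- 2)] on the segment from [1] to
    [2]. *)
Lemma Gamma_gt0 (a : R) : (0 < a)%R -> (0 < Gamma a)%R.
Proof.
move=> a0; rewrite -(pmulr_rgt0 _ a0) -Gamma_rec// -lte_fin -gammaI_EFin ?addr_gt0//.
apply: (@lt_le_trans _ _ (expR (- 2))%:E); first by rewrite lte_fin expR_gt0.
rewrite /gammaI.
have -> : (expR (- 2))%:E = \int[leb]_(x in `[1%R, 2%R]) (expR (- 2))%:E :> \bar R.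
  rewrite integral_cst//= lebesgue_measure_itv/= lte_fin ltr1n -EFinB.
  by rewrite (_ : 2 - 1 = 1)%R ?mule1//; ring.
apply: (@le_trans _ _ (\int[leb]_(x in `[1%R, 2%R]) (pos (fun t : R => t `^ (a + 1 - 1) * expR (- t))%R x)%:E)).
  apply: ge0_le_integral => //.
  - by apply: (@measurable_funS _ _ _ _ setT) => //; exact: measurable_gamma_posE.
  move=> x /=; rewrite in_itv /= => /andP[x1 x2]; rewrite lee_fin /pos ifT; last exact: lt_le_trans x1.
  rewrite addrK -[leLHS]mul1r ler_pM ?expR_ge0// ?ler_expR ?lerN2//.
  by rewrite -(powRr0 x) ler_powR// ltW.
apply: ge0_subset_integral => //; first exact: measurable_gamma_posE.
by move=> x _; rewrite lee_fin gamma_fun_ge0.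
Qed.

Lemma betaI_EFin (a b : R) : (0 < a)%R -> (0 < b)%R ->
  betaI a b = (Gamma a * Gamma b / Gamma (a + b))%:E.
Proof.
move=> a0 b0; have ab0 : (0 < a + b)%R by exact: addr_gt0.
have g0 := Gamma_gt0 ab0.
rewrite EFinM (EFinM (Gamma a)) -!gammaI_EFin// gamma_beta gammaI_EFin//.

by rewrite muleAC -EFinM mulfV ?gt_eqF// mul1e.
Qed.

End GammaBeta.

(** * Goursat's theorem for real one-forms *)

Section SegmentIntegral.
Context {R : realType}.
Local Notation leb := (@lebesgue_measure R).
Implicit Types (f g : R -> R) (a b c : R).

Definition Int f a b : R := \int[leb]_(x in `[a, b]) f x.

(** Continuity is two-sided also at the endpoints, so the notion restricts to subsegments. *)
Definition cts_on f a b := forall x, a <= x <= b -> {for x, continuous f}.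

Lemma cts_integrable f a b : cts_on f a b -> leb.-integrable `[a, b] (EFin \o f).
Proof.
move=> cf; apply: continuous_compact_integrable; first exact: segment_compact.
by apply: continuous_in_subspaceT => x; rewrite inE /= in_itv /= => xab; exact: cf.
Qed.

Lemma IntD f a b c : a <= b -> b <= c -> cts_on f a c -> Int f a c = Int f a b + Int f b c.
Proof.
move=> ab bc cf; have If := cts_integrable cf.
have := @Rintegral_itvB R f (BLeft a) (BRight c) b If.
rewrite !bnd_simp => /(_ ab bc) E; rewrite /Int -(@Rintegral_itv_obnd_cbnd _ b).
  by rewrite -E addrC subrK.
apply: (integrableS _ _ _ If) => //; apply: subset_itvr; rewrite bnd_simp //.
Qed.

Lemma IntB f g a b : cts_on f a b -> cts_on g a b ->
  Int (fun x => f x - g x) a b = Int f a b - Int g a b.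
Proof. by move=> cf cg; rewrite /Int RintegralB//; exact: cts_integrable. Qed.

Lemma Int_cst k a b : a <= b -> Int (fun=> k) a b = k * (b - a).
Proof.
move=> ab; rewrite /Int Rintegral_cst//= lebesgue_measure_itv/= lte_fin.
case: ltP => [_|ba]; first by rewrite -EFinD.
by have -> : a = b; [apply/eqP; rewrite eq_le ab ba | rewrite subrr mulr0].
Qed.

Lemma cts_on_cst (k : R) a b : cts_on (fun=> k) a b.
Proof. by move=> x _; exact: cvg_cst. Qed.

Lemma cts_onB f g a b : cts_on f a b -> cts_on g a b -> cts_on (fun x => f x - g x) a b.
Proof. by move=> cf cg x xab; apply: cvgB; [exact: cf | exact: cg]. Qed.

Lemma Int_bound f a b (M : R) : a <= b -> cts_on f a b ->
  (forall x, a <= x <= b -> `|f x| <= M) -> `|Int f a b| <= M * (b - a).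
Proof.
move=> ab cf fM; have If := cts_integrable cf.
apply: le_trans (le_normr_Rintegral _ If) _ => //.
rewrite -(Int_cst M ab); apply: le_Rintegral => //.
- exact: integrable_norm.
- exact: (@cts_integrable (fun=> M) a b (@cts_on_cst M a b)).
Qed.

End SegmentIntegral.

Section Goursat.
Context {R : realType}.
Implicit Types (p q : R -> R -> R).

(* [p] and [q] are differentiable at [(s, t)] with [dp/dt = dq/ds]; no continuity of
   the derivatives is assumed, as in Goursat's theorem. *)
Definition closed_at p q s t := exists A B D : R, forall e : R, 0 < e -> exists2 d : R, 0 < d &
  forall h k : R, `|h| < d -> `|k| < d ->
    `|p (s + h) (t + k) - p s t - (A * h + B * k)| <= e * (`|h| + `|k|) /\
    `|q (s + h) (t + k) - q s t - (B * h + D * k)| <= e * (`|h| + `|k|).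

Lemma near_dist (s d : R) : 0 < d -> \forall x \near s, `|x - s| < d.
Proof. by move=> d0; apply/nbhs_ballP; exists d => //= y; rewrite /ball /= distrC. Qed.

Lemma lip_continuous (f : R -> R) (s d K : R) : 0 < d -> 0 <= K ->
  (forall h, `|h| < d -> `|f (s + h) - f s| <= K * `|h|) -> {for s, continuous f}.
Proof.
move=> d0 K0 H; have K1 : 0 < K + 1 by rewrite ltr_wpDl.
apply/cvgrPdist_le => /= e e0; near=> x.
have xd : `|x - s| < d by near: x; exact: near_dist.
have xe : `|x - s| < e / (K + 1) by near: x; apply: near_dist; rewrite divr_gt0.
have := H _ xd; rewrite subrKC distrC => /le_trans; apply.
move: xe; rewrite ltr_pdivlMr// => /ltW; apply: le_trans.
by rewrite mulrC ler_wpM2l// lerDl.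
Unshelve. all: by end_near.
Qed.

(** With error constant [1] and one increment equal to zero, each function is Lipschitz at the point
    along each axis. *)
Lemma closed_at_cont p q s t : closed_at p q s t ->
  [/\ {for s, continuous (p^~ t)}, {for t, continuous (p s)},
      {for s, continuous (q^~ t)} & {for t, continuous (q s)}].
Proof.
move=> [A [B [D H]]]; have [d d0 {}H] := H 1 ltr01.
have aux (u v w : R) : `|u - v * w| <= 1 * `|w| -> `|u| <= (`|v| + 1) * `|w|.
  move=> h; rewrite mulrDl -normrM; apply: le_trans (lerD (lexx _) h).
  by rewrite -{1}(subrK (v * w) u) addrC ler_normD.
have K0 (v : R) : 0 <= `|v| + 1 by rewrite addr_ge0.
split; [apply: (@lip_continuous _ _ d (`|A| + 1)) => // h hd|
        apply: (@lip_continuous _ _ d (`|B| + 1)) => // h hd|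
        apply: (@lip_continuous _ _ d (`|B| + 1)) => // h hd|
        apply: (@lip_continuous _ _ d (`|D| + 1)) => // h hd]; apply: aux.
- by have := (H h 0 hd); rewrite normr0 !mulr0 !addr0 => /(_ d0)[].
- by have := (H 0 h); rewrite normr0 !mulr0 !addr0 !add0r => /(_ d0 hd)[].
- by have := (H h 0 hd); rewrite normr0 !mulr0 !addr0 => /(_ d0)[_ ?].
- by have := (H 0 h); rewrite normr0 !mulr0 !addr0 !add0r => /(_ d0 hd)[_ ?].
Qed.

(* The integral of [p ds + q dt] around a rectangle. *)
Definition circ p q (a b w h : R) : R :=
  Int (p^~ b) a (a + w) - Int (p^~ (b + h)) a (a + w) +
  (Int (q (a + w)) b (b + h) - Int (q a) b (b + h)).

Definition closed_on p q (a b w h : R) :=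
  forall s t : R, a <= s <= a + w -> b <= t <= b + h -> closed_at p q s t.

Lemma closed_on_cts p q (a b w h : R) : closed_on p q a b w h ->
  (forall t : R, b <= t <= b + h -> cts_on (p^~ t) a (a + w)) /\
  (forall s : R, a <= s <= a + w -> cts_on (q s) b (b + h)).
Proof.
by move=> H; split=> [t tb s sa|s sa t tb]; have [] := closed_at_cont (H _ _ sa tb).
Qed.

(** Each inner side belongs to two quarters and is run through in opposite directions. *)
Lemma circ_quarter p q (a b w h : R) : 0 <= w -> 0 <= h -> closed_on p q a b (w + w) (h + h) ->
  circ p q a b (w + w) (h + h) = circ p q a b w h + circ p q (a + w) b w h +
    circ p q a (b + h) w h + circ p q (a + w) (b + h) w h.
Proof.
move=> w0 h0 /closed_on_cts[cp cq].
have P t : b <= t <= b + (h + h) -> Int (p^~ t) a (a + (w + w)) = Int (p^~ t) a (a + w) + Int (p^~ t) (a + w) (a + w + w).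
  by move=> tb; rewrite addrA (@IntD _ _ _ (a + w)) ?lerDl// -addrA; exact: cp.
have Q s : a <= s <= a + (w + w) -> Int (q s) b (b + (h + h)) = Int (q s) b (b + h) + Int (q s) (b + h) (b + h + h).
  by move=> sa; rewrite addrA (@IntD _ _ _ (b + h)) ?lerDl// -addrA; exact: cq.
rewrite /circ !P ?Q; try lra.
by rewrite !addrA; ring.
Qed.

(** The linear parts contribute [- B h w] on the horizontal sides and [B w h] on the vertical ones.
    They cancel because [dp/dt] and [dq/ds] are the same [B]. The factor [2] counts the errors on
    two opposite sides. *)
Lemma circ_small p q (a b w h s t A B D e : R) : 0 <= w -> 0 <= h -> 0 <= e -> closed_on p q a b w h ->
  (forall x y, a <= x <= a + w -> b <= y <= b + h ->
    `|p x y - p s t - (A * (x - s) + B * (y - t))| <= e * (w + h) /\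
    `|q x y - q s t - (B * (x - s) + D * (y - t))| <= e * (w + h)) ->
  `|circ p q a b w h| <= 2 * e * (w + h) ^+ 2.
Proof.
move=> w0 h0 e0 /closed_on_cts[cp cq] H.
have E : circ p q a b w h =
  Int (fun x => (p x b - p x (b + h)) - (- (B * h))) a (a + w) + Int (fun y => (q (a + w) y - q a y) - B * w) b (b + h).
  rewrite !IntB ?Int_cst ?lerDl//; first (by rewrite /circ !(addrAC _ _ (- a)) !(addrAC _ _ (- b)) !subrr !add0r; ring).
  all: try exact: cts_on_cst.
  all: try apply: cts_onB.
  all: try (apply: cp; lra).
  all: try (apply: cq; lra).
rewrite E; apply: le_trans (ler_normD _ _) _.
have -> : 2 * e * (w + h) ^+ 2 = 2 * e * (w + h) * (a + w - a) + 2 * e * (w + h) * (b + h - b) by ring.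
apply: lerD; apply: Int_bound; rewrite ?lerDl//.
- apply: cts_onB; last exact: cts_on_cst.
  by apply: cts_onB; apply: cp; lra.
- move=> x xa; have [|h1 _] := H x b xa; first lra.
  have [|h2 _] := H x (b + h) xa; first lra.
  move: h1 h2; rewrite !ler_norml => /andP[? ?] /andP[? ?]; apply/andP; split; lra.
- apply: cts_onB; last exact: cts_on_cst.
  by apply: cts_onB; apply: cq; lra.
- move=> y yb; have [||_ h1] := H (a + w) y; [lra|by []|].
  have [||_ h2] := H a y; [lra|by []|].
  move: h1 h2; rewrite !ler_norml => /andP[? ?] /andP[? ?]; apply/andP; split; lra.
Qed.

(** Every left end lies below every right end, so the supremum of the left ends belongs to all
    intervals. *)
Lemma nested_intervals (a : nat -> R) (w : R) : 0 <= w ->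
  (forall n, a n <= a n.+1 /\ a n.+1 + w / 2 ^+ n.+1 <= a n + w / 2 ^+ n) ->
  exists s, forall n, a n <= s <= a n + w / 2 ^+ n.
Proof.
move=> w0 H.
have up k n : a n <= a (n + k)%N.
  by elim: k => [|k IH]; rewrite ?addn0// addnS (le_trans IH)//; case: (H (n + k)%N).
have dn k n : a (n + k)%N + w / 2 ^+ (n + k) <= a n + w / 2 ^+ n.
  by elim: k => [|k IH]; rewrite ?addn0// addnS (le_trans _ IH)//; case: (H (n + k)%N).
have wn n : 0 <= w / 2 ^+ n by rewrite divr_ge0// exprn_ge0.
have ub n m : a m <= a n + w / 2 ^+ n.
  have [nm|mn] := leqP n m.
    have := dn (m - n)%N n; rewrite subnKC//; apply: le_trans; by rewrite lerDl.
  apply: (@le_trans _ _ (a n)); last by rewrite lerDl.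
  by have := up (n - m)%N m; rewrite subnKC// ltnW.
exists (sup (range a)) => n; apply/andP; split.
  apply: ub_le_sup; last by exists n.
  by exists (a 0%N + w / 2 ^+ 0) => _ [m _ <-]; exact: ub.
by apply: ge_sup => [|_ [m _ <-]]; [exists (a 0%N), 0%N | exact: ub].
Qed.

(** Goursat's bisection: one quarter keeps at least a quarter of the circulation, so in the limit it
    is at least [c / 4 ^ n]. Differentiability at the common point bounds it by a small multiple of
    the squared size, which decays at the same rate. *)
Lemma closed_form_circ0 p q (a b w h : R) : 0 <= w -> 0 <= h -> closed_on p q a b w h ->
  circ p q a b w h = 0.
Proof.
move=> w0 h0 C; apply/eqP/negPn/negP => N0.
pose c : R := `|circ p q a b w h|; have c0 : 0 < c by rewrite normr_gt0.
pose W n : R := w / 2 ^+ n; pose H n : R := h / 2 ^+ n.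
have W0 n : 0 <= W n by rewrite divr_ge0// exprn_ge0.
have H0 n : 0 <= H n by rewrite divr_ge0// exprn_ge0.
have WS n : W n.+1 + W n.+1 = W n by rewrite /W exprS invfM; field; rewrite expf_neq0.
have HS n : H n.+1 + H n.+1 = H n by rewrite /H exprS invfM; field; rewrite expf_neq0.
pose P (n : nat) (z : R * R) := [/\ closed_on p q z.1 z.2 (W n) (H n) & c / 4 ^+ n <= `|circ p q z.1 z.2 (W n) (H n)|].
(* The property of the current rectangle is put as a premise, so that [choice] yields a total
   function to iterate. *)
have step (x : nat * (R * R)) : exists z : R * R, P x.1 x.2 -> [/\ P x.1.+1 z,
   x.2.1 <= z.1 /\ z.1 + W x.1.+1 <= x.2.1 + W x.1 & x.2.2 <= z.2 /\ z.2 + H x.1.+1 <= x.2.2 + H x.1].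
  case: x => n [u v] /=; have [Pn|nP] := pselect (P n (u, v)); last by exists (u, v).
  have [/= Cn Kn] := Pn.
  have sub u' v' : u <= u' -> u' + W n.+1 <= u + W n -> v <= v' -> v' + H n.+1 <= v + H n ->
      closed_on p q u' v' (W n.+1) (H n.+1).
    move=> h1 h2 h3 h4 s t /andP[? ?] /andP[? ?]; apply: Cn; apply/andP; split; lra.
  have w1 := W0 n.+1; have v1 := H0 n.+1.
  suff : [\/ c / 4 ^+ n.+1 <= `|circ p q u v (W n.+1) (H n.+1)|,
             c / 4 ^+ n.+1 <= `|circ p q (u + W n.+1) v (W n.+1) (H n.+1)|,
             c / 4 ^+ n.+1 <= `|circ p q u (v + H n.+1) (W n.+1) (H n.+1)| |
             c / 4 ^+ n.+1 <= `|circ p q (u + W n.+1) (v + H n.+1) (W n.+1) (H n.+1)|].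
    have WSn := WS n; have HSn := HS n; clear Kn Cn Pn c0 N0.
    case=> K; [exists (u, v)|exists (u + W n.+1, v)|exists (u, v + H n.+1)|exists (u + W n.+1, v + H n.+1)];
      move=> _; (split; [split => //=; apply: sub => /=; clear K; lra|clear K; split; rewrite /=; lra|clear K; split; rewrite /=; lra]).
  move: Kn; rewrite -WS -HS circ_quarter//; last by rewrite WS HS.
  set x1 := circ _ _ _ _ _ _; set x2 := circ _ _ _ _ _ _; set x3 := circ _ _ _ _ _ _; set x4 := circ _ _ _ _ _ _; clearbody x1 x2 x3 x4.
  have -> : c / 4 ^+ n = 4 * (c / 4 ^+ n.+1) by rewrite exprS invfM; field; rewrite expf_neq0.
  set k := c / 4 ^+ n.+1; clearbody k => Kn.
  have T : 4 * k <= `|x1| + `|x2| + `|x3| + `|x4|.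
    apply: le_trans Kn _; apply: le_trans (ler_normD _ _) _; apply: lerD => //.
    by apply: le_trans (ler_normD _ _) _; apply: lerD => //; exact: ler_normD.
  have [?|?] := leP k `|x1|; first by constructor 1.
  have [?|?] := leP k `|x2|; first by constructor 2.
  have [?|?] := leP k `|x3|; first by constructor 3.
  by constructor 4; lra.
have [f fP] := choice step.
pose z := fix z n := if n is n'.+1 then f (n', z n') else (a, b).
have Pz n : P n (z n).
  elim: n => [|n IH].
    by split=> /=; rewrite /W /H expr0 !divr1.
  by have [] := fP (n, z n) IH.
have [s Hs] : exists s, forall n, (z n).1 <= s <= (z n).1 + w / 2 ^+ n.
  by apply: nested_intervals => // n; have [_ ? _] := fP (n, z n) (Pz n).
have [t Ht] : exists t, forall n, (z n).2 <= t <= (z n).2 + h / 2 ^+ n.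
  by apply: nested_intervals => // n; have [_ _ ?] := fP (n, z n) (Pz n).
have [A [B [D L]]] : closed_at p q s t.
  by have [CC _] := Pz 0%N; apply: CC; [exact: Hs | exact: Ht].
have wh0 : 0 <= w + h by exact: addr_ge0.
(* Chosen so that the bound of [circ_small] is at most half of [c / 4 ^ n]; the summand [1] keeps
   the denominator positive for degenerate rectangles. *)
pose e : R := c / (4 * ((w + h) ^+ 2 + 1)).
have q1 : 0 < (w + h) ^+ 2 + 1 by rewrite ltr_wpDl// sqr_ge0.
have e0 : 0 < e by rewrite divr_gt0// mulr_gt0.
have [d d0 {}L] := L e e0.
have [n nd] : exists n, w / 2 ^+ n + h / 2 ^+ n < d.
  exists (Num.truncn ((w + h) / d)).
  rewrite -mulrDl ltr_pdivrMr ?exprn_gt0// mulrC -ltr_pdivrMr//.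
  apply: lt_le_trans (truncnS_gt _) _; rewrite -natrX ler_nat; exact: ltn_expl.
have [Cn Kn] := Pz n.
have := Hs n; have := Ht n; rewrite -/(W n) -/(H n) in nd * => Hsn Htn.
have := @circ_small p q (z n).1 (z n).2 (W n) (H n) s t A B D e (W0 n) (H0 n) (ltW e0) Cn.
have Wn := W0 n; have Hn := H0 n.
have E x y : (z n).1 <= x <= (z n).1 + W n -> (z n).2 <= y <= (z n).2 + H n ->
    `|p x y - p s t - (A * (x - s) + B * (y - t))| <= e * (W n + H n) /\
    `|q x y - q s t - (B * (x - s) + D * (y - t))| <= e * (W n + H n).
  move=> xa yb.
  clear Kn c0 N0.
  have dx : `|x - s| <= W n by rewrite ler_norml; apply/andP; split; lra.
  have dy : `|y - t| <= H n by rewrite ler_norml; apply/andP; split; lra.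
  have [||] := L (x - s) (y - t); [lra|lra|].
  rewrite !subrKC => h1 h2; split; [apply: le_trans h1 _|apply: le_trans h2 _];
    by apply: ler_wpM2l; [exact: ltW|exact: lerD].
move=> /(_ E); apply/negP; rewrite -ltNge; apply: lt_le_trans Kn.
have -> : (W n + H n) ^+ 2 = (w + h) ^+ 2 / 4 ^+ n.
  rewrite /W /H -mulrDl expr_div_n; congr (_ / _); rewrite -exprM mulnC exprM; congr (_ ^+ _); ring.
rewrite mulrA ltr_pM2r ?invr_gt0 ?exprn_gt0// /e.
rewrite (_ : _ * _ = c / 2 * ((w + h) ^+ 2 / ((w + h) ^+ 2 + 1))); last by field; rewrite gt_eqF.
have : (w + h) ^+ 2 / ((w + h) ^+ 2 + 1) <= 1 by rewrite ler_pdivrMr// mul1r lerDl.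
by move=> le1; nra.
Qed.

End Goursat.

(** * Complex numbers and circle averages *)

Section ComplexBasics.
Context {R : realType}.
Local Notation C := (C R).
Implicit Types (x y z h : C) (a b r s t : R).

(** A real modulus: the norm of [C] takes its values in [C], and [normE] relates the two. *)
Definition cabs z : R := Num.sqrt (abs2 z).
Definition ii : C := Complex 0 1.

Lemma eqC z z' : cre z = cre z' -> cim z = cim z' -> z = z'.
Proof. by case: z z' => [a b] [c d]; rewrite /cre /cim /= => -> ->. Qed.

Lemma creD x y : cre (x + y) = cre x + cre y. Proof. by case: x y => [? ?] [? ?]. Qed.
Lemma cimD x y : cim (x + y) = cim x + cim y. Proof. by case: x y => [? ?] [? ?]. Qed.
Lemma creN x : cre (- x) = - cre x. Proof. by case: x. Qed.
Lemma cimN x : cim (- x) = - cim x. Proof. by case: x. Qed.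
Lemma creB x y : cre (x - y) = cre x - cre y. Proof. by rewrite creD creN. Qed.
Lemma cimB x y : cim (x - y) = cim x - cim y. Proof. by rewrite cimD cimN. Qed.
Lemma creM x y : cre (x * y) = cre x * cre y - cim x * cim y. Proof. by case: x y => [? ?] [? ?]. Qed.
Lemma cimM x y : cim (x * y) = cre x * cim y + cim x * cre y. Proof. by case: x y => [? ?] [? ?]. Qed.
Lemma cre_rc r : cre (rc r) = r. Proof. by []. Qed.
Lemma cim_rc r : cim (rc r) = 0. Proof. by []. Qed.
Lemma cre0 : cre (0 : C) = 0. Proof. by []. Qed.
Lemma cim0 : cim (0 : C) = 0. Proof. by []. Qed.
Lemma cre1 : cre (1 : C) = 1. Proof. by []. Qed.
Lemma cim1 : cim (1 : C) = 0. Proof. by []. Qed.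
Lemma cre_conj x : cre (cconj x) = cre x. Proof. by case: x. Qed.
Lemma cim_conj x : cim (cconj x) = - cim x. Proof. by case: x. Qed.

Definition cE := (creD, cimD, creN, cimN, creM, cimM, cre_rc, cim_rc, cre0, cim0, cre1, cim1, cre_conj, cim_conj).

Lemma cre_sum (I : Type) (r : seq I) (P : pred I) (F : I -> C) :
  cre (\sum_(i <- r | P i) F i) = \sum_(i <- r | P i) cre (F i).
Proof. exact: (big_morph _ creD cre0). Qed.
Lemma cim_sum (I : Type) (r : seq I) (P : pred I) (F : I -> C) :
  cim (\sum_(i <- r | P i) F i) = \sum_(i <- r | P i) cim (F i).
Proof. exact: (big_morph _ cimD cim0). Qed.

Lemma rc1 : rc (1 : R) = 1 :> C. Proof. by []. Qed.
Lemma rc0 : rc (0 : R) = 0 :> C. Proof. by []. Qed.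
Lemma rcD r s : rc (r + s) = rc r + rc s :> C. Proof. by apply: eqC; rewrite !cE ?addr0. Qed.
Lemma rcN r : rc (- r) = - rc r :> C. Proof. by apply: eqC; rewrite !cE ?oppr0. Qed.
Lemma rcB r s : rc (r - s) = rc r - rc s :> C. Proof. by rewrite rcD rcN. Qed.
Lemma rcM r s : rc (r * s) = rc r * rc s :> C. Proof. by apply: eqC; rewrite !cE; ring. Qed.
Lemma rcX r n : rc (r ^+ n) = rc r ^+ n :> C.
Proof. by elim: n => [|n IH]; rewrite ?expr0 ?rc1// !exprS rcM IH. Qed.
Lemma rc_sum (I : Type) (r : seq I) (P : pred I) (F : I -> R) :
  rc (\sum_(i <- r | P i) F i) = \sum_(i <- r | P i) rc (F i) :> C.
Proof. exact: (big_morph _ rcD rc0). Qed.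
Lemma rc_eq0 r : (rc r == 0 :> C) = (r == 0).
Proof. by rewrite eq_complex /= eqxx andbT. Qed.
Lemma rcV r : rc (r^-1) = (rc r)^-1 :> C.
Proof.
have [->|r0] := eqVneq r 0; first by rewrite !(invr0, rc0) .
by apply: (@mulfI _ (rc r)); rewrite ?rc_eq0// -rcM !mulfV ?rc_eq0.
Qed.

Lemma conjM x y : cconj (x * y) = cconj x * cconj y.
Proof. by apply: eqC; rewrite !cE; ring. Qed.
Lemma conjD x y : cconj (x + y) = cconj x + cconj y.
Proof. by apply: eqC; rewrite !cE; ring. Qed.
Lemma conj_rc r : cconj (rc r) = rc r :> C.
Proof. by apply: eqC; rewrite !cE ?oppr0. Qed.
Lemma conjK x : cconj (cconj x) = x.
Proof. by apply: eqC; rewrite !cE ?opprK. Qed.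
Lemma conj0 : cconj (0 : C) = 0. Proof. by apply: eqC; rewrite !cE ?oppr0. Qed.
Lemma conj_sum (I : Type) (r : seq I) (P : pred I) (F : I -> C) :
  cconj (\sum_(i <- r | P i) F i) = \sum_(i <- r | P i) cconj (F i).
Proof. exact: (big_morph _ conjD conj0). Qed.
Lemma mul_conj x : x * cconj x = rc (abs2 x).
Proof. by apply: eqC; rewrite !cE /abs2; ring. Qed.

Lemma abs2_ge0 z : 0 <= abs2 z. Proof. by rewrite addr_ge0 ?sqr_ge0. Qed.
Lemma abs2M x y : abs2 (x * y) = abs2 x * abs2 y.
Proof. by rewrite /abs2 !cE; ring. Qed.
Lemma abs2_rc r : abs2 (rc r) = r ^+ 2. Proof. by rewrite /abs2 !cE; ring. Qed.
Lemma abs2_conj z : abs2 (cconj z) = abs2 z. Proof. by rewrite /abs2 !cE sqrrN. Qed.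
Lemma abs2_0 : abs2 (0 : C) = 0. Proof. by rewrite -rc0 abs2_rc expr0n. Qed.
Lemma abs2_1 : abs2 (1 : C) = 1. Proof. by rewrite -rc1 abs2_rc expr1n. Qed.
Lemma abs2X z n : abs2 (z ^+ n) = abs2 z ^+ n.
Proof. by elim: n => [|n IH]; rewrite ?expr0 ?abs2_1// !exprS abs2M IH. Qed.
Lemma abs2_eq0 z : (abs2 z == 0) = (z == 0).
Proof. by rewrite /abs2 paddr_eq0 ?sqr_ge0// !sqrf_eq0 eq_complex. Qed.

Lemma cabs_ge0 z : 0 <= cabs z. Proof. exact: sqrtr_ge0. Qed.
Lemma cabs2 z : cabs z ^+ 2 = abs2 z. Proof. by rewrite sqr_sqrtr ?abs2_ge0. Qed.
Lemma normE z : `|z| = rc (cabs z) :> C. Proof. exact: normc_def. Qed.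
Lemma cabsM x y : cabs (x * y) = cabs x * cabs y.
Proof. by rewrite /cabs abs2M sqrtrM ?abs2_ge0. Qed.
Lemma cabs_rc r : cabs (rc r) = `|r|. Proof. by rewrite /cabs abs2_rc sqrtr_sqr. Qed.
Lemma cabs0 : cabs 0 = 0. Proof. by rewrite /cabs abs2_0 sqrtr0. Qed.
Lemma cabs1 : cabs 1 = 1. Proof. by rewrite /cabs abs2_1 sqrtr1. Qed.
Lemma cabs_eq0 z : (cabs z == 0) = (z == 0).
Proof. by rewrite -sqrf_eq0 cabs2 abs2_eq0. Qed.
Lemma cabsX z n : cabs (z ^+ n) = cabs z ^+ n.
Proof. by elim: n => [|n IH]; rewrite ?expr0 ?cabs1// !exprS cabsM IH. Qed.
Lemma cabsN z : cabs (- z) = cabs z. Proof. by rewrite /cabs /abs2 !cE !sqrrN. Qed.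
Lemma cabs_conj z : cabs (cconj z) = cabs z. Proof. by rewrite /cabs abs2_conj. Qed.
Lemma cabsD x y : cabs (x + y) <= cabs x + cabs y.
Proof. by have := ler_normD x y; rewrite !normE -rcD lecR. Qed.
Lemma cabsB x y : cabs (x - y) = cabs (y - x).
Proof. by rewrite -cabsN opprB. Qed.
Lemma cabsV z : cabs (z^-1) = (cabs z)^-1.
Proof.
have [->|z0] := eqVneq z 0; first by rewrite invr0 cabs0 invr0.
by apply: (@mulfI _ (cabs z)); rewrite ?cabs_eq0// -cabsM !mulfV ?cabs_eq0// cabs1.
Qed.
Lemma cabs_re z : `|cre z| <= cabs z.
Proof. by have := normc_ge_Re z; rewrite normE lecR. Qed.
Lemma cabs_im z : `|cim z| <= cabs z.
Proof.
rewrite -(@ler_sqr _ `|cim z|) ?nnegrE ?cabs_ge0// cabs2 real_normK ?num_real//.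
by rewrite /abs2 lerDr sqr_ge0.
Qed.
Lemma cabs_le z : cabs z <= `|cre z| + `|cim z|.
Proof.
rewrite -(@ler_sqr _ (cabs z)) ?nnegrE ?cabs_ge0 ?addr_ge0// cabs2 sqrrD !real_normK ?num_real//.
by rewrite /abs2 addrAC lerDl mulrn_wge0// mulr_ge0.
Qed.
Lemma cabs_sum (I : Type) (r : seq I) (P : pred I) (F : I -> C) :
  cabs (\sum_(i <- r | P i) F i) <= \sum_(i <- r | P i) cabs (F i).
Proof.
elim/big_ind2: _ => [|x a y b xa yb|//]; first by rewrite cabs0.
by apply: le_trans (cabsD _ _) _; exact: lerD.
Qed.

Definition cis t : C := Complex (cos t) (sin t).
Definition cexp z : C := rc (expR (cre z)) * cis (cim z).

Lemma cis0 : cis 0 = 1. Proof. by rewrite /cis cos0 sin0. Qed.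
Lemma cisD s t : cis (s + t) = cis s * cis t.
Proof. by apply: eqC; rewrite !cE /= ?cosD ?sinD; ring. Qed.
Lemma abs2_cis t : abs2 (cis t) = 1. Proof. by rewrite /abs2 /= cos2Dsin2. Qed.
Lemma cabs_cis t : cabs (cis t) = 1. Proof. by rewrite /cabs abs2_cis sqrtr1. Qed.
Lemma cisN t : cis (- t) = cconj (cis t).
Proof. by apply: eqC; rewrite /= ?cosN ?sinN. Qed.
Lemma cis2pi : cis (2 * pi) = 1.
Proof. by rewrite mulr_natl /cis cos2pi sin2pi. Qed.
Lemma cisX t n : cis t ^+ n = cis (n%:R * t).
Proof.
elim: n => [|n IH]; first by rewrite mul0r cis0.
by rewrite exprS IH -cisD -natr1 mulrDl mul1r addrC.
Qed.
Lemma cis_neq0 t : cis t != 0.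
Proof. by rewrite -cabs_eq0 cabs_cis oner_eq0. Qed.

Lemma cexp0 : cexp 0 = 1. Proof. by rewrite /cexp /= expR0 rc1 cis0 mul1r. Qed.
Lemma cexpD x y : cexp (x + y) = cexp x * cexp y.
Proof. by rewrite /cexp creD cimD expRD cisD rcM; ring. Qed.
Lemma cabs_cexp z : cabs (cexp z) = expR (cre z).
Proof. by rewrite /cexp cabsM cabs_cis cabs_rc mulr1 ger0_norm// expR_ge0. Qed.
Lemma abs2_cexp z : abs2 (cexp z) = expR (2 * cre z).
Proof. by rewrite -cabs2 cabs_cexp expr2 -expRD; congr expR; ring. Qed.
Lemma cexp_rc r : cexp (rc r) = rc (expR r).
Proof. by rewrite /cexp cre_rc cim_rc cis0 mulr1. Qed.
Lemma conj_cexp z : cconj (cexp z) = cexp (cconj z).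
Proof. by rewrite /cexp conjM conj_rc cre_conj cim_conj cisN. Qed.
Lemma cexp_natmul z n : cexp z ^+ n = cexp (n%:R * z).
Proof.
elim: n => [|n IH]; first by rewrite mul0r cexp0.
by rewrite exprS IH -cexpD -natr1 mulrDl mul1r addrC.
Qed.
Lemma cexp_Complex s t : cexp (Complex s t) = rc (expR s) * cis t. Proof. by []. Qed.

End ComplexBasics.

(** * Complex derivatives and the mean value property *)

Section ComplexDerivative.
Context {R : realType}.
Local Notation C := (C R).
Implicit Types (x y z h : C).

(** Denominators are cleared, so [h = 0] needs no exception; [cderivP] identifies this with the
    usual derivative. *)
Definition cderiv (g : C -> C) z (L : C) := forall e : R, 0 < e ->
  exists2 d : R, 0 < d & forall h, cabs h < d -> cabs (g (z + h) - g z - L * h) <= e * cabs h.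

Lemma nbhs0_cabs (P : set C) : nbhs (0 : C) P <-> exists2 d : R, 0 < d & forall h, cabs h < d -> P h.
Proof.
split.
  move=> /nbhs_ballP[e /= e0 H]; exists (cre e).
    by move: e0; rewrite ltcE => /andP[_].
  move=> h hd; apply: H; rewrite /ball /= sub0r normrN normE ltcE /=.
  by move: e0; rewrite ltcE /= => /andP[/eqP <- _]; rewrite eqxx.
move=> [d d0 H]; apply/nbhs_ballP; exists (rc d); first by rewrite /= ltcR.
by move=> h; rewrite /ball /= sub0r normrN normE ltcR => /H.
Qed.

Lemma cderivP (g : C -> C) z L : cderiv g z L <-> is_derive z 1 g L.
Proof.
have key : cderiv g z L <-> (h^-1 *: ((g \o shift z) (h *: (1 : C)) - g z)) @[h --> (0 : C)^'] --> L.
  split=> [H|/cvgrPdist_le H e e0].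
    apply/cvgrPdist_le => e e0.
    have re0 : 0 < cre e by move: e0; rewrite ltcE => /andP[].
    have ee : e = rc (cre e) by move: e0; rewrite ltcE /= => /andP[/eqP ie _]; apply: eqC => //; rewrite -ie.
    have [d d0 {}H] := H _ re0.
    apply/nbhs0_cabs; exists d => // h hd h0.
    rewrite /= /shift /= ee normE lecR -(ler_pM2r (x := cabs h)); last by rewrite lt_neqAle cabs_ge0 eq_sym cabs_eq0 h0.
    rewrite -cabsM mulrBl /GRing.scale /= mulr1 mulrAC mulVf// mul1r cabsB [h + z]addrC.
    by have := H h hd; rewrite [L * h]mulrC.
  have e0' : 0 < rc e by rewrite ltcR.
  have /nbhs0_cabs[d d0 {}H] := H _ e0'.
  exists d => // h hd; have [->|h0] := eqVneq h 0.
    by rewrite addr0 subrr mulr0 subr0 cabs0 mulr0.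
  have := H h hd h0; rewrite /= /shift /= normE lecR -(ler_pM2r (x := cabs h)); last by rewrite lt_neqAle cabs_ge0 eq_sym cabs_eq0 h0.
  by rewrite -cabsM mulrBl /GRing.scale /= mulr1 mulrAC mulVf// mul1r cabsB (addrC h).
split=> [/key H|[H1 H2]].
  split; first by apply/cvg_ex; exists L.
  exact/cvg_lim.
by apply/key; rewrite -H2; exact: H1.
Qed.

Definition cdiff (g : C -> C) z := exists L, cderiv g z L.

Lemma cdiffP (g : C -> C) z : cdiff g z <-> derivable g z 1.
Proof.
split=> [[L /cderivP[H _]]|H]; first exact: H.
by exists ('D_1 g z); apply/cderivP; exact: DeriveDef.
Qed.

Lemma cdiff_cst (c : C) z : cdiff (fun=> c) z.
Proof. apply/cdiffP; exact: derivable_cst. Qed.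

Lemma cdiff_id z : cdiff id z.
Proof. apply/cdiffP; exact: derivable_id. Qed.

Lemma cdiffM (f g : C -> C) z : cdiff f z -> cdiff g z -> cdiff (fun x => f x * g x) z.
Proof. move=> /cdiffP hf /cdiffP hg; apply/cdiffP; exact: (derivableM hf hg). Qed.

Lemma cdiffD (f g : C -> C) z : cdiff f z -> cdiff g z -> cdiff (fun x => f x + g x) z.
Proof. move=> /cdiffP hf /cdiffP hg; apply/cdiffP; exact: (derivableD hf hg). Qed.

Lemma cdiffB (f g : C -> C) z : cdiff f z -> cdiff g z -> cdiff (fun x => f x - g x) z.
Proof. move=> /cdiffP hf /cdiffP hg; apply/cdiffP; exact: (derivableB hf hg). Qed.

Lemma cdiffV (f : C -> C) z : f z != 0 -> cdiff f z -> cdiff (fun x => (f x)^-1) z.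
Proof. move=> f0 /cdiffP hf; apply/cdiffP; exact: (derivableV f0 hf). Qed.

Lemma cdiffX (f : C -> C) n z : cdiff f z -> cdiff (fun x => f x ^+ n) z.
Proof.
move=> hf; elim: n => [|n IH]; first exact: cdiff_cst.
rewrite (_ : (fun x => _) = (fun x => f x * f x ^+ n)); first exact: cdiffM.
by apply/funext => x; rewrite exprS.
Qed.

Lemma cdiff_comp (f g : C -> C) z : cdiff f z -> cdiff g (f z) -> cdiff (fun x => g (f x)) z.
Proof.
move=> /cdiffP/derivable1_diffP hf /cdiffP/derivable1_diffP hg; apply/cdiffP/derivable1_diffP.
exact: (differentiable_comp hf hg).
Qed.

Lemma cderiv_cont (g : C -> C) z L : cderiv g z L -> forall e : R, 0 < e ->
  exists2 d : R, 0 < d & forall h, cabs h < d -> cabs (g (z + h) - g z) <= e.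
Proof.
move=> H e e0; have [d d0 {}H] := H 1 ltr01.
have k0 : 0 < cabs L + 1 by rewrite ltr_wpDl// cabs_ge0.
exists (Num.min d (e / (cabs L + 1))); first by rewrite lt_min d0 divr_gt0.
move=> h; rewrite lt_min => /andP[hd]; rewrite ltr_pdivlMr// => /ltW he.
rewrite -(subrK (L * h) (g (z + h) - g z)); apply: le_trans (cabsD _ _) _.
apply: le_trans he; rewrite cabsM mulrDr mulr1 addrC [cabs h * _]mulrC lerD//.
by have := H h hd; rewrite mul1r.
Qed.

(** The addition formula reduces the claim to the point [0], where the real derivatives of [expR],
    [cos] and [sin] are combined. *)
Lemma cexp_deriv z : cderiv cexp z (cexp z).
Proof.
move=> e e0.
(* The error splits into four terms weighing [1], [2], [2] and [1] times [e1], in total [6]; the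
   factor [expR (cre z)] is the modulus of [cexp z]. *)
pose e1 := e / (expR (cre z) * 6).
have e10 : 0 < e1 by rewrite divr_gt0// mulr_gt0 ?expR_gt0.
have D0 (f : R -> R) (df : R) (e2 : R) : is_derive (0:R) (1:R) f df -> 0 < e2 ->
    exists2 d : R, 0 < d & forall x : R, `|x| < d -> `|f x - f 0 - df * x| <= e2 * `|x|.
  move=> [fd dfE] e20.
  have /cvgrPdist_le H : (h^-1 *: ((f \o shift 0) (h *: (1:R)) - f 0)) @[h --> (0:R)^'] --> df by rewrite -dfE; exact: fd.
  have := H _ e20 => /nbhs_ballP[d /= d0 {}H].
  exists d => // x xd; have [->|x0] := eqVneq x 0; first by rewrite mulr0 subr0 subrr normr0 mulr0.
  have := H x; rewrite /ball /= sub0r normrN => /(_ xd x0).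
  rewrite /shift /= addr0 /GRing.scale /= mulr1 -(ler_pM2r (x := `|x|)) ?normr_gt0//.
  by rewrite -normrM mulrBl mulrAC mulVf// mul1r distrC.
have [d1 d10 H1] := D0 _ _ _ (is_derive_expR 0) e10.
have [d2 d20 H2] := D0 _ _ _ (is_derive_cos 0) e10.
have [d3 d30 H3] := D0 _ _ _ (is_derive_sin 0) e10.
have [d4 d40 H4] : exists2 d : R, 0 < d & forall x : R, `|x| < d -> expR x <= 2 /\ `|expR x - 1| <= e1.
  have K0 : 0 < Num.min 1 e1 by rewrite lt_min ltr01.
  have [d d0 H] := D0 _ _ _ (is_derive_expR 0) ltr01.
  exists (Num.min d (Num.min 1 e1 / 2)); first by rewrite lt_min d0 divr_gt0.
  move=> x; rewrite lt_min => /andP[xd xe]; have := H x xd; rewrite expR0 !mul1r => h.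
  have : `|expR x - 1| <= Num.min 1 e1.
    rewrite -(subrK x (expR x - 1)); apply: le_trans (ler_normD _ _) _.
    apply: le_trans (lerD h (lexx _)) _; lra.
  by rewrite le_min => /andP[h1 h2]; split=> //; move: h1; rewrite ler_norml => /andP[_]; lra.
exists (Num.min (Num.min d1 d2) (Num.min d3 d4)); first by rewrite !lt_min d10 d20 d30 d40.
move=> h hd.
have ra := cabs_re h; have rb := cabs_im h.
move: hd; rewrite !lt_min => /andP[/andP[hd1 hd2] /andP[hd3 hd4]].
have := H1 _ (le_lt_trans ra hd1); have := H2 _ (le_lt_trans rb hd2); have := H3 _ (le_lt_trans rb hd3).
have [E2 E1] := H4 _ (le_lt_trans ra hd4).
rewrite expR0 cos0 sin0 oppr0 !mul0r !subr0 !mul1r => h3 h2 h1.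
have -> : cexp (z + h) - cexp z - cexp z * h = cexp z * (cexp h - 1 - h) by rewrite cexpD; ring.
rewrite cabsM cabs_cexp.
suff : cabs (cexp h - 1 - h) <= 6 * e1 * cabs h.
  move=> /(ler_wpM2l (expR_ge0 (cre z))) /le_trans; apply; rewrite /e1.
  by rewrite le_eqVlt; apply/orP; left; apply/eqP; field; rewrite gt_eqF// expR_gt0.
apply: le_trans (cabs_le _) _.
rewrite !creB !cimB /cexp creM cimM cre_rc cim_rc cre1 cim1 !mul0r !subr0 addr0 /=.
set a := cre h in ra h1 E1 E2 *; set b := cim h in rb h2 h3 *.
have -> : expR a * cos b - 1 - a = (expR a - 1 - a) + expR a * (cos b - 1) by ring.
have -> : expR a * sin b - b = expR a * (sin b - b) + (expR a - 1) * b by ring.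
have p0 := expR_ge0 a; have na := normr_ge0 a; have nb := normr_ge0 b.
have t1 : `|expR a * (cos b - 1)| <= 2 * (e1 * `|b|).
  by rewrite normrM (ger0_norm p0); apply: ler_pM.
have t2 : `|expR a * (sin b - b)| <= 2 * (e1 * `|b|).
  by rewrite normrM (ger0_norm p0); rewrite addr0 in h3; apply: ler_pM.
have t3 : `|(expR a - 1) * b| <= e1 * `|b| by rewrite normrM ler_wpM2r.
apply: le_trans (lerD (ler_normD _ _) (ler_normD _ _)) _.
have ea : e1 * `|a| <= e1 * cabs h by rewrite ler_wpM2l// ltW.
have eb : e1 * `|b| <= e1 * cabs h by rewrite ler_wpM2l// ltW.
lra.
Qed.

(** These are the real and imaginary parts of the form [G dz]; the Cauchy-Riemann equations, read
    off from multiplication by [L], make both closed. *)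
Lemma continuous_strip (G : C -> C) (s t : R) L : cderiv G (Complex s t) L ->
  closed_at (fun s t => cre (G (Complex s t))) (fun s t => - cim (G (Complex s t))) s t /\
  closed_at (fun s t => cim (G (Complex s t))) (fun s t => cre (G (Complex s t))) s t.
Proof.
move=> H.
have K (e : R) : 0 < e -> exists2 d : R, 0 < d & forall h k : R, `|h| < d -> `|k| < d ->
   `|cre (G (Complex (s + h) (t + k))) - cre (G (Complex s t)) - (cre L * h - cim L * k)| <= e * (`|h| + `|k|) /\
   `|cim (G (Complex (s + h) (t + k))) - cim (G (Complex s t)) - (cim L * h + cre L * k)| <= e * (`|h| + `|k|).
  move=> e0; have [d d0 {}H] := H e e0.
  exists (d / 2); first by rewrite divr_gt0.
  move=> h k hd kd; pose z : C := Complex h k.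
  have zd : cabs z < d.
    apply: le_lt_trans (cabs_le _) _; rewrite /= (splitr d); exact: ltrD.
  have Hz := H z zd; have le := ler_wpM2l (ltW e0) (cabs_le z).
  have := le_trans Hz le; rewrite /= => {}Hz.
  have E : Complex s t + z = Complex (s + h) (t + k) by [].
  rewrite E in Hz; split.
    by apply: le_trans Hz; apply: le_trans (cabs_re _); rewrite !creB creM.
  by apply: le_trans Hz; apply: le_trans (cabs_im _); rewrite !cimB cimM [cre L * _ + _]addrC.
split.
  exists (cre L), (- cim L), (- cre L) => e e0; have [d d0 {}K] := K e e0; exists d => // h k hd kd.
  have [K1 K2] := K h k hd kd; split; first by rewrite mulNr.
  set X := cim (G (Complex (s + h) (t + k))) in K2 *; set Y := cim (G (Complex s t)) in K2 *.
  by rewrite (_ : - X - - Y - _ = - (X - Y - (cim L * h + cre L * k))) ?normrN//; ring.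
exists (cim L), (cre L), (- cim L) => e e0; have [d d0 {}K] := K e e0; exists d => // h k hd kd.
by have [K1 K2] := K h k hd kd; split; rewrite ?mulNr.
Qed.

Definition ccts (h : R -> C) (a b : R) := cts_on (fun t => cre (h t)) a b /\ cts_on (fun t => cim (h t)) a b.

Definition cavg (h : R -> C) : C :=
  Complex ((2 * pi)^-1 * Int (fun t => cre (h t)) 0 (2 * pi)) ((2 * pi)^-1 * Int (fun t => cim (h t)) 0 (2 * pi)).

(** [G dz] integrates to zero around the rectangle, and its two horizontal sides cancel by
    periodicity; equality of the vertical sides remains. *)
Lemma strip_mean (G : C -> C) (s1 s2 : R) : s1 <= s2 ->
  (forall s t, s1 <= s <= s2 -> cdiff G (Complex s t)) ->
  (forall s, G (Complex s (2 * pi)) = G (Complex s 0)) ->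
  cavg (fun t => G (Complex s1 t)) = cavg (fun t => G (Complex s2 t)).
Proof.
move=> s12 dG per.
have pp : 0 <= 2 * pi :> R by rewrite mulr_ge0// pi_ge0.
have w0 : 0 <= s2 - s1 by rewrite subr_ge0.
have K s t : s1 <= s <= s1 + (s2 - s1) -> closed_at (fun s t => cre (G (Complex s t))) (fun s t => - cim (G (Complex s t))) s t /\
  closed_at (fun s t => cim (G (Complex s t))) (fun s t => cre (G (Complex s t))) s t.
  by rewrite subrKC => /(dG _ t)[L]; exact: continuous_strip.
have C1 := @closed_form_circ0 _ _ _ s1 0 (s2 - s1) (2 * pi) w0 pp (fun s t sa _ => (K s t sa).1).
have C2 := @closed_form_circ0 _ _ _ s1 0 (s2 - s1) (2 * pi) w0 pp (fun s t sa _ => (K s t sa).2).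
move: C1 C2; rewrite /circ !add0r !subrKC.
rewrite (_ : (fun s => cre (G (Complex s (2 * pi)))) = (fun s => cre (G (Complex s 0)))); last by apply/funext => s; rewrite per.
rewrite (_ : (fun s => cim (G (Complex s (2 * pi)))) = (fun s => cim (G (Complex s 0)))); last by apply/funext => s; rewrite per.
rewrite !subrr !add0r => /eqP + /eqP; rewrite !subr_eq0 => /eqP C1 /eqP C2.
have cim_cts s : s1 <= s <= s2 -> cts_on (fun t => cim (G (Complex s t))) 0 (2 * pi).
  move=> sa t _; have [|_ CC] := K s t; first by rewrite subrKC.
  by have [_ ? _ _] := closed_at_cont CC.
have IN s : s1 <= s <= s2 -> Int (fun t => - cim (G (Complex s t))) 0 (2 * pi) = - Int (fun t => cim (G (Complex s t))) 0 (2 * pi).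
  move=> sa; rewrite -[RHS]sub0r -{2}(mul0r (2 * pi - 0)) -(Int_cst 0 pp) -IntB//.
  - by congr Int; apply/funext => t; rewrite sub0r.
  - exact: cts_on_cst.
  - exact: cim_cts.
rewrite !IN ?lexx ?s12// in C1; move: C1 => /oppr_inj C1.
by rewrite /cavg C1 C2.
Qed.

Lemma eq_cavg (h k : R -> C) : h =1 k -> cavg h = cavg k.
Proof. by move=> hk; congr cavg; apply/funext. Qed.

(** Composition with the exponential unrolls the annulus into a periodic strip. *)
Lemma circle_mean (g : C -> C) (r1 r2 : R) : 0 < r1 -> r1 <= r2 ->
  (forall z, r1 <= cabs z <= r2 -> cdiff g z) ->
  cavg (fun t => g (rc r1 * cis t)) = cavg (fun t => g (rc r2 * cis t)).
Proof.
move=> r10 r12 dg; have r20 := lt_le_trans r10 r12.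
have E (r : R) : 0 < r -> cavg (fun t => (g \o cexp) (Complex (ln r) t)) = cavg (fun t => g (rc r * cis t)).
  by move=> r0; apply: eq_cavg => t; rewrite /= cexp_Complex lnK.
rewrite -(E r1 r10) -(E r2 r20); apply: strip_mean; first by rewrite ler_ln ?posrE.
  move=> s t /andP[s1 s2]; apply: (cdiff_comp (f := cexp) (g := g)).
    by exists (cexp (Complex s t)); exact: cexp_deriv.
  apply: dg; rewrite cabs_cexp /=; apply/andP; split.
    by rewrite -[leLHS]lnK ?posrE// ler_expR.
  by rewrite -[leRHS]lnK ?posrE// ler_expR.
by move=> s; rewrite /= !cexp_Complex cis2pi cis0.
Qed.

Lemma pi2_gt0 : 0 < 2 * pi :> R. Proof. by rewrite mulr_gt0// pi_gt0. Qed.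

(** The factor [2] comes from bounding real and imaginary parts separately. *)
Lemma cabs_cavg (h : R -> C) (M : R) : ccts h 0 (2 * pi) -> (forall t, 0 <= t <= 2 * pi -> cabs (h t) <= M) ->
  cabs (cavg h) <= 2 * M.
Proof.
move=> [c1 c2] hM; apply: le_trans (cabs_le _) _ => /=.
have b (f : R -> R) : cts_on f 0 (2 * pi) -> (forall t, 0 <= t <= 2 * pi -> `|f t| <= M) -> `|(2 * pi)^-1 * Int f 0 (2 * pi)| <= M.
  move=> cf fM; rewrite normrM gtr0_norm ?invr_gt0 ?pi2_gt0//.
  rewrite ler_pdivrMl ?pi2_gt0//.
  by apply: le_trans (Int_bound (ltW pi2_gt0) cf fM) _; rewrite subr0 mulrC.
have -> : 2 * M = M + M by ring.
apply: lerD; apply: b => // t tp.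
  exact: le_trans (cabs_re _) (hM t tp).
exact: le_trans (cabs_im _) (hM t tp).
Qed.

Lemma cavgB (h k : R -> C) : ccts h 0 (2 * pi) -> ccts k 0 (2 * pi) ->
  cavg (fun t => h t - k t) = cavg h - cavg k.
Proof.
move=> [h1 h2] [k1 k2]; apply: eqC; rewrite !cE /= -mulrBr -IntB//; congr (_ * _); congr Int;
  by apply/funext => t; rewrite !cE.
Qed.

Lemma cavg_cst (c : C) : cavg (fun=> c) = c.
Proof.
have p0 := pi2_gt0.
by apply: eqC; rewrite /cavg /= Int_cst ?(ltW p0)// subr0 mulrCA mulVf ?gt_eqF// mulr1.
Qed.

Lemma ccts_cst (c : C) a b : ccts (fun=> c) a b.
Proof. by split; exact: cts_on_cst. Qed.

Lemma cctsB (h k : R -> C) a b : ccts h a b -> ccts k a b -> ccts (fun t => h t - k t) a b.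
Proof.
move=> [h1 h2] [k1 k2]; split.
  rewrite (_ : (fun t => _) = (fun t => cre (h t) - cre (k t))); first exact: cts_onB.
  by apply/funext => t; rewrite creB.
rewrite (_ : (fun t => _) = (fun t => cim (h t) - cim (k t))); first exact: cts_onB.
by apply/funext => t; rewrite cimB.
Qed.

Lemma ccts_lip (h : R -> C) (a b : R) :
  (forall t, a <= t <= b -> forall e : R, 0 < e -> exists2 d : R, 0 < d & forall l : R, `|l| < d -> cabs (h (t + l) - h t) <= e) ->
  ccts h a b.
Proof.
move=> H; split=> t tab; apply/cvgrPdist_le => /= e e0; have [d d0 Hd] := H t tab e e0; near=> x.
  have xd : `|x - t| < d by near: x; exact: near_dist.
  have := Hd _ xd; rewrite subrKC distrC; apply: le_trans; rewrite -creB; exact: cabs_re.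
have xd : `|x - t| < d by near: x; exact: near_dist.
have := Hd _ xd; rewrite subrKC distrC; apply: le_trans; rewrite -cimB; exact: cabs_im.
Unshelve. all: by end_near.
Qed.

Lemma cabs_cis_lip (t l : R) : forall e : R, 0 < e -> exists2 d : R, 0 < d & forall l : R, `|l| < d -> cabs (cis (t + l) - cis t) <= e.
Proof.
move=> e e0; have [d d0 H] := cderiv_cont (cexp_deriv (Complex 0 t)) e0.
exists d => // k kd; have := H (Complex 0 k).
have -> : cabs (Complex 0 k) = `|k| by rewrite /cabs /abs2 /= expr0n add0r sqrtr_sqr.
move=> /(_ kd); have -> : Complex 0 t + Complex 0 k = Complex 0 (t + k) :> C by apply: eqC; rewrite !cE /= ?addr0.
by rewrite !cexp_Complex expR0 !mul1r.
Qed.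

Lemma ccts_circle (g : C -> C) (r : R) a b : 0 <= r ->
  (forall z, cabs z = r -> forall e : R, 0 < e -> exists2 d : R, 0 < d & forall h, cabs h < d -> cabs (g (z + h) - g z) <= e) ->
  ccts (fun t => g (rc r * cis t)) a b.
Proof.
move=> r0 H; apply: ccts_lip => t _ e e0.
have [|d d0 Hd] := H (rc r * cis t) _ e e0.
  by rewrite cabsM cabs_cis cabs_rc mulr1 ger0_norm.
have d1 : 0 < d / (r + 1) by rewrite divr_gt0// ltr_wpDl.
have d2 : 0 < d / 2 / (r + 1) by rewrite divr_gt0 ?ltr_wpDl// divr_gt0.
have [k k0 Hk] := cabs_cis_lip t 0 d2; exists k => // l lk.
have -> : rc r * cis (t + l) = rc r * cis t + rc r * (cis (t + l) - cis t) by ring.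
apply: Hd; rewrite cabsM cabs_rc ger0_norm//.
have := Hk l lk; rewrite ler_pdivlMr ?ltr_wpDl// => h.
have c0 := cabs_ge0 (cis (t + l) - cis t).
rewrite mulrDr mulr1 in h; rewrite mulrC; lra.
Qed.

(** The mean is the same on all smaller circles, and on very small ones it is close to [g 0] by
    continuity at the centre. *)
Lemma disc_mean (g : C -> C) (r : R) : 0 < r ->
  (forall z, 0 < cabs z <= r -> cdiff g z) ->
  (forall e : R, 0 < e -> exists2 d : R, 0 < d & forall h, cabs h < d -> cabs (g h - g 0) <= e) ->
  cavg (fun t => g (rc r * cis t)) = g 0.
Proof.
move=> r0 dg cg; apply/eqP; rewrite -subr_eq0 -cabs_eq0.
have c0 := cabs_ge0 (cavg (fun t => g (rc r * cis t)) - g 0).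
rewrite eq_le c0 andbT; apply/ler_addgt0Pl => e e0; rewrite addr0.
have e20 : 0 < e / 2 by rewrite divr_gt0.
have [d d0 Hd] := cg _ e20.
pose s := Num.min r (d / 2); have s0 : 0 < s by rewrite lt_min r0 divr_gt0.
have sd : s < d by rewrite gt_min; apply/orP; right; rewrite ltr_pdivrMr// mulr_natr mulr2n ltrDl.
have sr : s <= r by rewrite ge_min lexx.
have cs (z : C) : cabs z = s -> cdiff g z by move=> zs; apply: dg; rewrite zs s0.
have cc : ccts (fun t => g (rc s * cis t)) 0 (2 * pi).
  apply: ccts_circle; first exact: ltW.
  by move=> z /cs[L]; exact: cderiv_cont.
rewrite -(@circle_mean g s r)//; last by move=> z /andP[z1 z2]; apply: dg; rewrite (lt_le_trans s0).
rewrite -[X in _ - X](cavg_cst (g 0)) -cavgB//; last exact: ccts_cst.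
apply: le_trans (cabs_cavg (M := e / 2) _ _) _; last by rewrite mulrC divfK.
- by apply: cctsB => //; exact: ccts_cst.
- by move=> t _; apply: Hd; rewrite cabsM cabs_cis cabs_rc mulr1 gtr0_norm.
Qed.

End ComplexDerivative.

(** * Averages depending on a parameter, and Taylor expansion *)

Section CircleAverage.
Context {R : realType}.
Local Notation C := (C R).

Lemma ccts_bounded (h : R -> C) (a b : R) : a <= b -> ccts h a b ->
  exists2 B : R, 0 <= B & forall t, a <= t <= b -> cabs (h t) <= B.
Proof.
move=> ab [c1 c2].
have [|c cab cM] := @EVT_max R (fun t => `|cre (h t)| + `|cim (h t)|) a b ab.
  apply: continuous_in_subspaceT => t; rewrite inE /= in_itv /= => tab.
  by apply: cvgD; apply: cvg_norm; [exact: c1 | exact: c2].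
exists (`|cre (h c)| + `|cim (h c)|); first by rewrite addr_ge0.
by move=> t tab; apply: le_trans (cabs_le _) _; apply: cM; rewrite in_itv.
Qed.

(** Compactness of the segment turns joint continuity at each point [(r0, t)] into continuity
    uniform in [t]. *)
Lemma unif_param (F : R -> R -> C) (r0 a b : R) :
  (forall t, a <= t <= b -> forall e : R, 0 < e -> exists2 d : R, 0 < d & forall k l : R, `|k| < d -> `|l| < d -> cabs (F (r0 + k) (t + l) - F r0 t) <= e) ->
  forall e : R, 0 < e -> exists2 d : R, 0 < d & forall r, `|r - r0| < d -> forall t, a <= t <= b -> cabs (F r t - F r0 t) <= e.
Proof.
move=> H e e0; have e20 : 0 < e / 2 by rewrite divr_gt0.
have /compact_near_coveringP K := @segment_compact R a b.
have /nbhs_ballP[d /= d0 Hd] : \forall r \near r0, `[a, b]%classic `<=` (fun t => cabs (F r t - F r0 t) <= e).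
  apply: (K R (nbhs r0) (fun r t => cabs (F r t - F r0 t) <= e)) => t /=; rewrite in_itv /= => tab.
  have [d d0 Hd] := H t tab _ e20.
  exists ([set x | `|x - t| < d], [set x | `|x - r0| < d]); first by split; exact: near_dist.
  move=> [x r] [/= xt rr].
  have h1 := Hd _ _ rr xt; have h2 := Hd 0 _ (_ : `|0| < d) xt.
  rewrite normr0 in h2; have {}h2 := h2 d0; rewrite addr0 in h2; rewrite !subrKC in h1 h2.
  rewrite (_ : _ - _ = (F r x - F r0 t) - (F r0 x - F r0 t)); last by ring.
  by apply: le_trans (cabsD _ _) _; rewrite cabsN (splitr e) lerD.
by exists d => // r rd t tab; apply: Hd; rewrite /ball /= ?in_itv//= distrC.
Qed.

Lemma cavg_param (F : R -> R -> C) (r0 : R) :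
  (\forall r \near r0, ccts (F r) 0 (2 * pi)) ->
  (forall t, forall e : R, 0 < e -> exists2 d : R, 0 < d & forall k l : R, `|k| < d -> `|l| < d -> cabs (F (r0 + k) (t + l) - F r0 t) <= e) ->
  forall e : R, 0 < e -> exists2 d : R, 0 < d & forall r, `|r - r0| < d -> cabs (cavg (F r) - cavg (F r0)) <= e.
Proof.
move=> /nbhs_ballP[d1 /= d10 H1] H e e0; have e20 : 0 < e / 2 by rewrite divr_gt0.
have [d2 d20 H2] := @unif_param F r0 0 (2 * pi) (fun t _ => H t) _ e20.
have cF r : `|r - r0| < d1 -> ccts (F r) 0 (2 * pi) by move=> rd; apply: H1; rewrite /ball /= distrC.
exists (Num.min d1 d2); first by rewrite lt_min d10.
move=> r; rewrite lt_min => /andP[rd1 rd2].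
have c0 : ccts (F r0) 0 (2 * pi) by apply: cF; rewrite subrr normr0.
rewrite -cavgB//; last exact: cF.
apply: le_trans (cabs_cavg (M := e / 2) _ _) _; last by rewrite mulrC divfK.
  by apply: cctsB => //; exact: cF.
by move=> t tp; exact: H2.
Qed.

Lemma cctsD (h k : R -> C) a b : ccts h a b -> ccts k a b -> ccts (fun t => h t + k t) a b.
Proof.
move=> [h1 h2] [k1 k2]; split.
  rewrite (_ : (fun t => _) = (fun t => cre (h t) + cre (k t))); last by apply/funext => t; rewrite creD.
  by move=> t tab; apply: cvgD; [exact: h1 | exact: k1].
rewrite (_ : (fun t => _) = (fun t => cim (h t) + cim (k t))); last by apply/funext => t; rewrite cimD.
by move=> t tab; apply: cvgD; [exact: h2 | exact: k2].
Qed.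

Lemma cctsM (h k : R -> C) a b : ccts h a b -> ccts k a b -> ccts (fun t => h t * k t) a b.
Proof.
move=> [h1 h2] [k1 k2]; split.
  rewrite (_ : (fun t => _) = (fun t => cre (h t) * cre (k t) - cim (h t) * cim (k t))); last by apply/funext => t; rewrite creM.
  by move=> t tab; apply: cvgB; apply: cvgM; [exact: h1 | exact: k1 | exact: h2 | exact: k2].
rewrite (_ : (fun t => _) = (fun t => cre (h t) * cim (k t) + cim (h t) * cre (k t))); last by apply/funext => t; rewrite cimM.
by move=> t tab; apply: cvgD; apply: cvgM; [exact: h1 | exact: k2 | exact: h2 | exact: k1].
Qed.

Lemma cavgZ (c : C) (h : R -> C) : ccts h 0 (2 * pi) -> cavg (fun t => c * h t) = c * cavg h.
Proof.
move=> [h1 h2].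
have IZ (k : R) (f : R -> R) : cts_on f 0 (2 * pi) -> Int (fun t => k * f t) 0 (2 * pi) = k * Int f 0 (2 * pi).
  by move=> cf; rewrite /Int RintegralZl//; exact: cts_integrable.
have cZ (k : R) (f : R -> R) : cts_on f 0 (2 * pi) -> cts_on (fun t => k * f t) 0 (2 * pi).
  by move=> cf t tab; apply: cvgM; [exact: cvg_cst | exact: cf].
apply: eqC; rewrite !cE /=.
  rewrite (_ : (fun t => _) = (fun t => cre c * cre (h t) - cim c * cim (h t))); last by apply/funext => t; rewrite creM.
  by rewrite IntB ?IZ//; try exact: cZ; ring.
rewrite (_ : (fun t => _) = (fun t => cre c * cim (h t) - (- cim c) * cre (h t))); last by apply/funext => t; rewrite cimM; ring.
by rewrite IntB ?IZ//; try exact: cZ; ring.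
Qed.

Lemma cavgD (h k : R -> C) : ccts h 0 (2 * pi) -> ccts k 0 (2 * pi) ->
  cavg (fun t => h t + k t) = cavg h + cavg k.
Proof.
move=> ch ck; have c1 : ccts (fun t => -1 * k t) 0 (2 * pi) by apply: cctsM => //; exact: ccts_cst.
have -> : cavg k = - cavg (fun t => -1 * k t) by rewrite cavgZ// mulN1r opprK.
by rewrite -cavgB//; apply: eq_cavg => t; rewrite mulN1r opprK.
Qed.

Lemma ccts_sum (I : Type) (r : seq I) (h : I -> R -> C) a b : (forall i, ccts (h i) a b) ->
  ccts (fun t => \sum_(i <- r) h i t) a b.
Proof.
move=> ch; elim: r => [|i r IH].
  by under eq_fun do rewrite big_nil; exact: ccts_cst.
by under eq_fun do rewrite big_cons; exact: cctsD.
Qed.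

Lemma cavg_sum (I : Type) (r : seq I) (h : I -> R -> C) : (forall i, ccts (h i) 0 (2 * pi)) ->
  cavg (fun t => \sum_(i <- r) h i t) = \sum_(i <- r) cavg (h i).
Proof.
move=> ch; elim: r => [|i r IH].
  by under eq_cavg do rewrite big_nil; rewrite big_nil cavg_cst.
under eq_cavg do rewrite big_cons.
by rewrite cavgD ?IH ?big_cons//; exact: ccts_sum.
Qed.

Lemma cderiv_near (f g : C -> C) z L (d : R) : 0 < d -> (forall h, cabs h < d -> f (z + h) = g (z + h)) ->
  cderiv f z L -> cderiv g z L.
Proof.
move=> d0 fg H e e0; have [d' d'0 Hd] := H e e0.
exists (Num.min d d'); first by rewrite lt_min d0.
move=> h; rewrite lt_min => /andP[hd hd']; rewrite -fg//.
have := fg 0; rewrite addr0 cabs0 => <-//; exact: Hd.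
Qed.

Lemma cdiff_near (f g : C -> C) z (d : R) : 0 < d -> (forall h, cabs h < d -> f (z + h) = g (z + h)) ->
  cdiff f z -> cdiff g z.
Proof. by move=> d0 fg [L HL]; exists L; exact: cderiv_near d0 fg HL. Qed.

Lemma cdiff_cont (g : C -> C) z : cdiff g z -> forall e : R, 0 < e ->
  exists2 d : R, 0 < d & forall h, cabs h < d -> cabs (g (z + h) - g z) <= e.
Proof. by move=> [L]; exact: cderiv_cont. Qed.

Lemma cdiff_powV (z : C) (n : nat) : z != 0 -> cdiff (fun x : C => x ^- n) z.
Proof.
move=> z0; apply: (cdiffV (f := fun x => x ^+ n)); first by rewrite expf_neq0.
by apply: (cdiffX (f := id)); exact: cdiff_id.
Qed.

(* [rho^-k] times the [k]-th Fourier coefficient on [|z| = rho] does not depend on [rho]. *)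
Lemma circle_coef (g : C -> C) (k : nat) (r1 r2 : R) : 0 < r1 -> r1 <= r2 ->
  (forall z, r1 <= cabs z <= r2 -> cdiff g z) ->
  cavg (fun t => g (rc r1 * cis t) * (rc r1 * cis t) ^- k) =
  cavg (fun t => g (rc r2 * cis t) * (rc r2 * cis t) ^- k).
Proof.
move=> r10 r12 dg; apply: (@circle_mean _ (fun z => g z * z ^- k)) => // z zr.
have z0 : z != 0 by rewrite -cabs_eq0 gt_eqF//; case/andP: zr => h _; exact: lt_le_trans h.
by apply: (cdiffM (f := g)); [exact: dg | exact: cdiff_powV].
Qed.

Lemma cis_inv (t : R) : (cis t)^-1 = cis (- t) :> C.
Proof.
by apply: (mulfI (cis_neq0 t)); rewrite mulfV ?cis_neq0// -cisD subrr cis0.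
Qed.

Lemma ccts_circle_powV (r : R) k a b : 0 < r -> ccts (fun t => (rc r * cis t) ^- k) a b.
Proof.
move=> r0; apply: (@ccts_circle _ (fun z => z ^- k)); first exact: ltW.
move=> z zr; have z0 : z != 0 by rewrite -cabs_eq0 zr gt_eqF.
by apply: (cdiff_cont (g := fun z => z ^- k)); exact: cdiff_powV.
Qed.

Lemma rc1_mul (z : C) : rc 1 * z = z.
Proof. by apply: eqC; rewrite !cE; ring. Qed.

Lemma ccts_cis_powV k a b : ccts (fun t => cis t ^- k : C) a b.
Proof.
rewrite (_ : (fun t => _) = (fun t => (rc 1 * cis t : C) ^- k)); first exact: ccts_circle_powV.
by apply/funext => t; rewrite rc1_mul.
Qed.

Lemma cavg_circle_powV (r : R) k :
  cavg (fun t => (rc r * cis t) ^- k) = rc (r ^- k) * cavg (fun t => cis t ^- k).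
Proof.
rewrite -cavgZ; last exact: ccts_cis_powV.
by apply: eq_cavg => t; rewrite exprMn invfM rcV rcX.
Qed.

(** The mean is [r ^- k] times a constant, and it does not depend on the radius; comparing the radii
    [r] and [2 r] makes it vanish. *)
Lemma cavg_powV (r : R) k : 0 < r -> (0 < k)%N -> cavg (fun t => (rc r * cis t) ^- k) = 0.
Proof.
move=> r0 k0.
have aux (A : R -> C) (c : C) : (forall s, A s = rc (s ^- k) * c) -> A r = A (r + r) -> A r = 0.
  move=> AE; rewrite !AE => /eqP; rewrite -subr_eq0 -mulrBl mulf_eq0 -rcB rc_eq0 subr_eq0.
  case/orP => [/eqP h|/eqP ->]; last by rewrite mulr0.
  have : r ^+ k = (r + r) ^+ k by apply: invr_inj.
  move=> /eqP; rewrite eqrXn2 ?addr_ge0 ?(ltW r0)// => /eqP h'; exfalso.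
  by move: h'; lra.
apply: (aux (fun s => cavg (fun t => (rc s * cis t) ^- k)) _ (cavg_circle_powV ^~ k)).
apply: (@circle_mean _ (fun z => z ^- k)); [exact: r0 | by rewrite lerDl ltW |].
by move=> z /andP[h _]; apply: cdiff_powV; rewrite -cabs_eq0 gt_eqF// (lt_le_trans r0 h).
Qed.

(** Taylor's formula at the point [1] with coefficients read on the unit circle. Moving the
    coefficients to the circle of radius [rho] makes the remainder decay like [rho ^- K.+1]. *)
Lemma taylor_circle (g : C -> C) (rho : R) : 1 < rho ->
  (forall z, cabs z <= rho -> cdiff g z) ->
  exists2 B : R, 0 <= B & forall K, cabs (g 1 - \sum_(k < K.+1) cavg (fun t => g (cis t) * cis (- (k%:R * t)))) <= B * rho ^- K.+1.
Proof.
move=> rho1 dg; have rho0 : 0 < rho by exact: lt_trans rho1.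
have [L HL] : cdiff g 1 by apply: dg; rewrite cabs1 ltW.
(* The mean of this quotient over a circle enclosing [1] vanishes: that is Cauchy's integral formula
   for [g 1]. At [1] it is completed by the derivative. *)
pose h z := if z == 1 then L else z * (g z - g 1) / (z - 1).
have dh z : cabs z <= rho -> z != 1 -> cdiff h z.
  move=> zr z1; have d0 : 0 < cabs (z - 1) by rewrite lt_neqAle cabs_ge0 eq_sym cabs_eq0 subr_eq0 z1.
  apply: (@cdiff_near (fun z => z * (g z - g 1) / (z - 1)) h z _ d0) => [k kd|].
    rewrite /h; case: eqP => // e; exfalso; move: kd.
    by rewrite (_ : k = - (z - 1)) ?cabsN ?ltxx//; rewrite -e; ring.
  apply: (cdiffM (f := fun z => z * (g z - g 1)) (g := fun z => (z - 1)^-1)).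
    apply: (cdiffM (f := id)); first exact: cdiff_id.
    by apply: (cdiffB (f := g)); [exact: dg | exact: cdiff_cst].
  apply: (cdiffV (f := fun z => z - 1)); first by rewrite subr_eq0.
  by apply: (cdiffB (f := id)); [exact: cdiff_id | exact: cdiff_cst].
have ch z : cabs z <= rho -> forall e : R, 0 < e -> exists2 d : R, 0 < d & forall k, cabs k < d -> cabs (h (z + k) - h z) <= e.
  move=> zr; have [->|z1] := eqVneq z 1; last first.
    by apply: cdiff_cont; exact: dh.
  move=> e e0; have e20 : 0 < e / 2 by rewrite divr_gt0.
  have [d1 d10 H1] := HL _ e20; have [d2 d20 H2] := cderiv_cont HL e20.
  exists (Num.min d1 d2); first by rewrite lt_min d10.
  move=> k; rewrite lt_min => /andP[kd1 kd2]; rewrite /h eqxx.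
  have [->|k0] := eqVneq k 0; first by rewrite addr0 eqxx subrr cabs0 ltW.
  rewrite ifF; last by apply/negP => /eqP /(congr1 (fun x => x - 1)); rewrite subrr addrAC subrr add0r => /eqP; rewrite (negbTE k0).
  have -> : (1 + k) * (g (1 + k) - g 1) / (1 + k - 1) - L = (g (1 + k) - g 1 - L * k) / k + (g (1 + k) - g 1).
    have -> : 1 + k - 1 = k by ring.
    by field.
  apply: le_trans (cabsD _ _) _; rewrite (splitr e); apply: lerD; last exact: H2.
  by rewrite cabsM cabsV ler_pdivrMr ?H1// lt_neqAle cabs_ge0 eq_sym cabs_eq0 k0.
have cabsrt (r t : R) : 0 <= r -> cabs (rc r * cis t) = r.
  by move=> r0; rewrite cabsM cabs_cis cabs_rc mulr1 ger0_norm.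
have chr (r : R) : 0 <= r -> r <= rho -> ccts (fun t => h (rc r * cis t)) 0 (2 * pi).
  move=> r0 rr; apply: ccts_circle => // z zr; apply: ch; by rewrite zr.
(* Inside the unit circle [h] has no singularity, and [h 0 = 0]. *)
have M0 (r : R) : 0 < r -> r < 1 -> cavg (fun t => h (rc r * cis t)) = 0.
  move=> r0 r1; rewrite disc_mean//.
  - by rewrite /h eq_sym oner_eq0 mul0r mul0r.
  - move=> z /andP[z0 zr]; apply: dh; first by rewrite (le_trans zr)// ltW// (lt_trans r1).
    by apply: contraTneq zr => ->; rewrite cabs1 -ltNge.
  - move=> e e0; have [|d d0 Hd] := ch 0 _ e e0; first by rewrite cabs0 ltW.
    by exists d => // k kd; have := Hd k kd; rewrite add0r.
(* The unit circle passes through [1], where [h] is known to be continuous only. The mean is carried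
   across it by continuity in the radius, from [1 - k] to [1 + k]. *)
have M1 : cavg (fun t => h (rc rho * cis t)) = 0.
  have P e : 0 < e -> exists2 d : R, 0 < d & forall r : R, `|r - 1| < d -> cabs (cavg (fun t => h (rc r * cis t)) - cavg (fun t => h (rc 1 * cis t))) <= e.
    apply: (@cavg_param (fun r t => h (rc r * cis t))).
      have s0 : 0 < Num.min 1 (rho - 1) by rewrite lt_min ltr01 subr_gt0.
      apply: filterS (near_dist 1 s0) => r; rewrite lt_min => /andP[]; rewrite !ltr_norml => /andP[? ?] /andP[? ?].
      by apply: chr; lra.
    move=> t e' e'0.
    have [|d d0 Hd] := ch (rc 1 * cis t) _ _ e'0; first by rewrite cabsrt// ltW.
    have d20 : 0 < d / 4 by rewrite divr_gt0.
    have [d3 d30 H3] := cabs_cis_lip t 0 d20.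
    exists (Num.min d3 (d / 4)); first by rewrite lt_min d30.
    move=> k l; rewrite !lt_min => /andP[k3 k2] /andP[l3 l2].
    have -> : rc (1 + k) * cis (t + l) = rc 1 * cis t + (rc k * cis (t + l) + (cis (t + l) - cis t)).
      by rewrite rcD rc1; ring.
    apply: Hd; apply: le_lt_trans (cabsD _ _) _; rewrite cabsM cabs_rc cabs_cis mulr1.
    by have := H3 l l3; lra.
  apply/eqP; rewrite -cabs_eq0 eq_le cabs_ge0 andbT; apply/ler_addgt0Pl => e e0; rewrite addr0.
  have e20 : 0 < e / 2 by rewrite divr_gt0.
  have [d d0 Hd] := P _ e20.
  pose k := Num.min (Num.min (1 / 2) (rho - 1)) (d / 2).
  have k0 : 0 < k by rewrite !lt_min !divr_gt0 ?ltr01// subr_gt0 rho1.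
  have kd : k < d by rewrite gt_min; apply/orP; right; rewrite ltr_pdivrMr// mulr_natr mulr2n ltrDl.
  have k1 : k <= 1 / 2 by rewrite /k !ge_min lexx.
  have kr : k <= rho - 1 by rewrite /k !ge_min lexx orbT.
  have := Hd (1 - k); rewrite addrAC subrr add0r normrN gtr0_norm// => /(_ kd).
  rewrite M0; [|lra|lra]; rewrite sub0r cabsN => h1.
  have := Hd (1 + k); rewrite addrAC subrr add0r gtr0_norm// => /(_ kd) h2.
  have E : cavg (fun t => h (rc (1 + k) * cis t)) = cavg (fun t => h (rc rho * cis t)).
    apply: circle_mean; [lra|lra|move=> z /andP[z1 z2]].
    by apply: dh => //; apply: contraTneq z1 => ->; rewrite cabs1 -ltNge; lra.
  rewrite E in h2; set m1 := cavg (fun t => h (rc 1 * cis t)) in h1 h2.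
  rewrite -(subrK m1 (cavg _)); apply: le_trans (cabsD _ _) _; lra.
have [B B0 HB] := ccts_bounded (ltW (pi2_gt0 (R := R))) (chr rho (ltW rho0) (lexx _)).
exists (2 * B); first by rewrite mulr_ge0.
move=> K.
have rn t : rc rho * cis t != 0 :> C by rewrite mulf_neq0 ?cis_neq0// rc_eq0 gt_eqF.
have -> : \sum_(k < K.+1) cavg (fun t => g (cis t) * cis (- (k%:R * t))) =
    \sum_(k < K.+1) cavg (fun t => g (rc rho * cis t) * (rc rho * cis t) ^- k).
  apply: eq_bigr => k _; rewrite -(@circle_coef g k 1 rho) ?ltr01 ?(ltW rho1)//.
    by apply: eq_cavg => t; rewrite rc1_mul -cis_inv -cisX.
  by move=> z /andP[_]; exact: dg.
have cP k : ccts (fun t => (rc rho * cis t) ^- k) 0 (2 * pi) by exact: ccts_circle_powV.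
have cg : ccts (fun t => g (rc rho * cis t)) 0 (2 * pi).
  by apply: ccts_circle; [exact: ltW | move=> z zr; apply: cdiff_cont; apply: dg; rewrite zr].
rewrite -cavg_sum; last by move=> k; exact: cctsM.
(* The geometric sum of the powers [z ^- k], multiplied by [g z = g 1 + (g z - g 1)]. After
   averaging, the first term gives [g 1], the mean of [h] is zero, and the last term is the
   remainder. *)
have E t : \sum_(k < K.+1) g (rc rho * cis t) * (rc rho * cis t) ^- k =
   g 1 * (\sum_(k < K.+1) (rc rho * cis t) ^- k) + (h (rc rho * cis t) - h (rc rho * cis t) * (rc rho * cis t) ^- K.+1).
  have := rn t; have : rc rho * cis t != 1 :> C.
    by apply/eqP => /(congr1 cabs); rewrite cabsrt ?(ltW rho0)// cabs1 => r1; rewrite r1 ltxx in rho1.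
  move: (rc rho * cis t) => z z1 z0.
  rewrite -mulr_sumr /h (negbTE z1).
  have -> : \sum_(k < K.+1) z ^- k = (1 - z ^- K.+1) * z / (z - 1).
    have z1' : z - 1 != 0 by rewrite subr_eq0.
    elim: K => [|K IH]; first by rewrite big_ord1 expr0 invr1 expr1; field; rewrite ?z0 ?z1'.
    rewrite big_ord_recr /= IH; have -> : z ^- K.+1 = z ^- K.+2 * z by rewrite [z ^+ K.+2]exprSr invfM mulfVK.
    by move: (z ^- K.+2) => w; field; rewrite ?z1'.
  by have z1' : z - 1 != 0; [rewrite subr_eq0 | move: (z ^- K.+1) => w; field].
rewrite (eq_cavg E).
have cs : ccts (fun t => \sum_(k < K.+1) (rc rho * cis t) ^- k) 0 (2 * pi) by exact: ccts_sum.
have ch' := chr rho (ltW rho0) (lexx _).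
have chp : ccts (fun t => h (rc rho * cis t) * (rc rho * cis t) ^- K.+1) 0 (2 * pi) by exact: cctsM.
rewrite cavgD; [|by apply: cctsM => //; exact: ccts_cst|exact: cctsB].
rewrite cavgZ// cavgB// M1 sub0r cavg_sum//.
have -> : \sum_(i < K.+1) cavg (fun t => (rc rho * cis t) ^- i) = 1.
  rewrite big_ord_recl big1 ?addr0 => [|k _]; last exact: cavg_powV.
  by rewrite -[RHS]cavg_cst; apply: eq_cavg => t /=; rewrite expr0 invr1.
rewrite mulr1 opprD opprK addrA subrr add0r -mulrA.
apply: cabs_cavg => // t tp; rewrite cabsM cabsV cabsX cabsrt ?(ltW rho0)//.
by rewrite ler_wpM2r ?HB// invr_ge0 exprn_ge0// ltW.
Qed.

End CircleAverage.

(** * Shifts of the angle and Fourier coefficients of the exponential *)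

Section CircleShift.
Context {R : realType}.
Local Notation C := (C R).
Local Notation leb := (@lebesgue_measure R).

Lemma integral_shift (f : R -> \bar R) (c : R) : measurable_fun setT f ->
  (\int[leb]_x f (x + c)%R = \int[leb]_x f x)%E.
Proof.
move=> mf; rewrite integralE [RHS]integralE; congr (_ - _)%E.
  rewrite -(ge0_integral_shift c (measurable_funepos mf) (fun x => funepos_ge0 f x)).
  by apply: eq_integral => x _; rewrite !funeposE.
rewrite -(ge0_integral_shift c (measurable_funeneg mf) (fun x => funeneg_ge0 f x)).
by apply: eq_integral => x _; rewrite !funenegE.
Qed.

Lemma Int_shift (f : R -> R) (a b c : R) : cts_on f (a + c) (b + c) ->
  Int (fun x => f (x + c)) a b = Int f (a + c) (b + c).
Proof.
move=> cf; rewrite /Int /Rintegral; congr fine.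
rewrite integral_mkcond [RHS]integral_mkcond -[RHS](@integral_shift _ c).
  apply: eq_integral => x _; rewrite !patchE !mem_setE !in_itv /=.
  by rewrite !lerD2r.
apply/(measurable_restrictT _ _).1 => //.
by have /integrableP[] := cts_integrable cf.
Qed.

(** The part of the interval pushed beyond [2 pi] is brought back by periodicity. *)
Lemma cavg_shift (h : R -> C) (phi : R) : (forall t, h (t + 2 * pi) = h t) ->
  (forall a b, ccts h a b) -> 0 <= phi <= 2 * pi -> cavg (fun t => h (t + phi)) = cavg h.
Proof.
move=> per ch /andP[p0 p1].
have K (f : R -> R) : (forall t, f (t + 2 * pi) = f t) -> (forall a b, cts_on f a b) ->
    Int (fun t => f (t + phi)) 0 (2 * pi) = Int f 0 (2 * pi).
  move=> pf cf; rewrite Int_shift// add0r (@IntD _ _ phi (2 * pi)) ?lerDl//.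
  have -> : Int f (2 * pi) (2 * pi + phi) = Int f 0 phi.
    have := @Int_shift f 0 phi (2 * pi); rewrite add0r [phi + _]addrC => <- //.
    by congr Int; apply/funext => t; rewrite pf.
  by rewrite addrC -IntD.
rewrite /cavg; congr Complex; congr (_ * _).
  by apply: (K (fun t => cre (h t))) => [t|a b]; [rewrite per | case: (ch a b)].
by apply: (K (fun t => cim (h t))) => [t|a b]; [rewrite per | case: (ch a b)].
Qed.

Lemma cderiv_comp (f g : C -> C) z L M : cderiv f z L -> cderiv g (f z) M -> cderiv (fun x => g (f x)) z (M * L).
Proof.
move=> Hf Hg e e0.
have L0 := cabs_ge0 L; have M0 := cabs_ge0 M.
have e1 : 0 < e / (2 * (cabs L + 1)) by rewrite divr_gt0// mulr_gt0// ltr_wpDl.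
have e2 : 0 < Num.min 1 (e / (2 * (cabs M + 1))) by rewrite lt_min ltr01 divr_gt0// mulr_gt0// ltr_wpDl.
have [d1 d10 H1] := Hg _ e1; have [d2 d20 H2] := Hf _ e2.
exists (Num.min d2 (d1 / (cabs L + 1))); first by rewrite lt_min d20 divr_gt0// ltr_wpDl.
move=> h; rewrite lt_min => /andP[hd2]; rewrite ltr_pdivlMr ?ltr_wpDl// => hd1.
have h0 := cabs_ge0 h.
have F := H2 h hd2; set k := f (z + h) - f z in F.
have F1 : cabs (k - L * h) <= cabs h.
  by apply: le_trans F _; rewrite -[leRHS]mul1r ler_wpM2r// ge_min lexx.
have F2 : cabs (k - L * h) <= e / (2 * (cabs M + 1)) * cabs h.
  by apply: le_trans F _; rewrite ler_wpM2r// ge_min lexx orbT.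
have kb : cabs k <= cabs h * (cabs L + 1).
  rewrite -(subrK (L * h) k); apply: le_trans (cabsD _ _) _.
  by rewrite mulrDr mulr1 addrC lerD// cabsM mulrC.
have := H1 k (le_lt_trans kb hd1); have -> : f z + k = f (z + h) by rewrite /k; ring.
move=> G; rewrite (_ : _ - _ = (g (f (z + h)) - g (f z) - M * k) + M * (k - L * h)); last by ring.
apply: le_trans (cabsD _ _) _; rewrite cabsM.
have t1 : e / (2 * (cabs L + 1)) * cabs k <= e / 2 * cabs h.
  apply: le_trans (ler_wpM2l (ltW e1) kb) _.
  by rewrite le_eqVlt; apply/orP; left; apply/eqP; field; rewrite gt_eqF// ltr_wpDl.
have t2 : cabs M * cabs (k - L * h) <= e / 2 * cabs h.
  apply: le_trans (ler_wpM2l M0 F2) _; rewrite mulrA ler_wpM2r//.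
  have -> : cabs M * (e / (2 * (cabs M + 1))) = (e / 2) * (cabs M / (cabs M + 1)).
    by field; rewrite gt_eqF// ltr_wpDl.
  rewrite -[leRHS]mulr1 ler_wpM2l ?divr_ge0 ?(ltW e0)//.
  by rewrite ler_pdivrMr ?ltr_wpDl// mul1r lerDl.
lra.
Qed.

(** Along the imaginary axis the derivative is [i L], whose real part is [- cim L] and imaginary
    part [cre L]. *)
Lemma vertical_derive (g : C -> C) (t : R) L : cderiv g (Complex 0 t) L ->
  is_derive t (1 : R) (fun s => cre (g (Complex 0 s))) (- cim L) /\
  is_derive t (1 : R) (fun s => cim (g (Complex 0 s))) (cre L).
Proof.
move=> H.
have key (f : R -> R) (l : R) : (forall e : R, 0 < e -> exists2 d : R, 0 < d & forall x : R, `|x| < d -> `|f (t + x) - f t - l * x| <= e * `|x|) ->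
    is_derive t (1 : R) f l.
  move=> K.
  have C1 : (h^-1 *: ((f \o shift t) (h *: (1:R)) - f t)) @[h --> (0:R)^'] --> l.
    apply/cvgrPdist_le => e e0; have [d d0 {}K] := K e e0.
    apply/nbhs_ballP; exists d => // x; rewrite /ball /= sub0r normrN => xd x0.
    rewrite /shift /= /GRing.scale /= mulr1 -(ler_pM2r (x := `|x|)) ?normr_gt0//.
    by rewrite -normrM mulrBl mulrAC mulVf// mul1r distrC [x + t]addrC; exact: K.
  by split; [apply/cvg_ex; exists l | exact/cvg_lim].
have E x : cabs (Complex 0 x : C) = `|x| by rewrite /cabs /abs2 /= expr0n add0r sqrtr_sqr.
have S x : Complex 0 t + Complex 0 x = Complex 0 (t + x) :> C by apply: eqC; rewrite !cE /= ?addr0.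
split; apply: key => e e0; have [d d0 {}H] := H e e0; exists d => // x xd;
  have := H (Complex 0 x); rewrite E => /(_ xd); apply: le_trans.
  by apply: le_trans (cabs_re _); rewrite S !creB creM /= mulr0 sub0r opprK mulNr opprK.
by apply: le_trans (cabs_im _); rewrite S !cimB cimM /= mulr0 addr0.
Qed.

Lemma Int_FTC (F f : R -> R) (a b : R) : a < b -> (forall t, is_derive t (1 : R) F (f t)) ->
  cts_on f a b -> Int f a b = F b - F a.
Proof.
move=> ab dF cf.
have cF t : {for t, continuous F}.
  by apply: differentiable_continuous; apply/derivable1_diffP; have [] := dF t.
rewrite /Int /Rintegral (continuous_FTC2 (F := F) ab)//.
- by apply: continuous_in_subspaceT => t; rewrite inE /= in_itv /= => tab; exact: cf.
- split.
  + by move=> t _; have [] := dF t.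
  + by apply: cvg_at_right_filter; exact: cF.
  + by apply: cvg_at_left_filter; exact: cF.
- by move=> t _; rewrite derive1E; apply: derive_val.
Qed.

(** By the fundamental theorem of calculus, the derivative of a periodic function has mean zero. *)
Lemma cavg_derive0 (g : C -> C) (L : R -> C) : (forall t, cderiv g (Complex 0 t) (L t)) ->
  ccts L 0 (2 * pi) -> g (Complex 0 (2 * pi)) = g (Complex 0 0) -> cavg L = 0.
Proof.
move=> H [c1 c2] per; have pp := pi2_gt0 (R := R).
apply: eqC; rewrite /cavg /= ?cre0 ?cim0.
  have -> := @Int_FTC (fun s => cim (g (Complex 0 s))) _ 0 (2 * pi) pp (fun t => (vertical_derive (H t)).2) c1.
  by rewrite per subrr mulr0.
have cN : cts_on (fun t => - cim (L t)) 0 (2 * pi) by move=> t tp; apply: cvgN; exact: c2.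
have := Int_FTC pp (F := fun s => cre (g (Complex 0 s))) (f := fun t => - cim (L t)).
move=> /(_ (fun t => (vertical_derive (H t)).1) cN); rewrite per subrr => E.
have := IntB (@cts_on_cst _ 0 0 (2 * pi)) cN; rewrite E Int_cst ?(ltW pp)// mul0r subr0 => E0.
rewrite [X in Int X](_ : _ = (fun x => 0 - - cim (L x))); last by apply/funext => t; rewrite sub0r opprK.
by rewrite E0 mulr0.
Qed.

Lemma cdiff_cexpM (c z : C) : cdiff (fun x => cexp (c * x)) z.
Proof.
apply: (cdiff_comp (f := fun x => c * x)); first by apply: (cdiffM (f := fun=> c)); [exact: cdiff_cst | exact: cdiff_id].
by exists (cexp (c * z)); exact: cexp_deriv.
Qed.

Lemma ccts_cexp (c : C) a b : ccts (fun t => cexp (c * cis t)) a b.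
Proof.
have := @ccts_circle R (fun z => cexp (c * z)) 1 a b ler01.
rewrite (_ : (fun t => cexp (c * (rc 1 * cis t))) = (fun t => cexp (c * cis t))); last by apply/funext => t; rewrite rc1_mul.
by apply => z _; exact: (cdiff_cont (g := fun z => cexp (c * z)) (cdiff_cexpM c z)).
Qed.

(** The Taylor coefficients of the exponential. Differentiating the integrand of index [s.+1] in the
    angle gives a function of mean zero, that is, the recursion [(s + 1) a_(s+1) = c a_s]. *)
Lemma cavg_cexp (c : C) (s : nat) :
  cavg (fun t => cexp (c * cis t) * cis (- (s%:R * t))) = rc (s`!%:R^-1) * c ^+ s.
Proof.
have ccexp a b : ccts (fun t => cexp (c * cis t)) a b by exact: ccts_cexp.
have ccisN (k : nat) a b : ccts (fun t => cis (- (k%:R * t)) : C) a b.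
  by have := @ccts_cis_powV R k a b; congr ccts; apply/funext => t; rewrite -cis_inv -cisX.
elim: s => [|s IH].
  rewrite fact0 invr1 rc1 mul1r expr0.
  have := @disc_mean R (fun z => cexp (c * z)) 1 ltr01.
  rewrite mulr0 cexp0 => <-.
  - by apply: eq_cavg => t; rewrite mul0r oppr0 cis0 mulr1 rc1_mul.
  - by move=> z _; exact: cdiff_cexpM.
  - move=> e e0; have [d d0 H] := cdiff_cont (g := fun z => cexp (c * z)) (cdiff_cexpM c 0) e0.
    by exists d => // h hd; have := H h hd; rewrite add0r mulr0 cexp0.
(* Writing [cis t] as the exponential of [i t] makes the integrand the restriction of [g] to the
   imaginary axis. *)
pose g (z : C) := cexp (c * cexp z - s.+1%:R * z).
have gE t : g (Complex 0 t) = cexp (c * cis t) * cis (- (s.+1%:R * t)).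
  rewrite /g cexp_Complex expR0 rc1_mul cexpD; congr (_ * _).
  have -> : - (s.+1%:R * Complex 0 t) = Complex 0 (- (s.+1%:R * t)) :> C.
    have -> : s.+1%:R = rc (s.+1%:R) :> C by rewrite /rc; apply/esym; exact: (rmorph_nat (real_complex R)).
    by apply: eqC; rewrite !cE /=; ring.
  by rewrite cexp_Complex expR0 rc1_mul.
pose L t := (c * cis t - s.+1%:R) * (cexp (c * cis t) * cis (- (s.+1%:R * t))).
have dL t : cderiv g (Complex 0 t) (L t).
  rewrite /L -gE mulrC; apply: (@cderiv_comp (fun z => c * cexp z - s.+1%:R * z) cexp).
    have -> : cis t = cexp (Complex 0 t) by rewrite cexp_Complex expR0 rc1_mul.
    move=> e e0; have c0 := cabs_ge0 c.
    have e1 : 0 < e / (cabs c + 1) by rewrite divr_gt0// ltr_wpDl.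
    have [d d0 H] := cexp_deriv (Complex 0 t) e1; exists d => // h hd.
    rewrite (_ : _ - _ = c * (cexp (Complex 0 t + h) - cexp (Complex 0 t) - cexp (Complex 0 t) * h)); last by ring.
    rewrite cabsM; apply: le_trans (ler_wpM2l c0 (H h hd)) _; rewrite mulrA ler_wpM2r ?cabs_ge0//.
    rewrite mulrCA -[leRHS]mulr1 ler_wpM2l ?(ltW e0)// ler_pdivrMr ?ltr_wpDl// mul1r lerDl//.
  exact: cexp_deriv.
have := cavg_derive0 dL _ _.
have cG (k : nat) : ccts (fun t => cexp (c * cis t) * cis (- (k%:R * t))) 0 (2 * pi) by exact: cctsM.
have LE t : L t = c * (cexp (c * cis t) * cis (- (s%:R * t))) - s.+1%:R * (cexp (c * cis t) * cis (- (s.+1%:R * t))).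
  have : cis (- (s%:R * t)) = cis t * cis (- (s.+1%:R * t)) :> C.
    by rewrite -cisD; congr cis; rewrite -natr1; ring.
  by rewrite /L => ->; ring.
have cc1 : ccts (fun t => c * (cexp (c * cis t) * cis (- (s%:R * t)))) 0 (2 * pi) by apply: cctsM => //; exact: ccts_cst.
have cc2 : ccts (fun t => s.+1%:R * (cexp (c * cis t) * cis (- (s.+1%:R * t)))) 0 (2 * pi) by apply: cctsM => //; exact: ccts_cst.
rewrite (eq_cavg LE) cavgB// cavgZ// cavgZ// IH => H.
have cL : ccts L 0 (2 * pi).
  by rewrite (_ : L = fun t => c * (cexp (c * cis t) * cis (- (s%:R * t))) - s.+1%:R * (cexp (c * cis t) * cis (- (s.+1%:R * t)))); [exact: cctsB | apply/funext].
have gper : g (Complex 0 (2 * pi)) = g (Complex 0 0).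
  rewrite !gE cis2pi cis0 mulr0 oppr0 cis0 cisN -cisX cis2pi expr1n; congr (_ * _).
  by apply: eqC; rewrite !cE ?oppr0.
have {H} /eqP := H cL gper; rewrite subr_eq0 => /eqP H.
have s0 : s.+1%:R != 0 :> C by rewrite pnatr_eq0.
apply: (mulfI s0); rewrite -H factS natrM invfM rcM exprS.
have -> : s.+1%:R = rc (s.+1%:R) :> C by rewrite /rc; apply/esym; exact: (rmorph_nat (real_complex R)).
have E1 : rc (s.+1%:R) * rc (s.+1%:R^-1) = 1 :> C by rewrite -rcM mulfV ?pnatr_eq0.
by rewrite !mulrA E1 mul1r [c * _]mulrC.
Qed.

End CircleShift.

(** * Measurability of complex-valued functions *)

Section MeasC.
Context {R : realType} d (T : measurableType d).
Local Notation C := (C R).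

Definition cmfun (f : T -> C) :=
  measurable_fun setT (fun t => cre (f t)) /\ measurable_fun setT (fun t => cim (f t)).

Lemma cmfun_cst c : cmfun (fun=> c).
Proof. by split; exact: measurable_cst. Qed.

Lemma cmfunD f g : cmfun f -> cmfun g -> cmfun (fun t => f t + g t).
Proof.
move=> [f1 f2] [g1 g2]; split; [under eq_fun do rewrite creD | under eq_fun do rewrite cimD]; exact: measurable_funD.
Qed.

Lemma cmfunM f g : cmfun f -> cmfun g -> cmfun (fun t => f t * g t).
Proof.
move=> [f1 f2] [g1 g2]; split; [under eq_fun do rewrite creM | under eq_fun do rewrite cimM].
  by apply: measurable_funB; exact: measurable_funM.
by apply: measurable_funD; exact: measurable_funM.
Qed.

Lemma cmfun_rc (f : T -> R) : measurable_fun setT f -> cmfun (fun t => rc (f t)).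
Proof. by move=> mf; split => //=; exact: measurable_cst. Qed.

Lemma cmfun_conj f : cmfun f -> cmfun (fun t => cconj (f t)).
Proof.
move=> [f1 f2]; split; first by under eq_fun do rewrite cre_conj.
by under eq_fun do rewrite cim_conj; exact: measurableT_comp.
Qed.

Lemma cmfunX f (k : nat) : cmfun f -> cmfun (fun t => f t ^+ k).
Proof.
move=> mf; elim: k => [|k IH]; first by under eq_fun do rewrite expr0; exact: cmfun_cst.
by under eq_fun do rewrite exprS; exact: cmfunM.
Qed.

Lemma cmfun_sum (I : Type) (r : seq I) (F : I -> T -> C) : (forall i, cmfun (F i)) ->
  cmfun (fun t => \sum_(i <- r) F i t).
Proof.
move=> mF; elim: r => [|i r IH]; first by under eq_fun do rewrite big_nil; exact: cmfun_cst.
by under eq_fun do rewrite big_cons; exact: cmfunD.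
Qed.

Lemma cmfun_cexp f : cmfun f -> cmfun (fun t => cexp (f t)).
Proof.
move=> [f1 f2]; apply: cmfunM.
  by apply: cmfun_rc; apply: measurableT_comp.
split => /=; [apply: (measurableT_comp (f := @cos R)) => // | apply: (measurableT_comp (f := @sin R)) => //].
  by apply: continuous_measurable_fun; exact: continuous_cos.
by apply: continuous_measurable_fun; exact: continuous_sin.
Qed.

Lemma cmfun_cis (f : T -> R) : measurable_fun setT f -> cmfun (fun t => cis (f t)).
Proof.
move=> mf; split => /=; [apply: (measurableT_comp (f := @cos R)) => // | apply: (measurableT_comp (f := @sin R)) => //].
  by apply: continuous_measurable_fun; exact: continuous_cos.
by apply: continuous_measurable_fun; exact: continuous_sin.
Qed.

Lemma measurable_abs2 f : cmfun f -> measurable_fun setT (fun t => abs2 (f t)).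
Proof. by move=> [f1 f2]; apply: measurable_funD; exact: measurable_funX. Qed.

Lemma measurable_sqn k (u : T -> 'rV[C]_k) : cmeas u -> measurable_fun setT (fun t => sqn (u t)).
Proof. by move=> mu; apply: measurable_sum => j; apply: measurable_abs2; exact: mu. Qed.

Lemma cmeas_scalec k (c : T -> C) (u : T -> 'rV[C]_k) : cmfun c -> cmeas u -> cmeas (fun t => c t *: u t).
Proof. by move=> [c1 c2] mu; exact: cmeas_scale. Qed.

Lemma cmeas_lsub n m (u : T -> 'rV[C]_(n + m)) : cmeas u -> cmeas (fun t => lsubmx (u t)).
Proof. by move=> mu j; under eq_fun do rewrite mxE; under [X in _ /\ measurable_fun _ X]eq_fun do rewrite mxE; exact: mu. Qed.

Lemma cmeas_rsub n m (u : T -> 'rV[C]_(n + m)) : cmeas u -> cmeas (fun t => rsubmx (u t)).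
Proof. by move=> mu j; under eq_fun do rewrite mxE; under [X in _ /\ measurable_fun _ X]eq_fun do rewrite mxE; exact: mu. Qed.

End MeasC.

(** * Radial integrals and the moments of the weight *)

Section Sqn.
Context {R : realType}.
Local Notation C := (C R).

Lemma sqn_ge0 k (v : 'rV[C]_k) : 0 <= sqn v.
Proof. by apply: sumr_ge0 => j _; exact: abs2_ge0. Qed.

Lemma sqnZ k (c : C) (v : 'rV[C]_k) : sqn (c *: v) = abs2 c * sqn v.
Proof. by rewrite /sqn mulr_sumr; apply: eq_bigr => j _; rewrite mxE abs2M. Qed.

Lemma sqn_rot k t (v : 'rV[C]_k) : sqn (cis t *: v) = sqn v.
Proof. by rewrite sqnZ abs2_cis mul1r. Qed.

End Sqn.

Section Radial.
Context {R : realType}.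
Local Notation C := (C R).
Local Notation leb := (@lebesgue_measure R).
Local Open Scope ereal_scope.

(** As a function of [|v|^2], the radial density on the unit ball whose moments are Beta integrals;
    zero outside the ball. *)
Definition ballw (c x : R) : R := if (x < 1)%R then ((1 - x) `^ (c - 1))%R else 0%R.

Lemma ballw_ge0 c x : (0 <= ballw c x)%R.
Proof. by rewrite /ballw; case: ifP => // _; exact: powR_ge0. Qed.

Lemma measurable_ballw c : measurable_fun setT (ballw c).
Proof.
apply: measurable_fun_if => //.
- by apply: measurable_fun_ltr; [exact: measurable_id | exact: measurable_cst].
- apply: (@measurable_funS _ _ _ _ setT) => //.
  apply: (measurableT_comp (measurable_powR (c - 1))).
  by apply: measurable_funB; [exact: measurable_cst | exact: measurable_id].
Qed.

Lemma gammaI_shift (c r A : R) : (0 <= A)%R ->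
  A%:E * gammaI c = \int[leb]_t (A * pos (fun t => t `^ (c - 1) * expR (- t)) (t - r))%:E.
Proof.
move=> A0; pose g t := (pos (fun t : R => t `^ (c - 1) * expR (- t))%R t)%:E.
have mg : measurable_fun setT g by exact: measurable_gamma_posE.
have g0 t : 0 <= g t by rewrite lee_fin gamma_fun_ge0.
have -> : gammaI c = \int[leb]_t g (t + - r)%R by rewrite (ge0_integral_shift (- r) mg g0).
rewrite -ge0_integralZl//.
by apply: (measurableT_comp mg); exact: measurable_funD.
Qed.

(* [t = |v|^2 + r] with [r] Gamma-distributed, then [v = sqrt t x] *)
Lemma radial_gamma k (h : 'rV[C]_k -> R) (s : nat) (c : R) :
  cgood (fun v => (h v)%:E) -> (forall v, 0 <= h v)%R ->
  (forall (tau : R) v, (0 < tau)%R -> h (rc tau *: v)%R = (tau ^+ (2 * s) * h v)%R) ->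
  gammaI c * lebC (fun v => (h v * expR (- sqn v))%:E) =
  gammaI ((k + s)%:R + c) * lebC (fun v => (h v * ballw c (sqn v))%:E).
Proof.
move=> gh h0 hh.
have [d [T [P [Z [mZ HZ]]]]] := @lebC_rep R k.
pose ga x : R := pos (fun t => t `^ (c - 1) * expR (- t))%R x.
have ga0 x : (0 <= ga x)%R by exact: gamma_fun_ge0.
have mga : measurable_fun setT ga by apply: measurable_pos; exact: measurable_gamma_fun.
(* Integrating this joint density first over [t] gives the left side, first over [v] the right
   side. *)
pose H (v : 'rV[C]_k) (t : R) : \bar R := (h v * expR (- sqn v) * ga (t - sqn v))%:E.
have H0 v t : 0 <= H v t by rewrite lee_fin !mulr_ge0// expR_ge0.
have mhh d' (T' : measurableType d') (u : T' -> 'rV[C]_k) : cmeas u -> measurable_fun setT (fun t => h (u t)).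
  by move=> mu; apply/measurable_EFinP; exact: gh.
have mH d' (T' : measurableType d') (u : T' -> 'rV[C]_k) (p : T' -> R) : cmeas u -> measurable_fun setT p ->
    measurable_fun setT (fun t => H (u t) (p t)).
  move=> mu mp; apply/measurable_EFinP; apply: measurable_funM; [apply: measurable_funM|].
  - exact: mhh.
  - by apply: measurableT_comp => //; apply: measurableT_comp => //; exact: measurable_sqn.
  - by apply: (measurableT_comp mga); apply: measurable_funB => //; exact: measurable_sqn.
transitivity (\int[P]_x \int[leb]_t H (Z x) t).
  rewrite HZ; first last.
  - by move=> x; rewrite lee_fin mulr_ge0// expR_ge0.
  - move=> d' T' u mu; apply/measurable_EFinP; apply: measurable_funM; first exact: mhh.
    by apply: measurableT_comp => //; apply: measurableT_comp => //; exact: measurable_sqn.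
  rewrite -ge0_integralZl//; first last.
  - exact: gammaI_ge0.
  - by move=> x _; rewrite lee_fin mulr_ge0// expR_ge0.
  - apply/measurable_EFinP; apply: measurable_funM; first exact: mhh.
    by apply: measurableT_comp => //; apply: measurableT_comp => //; exact: measurable_sqn.
  apply: eq_integral => x _; rewrite muleC.
  by rewrite (gammaI_shift c (sqn (Z x))) ?mulr_ge0 ?expR_ge0.
rewrite (@fubini_tonelli _ _ _ _ _ P leb (fun z => H (Z z.1) z.2) (mH _ _ _ _ (cmeas_comp mZ measurable_fst) measurable_snd) (fun z => H0 _ _)) /=.
rewrite /gammaI muleC -ge0_integralZl//; first last.
- by apply: lebC_ge0 => x; rewrite lee_fin mulr_ge0// ballw_ge0.
- by move=> x _; rewrite lee_fin gamma_fun_ge0.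
- exact: measurable_gamma_posE.
apply: eq_integral => t _.
rewrite -(HZ (fun v => H v t))//; last by move=> d' T' u mu; apply: mH => //; exact: measurable_cst.
have [t0|t0] := ltP 0%R t; last first.
  rewrite /pos ltNge t0 /= mule0; transitivity (lebC (fun _ : 'rV[C]_k => 0)); last first.
    by rewrite HZ// integral0.
  apply: eq_lebC => v; rewrite /H /ga /pos ifF ?mulr0//; apply/negbTE; rewrite -leNgt subr_le0.
  exact: le_trans t0 (sqn_ge0 v).
pose r := (Num.sqrt t)^-1%R; have st0 : (0 < Num.sqrt t)%R by rewrite sqrtr_gt0.
have r0 : (0 < r)%R by rewrite invr_gt0.
have r2 : (r ^+ 2 = t^-1)%R by rewrite exprVn sqr_sqrtr// ltW.
pose g (v : 'rV[C]_k) := (h v * ballw c (sqn v))%:E.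
have gg : cgood g.
  move=> d' T' u mu; apply/measurable_EFinP; apply: measurable_funM; first exact: mhh.
  by apply: (measurableT_comp (measurable_ballw c)); exact: measurable_sqn.
have g0 v : 0 <= g v by rewrite lee_fin mulr_ge0// ballw_ge0.
have E v : H v t = (t `^ (c - 1) * expR (- t) * t ^+ s)%:E * g (rc r *: v)%R.
  rewrite /H /g /ga /pos /ballw -EFinM; congr EFin.
  rewrite hh// sqnZ abs2_rc r2 exprM r2 subr_gt0 ltr_pdivrMl// mulr1.
  case: ifP => xt; last by rewrite !mulr0.
  have -> : (1 - t^-1 * sqn v = t^-1 * (t - sqn v))%R by rewrite mulrBr mulVf ?gt_eqF.
  have tv0 : (0 < t - sqn v)%R by rewrite subr_gt0.
  rewrite powRM ?invr_ge0 ?ltW// -powR_inv1 ?ltW// -powRrM.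
  rewrite (_ : expR (- t) = expR (- sqn v) * expR (- (t - sqn v)))%R; last by rewrite -expRD; congr expR; ring.
  have S : (t `^ (c - 1) * t `^ (-1 * (c - 1)) = 1)%R by rewrite /powR (gt_eqF t0) -expRD -[RHS]expR0; congr expR; ring.
  have S2 : ((t `^ (-1)) ^+ s * t ^+ s = 1)%R by rewrite powR_inv1 ?ltW// exprVn mulVf// expf_neq0// gt_eqF.
  rewrite -[LHS]mul1r -[X in (X * _)%R = _]S -[LHS]mul1r -[X in (X * _)%R = _]S2; ring.
rewrite (eq_lebC E) lebCZl//; first last.
- by move=> d' T' u mu; apply: gg; apply: cmeas_scalec => //; exact: cmfun_cst.
- by rewrite !mulr_ge0 ?expR_ge0 ?powR_ge0 ?exprn_ge0 ?ltW.
rewrite (lebC_scale r0 gg g0) muleA -EFinM muleC /pos t0; congr (_ * _%:E).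
(* The Jacobian gives [t ^ k] and homogeneity [t ^ s], so the Gamma exponent rises from [c] to
   [k + s + c]. *)
rewrite /r exprM invrK sqr_sqrtr ?ltW// -!powR_mulrn ?ltW// [RHS]mulrC.
rewrite /powR (gt_eqF t0) -!expRD; congr expR; rewrite natrD; ring.
Qed.

End Radial.

Section LinComb.
Context {R : realType} d (T : measurableType d) (P : {measure set T -> \bar R}).

(** The coefficients may be negative, as [nu] may be. Additivity therefore rests on integrability,
    which follows from the finite value of each integral. *)
Lemma integral_lincomb k (phi : 'I_k -> T -> R) (c g : 'I_k -> R) :
  (forall i, measurable_fun setT (phi i)) -> (forall i x, 0 <= phi i x) ->
  (forall i, \int[P]_x (phi i x)%:E = (g i)%:E)%E ->
  P.-integrable setT (fun x => (\sum_i c i * phi i x)%:E) /\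
  (\int[P]_x (\sum_i c i * phi i x)%:E = (\sum_i c i * g i)%:E)%E.
Proof.
move=> mphi phi0 H.
have I i : P.-integrable setT (fun x => (phi i x)%:E).
  apply/integrableP; split; first exact/measurable_EFinP.
  under eq_integral do rewrite gee0_abs ?lee_fin//.
  by rewrite H ltry.
have Ic i : P.-integrable setT (fun x => ((c i)%:E * (phi i x)%:E)%E) by exact: integrableZl.
have E x : ((\sum_i c i * phi i x)%:E = \sum_i (c i)%:E * (phi i x)%:E)%E by rewrite sumEFin.
split; first by under eq_fun do rewrite E; exact: integrable_sum.
under eq_integral do rewrite E.
rewrite integral_sum// -sumEFin; apply: eq_bigr => i _.
by rewrite integralZl// H.
Qed.

End LinComb.

Section Moment.
Context {R : realType} (n m : nat) (nu alpha : R).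
Hypotheses (m0 : (0 < m)%N) (nu1 : -1 < nu) (alpha_gt : (m + n)%:R < alpha).
Local Notation C := (C R).

(* [Wfun] is the radial profile of the weight, expanded with coefficients [Wcoef] in powers of [1 / (1 - x)];
   [Smom s] is its normalised [s]-th moment and the denominator of [chi]. *)
Definition Wcoef (d : nat) : R := 'C(n, d)%:R * nu ^+ (n - d).
Definition Wfun (x : R) : R :=
  if x < 1 then (1 - x) `^ (alpha - m%:R - 1) * (nu + (1 - x)^-1) ^+ n else 0.
Definition Smom (s : nat) : R :=
  \sum_(d < n.+1) Wcoef d * (Gamma (alpha - m%:R - d%:R) / Gamma (alpha - d%:R + s%:R)).

(** The hypothesis on [alpha] keeps every Gamma argument of [Smom] positive, up to the extreme case
    [d = n]. *)
Lemma alpha_sub_gt0 (d : 'I_n.+1) : 0 < alpha - m%:R - d%:R.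
Proof.
rewrite -addrA -opprD subr_gt0 -natrD; apply: le_lt_trans alpha_gt.
by rewrite ler_nat leq_add2l -ltnS.
Qed.

Lemma alpha_m_gt0 : 0 < alpha - m%:R.
Proof. by have := alpha_sub_gt0 ord0; rewrite subr0. Qed.

Lemma alpha_gt0 : 0 < alpha.
Proof. by apply: lt_le_trans alpha_m_gt0 _; rewrite gerBl. Qed.

Lemma Wcoef_sum (x : R) : x < 1 ->
  \sum_(d < n.+1) Wcoef d * (1 - x) `^ (alpha - m%:R - d%:R - 1) =
  (1 - x) `^ (alpha - m%:R - 1) * (nu + (1 - x)^-1) ^+ n.
Proof.
move=> x1; have y0 : 0 < 1 - x by rewrite subr_gt0.
rewrite exprDn mulr_sumr; apply: eq_bigr => d _.
have -> : (1 - x) `^ (alpha - m%:R - d%:R - 1) = (1 - x) `^ (alpha - m%:R - 1) * (1 - x)^-1 ^+ d.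
  rewrite exprVn -powR_mulrn ?ltW// -powRN -powRD; last by apply/implyP => _; rewrite gt_eqF.
  by congr powR; ring.
by rewrite /Wcoef -mulr_natl; ring.
Qed.

Lemma Wfun_sum (x : R) : Wfun x = \sum_(d < n.+1) Wcoef d * ballw (alpha - m%:R - d%:R) x.
Proof.
rewrite /Wfun /ballw; case: ifP => x1; first by rewrite Wcoef_sum.
by rewrite big1// => d _; rewrite mulr0.
Qed.

Lemma Wbase_ge (x : R) : 0 <= x -> x < 1 -> (nu + 1) ^+ n <= (nu + (1 - x)^-1) ^+ n.
Proof.
move=> x0 x1; have y0 : 0 < 1 - x by rewrite subr_gt0.
have a0 : 0 <= nu + 1 by rewrite ltW// -ltrBlDr sub0r.
have h : nu + 1 <= nu + (1 - x)^-1 by rewrite lerD2l invf_ge1 ?gerBl//.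
by rewrite lerXn2r ?nnegrE//; apply: le_trans h.
Qed.

(** Here [nu > -1] enters: [nu + 1 / (1 - x)] is at least [nu + 1 > 0], although single terms of the
    expansion of [Wfun] may be negative. *)
Lemma Wfun_ge (x : R) : 0 <= x -> (nu + 1) ^+ n * ballw (alpha - m%:R) x <= Wfun x.
Proof.
move=> x0; rewrite /Wfun /ballw; case: ifP => x1; last by rewrite mulr0.
by rewrite mulrC ler_wpM2l ?powR_ge0// Wbase_ge.
Qed.

Lemma nu1_gt0 : 0 < (nu + 1) ^+ n.
Proof. by apply: exprn_gt0; rewrite -ltrBlDr sub0r. Qed.

Lemma Wfun_ge0 (x : R) : 0 <= x -> 0 <= Wfun x.
Proof. by move=> x0; apply: le_trans (Wfun_ge x0); rewrite mulr_ge0 ?ballw_ge0 ?ltW ?nu1_gt0. Qed.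

Lemma measurable_Wfun : measurable_fun setT Wfun.
Proof.
rewrite (_ : Wfun = fun x => \sum_(d < n.+1) Wcoef d * ballw (alpha - m%:R - d%:R) x); last by apply/funext => x; exact: Wfun_sum.
by apply: measurable_sum => d; apply: measurable_funM; [exact: measurable_cst | exact: measurable_ballw].
Qed.

(** [Gamma (m + s) * Smom s] is the integral of [x ^ (m + s - 1)] against the profile of the weight,
    and [Wbase_ge] bounds that profile below. The result gives positivity of [Smom] and later the
    growth of the kernel coefficients. *)
Lemma Smom_ge (s : nat) : (nu + 1) ^+ n * (Gamma (alpha - m%:R) / Gamma (alpha + s%:R)) <= Smom s.
Proof.
pose M : R := (m + s)%:R.
have M0 : 0 < M by rewrite ltr0n ltn_addr.
have GM := Gamma_gt0 M0.
have E (d : 'I_n.+1) : M + (alpha - m%:R - d%:R) = alpha - d%:R + s%:R by rewrite /M natrD; ring.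
have B (d : 'I_n.+1) : betaI M (alpha - m%:R - d%:R) =
    (Gamma M * (Gamma (alpha - m%:R - d%:R) / Gamma (alpha - d%:R + s%:R)))%:E.
  by rewrite betaI_EFin ?alpha_sub_gt0// E mulrA.
have [I1 I2] := @integral_lincomb R _ _ lebesgue_measure n.+1 (fun d => betaf M (alpha - m%:R - d%:R)) Wcoef _
  (fun d => measurable_betaf _ _) (fun d => betaf_ge0 _ _) B.
rewrite -(ler_pM2l GM) -lee_fin.
have -> : (Gamma M * Smom s)%:E = (\sum_(d < n.+1) Wcoef d * (Gamma M * (Gamma (alpha - m%:R - d%:R) / Gamma (alpha - d%:R + s%:R))))%:E.
  by congr EFin; rewrite /Smom mulr_sumr; apply: eq_bigr => d _; rewrite mulrCA.
rewrite -I2 mulrCA EFinM.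
have -> : (Gamma M * (Gamma (alpha - m%:R) / Gamma (alpha + s%:R)))%:E = betaI M (alpha - m%:R).
  by have := B ord0; rewrite !subr0.
rewrite /betaI -ge0_integralZl//; first last.
- by rewrite lee_fin ltW// nu1_gt0.
- by move=> x _; rewrite lee_fin betaf_ge0.
- by apply/measurable_EFinP; exact: measurable_betaf.
have Mb d : measurable_fun setT (fun x => (betaf M d x)%:E) by apply/measurable_EFinP; exact: measurable_betaf.
apply: ge0_le_integral => //.
- by move=> x _; rewrite mule_ge0 ?lee_fin ?betaf_ge0 ?(ltW nu1_gt0).
- exact: (measurable_funeM ((nu + 1) ^+ n)%:E (Mb _)).
- by have /integrableP[] := I1.
move=> x _; rewrite -EFinM lee_fin /betaf; case: ifP => [/andP[x0 x1]|_]; last first.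
  by rewrite mulr0 big1// => d _; rewrite mulr0.
rewrite (eq_bigr (fun d : 'I_n.+1 => x `^ (M - 1) * (Wcoef d * (1 - x) `^ (alpha - m%:R - d%:R - 1)))); last by move=> d _; rewrite mulrCA.
rewrite -mulr_sumr mulrCA ler_wpM2l ?powR_ge0// Wcoef_sum// mulrC ler_wpM2l ?powR_ge0//.
by rewrite Wbase_ge// ltW.
Qed.

Lemma Smom_gt0 (s : nat) : 0 < Smom s.
Proof.
apply: lt_le_trans (Smom_ge s); rewrite mulr_gt0 ?nu1_gt0// divr_gt0 ?Gamma_gt0 ?alpha_m_gt0//.
by rewrite ltr_pwDl ?alpha_gt0.
Qed.

Local Open Scope ereal_scope.
Lemma eq_mule_div (a b : R) (x y : \bar R) : (0 < b)%R -> a%:E * x = b%:E * y -> y = (a / b)%:E * x.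
Proof. by move=> b0 H; rewrite mulrC EFinM -muleA H muleA -EFinM mulVf ?gt_eqF// mul1e. Qed.

(** [radial_gamma] turns each power of the expansion of [Wfun] into the same Gaussian integral, with
    a quotient of Gamma values as factor. *)
Lemma lebC_Wfun (h : 'rV[C]_m -> R) (s : nat) :
  cgood (fun v => (h v)%:E) -> (forall v, 0 <= h v)%R ->
  (forall (tau : R) v, (0 < tau)%R -> h (rc tau *: v)%R = (tau ^+ (2 * s) * h v)%R) ->
  lebC (fun v => (h v * Wfun (sqn v))%:E) = (Smom s)%:E * lebC (fun v => (h v * expR (- sqn v))%:E).
Proof.
move=> gh h0 hh; set X := lebC (fun v => (h v * expR (- sqn v))%:E).
have mhh d' (T' : measurableType d') (u : T' -> 'rV[C]_m) : cmeas u -> measurable_fun setT (fun t => h (u t)).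
  by move=> mu; apply/measurable_EFinP; exact: gh.
have X0 : 0 <= X by apply: lebC_ge0 => v; rewrite lee_fin mulr_ge0 ?expR_ge0.
have mb c d' (T' : measurableType d') (u : T' -> 'rV[C]_m) : cmeas u -> measurable_fun setT (fun t => (h (u t) * ballw c (sqn (u t)))%R).
  by move=> mu; apply: measurable_funM; [exact: mhh | apply: (measurableT_comp (measurable_ballw c)); exact: measurable_sqn].
have A (d : 'I_n.+1) : lebC (fun v => (h v * ballw (alpha - m%:R - d%:R) (sqn v))%:E) =
    (Gamma (alpha - m%:R - d%:R) / Gamma (alpha - d%:R + s%:R))%:E * X.
  have cd := alpha_sub_gt0 d.
  have E : ((m + s)%:R + (alpha - m%:R - d%:R) = alpha - d%:R + s%:R)%R by rewrite natrD; ring.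
  have Mc : (0 < alpha - d%:R + s%:R)%R by rewrite -E ltr_wpDl.
  have G := Gamma_gt0 Mc.
  have := radial_gamma (alpha - m%:R - d%:R) gh h0 hh; rewrite E (gammaI_EFin cd) (gammaI_EFin Mc) -/X => H.
  exact: eq_mule_div.
(* If the Gaussian integral is infinite, a signed combination of the terms is meaningless. The term
   [d = 0] alone is infinite, and a multiple of it lies below [Wfun]. *)
have [Xoo|Xfin] := eqVneq X +oo.
  rewrite Xoo gt0_muley ?lte_fin ?Smom_gt0//; apply/eqP; rewrite -leye_eq.
  have := A ord0; rewrite !subr0 Xoo gt0_muley; last first.
    by rewrite lte_fin divr_gt0 ?Gamma_gt0 ?alpha_m_gt0// ltr_pwDl ?alpha_gt0.
  move=> A0; rewrite -(gt0_muley (x := ((nu + 1) ^+ n)%:E)) ?lte_fin ?nu1_gt0// -A0 -lebCZl; first last.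
  - by move=> v; rewrite lee_fin mulr_ge0 ?ballw_ge0.
  - by move=> d' T' u mu; apply/measurable_EFinP; exact: mb.
  - exact: ltW nu1_gt0.
  apply: le_lebC.
  - by move=> d' T' u mu; apply: measurable_funeM; apply/measurable_EFinP; exact: mb.
  - move=> d' T' u mu; apply/measurable_EFinP; apply: measurable_funM; first exact: mhh.
    by apply: (measurableT_comp measurable_Wfun); exact: measurable_sqn.
  - by move=> v; rewrite mule_ge0 ?lee_fin ?(ltW nu1_gt0)// mulr_ge0 ?ballw_ge0.
  - by move=> v; rewrite -EFinM lee_fin mulrCA ler_wpM2l// Wfun_ge// sqn_ge0.
have XE : X = (fine X)%:E by rewrite fineK// fin_numE Xfin andbT gt_eqF// (lt_le_trans _ X0).
have [d [T [P [Z [mZ HZ]]]]] := @lebC_rep R m.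
have H (i : 'I_n.+1) : \int[P]_t (h (Z t) * ballw (alpha - m%:R - i%:R) (sqn (Z t)))%:E =
    (Gamma (alpha - m%:R - i%:R) / Gamma (alpha - i%:R + s%:R) * fine X)%:E.
  rewrite EFinM -XE -A HZ// => [d' T' u mu|v]; last by rewrite lee_fin mulr_ge0 ?ballw_ge0.
  by apply/measurable_EFinP; exact: mb.
have [_ I2] := @integral_lincomb R _ _ P n.+1 (fun i t => h (Z t) * ballw (alpha - m%:R - i%:R) (sqn (Z t)))%R Wcoef _
  (fun i => mb _ _ _ _ mZ) (fun i t => mulr_ge0 (h0 _) (ballw_ge0 _ _)) H.
rewrite HZ; first last.
- by move=> v; rewrite lee_fin mulr_ge0// Wfun_ge0// sqn_ge0.
- move=> d' T' u mu; apply/measurable_EFinP; apply: measurable_funM; first exact: mhh.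
  by apply: (measurableT_comp measurable_Wfun); exact: measurable_sqn.
rewrite XE -EFinM /Smom mulr_suml.
under eq_bigr do rewrite -mulrA.
rewrite -I2; apply: eq_integral => t _; congr EFin; rewrite Wfun_sum mulr_sumr.
by apply: eq_bigr => i _; rewrite mulrCA.
Qed.

End Moment.

Section LineDerivative.
Context {R : realType}.

Lemma derive_line (V : normedModType R) (F : V -> R) (a v : V) (g : R -> R) (L : R) :
  (\forall t \near (0 : R), F (a + t *: v) = g t) -> is_derive (0 : R) (1 : R) g L -> 'D_v F a = L.
Proof.
move=> Fg [dg Lg]; have {dg}cg : h^-1 *: ((g \o shift 0) (h *: (1 : R)) - g 0) @[h --> (0 : R)^'] --> L.
  by rewrite -Lg; exact: dg.
have F0 : F a = g 0 by have := nbhs_singleton Fg; rewrite scale0r addr0.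
apply/cvg_lim => //; apply: cvg_trans cg; apply: near_eq_cvg.
near=> h; rewrite /= F0; congr (_ *: (_ - _)).
rewrite addr0 /GRing.scale /= mulr1 addrC; apply/esym.
by near: h; apply: (@cvg_within _ (nbhs (0 : R))).
Unshelve. all: by end_near.
Qed.

End LineDerivative.

(** * The volume form *)

Section Determinants.

(* [(1, 0; v, 1) (1 + uv, u; 0, 1) (1, 0; -v, 1) = (1, u; 0, 1 + vu)] *)
Lemma det_rank1 (K : comNzRingType) m (u : 'cV[K]_m) (v : 'rV[K]_m) :
  \det (1%:M + u *m v) = 1 + (v *m u) ord0 ord0.
Proof.
have E : block_mx 1%:M 0 v 1%:M *m block_mx (1%:M + u *m v) u 0 1%:M *m block_mx 1%:M 0 (- v) 1%:M =
    block_mx 1%:M u 0 (1%:M + v *m u).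
  rewrite !mulmx_block; congr block_mx; rewrite ?(mulmx0, mul0mx, mul1mx, mulmx1, addr0, add0r)//.
  - by rewrite mulmxN addrK.
  - by rewrite mulmxN mulmxDr mulmxDl mulmx1 mul1mx mulmxA [v + _]addrC subrr.
  - by rewrite addrC.
have := congr1 (@determinant _ _) E; rewrite !det_mulmx !det_lblock !det_ublock !det1 !mul1r !mulr1 => ->.
by rewrite [_ + _]mx11_scalar det_scalar1 mxE mxE eqxx.
Qed.

Lemma det_scalar_rank1 (K : fieldType) m (a c : K) (u : 'cV[K]_m) (v : 'rV[K]_m) : a != 0 ->
  \det (a%:M + c *: (u *m v)) = a ^+ m * (1 + c / a * (v *m u) ord0 ord0).
Proof.
move=> a0; have -> : a%:M + c *: (u *m v) = a *: (1%:M + (c / a *: u) *m v).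
  by rewrite scalerDr scale_scalar_mx mulr1 -scalemxAl scalerA mulrC divfK.
by rewrite detZ det_rank1 -scalemxAr mxE.
Qed.

(* Subtract [mu z^* w] times the lower rows from the upper ones. *)
Lemma det_hessian (K : fieldType) n m (z : 'rV[K]_n) (w : 'rV[K]_m) (z' : 'cV[K]_n) (w' : 'cV[K]_m)
    (gp gq gpp gpq gqq mu q : K) :
  gq != 0 -> (w *m w') ord0 ord0 = q ->
  gpp = mu * q * gpq -> gpq = mu * (gq + q * gqq) ->
  \det (block_mx (gp%:M + gpp *: (z' *m z)) (gpq *: (z' *m w)) (gpq *: (w' *m z)) (gq%:M + gqq *: (w' *m w))) =
  gp ^+ n * (gq ^+ m * (1 + gqq / gq * q)).
Proof.
move=> gq0 qE e1 e2.
have wwE : w *m w' = q%:M by rewrite [LHS]mx11_scalar qE.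
have E : block_mx 1%:M (- mu *: (z' *m w)) 0 1%:M *m
   block_mx (gp%:M + gpp *: (z' *m z)) (gpq *: (z' *m w)) (gpq *: (w' *m z)) (gq%:M + gqq *: (w' *m w)) =
   block_mx gp%:M 0 (gpq *: (w' *m z)) (gq%:M + gqq *: (w' *m w)).
  rewrite mulmx_block !mul1mx !mul0mx !add0r; congr block_mx.
  - rewrite -scalemxAl -scalemxAr scalerA -mulmxA [w *m (w' *m z)]mulmxA wwE mul_scalar_mx -scalemxAr scalerA.
    by rewrite -addrA -scalerDl e1 (_ : mu * q * gpq + _ = 0) ?scale0r ?addr0//; ring.
  - rewrite mulmxDr -!scalemxAl mul_mx_scalar -!scalemxAr scalerA scalerA -mulmxA [w *m (w' *m w)]mulmxA wwE mul_scalar_mx -scalemxAr scalerA.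
    by rewrite -scalerDl -scalerDl e2 (_ : mu * (gq + q * gqq) + _ = 0) ?scale0r//; ring.
have := congr1 (@determinant _ _) E; rewrite det_mulmx det_ublock !det1 !mul1r => ->.
by rewrite det_lblock det_scalar det_scalar_rank1// qE.
Qed.

End Determinants.

Section Hessian.
Context {R : realType} (n m : nat) (mu nu : R).
Hypothesis mu0 : 0 < mu.
Local Notation C := (C R).
Local Notation N := (n + m)%N.
Local Notation V := ('rV[R]_N * 'rV[R]_N)%type.

Definition isl (i : 'I_N) : bool := (i < n)%N.
(** [true] selects the block [z] and [false] the block [w], so that one formula serves for all pairs
    of coordinates. *)
Definition sqb (b : bool) (u : V) : R := \sum_(j < N | isl j == b) ((u.1 ord0 j) ^+ 2 + (u.2 ord0 j) ^+ 2).

Lemma sqn_lsub_toC (u : V) : sqn (lsubmx (toC u) : 'rV[C]_n) = sqb true u.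
Proof.
rewrite /sqb big_split_ord /= [X in _ = _ + X]big_pred0 ?addr0 => [|j]; last by rewrite /isl /= ltnNge leq_addr.
by apply: eq_big => [j|j _]; rewrite ?/isl /= ?ltn_ord// /abs2 !mxE.
Qed.

Lemma sqn_rsub_toC (u : V) : sqn (rsubmx (toC u) : 'rV[C]_m) = sqb false u.
Proof.
rewrite /sqb big_split_ord /= [X in _ = X + _]big_pred0 ?add0r => [|j]; last by rewrite /isl /= ltn_ord.
by apply: eq_big => [j|j _]; rewrite ?/isl /= ?ltnNge ?leq_addr// /abs2 !mxE.
Qed.

Definition dir (e : bool * 'I_N) : V :=
  if e.1 then ((delta_mx ord0 e.2 : 'rV[R]_N), (0 : 'rV[R]_N)) else ((0 : 'rV[R]_N), (delta_mx ord0 e.2 : 'rV[R]_N)).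
Definition crd (e : bool * 'I_N) (u : V) : R := if e.1 then u.1 ord0 e.2 else u.2 ord0 e.2.

Lemma crd_dir e f (u : V) t : crd e (u + t *: dir f) = crd e u + t * (e == f)%:R.
Proof.
case: e f => [[] i] [[] j]; rewrite /crd /dir /= !mxE /= ?xpair_eqE /= ?mulr0// eqxx /=; by case: (i == j).
Qed.

Lemma sqb_dir b e (u : V) t :
  sqb b (u + t *: dir e) = sqb b u + (isl e.2 == b)%:R * (2 * t * crd e u + t ^+ 2).
Proof.
have E (j : 'I_N) : ((u + t *: dir e).1 ord0 j) ^+ 2 + ((u + t *: dir e).2 ord0 j) ^+ 2 =
   ((u.1 ord0 j) ^+ 2 + (u.2 ord0 j) ^+ 2) + (j == e.2)%:R * (2 * t * crd e u + t ^+ 2).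
  have := crd_dir (true, j) e u t; have := crd_dir (false, j) e u t; rewrite /crd /= => -> ->.
  case: e => [c i]; have [->|/negbTE ne] := eqVneq j i; rewrite !xpair_eqE ?eqxx ?ne ?andbF /=; by case: c => /=; ring.
rewrite /sqb (eq_bigr _ (fun j _ => E j)) big_split /=; congr (_ + _).
rewrite -mulr_suml; congr (_ * _).
rewrite big_mkcond (bigD1 e.2) //= eqxx big1 ?addr0; first by case: (_ == b).
by move=> j /negbTE ->; case: ifP.
Qed.

(* [Phi] as a function of [p = |z|^2] and [q = |w|^2], with its partial derivatives [G1] and [G2]. *)
Definition PhiG (p q : R) : R := nu * mu * p - ln (expR (- mu * p) - q).
Definition Del (p q : R) : R := expR (- mu * p) - q.
Definition G1 (b : bool) (p q : R) : R := if b then nu * mu + mu * expR (- mu * p) / Del p q else (Del p q)^-1.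
Definition G2 (b c : bool) (p q : R) : R :=
  if b && c then mu ^+ 2 * expR (- mu * p) * q / Del p q ^+ 2
  else if b || c then mu * expR (- mu * p) / Del p q ^+ 2 else (Del p q ^+ 2)^-1.

Section Curve.
Variables (p q : R -> R) (dp dq : R).
Hypotheses (Hp : is_derive (0 : R) (1 : R) p dp) (Hq : is_derive (0 : R) (1 : R) q dq).
Hypothesis D0 : 0 < Del (p 0) (q 0).

Lemma is_derive_mull (f : R -> R) (k df : R) : is_derive (0 : R) (1 : R) f df ->
  is_derive (0 : R) (1 : R) (fun t => k * f t) (k * df).
Proof. by move=> H; exact: (@is_deriveZ _ _ _ f k 0 1 df H). Qed.

Lemma is_derive_exp_curve : is_derive (0 : R) (1 : R) (fun t => expR (- mu * p t)) (- mu * expR (- mu * p 0) * dp).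
Proof.
have H1 : is_derive (0 : R) (1 : R) (fun t => - mu * p t) (- mu * dp) by exact: is_derive_mull.
have H2 := @is_derive1_comp R expR (fun t => - mu * p t) 0 _ _ (is_derive_expR _) H1.
by apply: (is_derive_eq H2); rewrite mulrA [expR _ * _]mulrC.
Qed.

Lemma is_derive_Del : is_derive (0 : R) (1 : R) (fun t => Del (p t) (q t)) (- mu * expR (- mu * p 0) * dp - dq).
Proof. exact: (is_deriveB is_derive_exp_curve Hq). Qed.

Lemma is_derive_DelV : is_derive (0 : R) (1 : R) (fun t => (Del (p t) (q t))^-1)
  ((mu * expR (- mu * p 0) * dp + dq) / Del (p 0) (q 0) ^+ 2).
Proof.
have := is_deriveV (f := fun t => Del (p t) (q t)) (x := 0) (v := 1) _ is_derive_Del.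
move=> /(_ (lt0r_neq0 D0)) H; apply: (is_derive_eq H).
by rewrite /GRing.scale /= -exprVn; ring.
Qed.

Lemma is_derive_PhiG : is_derive (0 : R) (1 : R) (fun t => PhiG (p t) (q t))
  (G1 true (p 0) (q 0) * dp + G1 false (p 0) (q 0) * dq).
Proof.
have H1 : is_derive (0 : R) (1 : R) (fun t => nu * mu * p t) (nu * mu * dp) by exact: is_derive_mull.
have H2 := @is_derive1_comp R (@ln R) (fun t => Del (p t) (q t)) 0 _ _ (is_derive1_ln D0) is_derive_Del.
by apply: (is_derive_eq (is_deriveB H1 H2)); rewrite /G1; ring.
Qed.

Lemma is_derive_G1 b : is_derive (0 : R) (1 : R) (fun t => G1 b (p t) (q t))
  (G2 b true (p 0) (q 0) * dp + G2 b false (p 0) (q 0) * dq).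
Proof.
case: b; rewrite /G1 /G2 /=; last first.
  by apply: (is_derive_eq is_derive_DelV); rewrite mulrDl; ring.
have H1 : is_derive (0 : R) (1 : R) (fun t => mu * expR (- mu * p t)) (mu * (- mu * expR (- mu * p 0) * dp)).
  by apply: is_derive_mull; exact: is_derive_exp_curve.
have H2 := is_deriveM H1 is_derive_DelV.
apply: (is_derive_eq (is_deriveD (is_derive_cst (nu * mu) (0 : R) (1 : R)) H2)).
have d0 := lt0r_neq0 D0; rewrite /GRing.scale /= /Del in d0 *; field; exact: d0.
Qed.

End Curve.

Local Notation F := (fun v : V => @Phi R n m mu nu (toC v)).

Lemma Phi_toC (u : V) : Phi mu nu (toC u) = PhiG (sqb true u) (sqb false u).
Proof. by rewrite /Phi sqn_lsub_toC sqn_rsub_toC. Qed.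

Lemma is_derive_sqb b e (u : V) :
  is_derive (0 : R) (1 : R) (fun t => sqb b (u + t *: dir e)) (2 * crd e u * (isl e.2 == b)%:R).
Proof.
rewrite (_ : (fun t => _) = (fun t : R => sqb b u + (isl e.2 == b)%:R * (2 * crd e u * t + t * t))); last first.
  by apply/funext => t; rewrite sqb_dir expr2; congr (_ + _ * (_ + _)); ring.
have H0 := is_derive_id (0 : R) (1 : R).
have H1 := is_derive_mull (2 * crd e u) H0.
have H2 := is_deriveM H0 H0.
have H3 := is_derive_mull (isl e.2 == b)%:R (is_deriveD H1 H2).
apply: (is_derive_eq (is_deriveD (is_derive_cst (sqb b u) (0 : R) (1 : R)) H3)).
by rewrite /GRing.scale /= !mul0r; ring.
Qed.

Lemma line0 (e : bool * 'I_N) (u : V) : u + (0 : R) *: dir e = u.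
Proof. by rewrite scale0r addr0. Qed.

Lemma derive_Phi e (u : V) : 0 < Del (sqb true u) (sqb false u) ->
  'D_(dir e) F u = 2 * crd e u * G1 (isl e.2) (sqb true u) (sqb false u).
Proof.
move=> D0; apply: (derive_line (g := fun t => PhiG (sqb true (u + t *: dir e)) (sqb false (u + t *: dir e)))).
  by near=> t; rewrite Phi_toC.
have := is_derive_PhiG (is_derive_sqb true e u) (is_derive_sqb false e u).
rewrite line0 => /(_ D0) H; apply: (is_derive_eq H).
by case: (isl e.2) => /=; ring.
Unshelve. all: by end_near.
Qed.

Lemma Del_near e (u : V) : 0 < Del (sqb true u) (sqb false u) ->
  \forall t \near (0 : R), 0 < Del (sqb true (u + t *: dir e)) (sqb false (u + t *: dir e)).
Proof.
move=> D0; have [H _] := is_derive_Del (is_derive_sqb true e u) (is_derive_sqb false e u).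
have c := differentiable_continuous ((derivable1_diffP _ _).1 H).
by apply: (cvgr_gt _ c); rewrite /= line0.
Qed.

Lemma derive2_Phi e f (u : V) : 0 < Del (sqb true u) (sqb false u) ->
  'D_(dir e) ('D_(dir f) F) u =
  2 * (f == e)%:R * G1 (isl f.2) (sqb true u) (sqb false u)
  + 4 * crd e u * crd f u * G2 (isl f.2) (isl e.2) (sqb true u) (sqb false u).
Proof.
move=> D0; pose g t := 2 * crd f (u + t *: dir e) * G1 (isl f.2) (sqb true (u + t *: dir e)) (sqb false (u + t *: dir e)).
apply: (derive_line (g := g)).
  (* The formula for the first derivative is valid inside the domain only, and [Del_near] keeps the
     line in it for small [t]. *)
  by near=> t; rewrite derive_Phi//; near: t; exact: Del_near.
have H1 : is_derive (0 : R) (1 : R) (fun t => 2 * crd f (u + t *: dir e)) (2 * (f == e)%:R).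
  apply: is_derive_mull; rewrite (_ : (fun t => _) = (fun t : R => crd f u + (f == e)%:R * t)); last first.
    by apply/funext => t; rewrite crd_dir mulrC.
  have H := is_derive_mull (f == e)%:R (is_derive_id (0 : R) (1 : R)).
  by apply: (is_derive_eq (is_deriveD (is_derive_cst (crd f u) (0 : R) (1 : R)) H)); rewrite add0r mulr1.
have := @is_derive_G1 _ _ _ _ (is_derive_sqb true e u) (is_derive_sqb false e u) _ (isl f.2).
rewrite line0 => /(_ D0) H2; apply: (is_derive_eq (is_deriveM H1 H2)).
by rewrite /GRing.scale /= line0; case: (isl e.2) => /=; ring.
Unshelve. all: by end_near.
Qed.

Lemma ddbar_Phi (u : V) (j l : 'I_N) : 0 < Del (sqb true u) (sqb false u) ->
  ddbar F j l u = (j == l)%:R * rc (G1 (isl j) (sqb true u) (sqb false u))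
    + cconj (toC u ord0 j) * toC u ord0 l * rc (G2 (isl j) (isl l) (sqb true u) (sqb false u)).
Proof.
move=> D0; pose DD e f : R := 'D_(dir e) ('D_(dir f) F) u.
have key e f : DD e f = 2 * (f == e)%:R * G1 (isl f.2) (sqb true u) (sqb false u)
  + 4 * crd e u * crd f u * G2 (isl f.2) (isl e.2) (sqb true u) (sqb false u) by exact: derive2_Phi.
have -> : ddbar F j l u = rc 4^-1 * (Complex (DD (true, j) (true, l) + DD (false, j) (false, l))
  (DD (true, j) (false, l) - DD (false, j) (true, l)) : C) by [].
move: DD key => DD key; rewrite !key.
rewrite !xpair_eqE [l == j]eq_sym [toC u ord0 j]mxE [toC u ord0 l]mxE /crd.
have -> : (j == l)%:R = rc ((j == l)%:R) :> C by case: (j == l).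
have -> : G2 (isl l) (isl j) = G2 (isl j) (isl l) by rewrite /G2 andbC orbC.
by have [->|_] := eqVneq j l; apply: eqC; rewrite !cE /=; field.
Qed.

(** The Hessian consists of scalar blocks plus rank-one blocks, as in [det_hessian]. The two
    relations asked there between partial derivatives come down to
    [Del p q + q = expR (- mu * p)]. *)
Lemma det_Phi (u : V) (p := sqb true u) (q := sqb false u) : 0 < Del p q ->
  \det (\matrix_(j, l) ddbar F j l u) =
  rc (G1 true p q ^+ n * (Del p q ^- m * (expR (- mu * p) / Del p q))).
Proof.
move=> D0; have d0 := lt0r_neq0 D0.
pose z : 'rV[C]_n := lsubmx (toC u); pose w : 'rV[C]_m := rsubmx (toC u).
pose z' : 'cV[C]_n := \col_j cconj (z ord0 j); pose w' : 'cV[C]_m := \col_j cconj (w ord0 j).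
have -> : \matrix_(j, l) ddbar F j l u =
   block_mx ((rc (G1 true p q))%:M + rc (G2 true true p q) *: (z' *m z)) (rc (G2 true false p q) *: (z' *m w))
            (rc (G2 true false p q) *: (w' *m z)) ((rc (G1 false p q))%:M + rc (G2 false false p q) *: (w' *m w)).
  have il (i : 'I_n) : isl (lshift m i) = true by rewrite /isl /= ltn_ord.
  have ir (i : 'I_m) : isl (rshift n i) = false by rewrite /isl /= ltnNge leq_addr.
  apply/matrixP => i j; rewrite mxE ddbar_Phi//.
  case: (fintype.split_ordP i) => {}i ->; case: (fintype.split_ordP j) => {}j ->; rewrite ?block_mxEul ?block_mxEur ?block_mxEdl ?block_mxEdr ?il ?ir.
  - rewrite !mxE big_ord1 !mxE (inj_eq (@lshift_inj _ _)) -mulr_natl; congr (_ + _); ring.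
  - rewrite !mxE big_ord1 !mxE eq_lrshift mul0r add0r; ring.
  - rewrite !mxE big_ord1 !mxE eq_rlshift mul0r add0r; ring.
  - rewrite !mxE big_ord1 !mxE (inj_eq (@rshift_inj _ _)) -mulr_natl; congr (_ + _); ring.
rewrite (@det_hessian _ n m z w z' w' _ _ _ _ _ (rc mu) (rc q)).
- rewrite [RHS]rcM rcX; congr (_ * _); rewrite [RHS]rcM -exprVn rcX; congr (_ * _).
  by rewrite /G1 /G2 -rcV -!rcM -[1]rc1 -rcD; congr rc; rewrite /Del in d0 *; field; exact: d0.
- by rewrite rc_eq0 invr_eq0.
- rewrite mxE; under eq_bigr do rewrite !mxE mulrC -[cconj _ * _]mulrC mul_conj.
  by rewrite -rc_sum /q -sqn_rsub_toC /sqn; congr rc; apply: eq_bigr => i _; rewrite !mxE.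
- rewrite -!rcM /G2 /=; congr rc; rewrite /Del in d0 *; field; exact: d0.
- rewrite -!rcM -rcD -rcM /G1 /G2 /=; congr rc; rewrite /Del in d0 *; field; exact: d0.
Qed.

Variable alpha : R.

(** The weight in closed form: a Gaussian in [z] times a profile of [e^{mu |z|^2} |w|^2]. Since
    [Wfun] vanishes from [1] on, it also encodes the indicator of the domain. *)
Definition cwgt (x : 'rV[C]_N) : R := mu ^+ n / pi ^+ N
  * expR (- ((alpha * (nu + 1) - m%:R) * mu * sqn (lsubmx x : 'rV[C]_n)))
  * Wfun n m nu alpha (expR (mu * sqn (lsubmx x : 'rV[C]_n)) * sqn (rsubmx x : 'rV[C]_m)).

Lemma wgtE (u : V) : wgt mu nu alpha u = cwgt (toC u).
Proof.
set p := sqb true u; set q := sqb false u.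
have mD : (toC u \in @Dnm R n m mu) = (q < expR (- mu * p)).
  by apply/idP/idP; rewrite inE /Dnm /= sqn_lsub_toC sqn_rsub_toC.
rewrite /wgt /cwgt indicE mD sqn_lsub_toC sqn_rsub_toC /Wfun -/p -/q.
have ep : expR (mu * p) = (expR (- mu * p))^-1 by rewrite -expRN; congr expR; ring.
have e0 : 0 < expR (- mu * p) by exact: expR_gt0.
(* Membership in the domain and the test [x < 1] in [Wfun] are the same condition; when it fails
   both sides vanish. *)
rewrite ep [_^-1 * q]mulrC ltr_pdivrMr// mul1r; case: ifP => qp; last by rewrite mul0r mulr0.
rewrite mul1r; have D0 : 0 < Del p q by rewrite subr_gt0.
have d0 := lt0r_neq0 D0; have e0' := lt0r_neq0 e0.
rewrite /voldens det_Phi// cre_rc Phi_toC -/p -/q /PhiG -/(Del p q).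
have -> : 1 - q / expR (- mu * p) = Del p q / expR (- mu * p) by rewrite /Del; field.
have -> : G1 true p q = mu * (nu + (Del p q / expR (- mu * p))^-1) by rewrite /G1; field; rewrite e0' d0.
rewrite exprMn invf_div.
have -> : (Del p q / expR (- mu * p)) `^ (alpha - m%:R - 1) =
    expR (alpha * ln (Del p q)) * Del p q ^- m * (Del p q)^-1 * expR (mu * p * (alpha - m%:R - 1)).
  rewrite powRM ?invr_ge0 ?ltW// -expRN {2}/powR gt_eqF ?expR_gt0// expRK.
  rewrite -[Del p q ^- m]powR_invn; last exact: ltW.
  rewrite -[(Del p q)^-1]powR_inv1 ?ltW// /powR (negbTE d0) -!expRD; congr expR; ring.
have -> : expR (- alpha * (nu * mu * p - ln (Del p q))) =
   expR (- ((alpha * (nu + 1) - m%:R) * mu * p)) * expR (alpha * ln (Del p q)) * expR (mu * p * (alpha - m%:R - 1)) / expR (- mu * p).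
  by rewrite -expRN -!expRD; congr expR; ring.
have pN : pi ^+ N != 0 :> R by rewrite gt_eqF ?exprn_gt0 ?pi_gt0.
have dm : Del p q ^+ m != 0 by exact: expf_neq0.
move: (Del p q ^+ m) (pi ^+ N) (nu + _) dm pN => dm pN y dm0 pN0.
by field; rewrite d0 e0' dm0 pN0.
Qed.

End Hessian.

(** * Signed integrals and the transfer to Gaussian weights *)

Section SignedIntegral.
Context {R : realType}.
Local Notation C := (C R).
Local Notation leb := (@lebesgue_measure R).

Definition crgood k (g : 'rV[C]_k -> R) :=
  forall d (T : measurableType d) (u : T -> 'rV[C]_k), cmeas u -> measurable_fun setT (fun t => g (u t)).

(** Built from positive and negative parts exactly as [intCr], so that [innerH] unfolds to it. *)
Definition lebr k (g : 'rV[C]_k -> R) : R :=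
  fine (lebC (fun x => (Num.max (g x) 0)%:E)) - fine (lebC (fun x => (Num.max (- g x) 0)%:E)).

Definition cint k (g : 'rV[C]_k -> R) := crgood g /\ (lebC (fun x => `|g x|%:E) < +oo)%E.

Lemma crgoodE k (g : 'rV[C]_k -> R) : crgood g -> cgood (fun x => (g x)%:E).
Proof. by move=> gg d T u mu; apply/measurable_EFinP; exact: gg. Qed.

Lemma crgood_norm k (g : 'rV[C]_k -> R) : crgood g -> crgood (fun x => `|g x|).
Proof. by move=> gg d T u mu; apply: measurableT_comp => //; exact: gg. Qed.

Lemma crgood_max k (g : 'rV[C]_k -> R) : crgood g -> crgood (fun x => Num.max (g x) 0).
Proof. by move=> gg d T u mu; apply: measurable_maxr; [exact: gg | exact: measurable_cst]. Qed.

Lemma crgoodN k (g : 'rV[C]_k -> R) : crgood g -> crgood (fun x => - g x).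
Proof. by move=> gg d T u mu; apply: measurableT_comp => //; exact: gg. Qed.

Lemma crgoodD k (g h : 'rV[C]_k -> R) : crgood g -> crgood h -> crgood (fun x => g x + h x).
Proof. by move=> gg gh d T u mu; apply: measurable_funD; [exact: gg | exact: gh]. Qed.

Lemma crgoodM k (g h : 'rV[C]_k -> R) : crgood g -> crgood h -> crgood (fun x => g x * h x).
Proof. by move=> gg gh d T u mu; apply: measurable_funM; [exact: gg | exact: gh]. Qed.

Lemma crgood_cst k (c : R) : crgood (fun _ : 'rV[C]_k => c).
Proof. by move=> d T u mu; exact: measurable_cst. Qed.

Lemma lebC_normE k d (T : measurableType d) (P : {measure set T -> \bar R}) (Z : T -> 'rV[C]_k) (g : 'rV[C]_k -> R) :
  (forall g : 'rV[C]_k -> \bar R, cgood g -> (forall x, 0 <= g x)%E -> lebC g = \int[P]_t g (Z t))%E ->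
  crgood g -> (lebC (fun x => `|g x|%:E) = \int[P]_t `|(g (Z t))%:E|)%E.
Proof. by move=> H gg; apply: H => [|x]; [exact: crgoodE (crgood_norm gg) | rewrite lee_fin]. Qed.

(** The signed counterpart of [lebC_rep] for integrable functions; linearity of [lebr] is deduced
    from it. *)
Lemma lebr_rep k : exists d (T : measurableType d) (P : {sigma_finite_measure set T -> \bar R}) (Z : T -> 'rV[C]_k),
  [/\ cmeas Z, (forall g : 'rV[C]_k -> \bar R, cgood g -> (forall x, 0 <= g x)%E -> lebC g = \int[P]_t g (Z t))%E &
   forall g : 'rV[C]_k -> R, cint g -> P.-integrable setT (fun t => (g (Z t))%:E) /\
     (\int[P]_t (g (Z t))%:E = (lebr g)%:E)%E].
Proof.
have [d [T [P [Z [mZ H]]]]] := @lebC_rep R k.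
exists d, T, P, Z; split => // g [gg gf].
have I : P.-integrable setT (fun t => (g (Z t))%:E).
  apply/integrableP; split; first by apply/measurable_EFinP; exact: gg.
  by have E := lebC_normE H gg; rewrite E in gf.
split => //.
have [Ip In] := (integrable_funepos measurableT I, integrable_funeneg measurableT I).
have Ep : lebC (fun x => (Num.max (g x) 0)%:E) = (\int[P]_t ((fun t => (g (Z t))%:E)^\+ t))%E.
  rewrite H; first by apply: eq_integral => t _; rewrite funeposE EFin_max.
  - by apply: crgoodE; exact: crgood_max.
  - by move=> x; rewrite lee_fin le_max lexx orbT.
have En : lebC (fun x => (Num.max (- g x) 0)%:E) = (\int[P]_t ((fun t => (g (Z t))%:E)^\- t))%E.
  rewrite H; first by apply: eq_integral => t _; rewrite funenegE EFin_max.
  - by apply: crgoodE; apply: crgood_max; exact: crgoodN.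
  - by move=> x; rewrite lee_fin le_max lexx orbT.
rewrite /lebr Ep En integralE EFinB !fineK//; exact: integrable_fin_num.
Qed.

Lemma eq_lebr k (g h : 'rV[C]_k -> R) : g =1 h -> lebr g = lebr h.
Proof. by move=> gh; congr lebr; exact/funext. Qed.

Lemma eq_cint k (g h : 'rV[C]_k -> R) : g =1 h -> cint g -> cint h.
Proof. by move=> gh; rewrite (_ : h = g)//; apply/funext. Qed.

Lemma le_cint k (g h : 'rV[C]_k -> R) : crgood g -> cint h -> (forall x, `|g x| <= `|h x|) -> cint g.
Proof.
move=> gg [gh hf] le; split => //; apply: le_lt_trans hf; apply: le_lebC.
- by apply: crgoodE; exact: crgood_norm.
- by apply: crgoodE; exact: crgood_norm.
- by move=> x; rewrite lee_fin.
- by move=> x; rewrite lee_fin.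
Qed.

Lemma cintD k (g h : 'rV[C]_k -> R) : cint g -> cint h -> cint (fun x => g x + h x).
Proof.
move=> ig ih; split; first by apply: crgoodD; [case: ig | case: ih].
have [d [T [P [Z [mZ H HI]]]]] := @lebr_rep k.
rewrite (lebC_normE H); last by apply: crgoodD; [case: ig | case: ih].
by have /integrableP[_] := integrableD measurableT (HI _ ig).1 (HI _ ih).1.
Qed.

Lemma lebrD k (g h : 'rV[C]_k -> R) : cint g -> cint h -> lebr (fun x => g x + h x) = lebr g + lebr h.
Proof.
move=> ig ih; have [d [T [P [Z [mZ H HI]]]]] := @lebr_rep k.
have := integralD measurableT (HI _ ig).1 (HI _ ih).1; rewrite (HI _ ig).2 (HI _ ih).2 => E.
by apply: EFin_inj; exact: etrans (esym (HI _ (cintD ig ih)).2) E.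
Qed.

Lemma cintZ k (c : R) (g : 'rV[C]_k -> R) : cint g -> cint (fun x => c * g x).
Proof.
move=> [gg gf]; split; first exact: crgoodM (crgood_cst c) gg.
rewrite (@eq_lebC _ _ _ (fun x => `|c|%:E * `|g x|%:E)%E); last by move=> x; rewrite normrM.
rewrite lebCZl//; last by [move=> x; rewrite lee_fin | exact: crgoodE (crgood_norm gg)].
by apply: lte_mul_pinfty => //; rewrite ge0_fin_numE.
Qed.

Lemma lebrZ k (c : R) (g : 'rV[C]_k -> R) : cint g -> lebr (fun x => c * g x) = c * lebr g.
Proof.
move=> ig; have [d [T [P [Z [mZ H HI]]]]] := @lebr_rep k.
have := integralZl measurableT (HI _ ig).1 c; rewrite (HI _ ig).2 => E.
by apply: EFin_inj; exact: etrans (esym (HI _ (cintZ c ig)).2) E.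
Qed.

Lemma lebr_norm k (g : 'rV[C]_k -> R) : cint g -> (`|lebr g|%:E <= lebC (fun x => `|g x|%:E))%E.
Proof.
move=> ig; have [d [T [P [Z [mZ H HI]]]]] := @lebr_rep k.
rewrite -abse_EFin -(HI _ ig).2; apply: le_trans (le_abse_integral _ _ _) _ => //.
  by apply/measurable_EFinP; exact: ig.1.
by rewrite (lebC_normE H ig.1).
Qed.

Lemma lebr_ge0 k (g : 'rV[C]_k -> R) : (forall x, 0 <= g x) -> lebr g = fine (lebC (fun x => (g x)%:E)).
Proof.
move=> g0; rewrite /lebr [X in _ - fine X](_ : _ = 0%E); last first.
  have [d [T [P [Z [mZ H]]]]] := @lebC_rep R k.
  rewrite (@eq_lebC _ _ _ (fun=> 0%E)); last by move=> x; rewrite (max_idPr _)// oppr_le0.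
  by rewrite H// integral0.
by rewrite subr0; congr fine; apply: eq_lebC => x; rewrite (max_idPl _).
Qed.

Definition leb_inv k (phi : 'rV[C]_k -> 'rV[C]_k) :=
  (forall d (T : measurableType d) (u : T -> 'rV[C]_k), cmeas u -> cmeas (fun t => phi (u t))) /\
  (forall g : 'rV[C]_k -> \bar R, cgood g -> (forall x, 0 <= g x)%E -> lebC (fun x => g (phi x)) = lebC g).

Lemma crgood_comp k (phi : 'rV[C]_k -> 'rV[C]_k) (g : 'rV[C]_k -> R) : leb_inv phi -> crgood g -> crgood (fun x => g (phi x)).
Proof. by move=> [m _] gg d T u mu; apply: (gg _ _ (fun t => phi (u t))); exact: m. Qed.

Lemma lebr_inv k (phi : 'rV[C]_k -> 'rV[C]_k) (g : 'rV[C]_k -> R) : leb_inv phi -> crgood g ->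
  lebr (fun x => g (phi x)) = lebr g.
Proof.
move=> [_ H] gg; rewrite /lebr (H (fun x => (Num.max (g x) 0)%:E)) ?(H (fun x => (Num.max (- g x) 0)%:E))//.
- by apply: crgoodE; apply: crgood_max; exact: crgoodN.
- by move=> x; rewrite lee_fin le_max lexx orbT.
- by apply: crgoodE; exact: crgood_max.
- by move=> x; rewrite lee_fin le_max lexx orbT.
Qed.

Lemma lebC_norm_inv k (phi : 'rV[C]_k -> 'rV[C]_k) (g : 'rV[C]_k -> R) : leb_inv phi -> crgood g ->
  lebC (fun x => `|g (phi x)|%:E) = lebC (fun x => `|g x|%:E).
Proof. by move=> [_ H] gg; rewrite (H (fun x => `|g x|%:E))//; exact: crgoodE (crgood_norm gg). Qed.

Lemma cint_inv k (phi : 'rV[C]_k -> 'rV[C]_k) (g : 'rV[C]_k -> R) : leb_inv phi -> cint g -> cint (fun x => g (phi x)).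
Proof. by move=> ip [gg gf]; split; [exact: crgood_comp | rewrite lebC_norm_inv]. Qed.

Lemma leb_inv_rot k t : leb_inv (fun x : 'rV[C]_k => cis t *: x).
Proof.
split; last by move=> g gg g0; apply: lebC_rot => //; exact: abs2_cis.
by move=> d T u mu; apply: cmeas_scalec => //; exact: cmfun_cst.
Qed.

Lemma leb_inv_shift k (c : 'rV[C]_k) : leb_inv (fun x => x + c).
Proof.
split; last by move=> g gg g0; exact: lebC_shift.
by move=> d T u mu; apply: cmeasD => //; exact: cmeas_cst.
Qed.

Definition rotw n m (t : R) (x : 'rV[C]_(n + m)) : 'rV[C]_(n + m) := row_mx (lsubmx x) (cis t *: rsubmx x).

Lemma cmeas_rotw d (T : measurableType d) n m (p : T -> R) (u : T -> 'rV[C]_(n + m)) :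
  measurable_fun setT p -> cmeas u -> cmeas (fun t => rotw (p t) (u t)).
Proof.
move=> mp mu; apply: cmeas_row_mx; first exact: cmeas_lsub.
by apply: cmeas_scalec; [exact: cmfun_cis | exact: cmeas_rsub].
Qed.

Lemma leb_inv_rotw n m t : leb_inv (@rotw n m t).
Proof.
have mr d (T : measurableType d) (u : T -> 'rV[C]_(n + m)) : cmeas u -> cmeas (fun s => rotw t (u s)).
  by move=> mu; apply: cmeas_rotw => //; exact: measurable_cst.
split => // g gg g0.
rewrite !lebC_row_mx//; last by move=> d T u mu; exact: (gg _ _ (fun s => rotw t (u s)) (mr _ _ _ mu)).
apply: eq_lebC => z; have gz : cgood (fun w => g (row_mx z w)).
  by move=> d T u mu; apply: (gg _ _ (fun s => row_mx z (u s))); apply: cmeas_row_mx => //; exact: cmeas_cst.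
rewrite -(@lebC_rot R m (cis t) (fun w => g (row_mx z w)) (abs2_cis t) gz (fun w => g0 _)).
by apply: eq_lebC => w; rewrite /rotw row_mxKl row_mxKr.
Qed.

Lemma measurable_Int_param d (T : measurableType d) (h : T -> R -> R) (a b : R) :
  measurable_fun setT (fun z : T * R => h z.1 z.2) ->
  measurable_fun setT (fun t => Int (h t) a b).
Proof.
move=> mh; pose H (z : T * R) : R := if (a <= z.2) && (z.2 <= b) then h z.1 z.2 else 0.
have mH : measurable_fun setT (fun z => (H z)%:E).
  apply/measurable_EFinP; apply: measurable_fun_if => //.
    apply: measurable_and; apply: measurable_fun_ler => //; exact: measurable_snd.
  exact: (@measurable_funS _ _ _ _ setT).
pose Hp z := (Num.max (H z) 0)%:E; pose Hn z := (Num.max (- H z) 0)%:E.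
have E t : Int (h t) a b = fine (\int[leb]_y Hp (t, y) - \int[leb]_y Hn (t, y))%E.
  rewrite /Int /Rintegral integral_mkcond integralE; congr (fine (_ - _)%E); apply: eq_integral => y _;
    rewrite ?funeposE ?funenegE patchE mem_setE in_itv /= /Hp /Hn /H /= EFin_max; by case: ifP.
under eq_fun do rewrite E.
apply: measurableT_comp => //; apply: emeasurable_funB.
  apply: (@measurable_fun_fubini_tonelli_F _ _ _ _ _ leb Hp) => [|z]; last by rewrite lee_fin le_max lexx orbT.
  by apply/measurable_EFinP; apply: measurable_maxr; [exact/measurable_EFinP | exact: measurable_cst].
apply: (@measurable_fun_fubini_tonelli_F _ _ _ _ _ leb Hn) => [|z]; last by rewrite lee_fin le_max lexx orbT.
apply/measurable_EFinP; apply: measurable_maxr; last exact: measurable_cst.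
by apply: measurableT_comp => //; exact/measurable_EFinP.
Qed.

(** Fubini exchanges the average over [t] with the integral over space. The uniform bound [A] on a
    finite interval of angles gives integrability on the product. *)
Lemma lebr_avg k (G : R -> 'rV[C]_k -> R) (A I : R) :
  (forall d (T : measurableType d) (p : T -> R) (u : T -> 'rV[C]_k), measurable_fun setT p -> cmeas u ->
     measurable_fun setT (fun t => G (p t) (u t))) ->
  (forall x, cts_on (G^~ x) 0 (2 * pi)) ->
  (forall t, lebC (fun x => `|G t x|%:E) <= A%:E)%E -> (forall t, lebr (G t) = I) ->
  cint (fun x => (2 * pi)^-1 * Int (G^~ x) 0 (2 * pi)) /\ lebr (fun x => (2 * pi)^-1 * Int (G^~ x) 0 (2 * pi)) = I.
Proof.
move=> mG cG AG IG; have pp := pi2_gt0 (R := R).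
have iG t : cint (G t).
  split; last by apply: le_lt_trans (AG t) _; rewrite ltry.
  by move=> d T u mu; apply: (mG _ _ (fun=> t)) => //; exact: measurable_cst.
have gI : crgood (fun x => Int (G^~ x) 0 (2 * pi)).
  move=> d T u mu; apply: (@measurable_Int_param _ _ (fun s y => G y (u s))).
  by apply: (mG _ _ snd (fun z => u z.1)) => //; exact: cmeas_comp mu measurable_fst.
have [d [T [P [Z [mZ H HI]]]]] := @lebr_rep k.
pose F (z : T * R) : R := if (0 <= z.2) && (z.2 <= 2 * pi) then G z.2 (Z z.1) else 0.
have mF : measurable_fun setT (fun z => (F z)%:E).
  apply/measurable_EFinP; apply: measurable_fun_if => //.
    by apply: measurable_and; apply: measurable_fun_ler => //; exact: measurable_snd.
  apply: (@measurable_funS _ _ _ _ setT) => //.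
  by apply: (mG _ _ snd (fun z => Z z.1)) => //; exact: cmeas_comp mZ measurable_fst.
have lI : (\int[leb]_(y in `[0%R, (2 * pi)%R]) (cst A%:E) y = (A * (2 * pi))%:E)%E.
  rewrite integral_cst//= lebesgue_measure_itv/= lte_fin pp.
  by rewrite -EFinB subr0 -EFinM.
have IF : (P \x leb)%E.-integrable setT (fun z => (F z)%:E).
  apply/integrable21ltyP => //; apply: (@le_lt_trans _ _ (A * (2 * pi))%:E%E); last exact: ltry.
  rewrite -lI [leRHS]integral_mkcond; apply: ge0_le_integral => //.
  - by move=> y _; apply: integral_ge0.
  - by apply: (@measurable_fun_fubini_tonelli_G _ _ _ _ _ P (fun z => `|(F z)%:E|%E)) => //; exact: measurableT_comp.
  - by apply/(measurable_restrictT _ _).1.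
  - move=> y _; rewrite patchE mem_setE in_itv /= /F /=; case: ifP => _.
      by rewrite -(lebC_normE H (iG y).1).
    by under eq_integral do rewrite normr0; rewrite integral0.
have E1 x : (\int[leb]_y (F (x, y))%:E = (Int (G^~ (Z x)) 0 (2 * pi))%:E)%E.
  rewrite /Int /Rintegral fineK; last exact: (integrable_fin_num _ (cts_integrable (cG _))).
  rewrite integral_mkcond; apply: eq_integral => y _.
  by rewrite patchE mem_setE in_itv /= /F /=; case: ifP.
have E2 y : (\int[P]_x (F (x, y))%:E)%E = (if (0 <= y) && (y <= 2 * pi) then I%:E else 0%E).
  rewrite /F /=; case: ifP => _; last by rewrite integral0.
  by rewrite (HI _ (iG y)).2 IG.
have E0 : (\int[P]_x (Int (G^~ (Z x)) 0 (2 * pi))%:E = (I * (2 * pi))%:E)%E.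
  have := Fubini IF; under eq_integral do rewrite E1; move=> ->; under eq_integral do rewrite E2.
  rewrite -[RHS]/((I * (2 * pi))%:E) -(_ : \int[leb]_(y in `[0%R, (2 * pi)%R]) (cst I%:E) y = (I * (2 * pi))%:E)%E.
    by rewrite [RHS]integral_mkcond; apply: eq_integral => y _; rewrite patchE mem_setE in_itv.
  by rewrite integral_cst//= lebesgue_measure_itv/= lte_fin pp -EFinB subr0 -EFinM.
have cI : cint (fun x => Int (G^~ x) 0 (2 * pi)).
  split => //; rewrite (lebC_normE H gI).
  have /integrableP[_] := integrable_fubini_F IF; rewrite /fubini_F.
  apply: le_lt_trans; rewrite le_eqVlt; apply/orP; left; apply/eqP; apply: eq_integral => x _; congr (`|_|)%E.
  by apply/esym; exact: E1.
split; first exact: cintZ.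
rewrite lebrZ//; have -> : lebr (fun x => Int (G^~ x) 0 (2 * pi)) = I * (2 * pi).
  by apply: EFin_inj; rewrite -E0; exact: esym (HI _ cI).2.
by rewrite mulrCA mulVf ?mulr1// gt_eqF.
Qed.

Lemma lebr_cavg k (G : R -> 'rV[C]_k -> C) (A I : R) :
  (forall d (T : measurableType d) (p : T -> R) (u : T -> 'rV[C]_k), measurable_fun setT p -> cmeas u ->
     measurable_fun setT (fun t => cre (G (p t) (u t)))) ->
  (forall x, ccts (G^~ x) 0 (2 * pi)) ->
  (forall t, lebC (fun x => `|cre (G t x)|%:E) <= A%:E)%E -> (forall t, lebr (fun x => cre (G t x)) = I) ->
  cint (fun x => cre (cavg (G^~ x))) /\ lebr (fun x => cre (cavg (G^~ x))) = I.
Proof.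
move=> mG cG AG IG.
by have := @lebr_avg k (fun t x => cre (G t x)) A I mG (fun x => (cG x).1) AG IG.
Qed.

End SignedIntegral.

Section Transfer.
Context {R : realType} (n m : nat) (mu nu alpha : R).
Hypotheses (m0 : (0 < m)%N) (mu0 : 0 < mu) (nu1 : -1 < nu) (alpha_gt : (m + n)%:R < alpha).
Local Notation C := (C R).
Local Notation N := (n + m)%N.
Local Notation cwgt := (@cwgt R n m mu nu alpha).
Local Notation Smom := (@Smom R n m nu alpha).

Definition lam (s : nat) : R := mu * (alpha * (nu + 1) + s%:R).
Definition gss (s : nat) (x : 'rV[C]_N) : R :=
  expR (- (lam s * sqn (lsubmx x : 'rV[C]_n)) - sqn (rsubmx x : 'rV[C]_m)).
Definition c0 : R := mu ^+ n / pi ^+ N.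

Lemma c0_gt0 : 0 < c0.
Proof. by rewrite divr_gt0// exprn_gt0// pi_gt0. Qed.

Lemma cwgt_ge0 x : 0 <= cwgt x.
Proof.
rewrite /cwgt; apply: mulr_ge0; first by rewrite mulr_ge0 ?expR_ge0// ltW// c0_gt0.
by apply: Wfun_ge0 => //; rewrite mulr_ge0 ?expR_ge0 ?sqn_ge0.
Qed.

Lemma crgood_sqnl : crgood (fun x : 'rV[C]_N => sqn (lsubmx x : 'rV[C]_n)).
Proof. by move=> d T u mu'; apply: measurable_sqn; exact: cmeas_lsub. Qed.

Lemma crgood_sqnr : crgood (fun x : 'rV[C]_N => sqn (rsubmx x : 'rV[C]_m)).
Proof. by move=> d T u mu'; apply: measurable_sqn; exact: cmeas_rsub. Qed.

Lemma crgood_expR k (g : 'rV[C]_k -> R) : crgood g -> crgood (fun x => expR (g x)).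
Proof. by move=> gg d T u mu'; apply: measurableT_comp => //; exact: gg. Qed.

Lemma crgood_gss s : crgood (gss s).
Proof.
apply: crgood_expR; apply: crgoodD; apply: crgoodN; last exact: crgood_sqnr.
by apply: crgoodM; [exact: crgood_cst | exact: crgood_sqnl].
Qed.

Lemma crgood_cwgt : crgood cwgt.
Proof.
apply: crgoodM.
  apply: crgoodM; first exact: crgood_cst.
  by apply: crgood_expR; apply: crgoodN; apply: crgoodM; [exact: crgood_cst | exact: crgood_sqnl].
move=> d T u mu'; apply: (measurableT_comp (@measurable_Wfun R n m nu alpha)).
apply: measurable_funM; last exact: crgood_sqnr.
by apply: measurableT_comp => //; apply: measurable_funM; [exact: measurable_cst | exact: crgood_sqnl].
Qed.

(** For parts of degree [s] in [w], both the squared modulus and the product of one part with the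
    conjugate of another scale in this way. *)
Definition whom (s : nat) (H : 'rV[C]_N -> R) :=
  forall (tau : R) z v, 0 < tau -> H (row_mx z (rc tau *: v)) = tau ^+ (2 * s) * H (row_mx z v).

(** For fixed [z] the substitution [v = e^{mu |z|^2 / 2} w] makes the weight a radial function of
    [v]. [lebC_Wfun] then trades it for a Gaussian at the price of [Smom s]. *)
Lemma lebC_transfer s (H : 'rV[C]_N -> R) : crgood H -> (forall x, 0 <= H x) -> whom s H ->
  (lebC (fun x => (H x * cwgt x)%:E) = (c0 * Smom s)%:E * lebC (fun x => (H x * gss s x)%:E))%E.
Proof.
move=> gH H0 hH.
have S0 : 0 < Smom s by exact: Smom_gt0.
have gHz z : crgood (fun v => H (row_mx z v)).
  by move=> d T u mu'; apply: (gH _ _ (fun t => row_mx z (u t))); apply: cmeas_row_mx => //; exact: cmeas_cst.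
pose K z := lebC (fun v : 'rV[C]_m => (H (row_mx z v) * expR (- sqn v))%:E).
have gHe : crgood (fun x : 'rV[C]_N => H x * gss s x) by apply: crgoodM => //; exact: crgood_gss.
have K0 z : (0 <= K z)%E by apply: lebC_ge0 => v; rewrite lee_fin mulr_ge0 ?expR_ge0.
have gK : cgood K.
  move=> d T u mu'; apply: measurable_lebC => [t x|d' T' p v mp mv]; first by rewrite lee_fin mulr_ge0 ?expR_ge0.
  apply/measurable_EFinP; apply: measurable_funM.
    by apply: (gH _ _ (fun t => row_mx (u (p t)) (v t))); apply: cmeas_row_mx => //; exact: cmeas_comp mu' mp.
  by apply: measurableT_comp => //; apply: measurableT_comp => //; exact: measurable_sqn.
have gZ : cgood (fun z : 'rV[C]_n => (expR (- (lam s * sqn z)))%:E).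
  move=> d T u mu'; apply/measurable_EFinP; apply: measurableT_comp => //; apply: measurableT_comp => //.
  by apply: measurable_funM; [exact: measurable_cst | exact: measurable_sqn].
rewrite lebC_row_mx; first last.
- by move=> x; rewrite lee_fin mulr_ge0// cwgt_ge0.
- by apply: crgoodE; apply: crgoodM => //; exact: crgood_cwgt.
rewrite [X in (_ * X)%E]lebC_row_mx; first last.
- by move=> x; rewrite lee_fin mulr_ge0// expR_ge0.
- exact: crgoodE.
transitivity (lebC (fun z => (c0 * Smom s)%:E * ((expR (- (lam s * sqn z)))%:E * K z))%E); last first.
  rewrite lebCZl; first last.
  - by move=> z; rewrite mule_ge0// lee_fin expR_ge0.
  - by move=> d T u mu'; apply: emeasurable_funM; [exact: gZ | exact: gK].
  - by rewrite ltW// mulr_gt0// c0_gt0.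
  congr (_ * _)%E; apply: eq_lebC => z.
  rewrite /K -lebCZl ?expR_ge0//; first last.
  - by move=> v; rewrite lee_fin mulr_ge0 ?expR_ge0.
  - apply: crgoodE; apply: crgoodM => //; apply: crgood_expR; apply: crgoodN.
    by move=> d T u mu'; exact: measurable_sqn.
  by apply: eq_lebC => v; rewrite /gss row_mxKl row_mxKr -EFinM expRD; congr EFin; ring.
apply: eq_lebC => z; set p := sqn z.
pose e : R := expR (mu * p / 2); have e0 : 0 < e by exact: expR_gt0.
have e2 : e ^+ 2 = expR (mu * p) by rewrite -expRM_natl; congr expR; rewrite -mulr_natl; field.
pose g v := (H (row_mx z v) * Wfun n m nu alpha (sqn v))%:E.
have g0 v : (0 <= g v)%E by rewrite lee_fin mulr_ge0// Wfun_ge0// sqn_ge0.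
have gg : cgood g.
  apply: crgoodE; apply: crgoodM => // d T u mu'.
  by apply: (measurableT_comp (@measurable_Wfun R n m nu alpha)); exact: measurable_sqn.
have E w : (H (row_mx z w) * cwgt (row_mx z w))%:E =
    ((c0 * expR (- ((alpha * (nu + 1) - m%:R) * mu * p)) * (e^-1) ^+ (2 * s))%:E * g (rc e *: w))%E.
  rewrite /g hH// sqnZ abs2_rc e2 /cwgt row_mxKl row_mxKr -/p -/c0 -EFinM; congr EFin.
  have : (e^-1) ^+ (2 * s) * e ^+ (2 * s) = 1 by rewrite -exprMn mulVf ?expr1n// gt_eqF.
  by move: (_ ^+ _) (e ^+ _) => a b ab; rewrite -[LHS]mul1r -ab; ring.
rewrite (eq_lebC E) lebCZl; first last.
- by move=> v; exact: g0.
- by move=> d T u mu'; apply: gg; apply: cmeas_scalec => //; exact: cmfun_cst.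
- apply: mulr_ge0; last by apply: exprn_ge0; rewrite invr_ge0 ltW.
  by apply: mulr_ge0; [exact: ltW c0_gt0 | exact: expR_ge0].
rewrite (lebC_scale e0 gg g0) (lebC_Wfun m0 nu1 alpha_gt (s := s)) //; first last.
- by move=> tau v; exact: hH.
- exact: crgoodE.
rewrite -/(K z) !muleA -!EFinM; congr (_%:E * _)%E.
have E1 (j : nat) : e^-1 ^+ (2 * j) = expR (- (mu * p * j%:R)).
  by rewrite exprM exprVn e2 -expRN -expRM_natl; congr expR; rewrite -mulr_natl; ring.
rewrite !E1 /lam.
(* Undoing the substitution, homogeneity contributes [s] to the exponent, and the Jacobian
   contributes [m], which cancels the [- m] in [cwgt]: what remains is [lam s]. *)
have -> : expR (- (mu * (alpha * (nu + 1) + s%:R) * p)) =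
  expR (- ((alpha * (nu + 1) - m%:R) * mu * p)) * expR (- (mu * p * s%:R)) * expR (- (mu * p * m%:R)).
  by rewrite -!expRD; congr expR; ring.
ring.
Qed.

Lemma gss_ge0 s x : 0 <= gss s x.
Proof. exact: expR_ge0. Qed.

Lemma lebr_transfer s (H : 'rV[C]_N -> R) : crgood H -> whom s H -> cint (fun x => H x * gss s x) ->
  cint (fun x => H x * cwgt x) /\ lebr (fun x => H x * cwgt x) = c0 * Smom s * lebr (fun x => H x * gss s x).
Proof.
move=> gH hH iH.
(* A positively homogeneous [f] passes through multiplication by a weight. It is used for the
   absolute value, the positive part and the negative part. *)
have T (f : R -> R) : (forall x, 0 <= f x) -> measurable_fun setT f -> (forall a x, 0 <= a -> f (a * x) = a * f x) ->
    (lebC (fun x => (f (H x * cwgt x))%:E) = (c0 * Smom s)%:E * lebC (fun x => (f (H x * gss s x))%:E))%E.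
  move=> f0 mf fh.
  have E (w : 'rV[C]_N -> R) : (forall x, 0 <= w x) -> lebC (fun x => (f (H x * w x))%:E) = lebC (fun x => (f (H x) * w x)%:E).
    by move=> w0; apply: eq_lebC => x; rewrite mulrC fh// mulrC.
  rewrite (E _ cwgt_ge0) (E _ (gss_ge0 s)); apply: (lebC_transfer (H := fun x => f (H x))) => //.
    by move=> d T u mu'; apply: (measurableT_comp mf); exact: gH.
  by move=> tau z v t0; rewrite hH// fh// exprn_ge0// ltW.
have mxh a x : 0 <= a -> Num.max (a * x) 0 = a * Num.max x 0 :> R by move=> a0; rewrite maxr_pMr// mulr0.
split.
  split; first by apply: crgoodM => //; exact: crgood_cwgt.
  rewrite (T (fun x => `|x|))//; last by move=> a x a0; rewrite normrM ger0_norm.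
  by apply: lte_mul_pinfty; [rewrite lee_fin mulr_ge0 ?(ltW c0_gt0) ?(ltW (Smom_gt0 _ _ _ _)) | | exact: iH.2].
rewrite /lebr (T (fun x => Num.max x 0)); first last.
- exact: mxh.
- by apply: measurable_maxr => //; exact: measurable_cst.
- by move=> x; rewrite le_max lexx orbT.
rewrite (T (fun x => Num.max (- x) 0)); first last.
- by move=> a x a0; rewrite -mulrN mxh.
- by apply: measurable_maxr => //; exact: measurable_cst.
- by move=> x; rewrite le_max lexx orbT.
have F (f : R -> R) : (forall x, 0 <= f x) -> (forall x, f x <= `|x|) -> measurable_fun setT f ->
    (lebC (fun x => (f (H x * gss s x))%:E) \is a fin_num)%E.
  move=> f0 fle mf; rewrite ge0_fin_numE; last by apply: lebC_ge0 => x; rewrite lee_fin.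
  apply: le_lt_trans iH.2; apply: le_lebC.
  - by apply: crgoodE => d T' u mu'; apply: (measurableT_comp mf); exact: iH.1.
  - by apply: crgoodE; apply: crgood_norm; exact: iH.1.
  - by move=> x; rewrite lee_fin.
  - by move=> x; rewrite lee_fin.
have Fp : (lebC (fun x => (Num.max (H x * gss s x) 0)%:E) \is a fin_num)%E.
  apply: (F (fun x => Num.max x 0)) => [x|x|].
  - by rewrite le_max lexx orbT.
  - by rewrite ge_max normr_ge0 andbT ler_norm.
  - by apply: measurable_maxr => //; exact: measurable_cst.
have Fn : (lebC (fun x => (Num.max (- (H x * gss s x)) 0)%:E) \is a fin_num)%E.
  apply: (F (fun x => Num.max (- x) 0)) => [x|x|].
  - by rewrite le_max lexx orbT.
  - by rewrite ge_max normr_ge0 andbT -normrN ler_norm.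
  - by apply: measurable_maxr => //; exact: measurable_cst.
by rewrite !fineM// mulrBr.
Qed.

End Transfer.

(** * Reproducing kernels of the homogeneous parts *)

Section Cdot.
Context {R : realType}.
Local Notation C := (C R).

Definition cdot k (u v : 'rV[C]_k) : C := \sum_j u ord0 j * cconj (v ord0 j).

Lemma cdotDl k (u u' v : 'rV[C]_k) : cdot (u + u') v = cdot u v + cdot u' v.
Proof. by rewrite /cdot -big_split; apply: eq_bigr => j _; rewrite mxE mulrDl. Qed.

Lemma cdotZl k c (u v : 'rV[C]_k) : cdot (c *: u) v = c * cdot u v.
Proof. by rewrite /cdot mulr_sumr; apply: eq_bigr => j _; rewrite mxE mulrA. Qed.

Lemma conj_cdot k (u v : 'rV[C]_k) : cconj (cdot u v) = cdot v u.
Proof. by rewrite /cdot conj_sum; apply: eq_bigr => j _; rewrite conjM conjK mulrC. Qed.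

Lemma cdotDr k (u v v' : 'rV[C]_k) : cdot u (v + v') = cdot u v + cdot u v'.
Proof. by rewrite -conj_cdot cdotDl conjD !conj_cdot. Qed.

Lemma cdot_self k (u : 'rV[C]_k) : cdot u u = rc (sqn u).
Proof. by rewrite /cdot /sqn rc_sum; apply: eq_bigr => j _; rewrite mul_conj. Qed.

Lemma sqnD k (u v : 'rV[C]_k) : rc (sqn (u + v)) = rc (sqn u) + cdot u v + cdot v u + rc (sqn v).
Proof. by rewrite -cdot_self cdotDl !cdotDr !cdot_self; ring. Qed.

(** Cauchy-Schwarz in the form of a weighted arithmetic-geometric inequality; the free [c] allows
    exact matching of exponents later. *)
Lemma cabs_cdot k (u v : 'rV[C]_k) (c : R) : 0 < c -> cabs (cdot u v) <= (c * sqn u + c^-1 * sqn v) / 2.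
Proof.
move=> c0; apply: le_trans (cabs_sum _ _ _) _.
rewrite /sqn !mulr_sumr -big_split mulr_suml; apply: ler_sum => j _.
rewrite cabsM cabs_conj -!cabs2; set x := cabs _; set y := cabs _.
have : 0 <= c^-1 * (c * x - y) ^+ 2 by rewrite mulr_ge0 ?sqr_ge0// invr_ge0 ltW.
have -> : c^-1 * (c * x - y) ^+ 2 = c * x ^+ 2 + c^-1 * y ^+ 2 - 2 * (x * y) by field; rewrite gt_eqF.
by rewrite ler_pdivlMr// subr_ge0 mulrC.
Qed.

Lemma cmfun_cdot d (T : measurableType d) k (u v : T -> 'rV[C]_k) : cmeas u -> cmeas v -> cmfun (fun t => cdot (u t) (v t)).
Proof. by move=> mu mv; apply: cmfun_sum => j; apply: cmfunM; [exact: mu | apply: cmfun_conj; exact: mv]. Qed.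

(** Raise [1 + t <= exp t] to the power [s], at [t = x / s]. *)
Lemma pow_le_expR (s : nat) : exists2 M : R, 0 <= M & forall x, 0 <= x -> x ^+ s <= M * expR x.
Proof.
case: s => [|s]; first by exists 1 => // x x0; rewrite expr0 mul1r -expR0 ler_expR.
exists (s.+1%:R ^+ s.+1); first by rewrite exprn_ge0.
move=> x x0; have s0 : 0 < s.+1%:R :> R by rewrite ltr0n.
have -> : expR x = expR (x / s.+1%:R) ^+ s.+1 by rewrite -expRM_natl -mulr_natl mulrCA mulfV ?mulr1// gt_eqF.
rewrite -exprMn lerXn2r ?nnegrE ?mulr_ge0 ?expR_ge0 ?(ltW s0)//.
rewrite -ler_pdivrMl//; apply: le_trans (expR_ge1Dx _).
by rewrite mulrC lerDr.
Qed.

Lemma cavg_conj (h : R -> C) : ccts h 0 (2 * pi) -> cavg (fun t => cconj (h t)) = cconj (cavg h).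
Proof.
move=> [h1 h2]; have pp := pi2_gt0 (R := R); apply: eqC; rewrite ?cre_conj ?cim_conj /cavg /=.
  by congr (_ * _); congr Int; apply/funext => t; rewrite cre_conj.
rewrite -mulrN; congr (_ * _).
have := IntB (@cts_on_cst _ 0 0 (2 * pi)) h2; rewrite Int_cst ?(ltW pp)// mul0r sub0r => <-.
by congr Int; apply/funext => t; rewrite cim_conj sub0r.
Qed.

Lemma ccts_conj (h : R -> C) a b : ccts h a b -> ccts (fun t => cconj (h t)) a b.
Proof.
move=> [h1 h2]; split; first by under [X in cts_on X]funext do rewrite cre_conj.
by under [X in cts_on X]funext do rewrite cim_conj; move=> x xab; apply: cvgN; exact: h2.
Qed.

End Cdot.

Section Gauss.
Context {R : realType} (n m : nat).
Local Notation C := (C R).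

Definition gauss2 (c d : R) (x : 'rV[C]_(n + m)) : R :=
  expR (- (c * sqn (lsubmx x : 'rV[C]_n)) - d * sqn (rsubmx x : 'rV[C]_m)).

Lemma cgood_gauss1 k (c : R) : cgood (fun z : 'rV[C]_k => (expR (- (c * sqn z)))%:E).
Proof.
move=> d T u mu; apply/measurable_EFinP; apply: measurableT_comp => //; apply: measurableT_comp => //.
by apply: measurable_funM; [exact: measurable_cst | exact: measurable_sqn].
Qed.

Lemma lebC_gauss1 k (c : R) : 0 < c -> lebC (fun z : 'rV[C]_k => (expR (- (c * sqn z)))%:E) = (pi ^+ k / c ^+ k)%:E.
Proof.
move=> c0; pose r := Num.sqrt c; have r0 : 0 < r by rewrite sqrtr_gt0.
have r2 : r ^+ 2 = c by rewrite sqr_sqrtr// ltW.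
have := @lebC_scale R k (fun z => (expR (- sqn z))%:E) r r0.
rewrite (@eq_lebC _ _ (fun z => (expR (- sqn (rc r *: z)))%:E) (fun z => (expR (- (c * sqn z)))%:E)); last first.
  by move=> z; rewrite sqnZ abs2_rc r2.
move=> ->; last by move=> z; rewrite lee_fin expR_ge0.
  by rewrite lebC_gauss -EFinM exprM exprVn r2 exprVn mulrC.
by have := @cgood_gauss1 k 1; congr cgood; apply/funext => z; rewrite mul1r.
Qed.

Lemma crgood_gauss2 c d : crgood (gauss2 c d).
Proof.
apply: crgood_expR; apply: crgoodD; apply: crgoodN; apply: crgoodM; try exact: crgood_cst.
  exact: crgood_sqnl.
exact: crgood_sqnr.
Qed.

Lemma lebC_gauss2 c d : 0 < c -> 0 < d ->
  lebC (fun x => (gauss2 c d x)%:E) = (pi ^+ (n + m) / (c ^+ n * d ^+ m))%:E.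
Proof.
move=> c0 d0; rewrite lebC_row_mx; first last.
- by move=> x; rewrite lee_fin expR_ge0.
- exact: crgoodE (crgood_gauss2 c d).
rewrite (@eq_lebC _ _ _ (fun z : 'rV[C]_n => ((pi ^+ m / d ^+ m)%:E * (expR (- (c * sqn z)))%:E)%E)); last first.
  move=> z; rewrite -(lebC_gauss1 m d0) muleC -lebCZl ?expR_ge0//.
  - by apply: eq_lebC => w; rewrite /gauss2 row_mxKl row_mxKr expRD EFinM.
  - exact: cgood_gauss1.
rewrite lebCZl.
- by rewrite lebC_gauss1// -EFinM; congr EFin; rewrite exprD; field; rewrite !expf_neq0 ?gt_eqF.
- by rewrite divr_ge0 ?exprn_ge0 ?pi_ge0 ?(ltW d0).
- exact: cgood_gauss1.
- by move=> z; rewrite lee_fin expR_ge0.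
Qed.

End Gauss.

Section ReproHom.
Context {R : realType} (n m : nat) (mu nu alpha : R).
Hypotheses (m0 : (0 < m)%N) (mu0 : 0 < mu) (nu1 : -1 < nu) (alpha_gt : (m + n)%:R < alpha).
Local Notation C := (C R).
Local Notation N := (n + m)%N.
Local Notation cwgt := (@cwgt R n m mu nu alpha).
Local Notation Smom := (@Smom R n m nu alpha).
Local Notation lam := (@lam R mu nu alpha).
Local Notation gss := (@gss R n m mu nu alpha).
Local Notation c0 := (@c0 R n m mu).

(** Normalised so that in [repro_hom] the moment [Smom s], the factor [s!] of the exponential series
    and the Gaussian volume all cancel. *)
Definition hcoef (s : nat) : R := ((nu + 1) * alpha + s%:R) ^+ n / (Smom s * s`!%:R).

Definition Kern (s : nat) (x y : 'rV[C]_N) : C :=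
  rc (hcoef s) * cdot (rsubmx x) (rsubmx y) ^+ s * cexp (rc (lam s) * cdot (lsubmx x) (lsubmx y)).

Lemma lam_gt0 s : 0 < lam s.
Proof.
have a0 := alpha_gt0 alpha_gt; rewrite /lam mulr_gt0// ltr_pwDl// mulr_gt0//.
by rewrite -ltrBlDr sub0r.
Qed.

Lemma hcoef_ge0 s : 0 <= hcoef s.
Proof.
have a0 := alpha_gt0 alpha_gt; have n0 : 0 < nu + 1 by rewrite -ltrBlDr sub0r.
rewrite /hcoef divr_ge0 ?exprn_ge0 ?addr_ge0 ?mulr_ge0 ?(ltW a0) ?(ltW n0)//.
by rewrite ltW// Smom_gt0.
Qed.

Definition cgoodc (F : 'rV[C]_N -> C) :=
  forall d (T : measurableType d) (u : T -> 'rV[C]_N), cmeas u -> cmfun (fun t => F (u t)).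

Lemma cgoodcM F G : cgoodc F -> cgoodc G -> cgoodc (fun x => F x * G x).
Proof. by move=> mF mG d T u mu'; apply: cmfunM; [exact: mF | exact: mG]. Qed.

Lemma cgoodc_conj F : cgoodc F -> cgoodc (fun x => cconj (F x)).
Proof. by move=> mF d T u mu'; apply: cmfun_conj; exact: mF. Qed.

Lemma crgood_cre F : cgoodc F -> crgood (fun x => cre (F x)).
Proof. by move=> mF d T u mu'; exact: (mF _ _ _ mu').1. Qed.

Lemma crgood_abs2 F : cgoodc F -> crgood (fun x => abs2 (F x)).
Proof. by move=> mF d T u mu'; apply: measurable_abs2; exact: mF. Qed.

(* [Kern s] is, up to a constant, the part of degree [s] in [w] of [Eker s]. *)
Definition Eker (s : nat) (x y : 'rV[C]_N) : C :=
  cexp (cdot (rsubmx x) (rsubmx y)) * cexp (rc (lam s) * cdot (lsubmx x) (lsubmx y)).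

Lemma cgoodc_Eker s y : cgoodc (Eker s ^~ y).
Proof.
move=> d T u mu'; apply: cmfunM; apply: cmfun_cexp.
  by apply: cmfun_cdot; [exact: cmeas_rsub | exact: cmeas_cst].
apply: cmfunM; first exact: cmfun_cst.
by apply: cmfun_cdot; [exact: cmeas_lsub | exact: cmeas_cst].
Qed.

Lemma cgoodc_Kern s y : cgoodc (Kern s ^~ y).
Proof.
move=> d T u mu'; apply: cmfunM; first apply: cmfunM.
- exact: cmfun_cst.
- by apply: cmfunX; apply: cmfun_cdot; [exact: cmeas_rsub | exact: cmeas_cst].
apply: cmfun_cexp; apply: cmfunM; first exact: cmfun_cst.
by apply: cmfun_cdot; [exact: cmeas_lsub | exact: cmeas_cst].
Qed.

(** The exponents are half of those of the Gaussian weight, so the squared modulus times [gss s] is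
    still dominated by an integrable Gaussian. *)
Definition gbound s (G : 'rV[C]_N -> C) := exists2 M : R, 0 <= M &
  forall x, abs2 (G x) <= M * expR (2^-1 * lam s * sqn (lsubmx x : 'rV[C]_n) + 2^-1 * sqn (rsubmx x : 'rV[C]_m)).

Lemma cdot_half k (u v : 'rV[C]_k) : 2 * cabs (cdot u v) <= 2^-1 * sqn u + 2 * sqn v.
Proof. by have := @cabs_cdot R k u v 2^-1; rewrite invr_gt0 ltr0n invrK => /(_ isT); rewrite ler_pdivlMr// mulrC. Qed.

Lemma cre_le_cabs (z : C) : cre z <= cabs z.
Proof. exact: le_trans (ler_norm _) (cabs_re z). Qed.

Lemma gbound_zpart s (x y : 'rV[C]_N) : abs2 (cexp (rc (lam s) * cdot (lsubmx x : 'rV[C]_n) (lsubmx y))) <=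
  expR (2 * lam s * sqn (lsubmx y : 'rV[C]_n)) * expR (2^-1 * lam s * sqn (lsubmx x : 'rV[C]_n)).
Proof.
rewrite abs2_cexp -expRD ler_expR creM /= mul0r subr0.
have l0 := lam_gt0 s; set z := lsubmx x : 'rV[C]_n; set a := lsubmx y : 'rV[C]_n.
rewrite mulrCA; apply: (@le_trans _ _ (lam s * (2 * cabs (cdot z a)))).
  by rewrite ler_wpM2l ?(ltW l0)// ler_wpM2l// cre_le_cabs.
apply: le_trans (ler_wpM2l (ltW l0) (cdot_half z a)) _.
by rewrite le_eqVlt; apply/orP; left; apply/eqP; ring.
Qed.

Lemma gbound_Eker s y : gbound s (Eker s ^~ y).
Proof.
exists (expR (2 * sqn (rsubmx y : 'rV[C]_m)) * expR (2 * lam s * sqn (lsubmx y : 'rV[C]_n))).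
  by rewrite mulr_ge0 ?expR_ge0.
move=> x; rewrite /Eker abs2M mulrC expRD [X in _ <= X]mulrACA mulrC.
rewrite [leRHS](_ : _ = expR (2 * sqn (rsubmx y : 'rV[C]_m)) * expR (2^-1 * sqn (rsubmx x : 'rV[C]_m)) *
  (expR (2 * lam s * sqn (lsubmx y : 'rV[C]_n)) * expR (2^-1 * lam s * sqn (lsubmx x : 'rV[C]_n)))); last by ring.
apply: ler_pM; rewrite ?abs2_ge0//; last exact: gbound_zpart.
rewrite abs2_cexp -expRD ler_expR; apply: (@le_trans _ _ (2 * cabs (cdot (rsubmx x : 'rV[C]_m) (rsubmx y)))).
  by rewrite ler_wpM2l// cre_le_cabs.
by rewrite addrC; exact: cdot_half.
Qed.

Lemma gbound_Kern s y : gbound s (Kern s ^~ y).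
Proof.
have [M M0 HM] := @pow_le_expR R (2 * s).
exists (hcoef s ^+ 2 * M * expR (2 * sqn (rsubmx y : 'rV[C]_m)) * expR (2 * lam s * sqn (lsubmx y : 'rV[C]_n))).
  by rewrite mulr_ge0 ?expR_ge0// mulr_ge0 ?expR_ge0// mulr_ge0 ?sqr_ge0.
move=> x; rewrite /Kern abs2M expRD.
rewrite [leRHS](_ : _ = hcoef s ^+ 2 * M * expR (2 * sqn (rsubmx y : 'rV[C]_m)) * expR (2^-1 * sqn (rsubmx x : 'rV[C]_m)) *
  (expR (2 * lam s * sqn (lsubmx y : 'rV[C]_n)) * expR (2^-1 * lam s * sqn (lsubmx x : 'rV[C]_n)))); last by ring.
apply: ler_pM; rewrite ?abs2_ge0//; last exact: gbound_zpart.
rewrite abs2M abs2_rc abs2X -cabs2 -exprM -(mulrA (_ * M)) -(mulrA (hcoef s ^+ 2)).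
apply: (ler_wpM2l (sqr_ge0 (hcoef s))).
set t := cabs _; have t0 : 0 <= t by exact: cabs_ge0.
apply: le_trans (HM _ t0) _; rewrite ler_wpM2l// -expRD ler_expR.
apply: (@le_trans _ _ (2 * t)); first by rewrite ler_peMl// ler1n.
by rewrite addrC; exact: cdot_half.
Qed.

Lemma gssE s x : gss s x = gauss2 (lam s) 1 x.
Proof. by rewrite /gss /gauss2 mul1r. Qed.

Lemma gbound_lty s G : cgoodc G -> gbound s G -> (lebC (fun x => (abs2 (G x) * gss s x)%:E) < +oo)%E.
Proof.
move=> mG [M M0 HM]; have l0 := lam_gt0 s.
apply: (@le_lt_trans _ _ (lebC (fun x => (M%:E * (gauss2 (2^-1 * lam s) 2^-1 x)%:E)%E))).
  apply: le_lebC.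
  - by apply: crgoodE; apply: crgoodM; [exact: crgood_abs2 | exact: crgood_gss].
  - move=> d T u mu'; apply: measurable_funeM; apply/measurable_EFinP; exact: crgood_gauss2.
  - by move=> x; rewrite lee_fin mulr_ge0 ?abs2_ge0 ?expR_ge0.
  - move=> x; rewrite -EFinM lee_fin gssE; apply: le_trans (ler_wpM2r (expR_ge0 _) (HM x)) _.
    rewrite -[leLHS]mulrA; apply: ler_wpM2l => //; rewrite /gauss2 -expRD ler_expR le_eqVlt.
    by apply/orP; left; apply/eqP; field.
rewrite lebCZl//.
- have h2 : 0 < 2^-1 :> R by rewrite invr_gt0.
  by rewrite (lebC_gauss2 _ _ (mulr_gt0 h2 l0) h2) -EFinM ltry.
- exact: crgoodE (crgood_gauss2 _ _).
- by move=> x; rewrite lee_fin expR_ge0.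
Qed.

(** Arithmetic-geometric inequality with a free weight [r]; a power of the tail ratio is inserted in
    the final estimate. *)
Lemma abs_creM_le (r : R) (z w : C) : 0 < r -> `|cre (z * w)| <= r / 2 * abs2 z + r^-1 / 2 * abs2 w.
Proof.
move=> r0; apply: le_trans (cabs_re _) _; rewrite cabsM -!cabs2; set x := cabs z; set y := cabs w.
have : 0 <= r^-1 * (r * x - y) ^+ 2 by rewrite mulr_ge0 ?sqr_ge0// invr_ge0 ltW.
have -> : r^-1 * (r * x - y) ^+ 2 = 2 * (r / 2 * x ^+ 2 + r^-1 / 2 * y ^+ 2 - x * y) by field; rewrite gt_eqF.
by rewrite pmulr_rge0// subr_ge0.
Qed.

Lemma cint_creM (F G : 'rV[C]_N -> C) (w : 'rV[C]_N -> R) : cgoodc F -> cgoodc G -> crgood w -> (forall x, 0 <= w x) ->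
  (lebC (fun x => (abs2 (F x) * w x)%:E) < +oo)%E -> (lebC (fun x => (abs2 (G x) * w x)%:E) < +oo)%E ->
  cint (fun x => cre (F x * G x) * w x).
Proof.
move=> mF mG mw w0 iF iG.
have I (H : 'rV[C]_N -> C) : cgoodc H -> (lebC (fun x => (abs2 (H x) * w x)%:E) < +oo)%E -> cint (fun x => abs2 (H x) * w x).
  move=> mH iH; split; first by apply: crgoodM => //; exact: crgood_abs2.
  by rewrite (@eq_lebC _ _ _ (fun x => (abs2 (H x) * w x)%:E))// => x; rewrite ger0_norm// mulr_ge0 ?abs2_ge0.
apply: (le_cint (h := fun x => 1 / 2 * (abs2 (F x) * w x) + 1^-1 / 2 * (abs2 (G x) * w x))).
- by apply: crgoodM => //; apply: crgood_cre; exact: cgoodcM.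
- by apply: cintD; apply: cintZ; exact: I.
move=> x; rewrite normrM [`|w x|]ger0_norm// !mulrA -mulrDl normrM [`|w x|]ger0_norm// ler_wpM2r//.
by rewrite [leRHS]ger0_norm ?abs_creM_le// addr_ge0 ?mulr_ge0 ?abs2_ge0// ?invr_ge0.
Qed.

Section Repro.
(** The function [F] is abstract because it stands both for a homogeneous part of [f] and for
    [Kern s] itself. In [vF] the factor [cexp (c * cis t)] anticipates the exponential left over by
    the translation to [y]. *)
Variables (s : nat) (F : 'rV[C]_N -> C) (y : 'rV[C]_N).
Hypotheses (mF : cgoodc F)
  (hF : forall (tau : R) z v, 0 < tau -> F (row_mx z (rc tau *: v)) = rc (tau ^+ s) * F (row_mx z v))
  (rF : forall t x, F (rotw t x) = cis (s%:R * t) * F x)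
  (cF : forall x, ccts (fun t => F (cis t *: x + y)) 0 (2 * pi))
  (vF : forall x c, cavg (fun t => F (cis t *: x + y) * cexp (c * cis t)) = F y)
  (iF : (lebC (fun x => (abs2 (F x) * gss s x)%:E) < +oo)%E).

Local Notation B x := (cdot (rsubmx x : 'rV[C]_m) (rsubmx y)).
Local Notation A x := (cdot (lsubmx x : 'rV[C]_n) (lsubmx y)).
Let g4 (x : 'rV[C]_N) : C := F x * cconj (Eker s x y) * rc (gss s x).
Let g5 (x : 'rV[C]_N) : C := F (x + y) * cexp (- (rc (lam s) * A x + B x)) * rc (gss s x).

Lemma cre_mul_rc (z : C) (r : R) : cre (z * rc r) = cre z * r.
Proof. by rewrite creM /= mulr0 subr0. Qed.

Lemma cint_g4 : cint (fun x => cre (g4 x)).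
Proof.
apply: (eq_cint (g := fun x => cre (F x * cconj (Eker s x y)) * gss s x)).
  by move=> x; rewrite /g4 cre_mul_rc.
apply: cint_creM => //.
- by apply: cgoodc_conj; exact: cgoodc_Eker.
- exact: crgood_gss.
- by move=> x; exact: expR_ge0.
- rewrite (@eq_lebC _ _ _ (fun x => (abs2 (Eker s x y) * gss s x)%:E)); last by move=> x; rewrite abs2_conj.
  by apply: gbound_lty; [exact: cgoodc_Eker | exact: gbound_Eker].
Qed.

Lemma cint_Kern_gss : cint (fun x => cre (F x * cconj (Kern s x y)) * gss s x).
Proof.
apply: cint_creM => //.
- by apply: cgoodc_conj; exact: cgoodc_Kern.
- exact: crgood_gss.
- by move=> x; exact: expR_ge0.
- rewrite (@eq_lebC _ _ _ (fun x => (abs2 (Kern s x y) * gss s x)%:E)); last by move=> x; rewrite abs2_conj.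
  by apply: gbound_lty; [exact: cgoodc_Kern | exact: gbound_Kern].
Qed.

Lemma gss_rotw t x : gss s (rotw t x) = gss s x.
Proof. by rewrite /gss /rotw row_mxKl row_mxKr sqn_rot. Qed.

(* Averaging over the rotations of [w] keeps the degree [s] part of [exp <w, b>]. *)
Lemma lebr_Kern_Eker :
  lebr (fun x => cre (F x * cconj (Kern s x y)) * gss s x) = hcoef s * s`!%:R * lebr (fun x => cre (g4 x)).
Proof.
pose G t x := g4 (rotw t x).
have jG d (T : measurableType d) (p : T -> R) (u : T -> 'rV[C]_N) : measurable_fun setT p -> cmeas u ->
    measurable_fun setT (fun t => cre (G (p t) (u t))).
  move=> mp mu'; apply: (cint_g4.1 _ _ (fun t => rotw (p t) (u t))); exact: cmeas_rotw.
have GE t x : G t x = F x * cconj (cexp (rc (lam s) * A x)) * rc (gss s x) * cconj (cexp (B x * cis t) * cis (- (s%:R * t))).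
  rewrite /G /g4 rF gss_rotw /Eker /rotw row_mxKl row_mxKr cdotZl (conjM (cexp _) (cexp _)) (conjM (cexp _) (cis _)) cisN conjK [cis t * _]mulrC; ring.
have cE x : ccts (fun t => cexp (B x * cis t) * cis (- (s%:R * t))) 0 (2 * pi).
  apply: cctsM; first exact: ccts_cexp.
  by have := @ccts_cis_powV R s 0 (2 * pi); congr ccts; apply/funext => t; rewrite -cis_inv -cisX.
have cG x : ccts (G^~ x) 0 (2 * pi).
  rewrite (_ : G^~ x = fun t => F x * cconj (cexp (rc (lam s) * A x)) * rc (gss s x) * cconj (cexp (B x * cis t) * cis (- (s%:R * t)))); last by apply/funext => t; exact: GE.
  by apply: cctsM; [exact: ccts_cst | apply: ccts_conj].
have [a aE] : exists a, (lebC (fun x => `|cre (g4 x)|%:E) = a%:E)%E.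
  exists (fine (lebC (fun x => `|cre (g4 x)|%:E))); rewrite fineK// ge0_fin_numE; first exact: cint_g4.2.
  by apply: lebC_ge0 => x; rewrite lee_fin.
have AG t : (lebC (fun x => `|cre (G t x)|%:E) <= a%:E)%E.
  by rewrite -aE (lebC_norm_inv (g := fun x => cre (g4 x)) (@leb_inv_rotw R n m t))//; exact: cint_g4.1.
have IG t : lebr (fun x => cre (G t x)) = lebr (fun x => cre (g4 x)).
  by rewrite (lebr_inv (g := fun x => cre (g4 x)) (@leb_inv_rotw R n m t))//; exact: cint_g4.1.
have [_ <-] := lebr_cavg jG cG AG IG.
have cavgG x : cavg (G^~ x) = F x * cconj (cexp (rc (lam s) * A x)) * rc (gss s x) * cconj (rc (s`!%:R^-1) * B x ^+ s).
  by rewrite (eq_cavg (GE^~ x)) cavgZ ?cavg_conj ?cavg_cexp//; apply: ccts_conj.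
have f0 : s`!%:R != 0 :> R by rewrite pnatr_eq0 -lt0n fact_gt0.
have E x : cre (F x * cconj (Kern s x y)) * gss s x = hcoef s * s`!%:R * cre (cavg (G^~ x)).
  rewrite cavgG /Kern -cre_mul_rc -[RHS]mulrC -cre_mul_rc; congr cre.
  rewrite (conjM (_ * _) (cexp _)) (conjM (rc _) (_ ^+ _)) (conjM (rc _) (_ ^+ _)) !conj_rc.
  have -> : rc (hcoef s) = rc (hcoef s * s`!%:R) * rc (s`!%:R^-1) :> C by rewrite -rcM mulfK.
  ring.
rewrite (eq_lebr E) lebrZ//; exact: (lebr_cavg jG cG AG IG).1.
Qed.

(** Completing the square: the antiholomorphic exponential of [Eker] cancels one of the two cross
    terms of the translated Gaussian. The surviving one is holomorphic in [x]. *)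
Lemma g4_shift x : g4 (x + y) = g5 x.
Proof.
rewrite /g4 /g5 -(mulrA (F _)) -(mulrA (F _) (cexp _)); congr (_ * _).
rewrite /Eker (conjM (cexp _) (cexp _)) !conj_cexp (conjM (rc _)) conj_rc !conj_cdot -cexpD /gss -!cexp_rc -!cexpD; congr cexp.
rewrite !linearD /= !rcD !rcN !rcM !sqnD !cdotDr !cdot_self; ring.
Qed.

(* Recentred at [y] the integrand is a holomorphic function times a radial
   weight, so the mean value property applies. *)
Lemma lebr_g4 : lebr (fun x => cre (g4 x)) = cre (F y) * (pi ^+ N / lam s ^+ n).
Proof.
have l0 := lam_gt0 s.
have g45 x : cre (g4 (x + y)) = cre (g5 x) by rewrite g4_shift.
have i5 : cint (fun x => cre (g5 x)).
  by apply: eq_cint g45 _; exact: (cint_inv (g := fun x => cre (g4 x)) (leb_inv_shift y) cint_g4).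
rewrite -(lebr_inv (g := fun x => cre (g4 x)) (leb_inv_shift y) cint_g4.1) (eq_lebr g45).
pose G t x := g5 (cis t *: x).
have jG d (T : measurableType d) (p : T -> R) (u : T -> 'rV[C]_N) : measurable_fun setT p -> cmeas u ->
    measurable_fun setT (fun t => cre (G (p t) (u t))).
  move=> mp mu'; apply: (i5.1 _ _ (fun t => cis (p t) *: u t)).
  by apply: cmeas_scalec => //; exact: cmfun_cis.
have GE t x : G t x = rc (gss s x) * (F (cis t *: x + y) * cexp (- (rc (lam s) * A x + B x) * cis t)).
  rewrite /G /g5 /gss !linearZ /= !sqn_rot !cdotZl mulrC; congr (_ * (_ * cexp _)); ring.
have cG0 x : ccts (fun t => F (cis t *: x + y) * cexp (- (rc (lam s) * A x + B x) * cis t)) 0 (2 * pi).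
  by apply: cctsM; [exact: cF | exact: ccts_cexp].
have cG x : ccts (G^~ x) 0 (2 * pi).
  rewrite (_ : G^~ x = fun t => rc (gss s x) * (F (cis t *: x + y) * cexp (- (rc (lam s) * A x + B x) * cis t))); last by apply/funext => t; exact: GE.
  by apply: cctsM; first exact: ccts_cst.
have [a aE] : exists a, (lebC (fun x => `|cre (g5 x)|%:E) = a%:E)%E.
  exists (fine (lebC (fun x => `|cre (g5 x)|%:E))); rewrite fineK// ge0_fin_numE; first exact: i5.2.
  by apply: lebC_ge0 => x; rewrite lee_fin.
have AG t : (lebC (fun x => `|cre (G t x)|%:E) <= a%:E)%E.
  by rewrite -aE (lebC_norm_inv (g := fun x => cre (g5 x)) (@leb_inv_rot R N t))//; exact: i5.1.
have IG t : lebr (fun x => cre (G t x)) = lebr (fun x => cre (g5 x)).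
  by rewrite (lebr_inv (g := fun x => cre (g5 x)) (@leb_inv_rot R N t))//; exact: i5.1.
have [_ <-] := lebr_cavg jG cG AG IG.
have E x : cre (cavg (G^~ x)) = cre (F y) * gauss2 (lam s) 1 x.
  by rewrite (eq_cavg (GE^~ x)) cavgZ// vF mulrC cre_mul_rc gssE.
rewrite (eq_lebr E) lebrZ; last first.
  split; first exact: crgood_gauss2.
  rewrite (@eq_lebC _ _ _ (fun x => (gauss2 (lam s) 1 x)%:E)) ?lebC_gauss2 ?ltry//.
  by move=> x; rewrite ger0_norm// expR_ge0.
by rewrite lebr_ge0 ?lebC_gauss2//= ?expr1n ?mulr1// => x; exact: expR_ge0.
Qed.

(** The weight is exchanged for a Gaussian by homogeneity, [Kern s] for [Eker s] by rotation in [w],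
    and the value at [y] comes from [lebr_g4]; [hcoef] absorbs all constants. *)
Lemma repro_hom : cint (fun x => cre (F x * cconj (Kern s x y)) * cwgt x) /\
  lebr (fun x => cre (F x * cconj (Kern s x y)) * cwgt x) = cre (F y).
Proof.
have l0 := lam_gt0 s; have S0 := Smom_gt0 m0 nu1 alpha_gt s.
have hH : whom s (fun x => cre (F x * cconj (Kern s x y))).
  move=> tau z v t0.
  have -> : Kern s (row_mx z (rc tau *: v)) y = rc (tau ^+ s) * Kern s (row_mx z v) y.
    by rewrite /Kern !row_mxKl !row_mxKr cdotZl exprMn rcX; ring.
  rewrite hF// (conjM (rc _)) conj_rc mul2n -addnn exprD [RHS]mulrC -cre_mul_rc rcM; congr cre; ring.
have mH : crgood (fun x => cre (F x * cconj (Kern s x y))).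
  by apply: crgood_cre; apply: cgoodcM => //; apply: cgoodc_conj; exact: cgoodc_Kern.
have [I ->] := lebr_transfer m0 mu0 nu1 alpha_gt mH hH cint_Kern_gss; split => //.
rewrite lebr_Kern_Eker lebr_g4 /hcoef /c0.
have f0 : s`!%:R != 0 :> R by rewrite pnatr_eq0 -lt0n fact_gt0.
have pN : pi ^+ N != 0 :> R by rewrite expf_neq0// gt_eqF// pi_gt0.
have ln0 : lam s ^+ n != 0 by rewrite expf_neq0// gt_eqF.
have lE : mu ^+ n * ((nu + 1) * alpha + s%:R) ^+ n = lam s ^+ n by rewrite -exprMn /lam; congr (_ ^+ _); ring.
transitivity (cre (F y) * (mu ^+ n * ((nu + 1) * alpha + s%:R) ^+ n / lam s ^+ n)); last by rewrite lE divff// mulr1.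
move: (lam s ^+ n) (pi ^+ N) ln0 pN => L p L0 p0.
by field; rewrite L0 f0 p0 gt_eqF.
Qed.

End Repro.

End ReproHom.

(** * Homogeneous parts of holomorphic functions *)

Section Continuity.
Context {R : realType}.
Local Notation C := (C R).

Lemma nbhs_cabs (z : C) (P : set C) : nbhs z P <-> exists2 d : R, 0 < d & forall h, cabs (h - z) < d -> P h.
Proof.
split.
  move=> /nbhs_ballP[e /= e0 H]; exists (cre e); first by move: e0; rewrite ltcE => /andP[_].
  move=> h hd; apply: H; rewrite /ball /= -normrN opprB normE ltcE /=.
  by move: e0; rewrite ltcE /= => /andP[/eqP <- _]; rewrite eqxx.
move=> [d d0 H]; apply/nbhs_ballP; exists (rc d); first by rewrite /= ltcR.
by move=> h; rewrite /ball /= -normrN opprB normE ltcR => /H.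
Qed.

Lemma nbhs_row_cabs k (x : 'rV[C]_k) (P : set 'rV[C]_k) : nbhs x P ->
  exists2 d : R, 0 < d & forall x' : 'rV[C]_k, (forall j, cabs (x' ord0 j - x ord0 j) < d) -> P x'.
Proof.
move=> /nbhs_ballP[e /= e0 H]; exists (cre e); first by move: e0; rewrite ltcE => /andP[_].
move=> x' hd; apply: H; split => // i j; rewrite (ord1 i) /ball /= -normrN opprB normE ltcE /=.
by move: e0; rewrite ltcE /= => /andP[/eqP <- _]; rewrite eqxx hd.
Qed.

Lemma diff_cont_coord k (f : 'rV[C]_k -> C) x : differentiable f x -> forall e : R, 0 < e ->
  exists2 d : R, 0 < d & forall x' : 'rV[C]_k, (forall j, cabs (x' ord0 j - x ord0 j) < d) -> cabs (f x' - f x) <= e.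
Proof.
move=> df e e0; have cf := differentiable_continuous df.
have : nbhs (f x) [set z | cabs (z - f x) <= e] by apply/nbhs_cabs; exists e => // h /ltW.
by move=> /cf; exact: nbhs_row_cabs.
Qed.

Lemma cdiff_line k (f : 'rV[C]_k -> C) (x d : 'rV[C]_k) (t : C) :
  differentiable f (x + t *: d) -> cdiff (fun s => f (x + s *: d)) t.
Proof.
move=> df; apply/cdiffP/derivable1_diffP.
exact: (@differentiable_comp _ _ _ _ (fun s : C => x + s *: d) f).
Qed.

End Continuity.

Section CircleMore.
Context {R : realType}.
Local Notation C := (C R).
Local Notation leb := (@lebesgue_measure R).

Lemma cis_period t (z : int) : cis (t + 2 * pi * z%:~R) = cis t :> C.
Proof.
have P k s : cis (s + 2 * pi * k%:R) = cis s :> C.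
  elim: k s => [|k IH] s; first by rewrite mulr0 addr0.
  rewrite (_ : s + 2 * pi * k.+1%:R = (s + 2 * pi * k%:R) + 2 * pi); last by rewrite -natr1; ring.
  by rewrite cisD cis2pi IH mulr1.
case: z => k; first by rewrite -pmulrn P.
by rewrite -(P k.+1 (t + _)) NegzE mulrNz mulrN -pmulrn subrK.
Qed.

Lemma rc_cis_powV (A : C) (r t : R) (s : nat) :
  A * (rc r * cis t) ^- s = rc (r ^- s) * (A * cis (- (s%:R * t))).
Proof. by rewrite exprMn invfM rcV rcX -cis_inv -cisX mulrCA. Qed.

(** The floor of [phi / (2 pi)] reduces an arbitrary shift to one within a single period. *)
Lemma cavg_cis_shift (g : C -> C) (phi : R) : (forall a b, ccts (fun t => g (cis t)) a b) ->
  cavg (fun t => g (cis (t + phi))) = cavg (fun t => g (cis t)).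
Proof.
move=> cg; have pp := pi2_gt0 (R := R).
pose z := Num.floor (phi / (2 * pi)); pose phi0 := phi - 2 * pi * z%:~R.
have E t : g (cis (t + phi)) = g (cis (t + phi0)).
  by rewrite -(cis_period (t + phi0) z) /phi0 addrA subrK.
rewrite (eq_cavg E); apply: (cavg_shift (h := fun t => g (cis t))) => //.
  by move=> t; have := cis_period t 1; rewrite mulr1 => ->.
have /andP[h1 h2] := floor_itv (phi / (2 * pi)); rewrite -/z in h1 h2.
rewrite subr_ge0 lerBlDr; apply/andP; split; first by rewrite mulrC -ler_pdivlMr.
by rewrite -[X in X + _]mulr1 -mulrDr mulrC -ler_pdivrMr// ltW//; move: h2; rewrite intrD addrC.
Qed.

Lemma ccts_shift (h : R -> C) (t : R) : (forall a b, ccts h a b) -> forall a b, ccts (fun r => h (r + t)) a b.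
Proof.
move=> ch a b; have K (g : R -> R) : (forall a b, cts_on g a b) -> cts_on (fun r => g (r + t)) a b.
  move=> cg x _; apply: (@continuous_comp _ _ _ (fun r => r + t) g).
    by apply: cvgD; [exact: cvg_id | exact: cvg_cst].
  by apply: (cg (x + t) (x + t)); rewrite lexx.
split; [apply: (K (fun r => cre (h r))) | apply: (K (fun r => cim (h r)))] => c d; [exact: (ch c d).1 | exact: (ch c d).2].
Qed.

Lemma cavg_coef_shift (A : C -> C) (s : nat) (t : R) : (forall a b, ccts (fun r => A (cis r)) a b) ->
  cavg (fun r => A (cis (r + t)) * cis (- (s%:R * r))) = cis (s%:R * t) * cavg (fun r => A (cis r) * cis (- (s%:R * r))).
Proof.
move=> cA; have cB a b : ccts (fun r => A (cis r) * cis r ^- s) a b by apply: cctsM => //; exact: ccts_cis_powV.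
have E1 r : cis r ^- s = cis (- (s%:R * r)) :> C by rewrite -cis_inv -cisX.
have E := @cavg_cis_shift (fun z => A z * z ^- s) t cB.
have -> : cavg (fun r => A (cis r) * cis (- (s%:R * r))) = cavg (fun r => A (cis r) * cis r ^- s).
  by apply: eq_cavg => r; rewrite E1.
rewrite -E -cavgZ; last exact: (ccts_shift t cB).
apply: eq_cavg => r; rewrite E1 mulrCA -cisD; congr (_ * cis _); ring.
Qed.

Lemma Int_swap (A : R -> R -> R) (M : R) :
  measurable_fun setT (fun z : R * R => A z.1 z.2) ->
  (forall s t, 0 <= s <= 2 * pi -> 0 <= t <= 2 * pi -> `|A s t| <= M) ->
  Int (fun s => Int (A s) 0 (2 * pi)) 0 (2 * pi) = Int (fun t => Int (A^~ t) 0 (2 * pi)) 0 (2 * pi).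
Proof.
move=> mA AM; have pp := pi2_gt0 (R := R).
pose I (t : R) := (0 <= t) && (t <= 2 * pi).
pose F (z : R * R) : R := if I z.1 && I z.2 then A z.1 z.2 else 0.
have mI d (T : measurableType d) (p : T -> R) : measurable_fun setT p -> measurable_fun setT (fun t => I (p t)).
  by move=> mp; apply: measurable_and; apply: measurable_fun_ler => //; exact: measurable_cst.
have mF : measurable_fun setT (fun z => (F z)%:E).
  apply/measurable_EFinP; apply: measurable_fun_if => //.
    by apply: measurable_and; apply: mI; [exact: measurable_fst | exact: measurable_snd].
  exact: (@measurable_funS _ _ _ _ setT).
have M0 : 0 <= M by apply: le_trans (AM 0 0 _ _); rewrite ?lexx ?(ltW pp).
have pI (c : R) : (\int[leb]_y (if I y then c else 0)%:E = (c * (2 * pi))%:E)%E.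
  rewrite -[RHS](_ : (\int[leb]_(y in `[0%R, (2 * pi)%R]) (cst c%:E) y)%E = _).
    by rewrite [RHS]integral_mkcond; apply: eq_integral => y _; rewrite patchE mem_setE in_itv /= /I; case: ifP.
  by rewrite integral_cst//= lebesgue_measure_itv/= lte_fin pp -EFinB subr0 -EFinM.
have mIE (c : R) : measurable_fun setT (fun y => (if I y then c else 0)%:E).
  by apply/measurable_EFinP; apply: measurable_fun_if => //; exact: mI.
have absF s t : `|F (s, t)| <= (if I s then if I t then M else 0 else 0).
  rewrite /F /=; case Is: (I s); case It: (I t) => /=; rewrite ?normr0//; exact: AM.
have i1 s : leb.-integrable setT (fun t => (F (s, t))%:E).
  apply/integrableP; split; first exact: (measurableT_comp mF (pair1_measurable s)).
  apply: (@le_lt_trans _ _ (\int[leb]_y (if I y then M else 0)%:E)%E); last by rewrite pI ltry.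
  apply: ge0_le_integral => //.
  - by apply: measurableT_comp => //; exact: (measurableT_comp mF (pair1_measurable s)).
  - exact: mIE.
  - by move=> t _; rewrite lee_fin; apply: le_trans (absF s t) _; case: (I s); case: (I t).
have i2 t : leb.-integrable setT (fun s => (F (s, t))%:E).
  apply/integrableP; split; first exact: (measurableT_comp mF (pair2_measurable t)).
  apply: (@le_lt_trans _ _ (\int[leb]_y (if I y then M else 0)%:E)%E); last by rewrite pI ltry.
  apply: ge0_le_integral => //.
  - by apply: measurableT_comp => //; exact: (measurableT_comp mF (pair2_measurable t)).
  - exact: mIE.
  - by move=> s _; rewrite lee_fin; apply: le_trans (absF s t) _; case: (I s); case: (I t).
have iF : (leb \x leb)%E.-integrable setT (fun z => (F z)%:E).
  apply/integrable12ltyP => //.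
  apply: (@le_lt_trans _ _ (\int[leb]_y (if I y then M * (2 * pi) else 0)%:E)%E); last by rewrite pI ltry.
  apply: ge0_le_integral => //.
  - by move=> y _; apply: integral_ge0.
  - by apply: (@measurable_fun_fubini_tonelli_F _ _ _ _ _ leb (fun z => `|(F z)%:E|%E)) => //; exact: measurableT_comp.
  - exact: mIE.
  - move=> s _; apply: (@le_trans _ _ (\int[leb]_t (if I t then (if I s then M else 0) else 0)%:E)%E).
      apply: ge0_le_integral => //.
      + by apply: measurableT_comp => //; exact: (measurableT_comp mF (pair1_measurable s)).
      + exact: mIE.
      + by move=> t _; rewrite lee_fin; apply: le_trans (absF s t) _; case: (I s); case: (I t).
    by rewrite pI; case: (I s); rewrite ?mul0r.
have IntE (h : R -> R) (H : R -> \bar R) : (forall s, H s = (if I s then h s else 0)%:E) -> Int h 0 (2 * pi) = fine (\int[leb]_s H s)%E.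
  move=> HE; rewrite /Int /Rintegral; congr fine; rewrite integral_mkcond; apply: eq_integral => y _.
  by rewrite HE patchE mem_setE in_itv /= /I; case: ifP.
rewrite (IntE _ (fun s => \int[leb]_t (F (s, t))%:E)%E) ?(IntE _ (fun t => \int[leb]_s (F (s, t))%:E)%E).
- by congr fine; exact: (Fubini iF).
- move=> t; case It: (I t).
    rewrite (IntE _ (fun s => (F (s, t))%:E)); first by rewrite fineK// integrable_fin_num.
    by move=> s; rewrite /F /= It andbT.
  by rewrite /F /=; under eq_integral do rewrite It andbF; rewrite integral0.
- move=> s; case Is: (I s).
    rewrite (IntE _ (fun t => (F (s, t))%:E)); first by rewrite fineK// integrable_fin_num.
    by move=> t; rewrite /F /= Is.
  by rewrite /F /=; under eq_integral do rewrite Is; rewrite integral0.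
Qed.

Lemma IntZ (c : R) (f : R -> R) a b : cts_on f a b -> Int (fun t => c * f t) a b = c * Int f a b.
Proof. by move=> cf; apply: RintegralZl => //; exact: cts_integrable. Qed.

Lemma cavg_swap (A : R -> R -> C) (M : R) :
  cmfun (fun z : R * R => A z.1 z.2) ->
  (forall s t, 0 <= s <= 2 * pi -> 0 <= t <= 2 * pi -> cabs (A s t) <= M) ->
  (forall s, ccts (A s) 0 (2 * pi)) -> (forall t, ccts (A^~ t) 0 (2 * pi)) ->
  cavg (fun s => cavg (A s)) = cavg (fun t => cavg (A^~ t)).
Proof.
move=> [m1 m2] AM c1 c2; have pp := pi2_gt0 (R := R).
have K (B : R -> R -> R) : measurable_fun setT (fun z : R * R => B z.1 z.2) ->
    (forall s t, 0 <= s <= 2 * pi -> 0 <= t <= 2 * pi -> `|B s t| <= M) ->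
    (forall s, cts_on (B s) 0 (2 * pi)) -> (forall t, cts_on (B^~ t) 0 (2 * pi)) ->
    Int (fun s => (2 * pi)^-1 * Int (B s) 0 (2 * pi)) 0 (2 * pi) = Int (fun t => (2 * pi)^-1 * Int (B^~ t) 0 (2 * pi)) 0 (2 * pi).
  move=> mB BM b1 b2.
  transitivity (Int (fun s => Int (fun t => (2 * pi)^-1 * B s t) 0 (2 * pi)) 0 (2 * pi)).
    by congr Int; apply/funext => s; rewrite IntZ.
  rewrite (@Int_swap (fun s t => (2 * pi)^-1 * B s t) ((2 * pi)^-1 * M)).
  - by congr Int; apply/funext => t; rewrite IntZ.
  - by apply: measurable_funM => //; exact: measurable_cst.
  - move=> s t s1 t1; have i0 : 0 <= (2 * pi)^-1 :> R by rewrite invr_ge0 ltW.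
    by rewrite normrM (ger0_norm i0) (ler_wpM2l i0)// BM.
apply: eqC.
  apply: (congr1 (fun x => (2 * pi)^-1 * x) (K (fun s t => cre (A s t)) m1 _ (fun s => (c1 s).1) (fun t => (c2 t).1))).
  by move=> s t s1 t1; apply: le_trans (cabs_re _) (AM s t s1 t1).
apply: (congr1 (fun x => (2 * pi)^-1 * x) (K (fun s t => cim (A s t)) m2 _ (fun s => (c1 s).2) (fun t => (c2 t).2))).
by move=> s t s1 t1; apply: le_trans (cabs_im _) (AM s t s1 t1).
Qed.

(** A continuous function on a compact square is bounded; this supplies the bound that the exchange
    of two circle averages asks for. *)
Lemma joint_bounded (A : R -> R -> C) (a b : R) :
  (forall s t, forall e : R, 0 < e -> exists2 d : R, 0 < d & forall k l : R, `|k| < d -> `|l| < d -> cabs (A (s + k) (t + l) - A s t) <= e) ->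
  exists M : R, forall s t, a <= s <= b -> a <= t <= b -> cabs (A s t) <= M.
Proof.
move=> H; pose g (z : R * R) : R := cabs (A z.1 z.2).
have cg : continuous g.
  move=> [s t]; apply/cvgrPdist_le => e e0; have [d d0 Hd] := H s t e e0.
  exists ([set x | `|x - s| < d], [set x | `|x - t| < d]); first by split; exact: near_dist.
  move=> [x y] [/= xs yt]; have := Hd _ _ xs yt; rewrite !subrKC => L.
  apply: le_trans L; rewrite /g /= ler_norml lerBlDr -[cabs (A x y)]opprK lerBrDl opprK.
  apply/andP; split; last first.
    by rewrite cabsB -[X in cabs X <= _](subrK (A x y)) cabsD.
  by rewrite lerBlDr addrC -[X in cabs X <= _](subrK (A s t)) cabsD.
have cK : compact (`[a, b]%classic `*` `[a, b]%classic : set (R * R)) by apply: compact_setX; exact: segment_compact.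
have := compact_bounded (continuous_compact (continuous_subspaceT cg) cK).
move=> [M [_ HM]]; exists (M + 1) => s t sab tab.
have := HM (M + 1) _ (g (s, t)); rewrite ltrDl ltr01 => /(_ isT) /=.
rewrite /= /g ger0_norm ?cabs_ge0//; apply; by exists (s, t).
Qed.

End CircleMore.

(** * Measurability by approximation on grids *)

Section FloorApproximation.
Context {R : realType}.
Local Notation C := (C R).

Lemma measurable_allb d (T : measurableType d) (I : Type) (s : seq I) (b : I -> T -> bool) :
  (forall i, measurable_fun setT (b i)) -> measurable_fun setT (fun t => all (fun i => b i t) s).
Proof.
move=> mb; elim: s => [|i s IH] /=; first exact: measurable_cst.
by apply: measurable_and.
Qed.

(** A preimage is a countable union of level sets of [c], so [g] may be any function. *)
Lemma measurable_countable_comp d (T : measurableType d) d' (U : measurableType d') (K : countType) (c : T -> K) (g : K -> U) :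
  (forall z, measurable_fun setT (fun t => c t == z)) -> measurable_fun setT (fun t => g (c t)).
Proof.
move=> mc _ B mB; rewrite setTI.
rewrite (_ : _ @^-1` B = \bigcup_z (if g z \in B then (fun t => c t == z) @^-1` [set true] else set0)).
  apply: countable_bigcupT_measurable => // z; case: ifP => // _.
  by rewrite -[_ @^-1` _]setTI; exact: mc.
apply/seteqP; split => [t Bt|t [z _]].
  by exists (c t) => //; rewrite mem_set//= eqxx.
by case: ifPn => [/set_mem Bz /= /eqP ->//|].
Qed.

(* A differentiable function is a pointwise limit of its values on grids, which take countably many values. *)
Definition gridC (i : nat) (z : int * int) : C := Complex (z.1%:~R / i.+1%:R) (z.2%:~R / i.+1%:R).
Definition codeC (i : nat) (z : C) : int * int := (Num.floor (i.+1%:R * cre z), Num.floor (i.+1%:R * cim z)).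

Lemma grid_re (i : nat) (x : R) : `|(Num.floor (i.+1%:R * x))%:~R / i.+1%:R - x| <= i.+1%:R^-1.
Proof.
have i0 : 0 < i.+1%:R :> R by rewrite ltr0n.
have /andP[h1 h2] := floor_itv (i.+1%:R * x); rewrite intrD in h2.
rewrite -[X in _ - X](mulKf (lt0r_neq0 i0)) mulrC -mulrBr normrM gtr0_norm ?invr_gt0// -[leRHS]mulr1.
rewrite ler_wpM2l ?invr_ge0 ?(ltW i0)// ler_norml lerBrDl lerBlDr; apply/andP; split.
  by rewrite ltW// -[1]/(1%:~R).
rewrite lerBlDr; by apply: le_trans h1 _; rewrite lerDr.
Qed.

Lemma measurable_floor_eq d (T : measurableType d) (g : T -> R) (z : int) : measurable_fun setT g ->
  measurable_fun setT (fun t => Num.floor (g t) == z).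
Proof.
move=> mg; under eq_fun do rewrite floor_eq.
by apply: measurable_and; [apply: measurable_fun_ler | apply: measurable_fun_ltr] => //; exact: measurable_cst.
Qed.

(** Rounding to a grid leaves countably many values, hence a measurable function whatever [phi] is.
    Continuity of [phi] at the points selected by [b] makes these functions converge as the mesh
    shrinks. *)
Lemma measurable_approx d (T : measurableType d) k (u : T -> 'rV[C]_k) (phi : 'rV[C]_k -> R) (b : T -> bool) :
  cmeas u -> measurable_fun setT b ->
  (forall t, b t -> forall e : R, 0 < e -> exists2 dl : R, 0 < dl &
     forall x' : 'rV[C]_k, (forall j, cabs (x' ord0 j - u t ord0 j) < dl) -> `|phi x' - phi (u t)| <= e) ->
  measurable_fun setT (fun t => if b t then phi (u t) else 0).
Proof.
move=> mu mb H.
pose q (i : nat) (c : {ffun 'I_k -> int * int}) : 'rV[C]_k := \row_j gridC i (c j).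
pose c (i : nat) (t : T) : {ffun 'I_k -> int * int} := [ffun j => codeC i (u t ord0 j)].
pose h (i : nat) (t : T) : R := if b t then phi (q i (c i t)) else 0.
apply: (@measurable_fun_cvg _ _ _ setT h) => [i|t _]; last first.
  rewrite /h; case bt: (b t); last exact: cvg_cst.
  apply/cvgrPdist_le => e e0; have [dl dl0 Hd] := H t bt e e0.
  near=> i; rewrite distrC; apply: Hd => j; rewrite mxE /gridC ffunE /codeC /=.
  apply: le_lt_trans (cabs_le _) _; rewrite creB cimB /=.
  apply: (@le_lt_trans _ _ (i.+1%:R^-1 + i.+1%:R^-1)); first by apply: lerD; exact: grid_re.
  have -> : i.+1%:R^-1 + i.+1%:R^-1 = i.+1%:R^-1 * 2 :> R by ring.
  rewrite ltr_pdivrMl ?ltr0n// -ltr_pdivrMr//.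
  apply: lt_trans (truncnS_gt _) _; rewrite ltr_nat ltnS.
  by near: i; exact: nbhs_infty_ge.
apply: measurable_fun_if => //.
apply: (@measurable_funS _ _ _ _ setT) => //.
apply: (@measurable_countable_comp _ _ _ _ _ (c i) (fun z => phi (q i z))) => z.
have E t : (c i t == z) = all (fun j => codeC i (u t ord0 j) == z j) (enum 'I_k).
  apply/eqP/allP => [<- j _|K]; first by rewrite ffunE.
  by apply/ffunP => j; rewrite ffunE; apply/eqP; apply: K; rewrite mem_enum.
under eq_fun do rewrite E.
apply: measurable_allb => j; rewrite /codeC; case: (z j) => z1 z2.
under eq_fun do rewrite xpair_eqE /=.
apply: measurable_and; apply: measurable_floor_eq; apply: measurable_funM => //; by [exact: measurable_cst | exact: (mu j).1 | exact: (mu j).2].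
Unshelve. all: by end_near.
Qed.

End FloorApproximation.

Section HomogeneousParts.
Context {R : realType} (n m : nat) (mu : R).
Hypothesis mu0 : 0 < mu.
Local Notation C := (C R).
Local Notation N := (n + m)%N.
Variable f : 'rV[C]_N -> C.
Hypothesis hf : holo_on f (@Dnm R n m mu).

Definition inD (x : 'rV[C]_N) : bool := sqn (rsubmx x : 'rV[C]_m) < expR (- mu * sqn (lsubmx x : 'rV[C]_n)).
(** The values of [f] off the domain are arbitrary; setting them to zero restores measurability
    without changing any weighted integral. *)
Definition fD (x : 'rV[C]_N) : C := if inD x then f x else 0.

Lemma inDP x : Dnm mu x <-> inD x.
Proof. by []. Qed.

Lemma measurable_inD d (T : measurableType d) (u : T -> 'rV[C]_N) : cmeas u -> measurable_fun setT (fun t => inD (u t)).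
Proof.
move=> mu'; apply: measurable_fun_ltr; first by apply: measurable_sqn; exact: cmeas_rsub.
apply: measurableT_comp => //; apply: measurable_funM; first exact: measurable_cst.
by apply: measurable_sqn; exact: cmeas_lsub.
Qed.

Lemma cgoodc_fD : cgoodc fD.
Proof.
move=> d T u mu'; have mi := measurable_inD mu'.
have K (p : C -> R) : (forall z z', `|p z - p z'| <= cabs (z - z')) ->
    measurable_fun setT (fun t => if inD (u t) then p (f (u t)) else 0).
  move=> pc; apply: (measurable_approx (phi := fun x => p (f x))) => // t bt e e0.
  have [dl dl0 Hd] := diff_cont_coord (hf bt) e0.
  by exists dl => // x' hx'; apply: le_trans (pc _ _) (Hd _ hx').
split; rewrite /fD; [have := K (@cre R) | have := K (@cim R)].
  move=> /(_ (fun z z' => _)); rewrite (_ : (fun t => if _ then _ else _) = (fun t => cre (if inD (u t) then f (u t) else 0))).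
    by apply => z z'; rewrite -creB; exact: cabs_re.
  by apply/funext => t; case: ifP.
move=> /(_ (fun z z' => _)); rewrite (_ : (fun t => if _ then _ else _) = (fun t => cim (if inD (u t) then f (u t) else 0))).
  by apply => z z'; rewrite -cimB; exact: cabs_im.
by apply/funext => t; case: ifP.
Qed.

Lemma inD_row z v : inD (row_mx z v) = (sqn v < expR (- mu * sqn z)).
Proof. by rewrite /inD row_mxKl row_mxKr. Qed.

(* The disc of radius [tau] in the direction [w] stays inside the domain. *)
Definition adm (tau : R) (x : 'rV[C]_N) := 0 < tau /\
  tau ^+ 2 * sqn (rsubmx x : 'rV[C]_m) < expR (- mu * sqn (lsubmx x : 'rV[C]_n)).

Definition wscale (c : C) (x : 'rV[C]_N) : 'rV[C]_N := row_mx (lsubmx x) (c *: rsubmx x).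

Lemma adm_inD tau x (c : C) : adm tau x -> cabs c <= tau -> inD (wscale c x).
Proof.
move=> [t0 H] ct; rewrite inD_row sqnZ -cabs2; apply: le_lt_trans H.
by rewrite ler_wpM2r ?sqn_ge0// lerXn2r ?nnegrE ?cabs_ge0// ltW.
Qed.

Lemma wscale_line (c : C) x : wscale c x = row_mx (lsubmx x) 0 + c *: row_mx 0 (rsubmx x).
Proof. by rewrite scale_row_mx add_row_mx scaler0 addr0 add0r. Qed.

Lemma cdiff_wscale tau x (c : C) : adm tau x -> cabs c <= tau -> cdiff (fun s => f (wscale s x)) c.
Proof.
move=> ax ct; under [X in cdiff X]funext do rewrite wscale_line.
by apply: cdiff_line; rewrite -wscale_line; apply: hf; exact: adm_inD ax ct.
Qed.

(** Cauchy's formula, on the circle of radius [tau], for the coefficient of degree [s] of the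
    function [c |-> f (z, c w)]. *)
Definition hpart (s : nat) (tau : R) (x : 'rV[C]_N) : C :=
  rc (tau ^- s) * cavg (fun t => fD (wscale (rc tau * cis t) x) * cis (- (s%:R * t))).

Lemma cabs_rc_cis (r t : R) : 0 <= r -> cabs (rc r * cis t) = r.
Proof. by move=> r0; rewrite cabsM cabs_cis mulr1 cabs_rc ger0_norm. Qed.

Lemma fD_adm tau x (r t : R) : adm tau x -> 0 <= r -> r <= tau -> fD (wscale (rc r * cis t) x) = f (wscale (rc r * cis t) x).
Proof. by move=> ax r0 rt; rewrite /fD (adm_inD ax) ?cabs_rc_cis. Qed.

(** Both circles lie in one disc on which [f] is holomorphic in the scaling variable, so
    [circle_coef] applies. *)
Lemma hpart_indep s tau1 tau2 x : adm tau1 x -> adm tau2 x -> hpart s tau1 x = hpart s tau2 x.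
Proof.
wlog t12 : tau1 tau2 / tau1 <= tau2 => [W|] a1 a2.
  by case/orP: (le_total tau1 tau2) => h; [exact: W | rewrite (W tau2 tau1)].
have t10 := a1.1; have t20 := a2.1.
have E (r : R) : adm r x -> hpart s r x = cavg (fun t => f (wscale (rc r * cis t) x) * (rc r * cis t) ^- s).
  move=> ar; have r0 := ar.1.
  have cc : ccts (fun t => fD (wscale (rc r * cis t) x) * cis (- (s%:R * t))) 0 (2 * pi).
    apply: cctsM.
      rewrite (_ : (fun t => _) = (fun t => f (wscale (rc r * cis t) x))); last by apply/funext => t; rewrite (fD_adm _ ar)// ltW.
      apply: (ccts_circle (g := fun c => f (wscale c x))); first exact: ltW.
      by move=> z zr; apply: (cdiff_cont (g := fun c => f (wscale c x))); apply: cdiff_wscale ar _; rewrite zr.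
    by have := @ccts_cis_powV R s 0 (2 * pi); congr ccts; apply/funext => t; rewrite -cis_inv -cisX.
  rewrite /hpart -cavgZ//; apply: eq_cavg => t.
  by rewrite (fD_adm _ ar (ltW r0) (lexx r)) rc_cis_powV.
have H z : tau1 <= cabs z <= tau2 -> cdiff (fun c => f (wscale c x)) z by move=> /andP[_ z2]; exact: cdiff_wscale a2 z2.
by rewrite (E _ a1) (E _ a2); exact: (@circle_coef R (fun c => f (wscale c x)) s tau1 tau2 t10 t12 H).
Qed.

(* An admissible radius defined on the whole space: [hpart] does not depend on the radius, so
   [hcomp] extends the homogeneous parts of [f] to entire functions. *)
Definition tauf (x : 'rV[C]_N) : R := expR (- (mu * sqn (lsubmx x : 'rV[C]_n)) / 2) / (1 + sqn (rsubmx x : 'rV[C]_m)).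

(** The radius depends on bounds of the two blocks only, hence serves a whole bounded set of points;
    the key inequality is [B2 < (1 + B2) ^ 2]. *)
Lemma adm_tau (B1 B2 : R) x : sqn (lsubmx x : 'rV[C]_n) <= B1 -> sqn (rsubmx x : 'rV[C]_m) <= B2 ->
  adm (expR (- (mu * B1) / 2) / (1 + B2)) x.
Proof.
move=> h1 h2; have B20 : 0 <= B2 by exact: le_trans (sqn_ge0 _) h2.
have d0 : 0 < 1 + B2 by rewrite ltr_wpDr.
split; first by rewrite divr_gt0 ?expR_gt0.
rewrite expr_div_n -expRM_natl mulrAC.
apply: (@lt_le_trans _ _ (expR (- (mu * B1)))); last by rewrite ler_expR mulNr lerN2 ler_pM2l.
rewrite (_ : 2%:R * (- (mu * B1) / 2) = - (mu * B1)); last by field.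
rewrite -mulrA gtr_pMr ?expR_gt0// ltr_pdivrMr ?exprn_gt0// mul1r.
apply: le_lt_trans h2 _; rewrite expr2; have : 0 <= B2 * B2 by rewrite mulr_ge0.
lra.
Qed.

Lemma adm_tauf x : adm (tauf x) x.
Proof. exact: adm_tau. Qed.

Definition hcomp (s : nat) (x : 'rV[C]_N) : C := hpart s (tauf x) x.

Lemma hcompE s tau x : adm tau x -> hcomp s x = hpart s tau x.
Proof. by move=> ax; apply: hpart_indep => //; exact: adm_tauf. Qed.

(** Scaling [w] by [r] amounts to computing at radius [t * r] instead of [t]; the mean is unchanged
    and the prefactor yields [r ^ s]. *)
Lemma hcomp_scale s (r : R) z v : 0 < r -> hcomp s (row_mx z (rc r *: v)) = rc (r ^+ s) * hcomp s (row_mx z v).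
Proof.
move=> r0; set x := row_mx z (rc r *: v); set y := row_mx z v.
have {1}-> : hcomp s x = hpart s (tauf x) x by [].
move: (tauf x) (adm_tauf x) => t [t0 tx].
have ay : adm (t * r) y.
  split; first exact: mulr_gt0.
  by move: tx; rewrite /x /y !row_mxKl !row_mxKr sqnZ abs2_rc exprMn mulrA.
rewrite (hcompE s ay) /hpart mulrA -rcM.
have -> : r ^+ s * (t * r) ^- s = t ^- s by rewrite exprMn invfM mulrCA mulfV ?mulr1// expf_neq0// gt_eqF.
have W a : wscale (rc t * cis a) x = wscale (rc (t * r) * cis a) y.
  by rewrite /wscale /x /y !row_mxKl !row_mxKr scalerA rcM mulrAC.
by apply: (congr1 (fun c => rc (t ^- s) * c)); apply: eq_cavg => a; rewrite (W a).
Qed.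

Lemma ccts_fD tau x a b : adm tau x -> ccts (fun t => fD (wscale (rc tau * cis t) x)) a b.
Proof.
move=> ax; rewrite (_ : (fun t => _) = (fun t => f (wscale (rc tau * cis t) x))); last by apply/funext => t; rewrite (fD_adm _ ax)// ltW// ax.1.
apply: (ccts_circle (g := fun c => f (wscale c x))); first exact: ltW ax.1.
by move=> z zr; apply: (cdiff_cont (g := fun c => f (wscale c x))); apply: cdiff_wscale ax _; rewrite zr.
Qed.

Lemma ccts_cisN (s : nat) a b : ccts (fun t => cis (- (s%:R * t)) : C) a b.
Proof. by have := @ccts_cis_powV R s a b; congr ccts; apply/funext => t; rewrite -cis_inv -cisX. Qed.

Lemma hcomp_rotw s t x : hcomp s (rotw t x) = cis (s%:R * t) * hcomp s x.
Proof.
have ax := adm_tauf x.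
have tE : tauf (rotw t x) = tauf x by rewrite /tauf /rotw row_mxKl row_mxKr sqn_rot.
rewrite /hcomp tE /hpart mulrCA; congr (_ * _).
rewrite -(@cavg_coef_shift R (fun z => fD (wscale (rc (tauf x) * z) x)) s t (fun a b => ccts_fD a b ax)).
have W r : wscale (rc (tauf x) * cis r) (rotw t x) = wscale (rc (tauf x) * cis (r + t)) x.
  by rewrite /wscale /rotw !row_mxKl !row_mxKr scalerA -mulrA -cisD.
by apply: eq_cavg => r; rewrite W.
Qed.

Lemma cgoodc_hcomp s : cgoodc (hcomp s).
Proof.
move=> d T u mu'.
have mt : measurable_fun setT (fun t => tauf (u t)).
  apply: measurable_funM.
    apply: measurableT_comp => //; apply: measurable_funM; last exact: measurable_cst.
    apply: measurableT_comp => //; apply: measurable_funM; first exact: measurable_cst.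
    by apply: measurable_sqn; exact: cmeas_lsub.
  have E t : (1 + sqn (rsubmx (u t) : 'rV[C]_m))^-1 = (1 + sqn (rsubmx (u t) : 'rV[C]_m)) `^ (-1).
    by rewrite powR_inv1// addr_ge0 ?sqn_ge0.
  under eq_fun do rewrite E.
  apply: (measurableT_comp (measurable_powR (-1))); apply: measurable_funD; first exact: measurable_cst.
  by apply: measurable_sqn; exact: cmeas_rsub.
have mg : cmfun (fun z : T * R => fD (wscale (rc (tauf (u z.1)) * cis z.2) (u z.1)) * cis (- (s%:R * z.2))).
  apply: cmfunM.
    apply: (cgoodc_fD (u := fun z : T * R => wscale (rc (tauf (u z.1)) * cis z.2) (u z.1))).
    have mu1 := cmeas_comp mu' (@measurable_fst _ _ T R).
    apply: cmeas_row_mx; first exact: cmeas_lsub.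
    apply: cmeas_scalec; last exact: cmeas_rsub.
    by apply: cmfunM; [apply: cmfun_rc; exact: (measurableT_comp mt) | apply: cmfun_cis].
  apply: cmfun_cis; apply: measurableT_comp => //; apply: measurable_funM => //; exact: measurable_cst.
have mp : measurable_fun setT (fun t => tauf (u t) ^- s).
  have E t : tauf (u t) ^- s = tauf (u t) `^ (- s%:R) by rewrite powR_invn// ltW// (adm_tauf _).1.
  by under eq_fun do rewrite E; apply: (measurableT_comp (measurable_powR (- s%:R))).
apply: cmfunM; first exact: cmfun_rc.
split; rewrite /cavg /=; apply: measurable_funM; try exact: measurable_cst.
  exact: (@measurable_Int_param _ _ _ (fun t y => cre (fD (wscale (rc (tauf (u t)) * cis y) (u t)) * cis (- (s%:R * y))))  0 (2 * pi) mg.1).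
exact: (@measurable_Int_param _ _ _ (fun t y => cim (fD (wscale (rc (tauf (u t)) * cis y) (u t)) * cis (- (s%:R * y))))  0 (2 * pi) mg.2).
Qed.

End HomogeneousParts.

Section JointContinuity.
Context {R : realType}.
Local Notation C := (C R).

Definition jcont (A : R -> R -> C) := forall s t, forall e : R, 0 < e ->
  exists2 d : R, 0 < d & forall k l : R, `|k| < d -> `|l| < d -> cabs (A (s + k) (t + l) - A s t) <= e.

Lemma jcont_mul_cis (A : R -> R -> C) (s : nat) : jcont A -> jcont (fun r t => A r t * cis (- (s%:R * t))).
Proof.
move=> jA r t e e0; have e2 : 0 < e / 2 by rewrite divr_gt0.
have [d1 d10 H1] := jA r t _ e2.
have c0 : 0 < cabs (A r t) + 1 by rewrite ltr_wpDl ?cabs_ge0.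
have e3 : 0 < e / 2 / (cabs (A r t) + 1) by rewrite divr_gt0.
have [d2 d20 H2] := @cabs_cis_lip R (- (s%:R * t)) 0 _ e3.
have s0 : 0 < s%:R + 1 :> R by rewrite ltr_wpDl.
exists (Num.min d1 (d2 / (s%:R + 1))); first by rewrite lt_min d10 divr_gt0.
move=> k l; rewrite !lt_min => /andP[k1 _] /andP[l1]; rewrite ltr_pdivlMr// => l2.
have -> : - (s%:R * (t + l)) = - (s%:R * t) + - (s%:R * l) by ring.
set u := cis (_ + _); set v := cis (- (s%:R * t)).
rewrite (_ : _ - _ = (A (r + k) (t + l) - A r t) * u + A r t * (u - v)); last by ring.
apply: le_trans (cabsD _ _) _; rewrite !cabsM /u cabs_cis mulr1 (splitr e); apply: lerD; first exact: H1.
apply: (@le_trans _ _ ((cabs (A r t) + 1) * (e / 2 / (cabs (A r t) + 1)))); last first.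
  by rewrite mulrCA mulfV ?mulr1 ?gt_eqF.
apply: ler_pM; rewrite ?cabs_ge0//; first by rewrite lerDl.
apply: H2; rewrite normrN normrM ger0_norm//.
by apply: le_lt_trans l2; rewrite mulrC ler_wpM2l// lerDl.
Qed.

Lemma ccts_cavg_param (A : R -> R -> C) a b : jcont A -> (forall r, ccts (A r) 0 (2 * pi)) ->
  ccts (fun r => cavg (A r)) a b.
Proof.
move=> jA cA; apply: ccts_lip => r _ e e0.
have nA : \forall s \near (r : R), ccts (A s) 0 (2 * pi) by near=> s; exact: cA.
have [d d0 H] := @cavg_param R A r nA (fun t e e0 => jA r t e e0) e e0.
by exists d => // l ld; apply: H; rewrite addrC addKr.
Unshelve. all: by end_near.
Qed.

Lemma abs2D_le (x y : C) : abs2 (x + y) <= 2 * abs2 x + 2 * abs2 y.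
Proof.
rewrite /abs2 creD cimD; have h1 := sqr_ge0 (cre x - cre y); have h2 := sqr_ge0 (cim x - cim y).
rewrite -subr_ge0 (_ : _ - _ = (cre x - cre y) ^+ 2 + (cim x - cim y) ^+ 2); last by ring.
exact: addr_ge0.
Qed.

Lemma sqnD_le k (x y : 'rV[C]_k) (c : C) : cabs c <= 1 -> sqn (c *: x + y) <= 2 * sqn x + 2 * sqn y.
Proof.
move=> c1; rewrite /sqn !mulr_sumr -big_split; apply: ler_sum => j _; rewrite !mxE.
apply: le_trans (abs2D_le _ _) _; rewrite lerD2r ler_wpM2l// abs2M -cabs2 ler_piMl ?abs2_ge0//.
by rewrite exprn_ile1// cabs_ge0.
Qed.

Lemma cavgZr (h : R -> C) (k : C) : ccts h 0 (2 * pi) -> cavg (fun t => h t * k) = cavg h * k.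
Proof. by move=> ch; rewrite mulrC -cavgZ//; apply: eq_cavg => t; rewrite mulrC. Qed.

(** Expand the nonnegative integral of [|h - c|^2], where [c] is the mean of [h]. *)
Lemma jensen_cavg (h : R -> C) : ccts h 0 (2 * pi) ->
  abs2 (cavg h) <= (2 * pi)^-1 * Int (fun t => abs2 (h t)) 0 (2 * pi).
Proof.
move=> ch; have pp := pi2_gt0 (R := R); set c := cavg h.
have cc : ccts (fun t => cconj c * h t) 0 (2 * pi) by apply: cctsM => //; exact: ccts_cst.
have ca : cts_on (fun t => abs2 (h t)) 0 (2 * pi).
  have cM : ccts (fun t => h t * cconj (h t)) 0 (2 * pi) by apply: cctsM => //; exact: ccts_conj.
  have := cM.1; rewrite (_ : (fun t => cre (h t * cconj (h t))) = fun t => abs2 (h t))//.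
  by apply/funext => t; rewrite mul_conj.
have cr : cts_on (fun t => 2 * cre (cconj c * h t)) 0 (2 * pi).
  by move=> x xp; apply: cvgM; [exact: cvg_cst | exact: cc.1].
have cB : cts_on (fun t => 2 * cre (cconj c * h t) - abs2 c) 0 (2 * pi) by apply: cts_onB => //; exact: cts_on_cst.
have I0 : 0 <= Int (fun t => abs2 (h t - c)) 0 (2 * pi) by apply: Rintegral_ge0 => t _; exact: abs2_ge0.
have E t : abs2 (h t - c) = abs2 (h t) - (2 * cre (cconj c * h t) - abs2 c) by rewrite /abs2 !cE; ring.
have E2 : Int (fun t => cre (cconj c * h t)) 0 (2 * pi) = 2 * pi * abs2 c.
  have := congr1 (@cre R) (cavgZ (cconj c) ch); rewrite -/c [_ * c]mulrC mul_conj cre_rc => <-.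
  by rewrite /cavg /= mulrA divff ?mul1r// gt_eqF.
move: I0; under [X in Int X]funext do rewrite E.
rewrite IntB// IntB//; last exact: cts_on_cst.
rewrite IntZ ?Int_cst ?(ltW pp)//; last exact: cc.1.
by rewrite E2 => I0; rewrite ler_pdivlMl//; lra.
Qed.

End JointContinuity.

(* Otherwise conversion unfolds averages and exponentials down to the defining integrals and series. *)
Opaque cis cexp cavg.

(** * Mean value property of the homogeneous parts *)

Section PartsMeanValue.
Context {R : realType} (n m : nat) (mu : R).
Hypothesis mu0 : 0 < mu.
Local Notation C := (C R).
Local Notation N := (n + m)%N.
Variable f : 'rV[C]_N -> C.
Hypothesis hf : holo_on f (@Dnm R n m mu).
Local Notation fD := (@fD R n m mu f).
Local Notation adm := (@adm R n m mu).
Local Notation hcomp := (@hcomp R n m mu f).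

Variables (x y : 'rV[C]_N).
(** Bounds for both blocks of [c *: x + y] when [|c| <= 1], so that the single radius [tau] is
    admissible on this whole disc. *)
Let B1 : R := 2 * sqn (lsubmx x : 'rV[C]_n) + 2 * sqn (lsubmx y : 'rV[C]_n).
Let B2 : R := 2 * sqn (rsubmx x : 'rV[C]_m) + 2 * sqn (rsubmx y : 'rV[C]_m).
Let tau : R := expR (- (mu * B1) / 2) / (1 + B2).

Lemma adm_line (c : C) : cabs c <= 1 -> adm tau (c *: x + y).
Proof. by move=> c1; apply: adm_tau => //; rewrite linearD linearZ /= sqnD_le. Qed.

Lemma wscale_lin (c z : C) : wscale c (z *: x + y) = wscale c y + z *: wscale c x.
Proof.
rewrite /wscale scale_row_mx add_row_mx; apply: (congr2 (fun p q => row_mx p q)).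
  by rewrite linearD linearZ addrC.
by rewrite linearD linearZ scalerDr addrC !scalerA mulrC.
Qed.

Lemma wscale_coordl c (p : 'rV[C]_N) i : wscale c p ord0 (lshift m i) = p ord0 (lshift m i).
Proof. by rewrite /wscale row_mxEl mxE. Qed.

Lemma wscale_coordr c (p : 'rV[C]_N) i : wscale c p ord0 (rshift n i) = c * p ord0 (rshift n i).
Proof. by rewrite /wscale row_mxEr !mxE. Qed.

Lemma lin_coord (c : C) j : (c *: x + y) ord0 j = c * x ord0 j + y ord0 j.
Proof. by rewrite !mxE. Qed.

Lemma wscale_diff (c c' u u' : C) (M T e : R) : 0 <= e -> (forall j, cabs (x ord0 j) + cabs (y ord0 j) <= M) ->
  cabs u <= 1 -> cabs c' <= T -> cabs (c - c') <= T * e -> cabs (u - u') <= e ->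
  forall j, cabs (wscale c (u *: x + y) ord0 j - wscale c' (u' *: x + y) ord0 j) <= (1 + 2 * T) * (M * e).
Proof.
move=> e0 Mj u1 cT ce ue j.
have T0 : 0 <= T by exact: le_trans (cabs_ge0 _) cT.
have Lx i : cabs ((u - u') * x ord0 i) <= M * e.
  have cy := cabs_ge0 (y ord0 i).
  by rewrite mulrC cabsM; apply: ler_pM; rewrite ?cabs_ge0//; apply: le_trans (Mj i); rewrite lerDl.
have Lxy i : cabs (u * x ord0 i + y ord0 i) <= M.
  by apply: le_trans (cabsD _ _) (le_trans _ (Mj i)); rewrite cabsM lerD2r ler_piMl ?cabs_ge0.
have M0 : 0 <= M by apply: le_trans (Mj j); exact: addr_ge0 (cabs_ge0 _) (cabs_ge0 _).
have Me := mulr_ge0 M0 e0; have tM := mulr_ge0 T0 Me.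
rewrite mulrDl mul1r; case: (fintype.split_ordP j) => i ->.
  have El c0 u0 : wscale c0 (u0 *: x + y) ord0 (lshift m i) = u0 * x ord0 (lshift m i) + y ord0 (lshift m i).
    exact: etrans (wscale_coordl _ _ _) (lin_coord _ _).
  rewrite (congr2 (fun p q => p - q) (El c u) (El c' u')); set j' := lshift m i.
  rewrite (_ : _ - _ = (u - u') * x ord0 j'); last by ring.
  by apply: le_trans (Lx j') _; rewrite lerDl -mulrA mulr_ge0.
have Er c0 u0 : wscale c0 (u0 *: x + y) ord0 (rshift n i) = c0 * (u0 * x ord0 (rshift n i) + y ord0 (rshift n i)).
  exact: etrans (wscale_coordr _ _ _) (congr1 (fun p => c0 * p) (lin_coord _ _)).
rewrite (congr2 (fun p q => p - q) (Er c u) (Er c' u')); set j' := rshift n i.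
rewrite (_ : _ - _ = (c - c') * (u * x ord0 j' + y ord0 j') + c' * ((u - u') * x ord0 j')); last by ring.
apply: (@le_trans _ _ (T * e * M + T * (M * e))).
  by apply: le_trans (cabsD _ _) _; apply: lerD; rewrite cabsM; apply: ler_pM; rewrite ?cabs_ge0.
rewrite -[T * e * M]mulrA [e * M]mulrC; lra.
Qed.

Lemma cdiff_disc (c z : C) : cabs c <= tau -> cabs z <= 1 -> cdiff (fun s => f (wscale c (s *: x + y))) z.
Proof.
move=> ct z1; under [X in cdiff X]funext do rewrite wscale_lin.
by apply: cdiff_line; rewrite -wscale_lin; apply: hf; apply: adm_inD (adm_line z1) ct.
Qed.

(** Values of [f] on a torus: [r] moves along the complex line through [y], and [t] is the angle
    that extracts the degree in [w]. *)
Let A (r t : R) : C := fD (wscale (rc tau * cis t) (cis r *: x + y)).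

Lemma cabs_tau t : cabs (rc tau * cis t) <= tau.
Proof. by rewrite cabs_rc_cis// ltW// (adm_line (c := 0) _).1// cabs0. Qed.

Lemma A_E r t : A r t = f (wscale (rc tau * cis t) (cis r *: x + y)).
Proof. by rewrite /A /fD (adm_inD (adm_line _) (cabs_tau t))// cabs_cis. Qed.

Lemma jcont_A : jcont A.
Proof.
move=> r t e e0.
have Dq : Dnm mu (wscale (rc tau * cis t) (cis r *: x + y)).
  by apply: adm_inD (adm_line _) (cabs_tau t); rewrite cabs_cis.
have [d d0 Hd] := diff_cont_coord (hf Dq) e0.
have t0 : 0 <= tau by apply: le_trans (cabs_tau 0); exact: cabs_ge0.
pose M : R := 1 + \sum_j (cabs (x ord0 j) + cabs (y ord0 j)).
have Mj j : cabs (x ord0 j) + cabs (y ord0 j) <= M.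
  rewrite /M (bigD1 j) //= addrCA lerDl addr_ge0// sumr_ge0// => i _; exact: addr_ge0 (cabs_ge0 _) (cabs_ge0 _).
have M0 : 0 < M by rewrite ltr_pwDl// sumr_ge0// => i _; exact: addr_ge0 (cabs_ge0 _) (cabs_ge0 _).
have K0 : 0 < 2 * (1 + 2 * tau) * M by rewrite !mulr_gt0// ltr_pwDl// mulr_ge0.
have e1 : 0 < d / (2 * (1 + 2 * tau) * M) by rewrite divr_gt0.
have [d1 d10 H1] := @cabs_cis_lip R r 0 _ e1.
have [d2 d20 H2] := @cabs_cis_lip R t 0 _ e1.
exists (Num.min d1 d2); first by rewrite lt_min d10.
move=> k l; rewrite !lt_min => /andP[k1 _] /andP[_ l2]; rewrite !A_E.
have {}H1 := H1 k k1; have {}H2 := H2 l l2; set eta := d / _ in e1 H1 H2.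
have etaE : 2 * (1 + 2 * tau) * M * eta = d by rewrite /eta mulrC divfK// gt_eqF.
have fin : (1 + 2 * tau) * (M * eta) < d.
  have T0 : 0 < 1 + 2 * tau by apply: ltr_pwDl => //; exact: mulr_ge0.
  have P0 : 0 < (1 + 2 * tau) * (M * eta) by exact: mulr_gt0 T0 (mulr_gt0 M0 e1).
  by rewrite -etaE (_ : 2 * _ * _ * _ = 2 * ((1 + 2 * tau) * (M * eta))) ?ltr_pMl ?ltr1n//; ring.
apply: Hd => j; apply: le_lt_trans fin.
apply: wscale_diff => //; rewrite ?cabs_cis ?cabs_tau ?(ltW e1)//.
by rewrite -mulrBr cabsM cabs_rc (ger0_norm t0) ler_wpM2l.
Qed.

Lemma ccts_A1 t a b : ccts (A^~ t) a b.
Proof.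
rewrite (_ : A^~ t = fun r => f (wscale (rc tau * cis t) ((rc 1 * cis r) *: x + y))); last first.
  by apply/funext => r; rewrite rc1_mul -A_E.
apply: (ccts_circle (g := fun z => f (wscale (rc tau * cis t) (z *: x + y)))) => // z z1.
apply: (cdiff_cont (g := fun z => f (wscale (rc tau * cis t) (z *: x + y)))).
by apply: cdiff_disc; [exact: cabs_tau | rewrite z1].
Qed.

Lemma ccts_A2 r a b : ccts (A r) a b.
Proof. by apply: ccts_fD => //; apply: adm_line; rewrite cabs_cis. Qed.

Lemma hcomp_A s r : hcomp s (cis r *: x + y) = rc (tau ^- s) * cavg (fun t => A r t * cis (- (s%:R * t))).
Proof. by rewrite (hcompE mu0 hf s (adm_line (c := cis r) _))// cabs_cis. Qed.

Lemma ccts_hcomp s a b : ccts (fun r => hcomp s (cis r *: x + y)) a b.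
Proof.
rewrite (_ : (fun r => _) = fun r => rc (tau ^- s) * cavg (fun t => A r t * cis (- (s%:R * t)))); last by apply/funext => r; exact: hcomp_A.
apply: cctsM; first exact: ccts_cst.
apply: ccts_cavg_param; first exact: jcont_mul_cis jcont_A.
by move=> r; apply: cctsM; [exact: ccts_A2 | exact: ccts_cisN].
Qed.

Lemma mean_A (c : C) t : cavg (fun r => A r t * cexp (c * cis r)) = fD (wscale (rc tau * cis t) y).
Proof.
pose g z := f (wscale (rc tau * cis t) (z *: x + y)) * cexp (c * z).
have dg z : cabs z <= 1 -> cdiff g z.
  move=> z1; apply: (cdiffM (f := fun z => f (wscale (rc tau * cis t) (z *: x + y))) (g := fun z => cexp (c * z))).
    by apply: cdiff_disc => //; exact: cabs_tau.
  exact: cdiff_cexpM.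
have g0 : g 0 = fD (wscale (rc tau * cis t) y).
  have := adm_inD (adm_line (c := 0) _) (cabs_tau t); rewrite cabs0 scale0r add0r => /(_ ler01) D0.
  by rewrite /g scale0r add0r mulr0 cexp0 mulr1 /fD D0.
rewrite -g0 -(@disc_mean R g 1 ltr01).
- by apply: eq_cavg => r; rewrite /g rc1_mul -A_E.
- by move=> z /andP[_ z1]; exact: dg.
- move=> e e0; have d0 : cdiff g 0 by apply: dg; rewrite cabs0.
  have [d d1 H] := cdiff_cont d0 e0; exists d => // h hd.
  by have := H h hd; rewrite add0r.
Qed.

(** After exchanging the two averages, each angle [t] leaves a mean of [f] along a complex line,
    where [disc_mean] applies; the factor [cexp (c * z)] equals [1] at the centre. *)
Lemma mean_hcomp s (c : C) : cavg (fun r => hcomp s (cis r *: x + y) * cexp (c * cis r)) = hcomp s y.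
Proof.
have mB : cmfun (fun z : R * R => A z.1 z.2 * cis (- (s%:R * z.2)) * cexp (c * cis z.1)).
  apply: cmfunM; [apply: cmfunM|].
  - apply: (cgoodc_fD hf (u := fun z : R * R => wscale (rc tau * cis z.2) (cis z.1 *: x + y))).
    have mu1 : cmeas (fun z : R * R => cis z.1 *: x + y).
      apply: cmeasD; last exact: cmeas_cst.
      by apply: cmeas_scalec; [apply: cmfun_cis; exact: measurable_fst | exact: cmeas_cst].
    apply: cmeas_row_mx; first exact: cmeas_lsub.
    apply: cmeas_scalec; last exact: cmeas_rsub.
    by apply: cmfunM; [exact: cmfun_cst | apply: cmfun_cis; exact: measurable_snd].
  - by apply: cmfun_cis; apply: measurableT_comp => //; apply: measurable_funM => //; exact: measurable_cst.
  - apply: cmfun_cexp; apply: cmfunM; first exact: cmfun_cst.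
    by apply: cmfun_cis; exact: measurable_fst.
have [M HM] := @joint_bounded R A 0 (2 * pi) jcont_A.
have BM r t : 0 <= r <= 2 * pi -> 0 <= t <= 2 * pi -> cabs (A r t * cis (- (s%:R * t)) * cexp (c * cis r)) <= M * expR (cabs c).
  move=> r1 t1; rewrite (cabsM (_ * _) (cexp _)) (cabsM (A r t)) cabs_cis mulr1 cabs_cexp; apply: ler_pM; rewrite ?cabs_ge0 ?expR_ge0 ?HM//.
  by rewrite ler_expR; apply: le_trans (cre_le_cabs _) _; rewrite cabsM cabs_cis mulr1.
have cE a b : ccts (fun r => cexp (c * cis r)) a b by exact: ccts_cexp.
have cB1 r : ccts (fun t => A r t * cis (- (s%:R * t)) * cexp (c * cis r)) 0 (2 * pi).
  by apply: cctsM; [apply: cctsM; [exact: ccts_A2 | exact: ccts_cisN] | exact: ccts_cst].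
have cB2 t : ccts (fun r => A r t * cis (- (s%:R * t)) * cexp (c * cis r)) 0 (2 * pi).
  exact: cctsM (cctsM (ccts_A1 t 0 (2 * pi)) (ccts_cst _ _ _)) (cE 0 (2 * pi)).
have H := @cavg_swap R (fun r t => A r t * cis (- (s%:R * t)) * cexp (c * cis r)) _ mB BM cB1 cB2.
have cA r : ccts (fun t => A r t * cis (- (s%:R * t))) 0 (2 * pi) by apply: cctsM; [exact: ccts_A2 | exact: ccts_cisN].
have cAE t : ccts (fun r => A r t * cexp (c * cis r)) 0 (2 * pi) by exact: cctsM (ccts_A1 t 0 (2 * pi)) (cE 0 (2 * pi)).
have E1 r : hcomp s (cis r *: x + y) * cexp (c * cis r) =
    rc (tau ^- s) * cavg (fun t => A r t * cis (- (s%:R * t)) * cexp (c * cis r)).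
  rewrite hcomp_A -mulrA; apply: (congr1 (fun k => rc (tau ^- s) * k)).
  exact: esym (cavgZr (cexp (c * cis r)) (cA r)).
have E2 t : cavg (fun r => A r t * cis (- (s%:R * t)) * cexp (c * cis r)) = fD (wscale (rc tau * cis t) y) * cis (- (s%:R * t)).
  rewrite -(mean_A c t) -(cavgZr _ (cAE t)); apply: eq_cavg => r; exact: mulrAC.
have ay : adm tau y by have := adm_line (c := 0); rewrite cabs0 scale0r add0r; apply.
have jB : jcont (fun r t => A r t * cis (- (s%:R * t))) by exact: jcont_mul_cis jcont_A.
have c3 : ccts (fun r => cavg (fun t => A r t * cis (- (s%:R * t)) * cexp (c * cis r))) 0 (2 * pi).
  rewrite (_ : (fun r => _) = fun r => cavg (fun t => A r t * cis (- (s%:R * t))) * cexp (c * cis r)).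
    exact: cctsM (ccts_cavg_param 0 (2 * pi) jB cA) (cE 0 (2 * pi)).
  by apply/funext => r; exact: (cavgZr (cexp (c * cis r)) (cA r)).
rewrite [RHS](hcompE mu0 hf s ay).
exact: etrans (eq_cavg E1) (etrans (cavgZ _ c3) (congr1 (fun k => rc (tau ^- s) * k) (etrans H (eq_cavg E2)))).
Qed.

End PartsMeanValue.

(** * Pairing with the kernel of one degree, and Taylor expansion in [w] *)

Section Coefficients.
Context {R : realType} (n m : nat) (mu nu alpha : R).
Hypotheses (m0 : (0 < m)%N) (mu0 : 0 < mu) (nu1 : -1 < nu) (alpha_gt : (m + n)%:R < alpha).
Local Notation C := (C R).
Local Notation N := (n + m)%N.
Local Notation cwgt := (@cwgt R n m mu nu alpha).
Local Notation Kern := (@Kern R n m mu nu alpha).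
Local Notation lam := (@lam R mu nu alpha).
Local Notation hcoef := (@hcoef R n m nu alpha).
Local Notation gss := (@gss R n m mu nu alpha).
Local Notation Smom := (@Smom R n m nu alpha).
Local Notation inD := (@inD R n m mu).

Lemma cwgt_out x : ~~ inD x -> cwgt x = 0.
Proof.
rewrite /inD -leNgt /cwgt /Wfun => h; rewrite ifF ?mulr0//; apply/negbTE; rewrite -leNgt.
rewrite -(divff (lt0r_neq0 (expR_gt0 (mu * sqn (lsubmx x : 'rV[C]_n))))) ler_wpM2l ?expR_ge0//.
by rewrite -expRN -mulNr.
Qed.

Lemma aw_ge0 c x : 0 <= abs2 c * cwgt x.
Proof. exact: mulr_ge0 (abs2_ge0 _) (cwgt_ge0 alpha mu0 nu1 x). Qed.

Lemma cwgt_rotw t x : cwgt (rotw t x) = cwgt x.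
Proof. by rewrite /cwgt /rotw row_mxKl row_mxKr sqn_rot. Qed.

Lemma Kern_rotw s t x y : Kern s (rotw t x) y = cis (s%:R * t) * Kern s x y.
Proof. by rewrite /Kern /rotw row_mxKl row_mxKr cdotZl exprMn cisX; ring. Qed.

Lemma Kern_scale s (r : R) z v y : Kern s (row_mx z (rc r *: v)) y = rc (r ^+ s) * Kern s (row_mx z v) y.
Proof. by rewrite /Kern !row_mxKl !row_mxKr cdotZl exprMn rcX; ring. Qed.

Lemma Kern_line s x y y' (c : C) : Kern s (c *: x + y') y =
  rc (hcoef s) * (c * cdot (rsubmx x) (rsubmx y) + cdot (rsubmx y') (rsubmx y)) ^+ s *
  cexp (rc (lam s) * (c * cdot (lsubmx x) (lsubmx y) + cdot (lsubmx y') (lsubmx y))).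
Proof. by rewrite /Kern !linearD !linearZ /= !cdotDl !cdotZl. Qed.

Lemma cdiff_aff (a b z : C) : cdiff (fun c => c * a + b) z.
Proof. by apply: cdiffD; [apply: cdiffM; [exact: cdiff_id | exact: cdiff_cst] | exact: cdiff_cst]. Qed.

Lemma cdiff_Kern s x y y' z : cdiff (fun c => Kern s (c *: x + y') y) z.
Proof.
under [X in cdiff X]funext do rewrite Kern_line.
apply: cdiffM; first by apply: cdiffM; [exact: cdiff_cst | apply: cdiffX; exact: cdiff_aff].
by apply: (cdiff_comp (g := fun c => cexp (rc (lam s) * c))); [exact: cdiff_aff | exact: cdiff_cexpM].
Qed.

Lemma whom_abs2_Kern s y : whom s (fun x : 'rV[C]_N => abs2 (Kern s x y)).
Proof. by move=> r z v r0; rewrite Kern_scale abs2M abs2_rc -exprM mulnC. Qed.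

Lemma Kern_wgt_lty s y : (lebC (fun x => (abs2 (Kern s x y) * cwgt x)%:E) < +oo)%E.
Proof.
have gK := @cgoodc_Kern R n m mu nu alpha s y.
rewrite (lebC_transfer m0 mu0 nu1 alpha_gt (s := s) (H := fun x => abs2 (Kern s x y))).
- apply: lte_mul_pinfty => //; first by exact/ltW/mulr_gt0/(Smom_gt0 m0 nu1 alpha_gt)/c0_gt0.
  exact: gbound_lty (gbound_Kern mu0 nu1 alpha_gt s y).
- exact: crgood_abs2.
- by move=> x; exact: abs2_ge0.
- exact: whom_abs2_Kern.
Qed.

Lemma Kern_diag s y : Kern s y y = rc (hcoef s * sqn (rsubmx y : 'rV[C]_m) ^+ s * expR (lam s * sqn (lsubmx y : 'rV[C]_n))).
Proof. by rewrite /Kern !cdot_self -rcM cexp_rc -rcX -!rcM. Qed.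

(** [Kern s ^~ y] satisfies the assumptions of [repro_hom], so it is reproduced by itself. *)
Lemma Kern_norm s y : lebC (fun x => (abs2 (Kern s x y) * cwgt x)%:E) = (cre (Kern s y y))%:E.
Proof.
have gK := @cgoodc_Kern R n m mu nu alpha s y.
have cK x : ccts (fun t => Kern s (cis t *: x + y) y) 0 (2 * pi).
  rewrite (_ : (fun t => _) = fun t => Kern s ((rc 1 * cis t) *: x + y) y); last by apply/funext => t; rewrite rc1_mul.
  apply: (ccts_circle (g := fun c => Kern s (c *: x + y) y)) => // z _.
  by apply: (cdiff_cont (g := fun c => Kern s (c *: x + y) y)); exact: cdiff_Kern.
have vK x c : cavg (fun t => Kern s (cis t *: x + y) y * cexp (c * cis t)) = Kern s y y.
  pose g z := Kern s (z *: x + y) y * cexp (c * z).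
  have dg z : cdiff g z by apply: cdiffM; [exact: cdiff_Kern | exact: cdiff_cexpM].
  have g0 : g 0 = Kern s y y by rewrite /g scale0r add0r mulr0 cexp0 mulr1.
  rewrite -g0 -(@disc_mean R g 1 ltr01).
  - by apply: eq_cavg => t; rewrite /g rc1_mul.
  - by move=> z _; exact: dg.
  - move=> e e0; have [d d0 H] := cdiff_cont (dg 0) e0; exists d => // h hd.
    by have := H h hd; rewrite add0r.
have iK := gbound_lty mu0 nu1 alpha_gt gK (gbound_Kern mu0 nu1 alpha_gt s y).
have [I L] := repro_hom m0 mu0 nu1 alpha_gt gK (fun r z v _ => Kern_scale s r z v y) (fun t x => Kern_rotw s t x y) cK vK iK.
have E x : cre (Kern s x y * cconj (Kern s x y)) * cwgt x = abs2 (Kern s x y) * cwgt x by rewrite mul_conj.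
rewrite (eq_lebr E) lebr_ge0 in L; last by move=> x; exact: aw_ge0.
rewrite -L fineK// ge0_fin_numE ?Kern_wgt_lty//.
by apply: lebC_ge0 => x; exact: aw_ge0.
Qed.

Variable f : 'rV[C]_N -> C.
Hypothesis hf : holo_on f (@Dnm R n m mu).
Hypothesis nf : (lebC (fun x => (abs2 (fD mu f x) * cwgt x)%:E) < +oo)%E.
Local Notation fD := (@fD R n m mu f).
Local Notation hcomp := (@hcomp R n m mu f).

Lemma hcomp_inD s x : inD x -> hcomp s x = cavg (fun t => fD (rotw t x) * cis (- (s%:R * t))).
Proof.
move=> Dx; have a1 : adm mu 1 x by split => //; rewrite expr1n mul1r.
rewrite (hcompE mu0 hf s a1) /hpart expr1n invr1 rc1 mul1r; apply: eq_cavg => t.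
by rewrite rc1_mul.
Qed.

Lemma ccts_fD_rotw x a b : inD x -> ccts (fun t => fD (rotw t x)) a b.
Proof.
move=> Dx; have a1 : adm mu 1 x by split => //; rewrite expr1n mul1r.
have E : (fun t => fD (rotw t x)) = (fun t => fD (wscale (rc 1 * cis t) x)) by apply/funext => t; rewrite rc1_mul.
exact: (eq_ind_r (fun g => ccts g a b) (ccts_fD hf a b a1) E).
Qed.

Lemma ccts_fD_rotw_wgt x a b : ccts (fun t => fD (rotw t x) * rc (cwgt x)) a b.
Proof.
have [Dx|/cwgt_out ->] := boolP (inD x); first by apply: cctsM; [exact: ccts_fD_rotw | exact: ccts_cst].
by under [X in ccts X]funext do rewrite rc0 mulr0; exact: ccts_cst.
Qed.

Lemma hcomp_wgt s x : hcomp s x * rc (cwgt x) = cavg (fun t => fD (rotw t x) * rc (cwgt x) * cis (- (s%:R * t))).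
Proof.
have [Dx|/cwgt_out ->] := boolP (inD x).
  rewrite hcomp_inD// -cavgZr; last by apply: cctsM; [exact: ccts_fD_rotw | exact: ccts_cisN].
  by apply: eq_cavg => t; exact: mulrAC.
by rewrite rc0 mulr0 -[LHS](cavg_cst 0); apply: eq_cavg => t; rewrite mulr0 mul0r.
Qed.

Lemma cint_norm_f : cint (fun x => abs2 (fD x) * cwgt x).
Proof.
split; first by apply: crgoodM; [apply: crgood_abs2; exact: cgoodc_fD | exact: crgood_cwgt].
rewrite (@eq_lebC _ _ _ (fun x => (abs2 (fD x) * cwgt x)%:E))// => x.
by rewrite (ger0_norm (aw_ge0 _ _)).
Qed.

(** By Jensen the squared modulus of the part is at most the average of [|f|^2] over rotations of
    [w], which leave the weight invariant. Homogeneity then moves the finite norm to the Gaussian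
    weight. *)
Lemma hcomp_norm s : (lebC (fun x => (abs2 (hcomp s x) * gss s x)%:E) < +oo)%E.
Proof.
have gh := cgoodc_hcomp mu0 hf s.
pose G t x := abs2 (fD (rotw t x)) * cwgt x.
have gfD := cgoodc_fD hf.
have jG d (T : measurableType d) (p : T -> R) (u : T -> 'rV[C]_N) : measurable_fun setT p -> cmeas u ->
    measurable_fun setT (fun t => G (p t) (u t)).
  move=> mp mu'; apply: measurable_funM; last exact: crgood_cwgt.
  by apply: measurable_abs2; apply: (gfD _ _ (fun t => rotw (p t) (u t))); exact: cmeas_rotw.
have cG x : cts_on (G^~ x) 0 (2 * pi).
  have [Dx|/cwgt_out E] := boolP (inD x); last first.
    by rewrite (_ : G^~ x = fun=> 0); [exact: cts_on_cst | apply/funext => t; rewrite /G E mulr0].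
  have cM : ccts (fun t => fD (rotw t x) * cconj (fD (rotw t x)) * rc (cwgt x)) 0 (2 * pi).
    apply: cctsM; last exact: ccts_cst.
    by apply: cctsM; [exact: ccts_fD_rotw | apply: ccts_conj; exact: ccts_fD_rotw].
  have := cM.1; congr cts_on; apply/funext => t.
  by rewrite mul_conj cre_mul_rc.
have [a aE] : exists a, (lebC (fun x => `|abs2 (fD x) * cwgt x|%:E) = a%:E)%E.
  exists (fine (lebC (fun x => `|abs2 (fD x) * cwgt x|%:E))); rewrite fineK// ge0_fin_numE; first exact: cint_norm_f.2.
  by apply: lebC_ge0 => x; rewrite lee_fin.
have GE t x : G t x = abs2 (fD (rotw t x)) * cwgt (rotw t x) by rewrite cwgt_rotw.
have AG t : (lebC (fun x => `|G t x|%:E) <= a%:E)%E.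
  rewrite -aE (@eq_lebC _ _ _ (fun x => `|abs2 (fD (rotw t x)) * cwgt (rotw t x)|%:E)); last by move=> x; rewrite GE.
  by rewrite (lebC_norm_inv (g := fun x => abs2 (fD x) * cwgt x) (@leb_inv_rotw R n m t)) ?cint_norm_f.1//; exact: cint_norm_f.1.
have IG t : lebr (G t) = lebr (fun x => abs2 (fD x) * cwgt x).
  rewrite (eq_lebr (GE t)).
  by rewrite (lebr_inv (g := fun x => abs2 (fD x) * cwgt x) (@leb_inv_rotw R n m t))//; exact: cint_norm_f.1.
have [iA _] := lebr_avg jG cG AG IG.
have iH : cint (fun x => abs2 (hcomp s x) * cwgt x).
  apply: (le_cint (h := fun x => (2 * pi)^-1 * Int (G^~ x) 0 (2 * pi))) => //.
    by apply: crgoodM; [exact: crgood_abs2 | exact: crgood_cwgt].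
  move=> x; have w0 : 0 <= cwgt x by exact: cwgt_ge0.
  rewrite (ger0_norm (aw_ge0 _ _)).
  have [Dx|/cwgt_out ->] := boolP (inD x); last by rewrite mulr0.
  apply: le_trans (ler_norm _).
  have ch : ccts (fun t => fD (rotw t x) * cis (- (s%:R * t))) 0 (2 * pi).
    by apply: cctsM; [exact: ccts_fD_rotw | exact: ccts_cisN].
  rewrite hcomp_inD//; apply: le_trans (ler_wpM2r w0 (jensen_cavg ch)) _.
  rewrite -mulrA ler_wpM2l ?invr_ge0 ?(ltW (pi2_gt0 (R := R)))// [leLHS]mulrC -IntZ; last first.
    have cM := cctsM ch (ccts_conj ch); have := cM.1; congr cts_on; apply/funext => t.
    by rewrite mul_conj cre_rc.
  rewrite le_eqVlt; apply/orP; left; apply/eqP; congr Int; apply/funext => t.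
  by rewrite /G abs2M abs2_cis mulr1 mulrC.
have h0 : forall x, 0 <= abs2 (hcomp s x) by move=> x; exact: abs2_ge0.
have wh : whom s (fun x => abs2 (hcomp s x)).
  by move=> r z v r0; rewrite (hcomp_scale mu0 hf s z v r0) abs2M abs2_rc -exprM mulnC.
have L := lebC_transfer m0 mu0 nu1 alpha_gt (crgood_abs2 gh) h0 wh.
have c0S : 0 < c0 n m mu * Smom s by rewrite mulr_gt0 ?c0_gt0 ?Smom_gt0.
have : (lebC (fun x => (abs2 (hcomp s x) * cwgt x)%:E) < +oo)%E.
  apply: le_lt_trans iH.2; rewrite le_eqVlt; apply/orP; left; apply/eqP; apply: eq_lebC => x.
  by rewrite (ger0_norm (aw_ge0 _ _)).
rewrite L; case: (lebC _) => [r| |] //=; first by move=> _; rewrite ltry.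
by rewrite gt0_muley ?lte_fin.
Qed.

(** Rotating [w] multiplies [Kern s] by [cis (s * t)]. Averaging over the rotations thus replaces
    [f] by its part of degree [s], which [repro_hom] reproduces. *)
Lemma coef_lebr s y :
  cint (fun x => cre (fD x * cconj (Kern s x y)) * cwgt x) /\
  lebr (fun x => cre (fD x * cconj (Kern s x y)) * cwgt x) = cre (hcomp s y).
Proof.
have gfD := cgoodc_fD hf; have gK := @cgoodc_Kern R n m mu nu alpha s y.
have gKc := cgoodc_conj gK.
have gw := @crgood_cwgt R n m mu nu alpha.
pose g x := cre (fD x * cconj (Kern s x y)) * cwgt x.
have ig : cint g.
  apply: cint_creM => //; first by move=> x; exact: cwgt_ge0.
  rewrite (@eq_lebC _ _ _ (fun x => (abs2 (Kern s x y) * cwgt x)%:E)); last by move=> x; rewrite abs2_conj.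
  exact: Kern_wgt_lty.
split => //.
pose G t x : C := cconj (Kern s x y) * (fD (rotw t x) * rc (cwgt x) * cis (- (s%:R * t))).
have GE t x : cre (G t x) = g (rotw t x).
  rewrite /g /G cwgt_rotw Kern_rotw (conjM (cis _)) -cisN -cre_mul_rc; congr cre; ring.
have jG d (T : measurableType d) (p : T -> R) (u : T -> 'rV[C]_N) : measurable_fun setT p -> cmeas u ->
    measurable_fun setT (fun t => cre (G (p t) (u t))).
  move=> mp mu'; under eq_fun do rewrite GE.
  by apply: (ig.1 _ _ (fun t => rotw (p t) (u t))); exact: cmeas_rotw.
have cG0 x : ccts (fun t => fD (rotw t x) * rc (cwgt x) * cis (- (s%:R * t))) 0 (2 * pi).
  by apply: cctsM; [exact: ccts_fD_rotw_wgt | exact: ccts_cisN].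
have cG x : ccts (G^~ x) 0 (2 * pi) by exact: cctsM (ccts_cst _ _ _) (cG0 x).
have [a aE] : exists a, (lebC (fun x => `|g x|%:E) = a%:E)%E.
  exists (fine (lebC (fun x => `|g x|%:E))); rewrite fineK// ge0_fin_numE; first exact: ig.2.
  by apply: lebC_ge0 => x; rewrite lee_fin.
have AG t : (lebC (fun x => `|cre (G t x)|%:E) <= a%:E)%E.
  rewrite -aE (@eq_lebC _ _ _ (fun x => `|g (rotw t x)|%:E)); last by move=> x; rewrite GE.
  by rewrite (lebC_norm_inv (@leb_inv_rotw R n m t) ig.1).
have IG t : lebr (fun x => cre (G t x)) = lebr g.
  by rewrite (eq_lebr (GE t)) (lebr_inv (@leb_inv_rotw R n m t) ig.1).
have [_ L] := lebr_cavg jG cG AG IG.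
rewrite -[LHS]L.
have E x : cre (cavg (G^~ x)) = cre (hcomp s x * cconj (Kern s x y)) * cwgt x.
  rewrite (cavgZ (cconj (Kern s x y)) (cG0 x)) -hcomp_wgt -cre_mul_rc; congr cre; ring.
rewrite (eq_lebr E).
exact: (repro_hom m0 mu0 nu1 alpha_gt (cgoodc_hcomp mu0 hf s) (fun r z v r0 => hcomp_scale mu0 hf s z v r0)
  (hcomp_rotw mu0 hf s) (fun x => ccts_hcomp mu0 hf x y s 0 (2 * pi)) (fun x c => mean_hcomp mu0 hf x y s c) (hcomp_norm s)).2.
Qed.

(* Taylor expansion of [t |-> f (a, t b)] at [t = 1]. *)
Lemma hcomp_taylor y : inD y -> exists B rho : R, [/\ 0 <= B, 1 < rho &
  forall K, cabs (f y - \sum_(s < K.+1) hcomp s y) <= B * rho ^- K.+1].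
Proof.
move=> Dy; set q := sqn (rsubmx y : 'rV[C]_m); set E := expR (- mu * sqn (lsubmx y : 'rV[C]_n)).
have q0 : 0 <= q by exact: sqn_ge0.
have E0 : 0 < E by exact: expR_gt0.
have qE : q < E by [].
(* As [eps <= 1], one has [(1 + eps) ^ 2 <= 1 + 3 eps], and [3 eps q] is at most [3 / 4] of the gap
   [E - q]. The denominator stays positive even for [q = 0]. *)
pose eps := (E - q) / (4 * (q + E)).
have d0 : 0 < 4 * (q + E) by rewrite mulr_gt0// ltr_wpDl.
have e0 : 0 < eps by rewrite divr_gt0// subr_gt0.
have e1 : eps <= 1 by rewrite ler_pdivrMr//; lra.
have r1 : 1 < 1 + eps by rewrite ltrDl.
have ar : adm mu (1 + eps) y.
  split; first by rewrite addr_gt0.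
  rewrite -/q -/E; apply: (@le_lt_trans _ _ (q + 3 * eps * q)).
    have : 0 <= eps * q * (1 - eps) by apply: mulr_ge0; [exact: mulr_ge0 (ltW e0) q0 | rewrite subr_ge0].
    move=> H; rewrite -subr_ge0.
    by rewrite (_ : q + 3 * eps * q - _ = eps * q * (1 - eps))//; ring.
  have : 3 * eps * q <= 3 / 4 * (E - q).
    rewrite (_ : 3 * eps * q = 3 / 4 * ((E - q) * (q / (q + E)))); last by rewrite /eps; field; rewrite gt_eqF// ltr_wpDl.
    rewrite ler_wpM2l ?divr_ge0// ler_piMr ?subr_ge0 ?(ltW qE)// ler_pdivrMr ?ltr_wpDl// mul1r lerDl ltW//.
  lra.
pose g (c : C) := f (wscale c y).
have dg z : cabs z <= 1 + eps -> cdiff g z by move=> zr; exact: (@cdiff_wscale R n m mu f hf (1 + eps) y z ar zr).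
have [B B0 HB] := taylor_circle r1 dg.
exists B, (1 + eps); split => // K; have := HB K.
rewrite /g (_ : wscale 1 y = y); last by rewrite /wscale scale1r hsubmxK.
rewrite (eq_bigr (fun s : 'I_K.+1 => hcomp s y))// => s _; rewrite (hcomp_inD _ Dy); apply: eq_cavg => t.
rewrite /fD (_ : inD (rotw t y))//.
by rewrite /inD /rotw row_mxKl row_mxKr sqn_rot.
Qed.

End Coefficients.

(** * Summing the kernels *)

Section ComplexSeries.
Context {R : realType}.
Local Notation C := (C R).
Implicit Types (u v : nat -> C) (a b : nat -> R).

Definition ccvg v (L : C) := forall e : R, 0 < e -> exists N, forall k, (N <= k)%N -> cabs (L - v k) <= e.

(** Meaningful for convergent series only; otherwise the limits take a default value. *)
Definition csum u : C := Complex (limn (series (fun s => cre (u s)))) (limn (series (fun s => cim (u s)))).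

Lemma ccvgP v L : ccvg v L -> v @ \oo --> L.
Proof.
move=> H; apply/cvgrPdist_le => e e0.
have eE : e = rc (cre e) by apply: eqC => //; case: (e) e0 => p q; rewrite ltcE /= => /andP[/eqP -> _].
have e0' : 0 < cre e by move: e0; rewrite ltcE /= => /andP[].
have [N HN] := H _ e0'; exists N => // k /= Nk.
by rewrite normE eE lecE /= eqxx; exact: HN.
Qed.

Lemma ccvg_ext u v L : u =1 v -> ccvg u L -> ccvg v L.
Proof. by move=> uv; rewrite (_ : v = u)//; apply/funext => k. Qed.

Lemma ccvgD u v L M : ccvg u L -> ccvg v M -> ccvg (fun k => u k + v k) (L + M).
Proof.
move=> hu hv e e0; have e2 : 0 < e / 2 by rewrite divr_gt0.
have [[N1 H1] [N2 H2]] := (hu _ e2, hv _ e2).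
exists (maxn N1 N2) => k; rewrite geq_max => /andP[k1 k2].
rewrite (_ : _ - _ = (L - u k) + (M - v k)); last by ring.
by apply: le_trans (cabsD _ _) _; rewrite [e]splitr lerD ?H1 ?H2.
Qed.

Lemma ccvgZ (c : C) u L : ccvg u L -> ccvg (fun k => c * u k) (c * L).
Proof.
move=> hu e e0; have c0 : 0 < cabs c + 1 by rewrite ltr_wpDl ?cabs_ge0.
have [N H] := hu _ (divr_gt0 e0 c0); exists N => k Nk.
rewrite -mulrBr cabsM; apply: le_trans (ler_wpM2l (cabs_ge0 c) (H k Nk)) _.
rewrite mulrA ler_pdivrMr// mulrC ler_pM2l// lerDl ler01//.
Qed.

Lemma ccvg_le u L (B : R) : ccvg u L -> (forall k, cabs (u k) <= B) -> cabs L <= B.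
Proof.
move=> hu HB; apply/ler_addgt0Pr => e e0; have [N H] := hu _ e0.
rewrite -[L](subrK (u N)); apply: le_trans (cabsD _ _) _.
by rewrite addrC lerD ?H.
Qed.

Lemma ccvg_shift u L (p : nat) : ccvg u L -> ccvg (fun k => u (k + p)%N) L.
Proof. by move=> hu e e0; have [N H] := hu _ e0; exists N => k Nk; apply: H; rewrite (leq_trans Nk)// leq_addr. Qed.

Lemma series_abs_cvg (w : nat -> R) (M : R) : (forall k, \sum_(s < k) `|w s| <= M) -> cvgn (series w).
Proof.
move=> H; apply: normed_cvg; apply: nondecreasing_is_cvgn.
  by apply: (@nondecreasing_series _ (fun s => `|w s|) xpredT 0%N) => s _ _.
by exists M => _ [k _ <-]; move: (H k); rewrite -(big_mkord xpredT (fun s => `|w s|)).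
Qed.

Lemma ccvg_csum u (M : R) : (forall k, \sum_(s < k) cabs (u s) <= M) -> ccvg (fun k => \sum_(s < k) u s) (csum u).
Proof.
move=> H e e0.
have c1 : cvgn (series (fun s => cre (u s))).
  by apply: (series_abs_cvg (M := M)) => k; apply: le_trans (H k); apply: ler_sum => s _; exact: cabs_re.
have c2 : cvgn (series (fun s => cim (u s))).
  by apply: (series_abs_cvg (M := M)) => k; apply: le_trans (H k); apply: ler_sum => s _; exact: cabs_im.
have e2 : 0 < e / 2 by rewrite divr_gt0.
have /cvgrPdist_le /(_ _ e2) [N1 _ H1] := c1; have /cvgrPdist_le /(_ _ e2) [N2 _ H2] := c2.
exists (maxn N1 N2) => k; rewrite geq_max => /andP[k1 k2].
apply: le_trans (cabs_le _) _; rewrite [e]splitr creB cimB cre_sum cim_sum.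
by have := lerD (H1 k k1) (H2 k k2); rewrite /series /= !big_mkord.
Qed.

(* The power series with these coefficients has radius of convergence at least one. *)
Definition subexp a := forall Q : R, 1 < Q -> exists2 A : R, 0 <= A & forall s, `|a s| <= A * Q ^+ s.

(** Each factor is bounded at the rate [sqrt Q], which is still above [1]. *)
Lemma subexpM a b : subexp a -> subexp b -> subexp (fun s => a s * b s).
Proof.
move=> ha hb Q Q1; have q1 : 1 < Num.sqrt Q by rewrite -sqrtr1 ltr_sqrt// (lt_trans ltr01).
have [A A0 HA] := ha _ q1; have [B B0 HB] := hb _ q1.
exists (A * B) => [|s]; first exact: mulr_ge0.
rewrite normrM; apply: le_trans (ler_pM (normr_ge0 _) (normr_ge0 _) (HA s) (HB s)) _.
by rewrite mulrACA -exprMn -expr2 sqr_sqrtr// ltW// (lt_trans ltr01).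
Qed.

Lemma subexp_le a b (c : R) : subexp b -> (forall s, `|a s| <= c * `|b s|) -> 0 <= c -> subexp a.
Proof.
move=> hb ab c0 Q Q1; have [B B0 HB] := hb _ Q1; exists (c * B) => [|s]; first exact: mulr_ge0.
by apply: le_trans (ab s) _; rewrite -mulrA ler_wpM2l.
Qed.

(** Beyond [N] each step costs at most a factor [Q]; the finite sum of the first terms dominates all
    earlier ones. *)
Lemma subexp_ratio a : (forall s, 0 <= a s) ->
  (forall Q : R, 1 < Q -> exists N, forall s, (N <= s)%N -> a s.+1 <= Q * a s) -> subexp a.
Proof.
move=> a0 H Q Q1; have [N HN] := H _ Q1; have Q0 : 0 <= Q by rewrite (le_trans ler01)// ltW.
exists (\sum_(i < N.+1) a i) => [|s]; first exact: sumr_ge0.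
have Qs k : 1 <= Q ^+ k by rewrite exprn_ege1// ltW.
rewrite ger0_norm//; have [sN|Ns] := leqP s N.
  apply: (@le_trans _ _ (\sum_(i < N.+1) a i)); last by rewrite ler_peMr ?sumr_ge0.
  have sN' : (s < N.+1)%N by [].
  by rewrite (bigD1 (Ordinal sN'))//= lerDl sumr_ge0.
rewrite -(subnKC (ltnW Ns)); elim: (s - N)%N => [|k IH].
  rewrite addn0; apply: (@le_trans _ _ (\sum_(i < N.+1) a i)); last by rewrite ler_peMr ?sumr_ge0.
  by rewrite big_ord_recr /= lerDr sumr_ge0.
rewrite addnS; apply: le_trans (HN _ (leq_addr _ _)) _.
by rewrite exprS mulrCA ler_wpM2l.
Qed.

Lemma geo_sum_le (t : R) k : 0 <= t -> t < 1 -> \sum_(s < k) t ^+ s <= (1 - t)^-1.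
Proof.
move=> t0 t1; have d0 : 0 < 1 - t by rewrite subr_gt0.
rewrite -(ler_pM2l d0) mulfV ?gt_eqF//.
have := subrX1 t k; rewrite -opprB => /(congr1 -%R); rewrite opprK -mulNr opprB => <-.
by rewrite lerBlDr lerDl exprn_ge0.
Qed.

Lemma subexp_sum a (r : R) : subexp a -> 0 <= r -> r < 1 ->
  exists2 M : R, 0 <= M & forall k, \sum_(s < k) `|a s| * r ^+ s <= M.
Proof.
(* This [Q] lies above [1] while [Q * r] stays below [1]. *)
move=> ha r0 r1; pose Q := 2 / (1 + r); have d0 : 0 < 1 + r by rewrite ltr_wpDr.
have Q1 : 1 < Q by rewrite ltr_pdivlMr// mul1r; lra.
have t0 : 0 <= Q * r by rewrite mulr_ge0// divr_ge0// ltW.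
have t1 : Q * r < 1 by rewrite mulrAC ltr_pdivrMr// mul1r; lra.
have [A A0 HA] := ha _ Q1; exists (A * (1 - Q * r)^-1) => [|k].
  by rewrite mulr_ge0// invr_ge0 subr_ge0 ltW.
apply: le_trans (ler_wpM2l A0 (geo_sum_le k t0 t1)); rewrite mulr_sumr; apply: ler_sum => s _.
by rewrite exprMn mulrA ler_wpM2r ?exprn_ge0.
Qed.

Lemma subexp_lin (be : R) : 0 < be -> subexp (fun s => be + s%:R).
Proof.
move=> b0; have p0 s : 0 < be + s%:R by rewrite ltr_pwDl.
apply: subexp_ratio => [s|Q Q1]; first exact: ltW.
have q0 : 0 < Q - 1 by rewrite subr_gt0.
exists (Num.bound (Q - 1)^-1) => s Ns.
have : (Q - 1)^-1 < s%:R.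
  apply: lt_le_trans (archi_boundP _) _; first by rewrite invr_ge0 ltW.
  by rewrite ler_nat.
rewrite -[X in X < _]div1r ltr_pdivrMr// => h.
have h2 : 1 <= (be + s%:R) * (Q - 1) by apply: le_trans (ltW h) _; rewrite mulrC [leRHS]mulrC ler_pM2l// lerDr ltW.
rewrite -natr1; lra.
Qed.

Lemma subexp_natmul a (k : nat) : subexp a -> subexp (fun s => a s ^+ k).
Proof.
move=> ha; elim: k => [|k IH].
  by move=> Q Q1; exists 1 => // s; rewrite expr0 normr1 mul1r exprn_ege1// ltW.
by under [X in subexp X]eq_fun do rewrite exprS; exact: subexpM.
Qed.

(** Second-order remainder of a power, by induction on [s]. The bound is of order
    [s ^ 2 rho ^ (s - 2)], written as a quotient so that small [s] need no separate exponent. *)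
Lemma pow_taylor1 (z h : C) (rho : R) s : 0 < rho -> cabs z <= rho -> cabs (z + h) <= rho ->
  cabs ((z + h) ^+ s - z ^+ s - (s%:R * z ^+ s.-1) * h) <= cabs h ^+ 2 * (s%:R ^+ 2 * rho ^+ s / rho ^+ 2).
Proof.
move=> r0 zr zhr; elim: s => [|s IH].
  by rewrite !expr0 subrr mul0r mul0r subr0 cabs0 expr0n /= mul0r mul0r mulr0.
have E : (z + h) ^+ s.+1 - z ^+ s.+1 - (s.+1%:R * z ^+ s) * h =
   (z + h) * ((z + h) ^+ s - z ^+ s - (s%:R * z ^+ s.-1) * h) + h ^+ 2 * (s%:R * z ^+ s.-1).
  case: s {IH} => [|s] /=; first by rewrite !expr1 !expr0; ring.
  rewrite -[s.+2%:R]natr1 -!/(GRing.exp _ _) !exprS; ring.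
rewrite [s.+1.-1]/= E; apply: le_trans (cabsD _ _) _.
rewrite !cabsM cabsX.
have cs : cabs (s%:R : C) = s%:R.
  have -> : s%:R = rc s%:R :> C.
    by elim: s {IH E} => [|s IHs]; [rewrite rc0 | rewrite -!natr1 rcD -IHs rc1].
  by rewrite cabs_rc normr_nat.
apply: (@le_trans _ _ (rho * (cabs h ^+ 2 * (s%:R ^+ 2 * rho ^+ s / rho ^+ 2)) + cabs h ^+ 2 * (s%:R * rho ^+ s.+1 / rho ^+ 2))).
  apply: lerD; first by apply: ler_pM; rewrite ?cabs_ge0.
  rewrite -expr2 ler_wpM2l ?sqr_ge0// cs -mulrA.
  case: s {IH E cs} => [|s]; first by rewrite !mul0r.
  rewrite ler_wpM2l//.
  rewrite /= -[X in rho ^+ X / _]addn2 exprD mulfK ?expf_neq0 ?gt_eqF//.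
  by rewrite lerXn2r ?nnegrE ?cabs_ge0// ltW.
have ph : 0 <= cabs h ^+ 2 * (rho ^+ s.+1 / rho ^+ 2) by rewrite mulr_ge0 ?sqr_ge0// divr_ge0 ?exprn_ge0 ?(ltW r0).
rewrite -subr_ge0 (_ : _ - _ = cabs h ^+ 2 * (rho ^+ s.+1 / rho ^+ 2) * (s%:R + 1)); first by rewrite mulr_ge0// addr_ge0.
by rewrite -[s.+1%:R]natr1 [rho ^+ s.+1]exprS; field; rewrite gt_eqF.
Qed.

(** Termwise differentiation: the second-order remainders of the powers remain summable on a disc of
    radius [rho] strictly between [|z|] and [1]. *)
Lemma cdiff_power_series a (z : C) : subexp a -> cabs z < 1 -> cdiff (fun c => csum (fun s => rc (a s) * c ^+ s)) z.
Proof.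
move=> ha z1; pose rho := (cabs z + 1) / 2.
have r0 : 0 < rho by rewrite divr_gt0// ltr_wpDl ?cabs_ge0.
have zr : cabs z < rho by rewrite ltr_pdivlMr//; lra.
have r1 : rho < 1 by rewrite ltr_pdivrMr//; lra.
(* The factor [(1 + s) ^ 2] absorbs both the derivatives and the second-order remainders, and leaves
   the growth subexponential. *)
have hs : subexp (fun s => a s * (1 + s%:R) ^+ 2) by apply: subexpM => //; apply: subexp_natmul; exact: subexp_lin.
have [M M0 HM] := subexp_sum hs (ltW r0) r1.
have cs (s : nat) : s%:R = rc s%:R :> C.
  by elim: s => [|s IHs]; [rewrite rc0 | rewrite -!natr1 rcD -IHs rc1].
have c1 c : cabs c <= rho -> ccvg (fun k => \sum_(s < k) rc (a s) * c ^+ s) (csum (fun s => rc (a s) * c ^+ s)).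
  move=> cr; apply: (ccvg_csum (M := M)) => k; apply: le_trans (HM k); apply: ler_sum => s _.
  rewrite cabsM cabsX cabs_rc normrM -mulrA ler_wpM2l//.
  rewrite -[leLHS]mul1r; apply: ler_pM; rewrite ?exprn_ge0 ?cabs_ge0//.
    by rewrite ger0_norm ?sqr_ge0// exprn_ege1// lerDl.
  by rewrite lerXn2r ?nnegrE ?cabs_ge0// ltW.
pose d s := rc (a s) * (s%:R * z ^+ s.-1).
have c2 : ccvg (fun k => \sum_(s < k) d s) (csum d).
  apply: (ccvg_csum (M := M / rho)) => k; rewrite ler_pdivlMr//; apply: le_trans (HM k); rewrite mulr_suml; apply: ler_sum => s _.
  rewrite /d 2!cabsM cabs_rc normrM cs cabs_rc normr_nat -!mulrA ler_wpM2l//.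
  rewrite ger0_norm ?sqr_ge0//; apply: ler_pM => //; first exact: mulr_ge0 (cabs_ge0 _) (ltW r0).
    have s0 : 0 <= s%:R :> R by [].
    nra.
  rewrite cabsX.
  case: (nat_of_ord s) => [|j]; first by rewrite /= !expr0 mul1r ltW.
  by rewrite /= exprSr ler_wpM2r ?(ltW r0)// lerXn2r ?nnegrE ?cabs_ge0 ?(ltW r0) ?(ltW zr).
exists (csum d) => e e0.
pose B := M / rho ^+ 2; have B0 : 0 <= B by rewrite divr_ge0// sqr_ge0.
have B1 : 0 < B + 1 by rewrite ltr_wpDl.
exists (Num.min (rho - cabs z) (e / (B + 1))).
  by rewrite lt_min subr_gt0 zr divr_gt0.
move=> h; rewrite lt_min => /andP[h1 h2].
have zh : cabs (z + h) <= rho by apply: le_trans (cabsD _ _) _; rewrite addrC -lerBrDr ltW.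
have L := ccvgD (ccvgD (c1 _ zh) (ccvgZ (-1) (c1 _ (ltW zr)))) (ccvgZ (- h) c2).
have K : cabs (csum (fun s => rc (a s) * (z + h) ^+ s) - csum (fun s => rc (a s) * z ^+ s) - csum d * h) <= cabs h ^+ 2 * B.
  have lin (p q r : C) : p - q - r * h = p + -1 * q + - h * r by ring.
  rewrite lin.
  apply: (ccvg_le L) => k; rewrite !mulr_sumr -!big_split /=; apply: le_trans (cabs_sum _ _ _) _.
  rewrite /B mulrA ler_pdivlMr ?exprn_gt0//; apply: le_trans (ler_wpM2l (sqr_ge0 _) (HM k)).
  rewrite mulr_sumr mulr_suml; apply: ler_sum => s _.
  rewrite (_ : _ + _ = rc (a s) * ((z + h) ^+ s - z ^+ s - (s%:R * z ^+ s.-1) * h)); last by rewrite /d; ring.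
  rewrite cabsM cabs_rc.
  have T := pow_taylor1 s r0 (ltW zr) zh.
  apply: (@le_trans _ _ (`|a s| * (cabs h ^+ 2 * (s%:R ^+ 2 * rho ^+ s / rho ^+ 2)) * rho ^+ 2)).
    by rewrite ler_wpM2r ?sqr_ge0// ler_wpM2l.
  rewrite (_ : _ * rho ^+ 2 = cabs h ^+ 2 * (`|a s| * s%:R ^+ 2 * rho ^+ s)); last by field; rewrite gt_eqF.
  rewrite ler_wpM2l ?sqr_ge0// ler_wpM2r ?exprn_ge0 ?(ltW r0)// normrM ler_wpM2l// ger0_norm ?sqr_ge0//.
  by rewrite lerXn2r ?nnegrE ?addr_ge0// lerDr.
apply: le_trans K _; rewrite expr2 -mulrA mulrC ler_wpM2r ?cabs_ge0//.
apply: (@le_trans _ _ (e / (B + 1) * B)); first by rewrite ler_wpM2r// ltW.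
by rewrite mulrAC ler_pdivrMr// ler_wpM2l ?(ltW e0)// lerDl.
Qed.

End ComplexSeries.

(** * The kernel as a power series, and its tail *)

Section KernelSeries.
Context {R : realType} (n m : nat) (mu nu alpha : R).
Hypotheses (m0 : (0 < m)%N) (mu0 : 0 < mu) (nu1 : -1 < nu) (alpha_gt : (m + n)%:R < alpha).
Local Notation C := (C R).
Local Notation N := (n + m)%N.
Local Notation cwgt := (@cwgt R n m mu nu alpha).
Local Notation Kern := (@Kern R n m mu nu alpha).
Local Notation lam := (@lam R mu nu alpha).
Local Notation hcoef := (@hcoef R n m nu alpha).
Local Notation inD := (@inD R n m mu).

(** [lam s] is affine in [s], so the kernels of all degrees are one common factor times the terms of
    a power series in the single variable [xi x y]. *)
Definition xi (x y : 'rV[C]_N) : C :=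
  cdot (rsubmx x : 'rV[C]_m) (rsubmx y) * cexp (rc mu * cdot (lsubmx x : 'rV[C]_n) (lsubmx y)).
Definition kfac (x y : 'rV[C]_N) : C := cexp (rc (mu * (alpha * (nu + 1))) * cdot (lsubmx x : 'rV[C]_n) (lsubmx y)).
Definition KK (x y : 'rV[C]_N) : C := kfac x y * csum (fun s => rc (hcoef s) * xi x y ^+ s).
(** The squared norm of the rescaled vector [e^{mu |z|^2 / 2} w]; it is below [1] inside the domain
    and equals [xi] on the diagonal. *)
Definition Xw (x : 'rV[C]_N) : R := sqn (rsubmx x : 'rV[C]_m) * expR (mu * sqn (lsubmx x : 'rV[C]_n)).

Lemma Kern_xi s x y : Kern s x y = kfac x y * (rc (hcoef s) * xi x y ^+ s).
Proof.
rewrite /Kern /xi /kfac exprMn cexp_natmul (_ : rc (lam s) * _ =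
  rc (mu * (alpha * (nu + 1))) * cdot (lsubmx x : 'rV[C]_n) (lsubmx y) + s%:R * (rc mu * cdot (lsubmx x : 'rV[C]_n) (lsubmx y))).
  by rewrite cexpD; move: (cexp _) (cexp _) (cdot _ _) => a b c; ring.
have -> : s%:R = rc s%:R :> C.
  by elim: s => [|s IHs]; [rewrite rc0 | rewrite -!natr1 rcD -IHs rc1].
by rewrite /lam mulrDr rcD !rcM; ring.
Qed.

Lemma Xw_ge0 x : 0 <= Xw x.
Proof. by rewrite mulr_ge0 ?sqn_ge0 ?expR_ge0. Qed.

Lemma Xw_lt1 x : inD x -> Xw x < 1.
Proof. by rewrite /inD /Xw mulNr expRN -[X in _ < X -> _]mul1r ltr_pdivlMr ?expR_gt0. Qed.

Lemma cabs_xi x y : cabs (xi x y) <= (Xw x + Xw y) / 2.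
Proof.
set z := lsubmx x : 'rV[C]_n; set a := lsubmx y : 'rV[C]_n.
rewrite (cabsM _ (cexp _)) cabs_cexp.
(* With this weight in [cabs_cdot], the Gaussian factors combine to exactly [Xw x] and [Xw y]. *)
have c0 : 0 < expR (mu / 2 * (sqn z - sqn a)) by exact: expR_gt0.
have e1 : expR (cre (rc mu * cdot z a)) <= expR (mu / 2 * (sqn z + sqn a)).
  rewrite ler_expR creM /= mul0r subr0 -mulrA ler_wpM2l ?(ltW mu0)//.
  apply: le_trans (cre_le_cabs _) _; apply: le_trans (cabs_cdot z a ltr01) _.
  by rewrite invr1 !mul1r mulrC.
have := ler_pM (cabs_ge0 _) (expR_ge0 _) (cabs_cdot (rsubmx x) (rsubmx y) c0) e1.
move=> h; apply: le_trans h _; rewrite le_eqVlt; apply/orP; left; apply/eqP.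
rewrite /Xw -/z -/a mulrAC -expRN; congr (_ / _); rewrite mulrDl.
rewrite mulrAC -expRD -[X in _ + X]mulrAC -expRD.
congr (_ + _); rewrite mulrC; congr (_ * expR _); by field.
Qed.

Lemma cabs_xi_lt1 x y : inD x -> inD y -> cabs (xi x y) < 1.
Proof.
move=> Dx Dy; apply: le_lt_trans (cabs_xi x y) _.
by rewrite ltr_pdivrMr// mul1r; have := Xw_lt1 Dx; have := Xw_lt1 Dy; lra.
Qed.

(** [Smom_ge] bounds [hcoef s] by a polynomial times [Gamma (alpha + s) / s!], whose successive
    ratios [(alpha + s) / (s + 1)] tend to [1]. *)
Lemma subexp_hcoef : subexp hcoef.
Proof.
have a0 : 0 < alpha := alpha_gt0 alpha_gt; have n0 : 0 < nu + 1 by rewrite -ltrBlDr sub0r.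
have b0 : 0 < (nu + 1) * alpha by exact: mulr_gt0.
have as0 s : 0 < alpha + s%:R by rewrite ltr_pwDl.
have fs0 s : 0 < s`!%:R :> R by rewrite ltr0n fact_gt0.
pose g s : R := Gamma (alpha + s%:R) / s`!%:R.
have g0 s : 0 < g s by rewrite divr_gt0 ?Gamma_gt0.
have hg : subexp g.
  apply: subexp_ratio => [s|Q Q1]; first exact: ltW.
  have q0 : 0 < Q - 1 by rewrite subr_gt0.
  exists (Num.bound (alpha / (Q - 1))) => s Ns.
  have : alpha / (Q - 1) < s%:R.
    apply: lt_le_trans (archi_boundP _) _; first by rewrite divr_ge0 ?(ltW a0) ?(ltW q0).
    by rewrite ler_nat.
  rewrite ltr_pdivrMr// => h.
  rewrite /g -natr1 addrA Gamma_rec// factS natrM -natr1.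
  rewrite (_ : _ / _ = (alpha + s%:R) / (s%:R + 1) * (Gamma (alpha + s%:R) / s`!%:R)); last first.
    by field; rewrite !gt_eqF// ltr_wpDl.
  rewrite ler_wpM2r ?(ltW (g0 s))// ler_pdivrMr ?ltr_wpDl//.
  lra.
pose c := ((nu + 1) ^+ n * Gamma (alpha - m%:R))^-1.
have gm0 : 0 < Gamma (alpha - m%:R) by rewrite Gamma_gt0// (alpha_m_gt0 alpha_gt).
have c0 : 0 < c by rewrite invr_gt0 mulr_gt0 ?exprn_gt0.
apply: (subexp_le (c := c) (subexpM (subexp_natmul n (subexp_lin b0)) hg)); last exact: ltW.
move=> s; have S0 := Smom_gt0 m0 nu1 alpha_gt s.
have p0 : 0 <= ((nu + 1) * alpha + s%:R) ^+ n by rewrite exprn_ge0// addr_ge0// ltW.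
rewrite ger0_norm ?(hcoef_ge0 m0 nu1 alpha_gt)// (ger0_norm (mulr_ge0 p0 (ltW (g0 s)))).
rewrite /hcoef mulrCA; apply: ler_wpM2l => //.
rewrite invfM /g mulrA ler_wpM2r ?invr_ge0 ?(ltW (fs0 s))//.
have G0 : 0 < Gamma (alpha + s%:R) by rewrite Gamma_gt0.
rewrite -[leRHS]invrK lef_pV2 ?posrE ?invr_gt0 ?mulr_gt0//.
apply: le_trans (Smom_ge m0 nu1 alpha_gt s); rewrite /c invfM invrK.
by rewrite mulrA.
Qed.

Lemma ccvg_KK x y : inD x -> inD y -> ccvg (fun k => \sum_(s < k) Kern s x y) (KK x y).
Proof.
move=> Dx Dy; have [M M0 HM] := subexp_sum subexp_hcoef (cabs_ge0 _) (cabs_xi_lt1 Dx Dy).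
apply: (@ccvg_ext _ (fun k => kfac x y * \sum_(s < k) rc (hcoef s) * xi x y ^+ s)).
  by move=> k; rewrite mulr_sumr; apply: eq_bigr => s _; rewrite Kern_xi.
apply: ccvgZ; apply: (ccvg_csum (M := M)) => k; apply: le_trans (HM k); apply: ler_sum => s _.
by rewrite cabsM cabsX cabs_rc.
Qed.

Lemma differentiable_lin k p (c : 'I_p -> C) (i : 'I_p -> 'I_k) (x : 'rV[C]_k) :
  differentiable (fun x : 'rV[C]_k => \sum_j x ord0 (i j) * c j) x.
Proof.
rewrite (_ : (fun x => _) = \sum_(j < p) (fun x : 'rV[C]_k => x ord0 (i j) *: (c j : C))); last first.
  by apply/funext => z; rewrite fct_sumE.
by apply: differentiable_sum => j; apply: differentiableZl; exact: differentiable_coord.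
Qed.

Lemma differentiable_cdot_r (y x : 'rV[C]_N) : differentiable (fun x : 'rV[C]_N => cdot (rsubmx x : 'rV[C]_m) (rsubmx y)) x.
Proof.
rewrite (_ : (fun x => _) = (fun x : 'rV[C]_N => \sum_j x ord0 (rshift n j) * cconj ((rsubmx y : 'rV[C]_m) ord0 j))).
  exact: differentiable_lin.
by apply/funext => z; apply: eq_bigr => j _; rewrite mxE.
Qed.

Lemma differentiable_cdot_l (y x : 'rV[C]_N) : differentiable (fun x : 'rV[C]_N => cdot (lsubmx x : 'rV[C]_n) (lsubmx y)) x.
Proof.
rewrite (_ : (fun x => _) = (fun x : 'rV[C]_N => \sum_j x ord0 (lshift m j) * cconj ((lsubmx y : 'rV[C]_n) ord0 j))).
  exact: differentiable_lin.
by apply/funext => z; apply: eq_bigr => j _; rewrite mxE.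
Qed.

Lemma differentiable_cdiff k (f : 'rV[C]_k -> C) (g : C -> C) x :
  differentiable f x -> cdiff g (f x) -> differentiable (fun x => g (f x)) x.
Proof. by move=> df /cdiffP/derivable1_diffP dg; exact: (differentiable_comp df dg). Qed.

Lemma holo_KK y : inD y -> holo_on (fun x => KK x y) (@Dnm R n m mu).
Proof.
move=> Dy x /inDP Dx; rewrite /KK /kfac.
apply: differentiableM.
  apply: (differentiable_cdiff (g := fun c => cexp (rc (mu * (alpha * (nu + 1))) * c))); last exact: cdiff_cexpM.
  exact: differentiable_cdot_l.
apply: (differentiable_cdiff (f := xi ^~ y) (g := fun c => csum (fun s => rc (hcoef s) * c ^+ s))); last first.
  exact: cdiff_power_series subexp_hcoef (cabs_xi_lt1 Dx Dy).
apply: differentiableM; first exact: differentiable_cdot_r.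
apply: (differentiable_cdiff (g := fun c => cexp (rc mu * c))); last exact: cdiff_cexpM.
exact: differentiable_cdot_l.
Qed.

(** Cauchy-Schwarz with weights; geometric weights will trade summability of the norms for a small
    factor in front of the tail. *)
Lemma weighted_CS (k : nat) (u a : nat -> R) : (forall i, 0 <= u i) -> (forall i, 0 < a i) ->
  (\sum_(i < k) u i) ^+ 2 <= (\sum_(i < k) a i) * \sum_(i < k) (a i)^-1 * u i ^+ 2.
Proof.
move=> u0 a0; elim: k => [|k IH]; first by rewrite !big_ord0 mul0r expr0n.
rewrite !big_ord_recr /=.
have : 0 <= \sum_(i < k) u i by exact: sumr_ge0.
have : 0 <= \sum_(i < k) a i by apply: sumr_ge0 => i _; exact: ltW.
have : 0 <= \sum_(i < k) (a i)^-1 * u i ^+ 2 by apply: sumr_ge0 => i _; rewrite mulr_ge0 ?sqr_ge0// invr_ge0 ltW.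
move: IH (u0 k) (a0 k); move: (\sum_(i < k) u i) (\sum_(i < k) a i) (\sum_(i < k) (a i)^-1 * u i ^+ 2) (u k) (a k).
move=> T A B v b IH v0 b0 B0 A0 T0.
rewrite (_ : (A + b) * _ = A * B + v ^+ 2 + (b * B + b^-1 * A * v ^+ 2)); last by field; rewrite gt_eqF.
rewrite (_ : (T + v) ^+ 2 = T ^+ 2 + v ^+ 2 + 2 * T * v); last by ring.
rewrite !lerD//.
have p0 : 0 <= b * B by rewrite mulr_ge0// ltW.
have q0 : 0 <= b^-1 * A * v ^+ 2 by rewrite mulr_ge0 ?sqr_ge0// mulr_ge0// invr_ge0 ltW.
have [r0 s0] := (mulr_ge0 (mulr_ge0 (ler0n _ 2) T0) v0, addr_ge0 p0 q0).
(* The cross term is compared after squaring: [T ^ 2 <= A B] by induction, and [4 A B v ^ 2] is at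
   most the square of the sum by the arithmetic-geometric inequality. *)
rewrite -(ler_pXn2r (n := 2)) ?nnegrE//.
apply: (@le_trans _ _ (4 * (A * B) * v ^+ 2)).
  rewrite (_ : (2 * T * v) ^+ 2 = 4 * T ^+ 2 * v ^+ 2); last by ring.
  by rewrite ler_wpM2r ?sqr_ge0// ler_wpM2l.
rewrite -subr_ge0 (_ : _ - _ = (b * B - b^-1 * A * v ^+ 2) ^+ 2) ?sqr_ge0//.
by field; rewrite gt_eqF.
Qed.

Section Tail.
Variables (y : 'rV[C]_N) (q : R).
Hypotheses (Dy : inD y) (q0 : 0 < q) (q1 : q < 1) (Xq : Xw y < q).

(** Majorant of all tails. The weights [q ^- s] still leave it integrable because the squared norms
    decay like [Xw y ^ s] up to subexponential factors, and [Xw y < q]. *)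
Let B (x : 'rV[C]_N) : \bar R := (\sum_(0 <= s <oo) (q ^- s * (abs2 (Kern s x y) * cwgt x))%:E)%E.

Lemma maj_ge0 s x : 0 <= q ^- s * (abs2 (Kern s x y) * cwgt x).
Proof. by apply: mulr_ge0; [rewrite invr_ge0 exprn_ge0// ltW | exact: aw_ge0]. Qed.

Lemma crgood_maj s : crgood (fun x => q ^- s * (abs2 (Kern s x y) * cwgt x)).
Proof.
apply: crgoodM; first exact: crgood_cst.
by apply: crgoodM; [apply: crgood_abs2; exact: cgoodc_Kern | exact: crgood_cwgt].
Qed.

Lemma cgood_B : cgood B.
Proof.
move=> d T u mu'; rewrite /B; apply: (ge0_emeasurable_sum (P := xpredT)) => [s x _ _|s _].
  by rewrite lee_fin maj_ge0.
by apply/measurable_EFinP; exact: (crgood_maj s).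
Qed.

Lemma B_ge0 x : (0 <= B x)%E.
Proof. by apply: nneseries_ge0 => s _ _; rewrite lee_fin maj_ge0. Qed.

(** Integrated termwise, the squared norms are the diagonal values by [Kern_norm], which leaves a
    power series at [Xw y / q < 1]. *)
Lemma B_lty : (lebC B < +oo)%E.
Proof.
have [d [T [P [Z [mZ H]]]]] := @lebC_rep R N.
rewrite (H _ cgood_B B_ge0) /B (@integral_nneseries _ _ _ P setT measurableT
  (fun s t => (q ^- s * (abs2 (Kern s (Z t) y) * cwgt (Z t)))%:E)); first last.
- by move=> s t _; rewrite lee_fin maj_ge0.
- by move=> s; apply/measurable_EFinP; exact: (crgood_maj s mZ).
have E s : (\int[P]_t (q ^- s * (abs2 (Kern s (Z t) y) * cwgt (Z t)))%:E)%E = (q ^- s * cre (Kern s y y))%:E.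
  rewrite -(H (fun x => (q ^- s * (abs2 (Kern s x y) * cwgt x))%:E)); first last.
  - by move=> x; rewrite lee_fin maj_ge0.
  - exact: crgoodE (crgood_maj s).
  rewrite EFinM -(Kern_norm m0 mu0 nu1 alpha_gt) -lebCZl.
  - by apply: eq_lebC => x; rewrite -EFinM.
  - by rewrite invr_ge0 exprn_ge0// ltW.
  - by apply: crgoodE; apply: crgoodM; [apply: crgood_abs2; exact: cgoodc_Kern | exact: crgood_cwgt].
  - by move=> x; rewrite lee_fin; exact: aw_ge0.
have t0 : 0 <= Xw y / q by rewrite divr_ge0 ?Xw_ge0// ltW.
have t1 : Xw y / q < 1 by rewrite ltr_pdivrMr// mul1r.
have [M M0 HM] := subexp_sum subexp_hcoef t0 t1.
pose e := expR (mu * (alpha * (nu + 1)) * sqn (lsubmx y : 'rV[C]_n)).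
apply: (@le_lt_trans _ _ (e * M)%:E); last exact: ltry.
apply: lime_le; first by apply: is_cvg_nneseries => s _ _; rewrite E lee_fin Kern_diag /= mulr_ge0 ?invr_ge0 ?exprn_ge0 ?(ltW q0)// mulr_ge0 ?expR_ge0// mulr_ge0 ?exprn_ge0 ?sqn_ge0// hcoef_ge0.
apply: nearW => k; under eq_bigr do rewrite E.
rewrite sumEFin lee_fin big_mkord; apply: le_trans (ler_wpM2l (expR_ge0 _) (HM k)).
rewrite mulr_sumr; apply: ler_sum => s _; rewrite Kern_diag cre_rc ger0_norm ?(hcoef_ge0 m0 nu1 alpha_gt)//.
rewrite le_eqVlt; apply/orP; left; apply/eqP.
rewrite /lam /Xw !exprMn exprVn -expRM_natl.
rewrite (_ : mu * (alpha * (nu + 1) + s%:R) * sqn (lsubmx y : 'rV[C]_n) =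
   mu * (alpha * (nu + 1)) * sqn (lsubmx y : 'rV[C]_n) + s%:R * (mu * sqn (lsubmx y : 'rV[C]_n))); last by ring.
rewrite expRD -/e; move: (expR _) (sqn _) => b c; ring.
Qed.

(** Weighted Cauchy-Schwarz with weights [q ^ (L + i)]: their sum is at most [q ^ L / (1 - q)], and
    the other factor is part of the majorant. *)
Lemma tail_pointwise x L : inD x ->
  ((abs2 (KK x y - \sum_(s < L) Kern s x y) * cwgt x)%:E <= (q ^+ L / (1 - q))%:E * B x)%E.
Proof.
move=> Dx; have w0 := cwgt_ge0 alpha mu0 nu1 x.
have d0 : 0 < 1 - q by rewrite subr_gt0.
have c0 : 0 < q ^+ L / (1 - q) by rewrite divr_gt0// exprn_gt0.
have HB k : ((\sum_(s < k) q ^- s * (abs2 (Kern s x y) * cwgt x))%:E <= B x)%E.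
  rewrite /B -sumEFin -(big_mkord xpredT (fun s => (q ^- s * (abs2 (Kern s x y) * cwgt x))%:E)).
  by apply: nneseries_lim_ge => s _ _; rewrite lee_fin maj_ge0.
(* Where the majorant is infinite the inequality is trivial. *)
have := B_ge0 x; case: (B x) HB => [b| |] //; last by move=> _ _; rewrite gt0_muley ?lte_fin// leey.
move=> HB b0; rewrite -EFinM lee_fin.
have [->|wn0] := eqVneq (cwgt x) 0; first by rewrite mulr0 mulr_ge0// ltW.
have wp : 0 < cwgt x by rewrite lt_neqAle eq_sym wn0.
rewrite -ler_pdivlMr//; set c := (X in _ <= X).
have cc0 : 0 <= c by rewrite divr_ge0// mulr_ge0// ltW.
have cvK := ccvg_shift L (ccvg_KK Dx Dy).
have cvT : ccvg (fun k => \sum_(s < k + L) Kern s x y + (-1) * \sum_(s < L) Kern s x y)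
   (KK x y + (-1) * \sum_(s < L) Kern s x y).
  apply: ccvgD => //; move=> e e0; exists 0%N => k _; rewrite subrr cabs0; exact: ltW.
rewrite -mulN1r -cabs2 -(sqr_sqrtr cc0) lerXn2r ?nnegrE ?cabs_ge0 ?sqrtr_ge0//.
apply: (ccvg_le cvT) => k.
rewrite addnC big_split_ord /= mulN1r addrAC subrr add0r.
rewrite -[leLHS]ger0_norm ?cabs_ge0// -sqrtr_sqr ler_sqrt//.
apply: le_trans (_ : (\sum_(s < k) cabs (Kern (L + s) x y)) ^+ 2 <= _).
  by rewrite lerXn2r ?nnegrE ?cabs_ge0 ?sumr_ge0 ?cabs_sum// => s _; exact: cabs_ge0.
have qi i : 0 < q ^+ (L + i) by exact: exprn_gt0.
apply: le_trans (@weighted_CS k (fun i => cabs (Kern (L + i) x y)) (fun i => q ^+ (L + i)) (fun i => cabs_ge0 _) qi) _.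
rewrite /c -mulrA; apply: ler_pM.
- by apply: sumr_ge0 => s _; exact: ltW.
- by apply: sumr_ge0 => s _; rewrite mulr_ge0 ?sqr_ge0// invr_ge0 ltW.
- under eq_bigr do rewrite exprD.
  by rewrite -mulr_sumr ler_wpM2l ?exprn_ge0 ?(ltW q0)//; apply: geo_sum_le => //; exact: ltW.
rewrite ler_pdivlMr//; have := HB (L + k)%N; rewrite lee_fin big_split_ord /=.
apply: le_trans; rewrite mulr_suml; apply: ler_wpDl; first by apply: sumr_ge0 => s _; exact: maj_ge0.
by apply: ler_sum => s _; rewrite cabs2 -mulrA.
Qed.

End Tail.

(** With [r] halfway between [Xw y] and [1], the pointwise bound integrates to order [r ^ L]; the
    witness [q = sqrt r] presents this as a squared norm. *)
Lemma kern_tail y : inD y -> exists q A : R, [/\ 0 < q, q < 1, 0 <= A &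
  forall L, (lebC (fun x => (abs2 (fD mu (fun x => KK x y) x - \sum_(s < L) Kern s x y) * cwgt x)%:E) <= (A * q ^+ (2 * L))%:E)%E].
Proof.
move=> Dy; have X1 := Xw_lt1 Dy; have X0 := Xw_ge0 y.
pose r := (1 + Xw y) / 2; have r0 : 0 < r by rewrite divr_gt0// ltr_wpDr.
have r1 : r < 1 by rewrite ltr_pdivrMr//; lra.
have Xr : Xw y < r by rewrite ltr_pdivlMr//; lra.
have d0 : 0 < 1 - r by rewrite subr_gt0.
have [cB B0] := (cgood_B y r0, fun x => B_ge0 y r0 x).
have Bf := B_lty r0 Xr.
set B := (fun x => _) in cB B0 Bf.
have [b bE] : exists b, lebC B = b%:E by exists (fine (lebC B)); rewrite fineK// ge0_fin_numE// lebC_ge0.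
have b0 : 0 <= b by rewrite -lee_fin -bE lebC_ge0.
exists (Num.sqrt r), (b / (1 - r)); split.
- by rewrite sqrtr_gt0.
- by rewrite -sqrtr1 ltr_sqrt.
- by rewrite divr_ge0// ltW.
move=> L; rewrite exprM sqr_sqrtr ?(ltW r0)//.
have c0 : 0 <= r ^+ L / (1 - r) by rewrite divr_ge0 ?exprn_ge0// ltW.
rewrite (_ : b / (1 - r) * r ^+ L = r ^+ L / (1 - r) * b); last by ring.
rewrite EFinM -bE -lebCZl//.
apply: le_lebC.
- apply: crgoodE; apply: crgoodM; last exact: crgood_cwgt.
  apply: crgood_abs2 => d T u mu'; under eq_fun do rewrite -mulN1r mulr_sumr.
  apply: cmfunD; first exact: (cgoodc_fD (holo_KK Dy)).
  by apply: cmfun_sum => s; apply: cmfunM; [exact: cmfun_cst | exact: (@cgoodc_Kern R n m mu nu alpha s y)].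
- by move=> d T u mu'; apply: measurable_funeM; exact: cB.
- by move=> x; rewrite lee_fin; exact: aw_ge0.
- move=> x; have [Dx|Dx] := boolP (inD x); last first.
    have c0' : (0 <= (r ^+ L / (1 - r))%:E)%E by rewrite lee_fin.
    by rewrite (cwgt_out _ _ Dx) mulr0; exact: mule_ge0 c0' (B0 x).
  by rewrite /fD Dx; exact: tail_pointwise.
Qed.

End KernelSeries.

(** * The formula on the diagonal *)

Section Expansion.
Context {R : realType} (n m : nat) (mu nu alpha : R).
Hypotheses (m0 : (0 < m)%N) (mu0 : 0 < mu) (nu1 : -1 < nu) (alpha_gt : (m + n)%:R < alpha).
Local Notation C := (C R).
Local Notation N := (n + m)%N.
Local Notation Kern := (@Kern R n m mu nu alpha).

(** [P p a] says that [p] agrees with the exponential series of [a] up to degree [K]. The binomial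
    theorem makes this stable under products, and truncation is invisible in those degrees. *)
Lemma coef_exp_prod K (I : finType) (x : I -> R) s : (s <= K)%N ->
  (\prod_i \sum_(j < K.+1) ((x i ^+ j / j`!%:R) *: 'X^j) : {poly R})`_s = (\sum_i x i) ^+ s / s`!%:R.
Proof.
have f0 j : j`!%:R != 0 :> R by rewrite pnatr_eq0 -lt0n fact_gt0.
move: s; pose P (p : {poly R}) (a : R) := forall s, (s <= K)%N -> p`_s = a ^+ s / s`!%:R.
suff : P (\prod_i \sum_(j < K.+1) ((x i ^+ j / j`!%:R) *: 'X^j)) (\sum_i x i) by [].
apply: (big_ind2 P).
- by move=> [|s] _; rewrite coef1 ?expr0 ?divr1// expr0n mul0r.
- move=> p a q b hp hq s sK; rewrite coefMr exprDn mulr_suml; apply: eq_bigr => j _.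
  have js : (j <= s)%N by rewrite -ltnS.
  rewrite (hp _ (leq_trans (leq_subr _ _) sK)) (hq _ (leq_trans js sK)) -mulr_natr.
  have /(congr1 (fun k => k%:R : R)) := bin_fact js; rewrite !natrM => <-.
  have c0 : 'C(s, j)%:R != 0 :> R by rewrite pnatr_eq0 -lt0n bin_gt0.
  by field; rewrite c0 !f0.
- move=> i _ s sK; rewrite coef_sum (bigD1 (Ordinal (sK : (s < K.+1)%N)))//= coefZ coefXn eqxx mulr1.
  rewrite big1 ?addr0// => j js; rewrite coefZ coefXn (_ : (s == j) = false) ?mulr0//.
  by apply: contra_neqF js => /eqP sj; apply: val_inj.
Qed.

(** Expand the product of truncated exponentials by choosing one exponent per index; the choices of
    total degree [s] make up the coefficient of that degree. *)
Lemma multinomial_exp K (I : finType) (x : I -> R) s : (s <= K)%N ->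
  \sum_(f : {ffun I -> 'I_K.+1} | (\sum_i f i == s)%N) \prod_i (x i ^+ f i / (f i)`!%:R) = (\sum_i x i) ^+ s / s`!%:R.
Proof.
move=> sK; rewrite -(coef_exp_prod x sK) bigA_distr_bigA coef_sum.
rewrite [RHS](bigID (fun f : {ffun I -> 'I_K.+1} => (\sum_i f i == s)%N)) /= [X in _ = _ + X]big1 ?addr0; last first.
  move=> f fs; rewrite scaler_prod prodrXr coefZ coefXn eq_sym (negbTE fs) mulr0//.
by apply: eq_bigr => f fs; rewrite [in RHS]scaler_prod [in RHS]prodrXr coefZ coefXn eq_sym fs mulr1.
Qed.

(** [poch] equals [Gamma alpha / Gamma (alpha - m - n)], which cancels against the Gamma factors of
    [psi] and of the summand. Only [chi] and the factorials remain. *)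
Lemma ktermE (p : 'rV[C]_N) (q : 'I_m -> nat) :
  rc (poch (alpha - m%:R - n%:R) (m + n) * expR (mu * (nu + 1) * alpha * sqn (lsubmx p : 'rV[C]_n))) * kterm mu nu alpha p q =
  rc (expR (mu * (nu + 1) * alpha * sqn (lsubmx p : 'rV[C]_n)) * chi n m nu alpha (qabs q) *
    \prod_i ((expR (mu * sqn (lsubmx p : 'rV[C]_n)) * abs2 ((rsubmx p : 'rV[C]_m) ord0 i)) ^+ q i / (q i)`!%:R)).
Proof.
have a0 := alpha_gt0 alpha_gt.
have G0 := Gamma_gt0 a0.
have d0 : 0 < alpha - m%:R - n%:R by exact: (alpha_sub_gt0 alpha_gt ord_max).
have G1 := Gamma_gt0 d0.
have G2 : 0 < Gamma (alpha + (qabs q)%:R) by rewrite Gamma_gt0// ltr_pwDl.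
rewrite /kterm mul_conj -!rcM; congr rc.
have -> : abs2 (\prod_(i < m) (rc (expR (mu / 2 * sqn (lsubmx p : 'rV[C]_n))) * (rsubmx p : 'rV[C]_m) ord0 i) ^+ q i) =
   \prod_i (expR (mu * sqn (lsubmx p : 'rV[C]_n)) * abs2 ((rsubmx p : 'rV[C]_m) ord0 i)) ^+ q i.
  rewrite (big_morph _ (@abs2M R) (@abs2_1 R)); apply: eq_bigr => i _.
  rewrite abs2X abs2M abs2_rc -expRM_natl; congr ((expR _ * _) ^+ _); by field.
have -> : \prod_(i < m) Gamma ((q i)%:R + 1) = \prod_(i < m) (q i)`!%:R :> R.
  by apply: eq_bigr => i _; rewrite natr1 Gamma_nat.
rewrite prodf_div.
have F0 : \prod_i (q i)`!%:R != 0 :> R by apply/prodf_neq0 => i _; rewrite pnatr_eq0 -lt0n fact_gt0.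
rewrite /psi /poch [(qabs q)%:R + alpha]addrC.
have -> : alpha - m%:R - n%:R + (m + n)%:R = alpha by rewrite natrD; ring.
move: (\prod_i _) (\prod_i _) F0 (expR _) (chi _ _ _ _ _) => Y F F0 E ch.
move: (Gamma alpha) (Gamma (alpha - _ - _)) (Gamma (alpha + _)) G0 G1 G2 => g0 g1 g2 h0 h1 h2.
by field; rewrite F0 !gt_eqF.
Qed.

Lemma Kern_chi s (p : 'rV[C]_N) : Kern s p p =
  rc (expR (mu * (nu + 1) * alpha * sqn (lsubmx p : 'rV[C]_n)) * chi n m nu alpha s *
    ((\sum_i expR (mu * sqn (lsubmx p : 'rV[C]_n)) * abs2 ((rsubmx p : 'rV[C]_m) ord0 i)) ^+ s / s`!%:R)).
Proof.
rewrite Kern_diag -mulr_sumr -/(sqn _) exprMn -expRM_natl; congr rc.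
rewrite /hcoef /chi -/(@Smom R n m nu alpha s) /lam invfM.
rewrite (_ : mu * (alpha * (nu + 1) + s%:R) * sqn (lsubmx p : 'rV[C]_n) =
   mu * (nu + 1) * alpha * sqn (lsubmx p : 'rV[C]_n) + s%:R * (mu * sqn (lsubmx p : 'rV[C]_n))); last by ring.
by rewrite expRD; move: (expR _) (expR _) (Smom _ _ _ _ _)^-1 => a b c; ring.
Qed.

Lemma kpartialE (p : 'rV[C]_N) K :
  rc (poch (alpha - m%:R - n%:R) (m + n) * expR (mu * (nu + 1) * alpha * sqn (lsubmx p : 'rV[C]_n))) * kpartial mu nu alpha p K =
  \sum_(s < K.+1) Kern s p p.
Proof.
rewrite /kpartial mulr_sumr.
(* Multi-indices are grouped by total degree; [inord] loses nothing, as that degree is at most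
   [K]. *)
rewrite (partition_big (fun q : {ffun 'I_m -> 'I_K.+1} => inord (qabs (fun i => (q i : nat))) : 'I_K.+1) xpredT)//=.
apply: eq_bigr => s _; rewrite Kern_chi -(multinomial_exp _ (ltn_ord s : (s <= K)%N)).
rewrite [in RHS]mulr_sumr rc_sum; apply: eq_big => [q|q /andP[qK /eqP qs]].
  apply/andP/eqP => [[qK /eqP <-]|qs]; first by rewrite inordK.
  rewrite /qabs qs -ltnS ltn_ord; split => //; apply/eqP/val_inj; by rewrite /= inordK.
by rewrite ktermE -[qabs _ in LHS](_ : nat_of_ord s = _)// -qs inordK.
Qed.

Lemma kformula_KK (p : 'rV[C]_N) : inD mu p -> kformula_is mu nu alpha p (KK mu nu alpha p p).
Proof.
move=> Dp; rewrite /kformula_is; apply: ccvgP.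
(* The partial sum up to degree [K] contains [K + 1] kernels, hence the shift. *)
apply: (ccvg_ext (u := fun K => \sum_(s < K + 1) Kern s p p)); last exact: ccvg_shift (ccvg_KK m0 mu0 nu1 alpha_gt Dp Dp).
by move=> K; rewrite addn1 kpartialE.
Qed.

End Expansion.

(** * The reproducing property of the summed kernel *)

Section Reproducing.
Context {R : realType} (n m : nat) (mu nu alpha : R).
Hypotheses (m0 : (0 < m)%N) (mu0 : 0 < mu) (nu1 : -1 < nu) (alpha_gt : (m + n)%:R < alpha).
Local Notation C := (C R).
Local Notation N := (n + m)%N.
Local Notation Kern := (@Kern R n m mu nu alpha).
Local Notation cwgt := (@cwgt R n m mu nu alpha).
Local Notation KK := (@KK R n m mu nu alpha).
Local Notation fD := (@fD R n m mu).
Local Notation inD := (@inD R n m mu).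

(** The weight vanishes off the domain, where [f] and [fD f] may differ. *)
Lemma normH2_fD (f : 'rV[C]_N -> C) :
  normH2 mu nu alpha f = lebC (fun x => (abs2 (fD f x) * cwgt x)%:E).
Proof.
rewrite /normH2 /lebC; congr intC; apply/funext => u.
rewrite wgtE /fD; case: ifPn => // /cwgt_out ->.
by rewrite !mulr0.
Qed.

Lemma innerH_fD (f g : 'rV[C]_N -> C) : innerH mu nu alpha f g =
  Complex (lebr (fun x => cre (fD f x * cconj (fD g x)) * cwgt x))
          (lebr (fun x => cim (fD f x * cconj (fD g x)) * cwgt x)).
Proof.
have E (p : C -> R) : intCr (fun u => p (f (toC u) * cconj (g (toC u))) * wgt mu nu alpha u) =
    lebr (fun x => p (fD f x * cconj (fD g x)) * cwgt x).
  rewrite -[RHS]/(intCr (fun u => p (fD f (toC u) * cconj (fD g (toC u))) * cwgt (toC u))).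
  congr intCr; apply/funext => u; rewrite wgtE /fD; case: ifPn => // /cwgt_out ->.
  by rewrite !mulr0.
by rewrite /innerH !E.
Qed.

Lemma geometric_eq (a b p q c d : R) : 0 <= p -> p < 1 -> 0 <= q -> q < 1 ->
  (forall k : nat, `|a - b| <= c * p ^+ k + d * q ^+ k) -> a = b.
Proof.
move=> p0 p1 q0 q1 H; apply/eqP; rewrite -subr_eq0 -normr_le0.
have cp : geometric c p @ \oo --> (0 : R) by apply: cvg_geometric; rewrite ger0_norm.
have cq : geometric d q @ \oo --> (0 : R) by apply: cvg_geometric; rewrite ger0_norm.
have cs : geometric c p \+ geometric d q @ \oo --> (0 + 0 : R) by exact: cvgD.
rewrite addr0 in cs; rewrite -(cvg_lim _ cs)//; apply: limr_ge; first by apply/cvg_ex; exists 0.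
by apply: nearW => k; exact: H.
Qed.

Lemma inH_KK y : inD y -> inH mu nu alpha (fun x => KK x y).
Proof.
move=> Dy; split; first exact: holo_KK.
have [q [A [q0 q1 A0 H]]] := kern_tail m0 mu0 nu1 alpha_gt Dy.
rewrite normH2_fD; apply: le_lt_trans (ltry (A * q ^+ (2 * 0))); apply: le_trans (H 0%N).
rewrite le_eqVlt; apply/orP; left; apply/eqP; apply: eq_lebC => x.
by rewrite big_ord0 subr0.
Qed.

(** The kernel is split into a partial sum and a tail. The partial sum pairs with [f] to the Taylor
    polynomial of [f] at [y] in the direction [w], the tail pairing is small, and both errors are
    geometric. *)
Lemma repr_re (f : 'rV[C]_N -> C) y : holo_on f (@Dnm R n m mu) ->
  (lebC (fun x => (abs2 (fD f x) * cwgt x)%:E) < +oo)%E -> inD y ->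
  lebr (fun x => cre (fD f x * cconj (fD (fun x => KK x y) x)) * cwgt x) = cre (f y).
Proof.
move=> hf nf Dy; set K := fun x => KK x y.
have hK : holo_on K (@Dnm R n m mu) by exact: holo_KK.
have gf : cgoodc (fD f) by exact: cgoodc_fD hf.
have gK : cgoodc (fD K) by exact: cgoodc_fD hK.
have gw := @crgood_cwgt R n m mu nu alpha.
have [q [A [q0 q1 A0 HA]]] := kern_tail m0 mu0 nu1 alpha_gt Dy.
pose h s x := cre (fD f x * cconj (Kern s x y)) * cwgt x.
have ch s : cint (h s) /\ lebr (h s) = cre (hcomp mu f s y) by exact: coef_lebr.
pose S k x := \sum_(s < k) Kern s x y.
have gS k : cgoodc (S k).
  by move=> d T u mu'; apply: cmfun_sum => s; exact: (@cgoodc_Kern R n m mu nu alpha s y).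
have cS k : cint (fun x => cre (fD f x * cconj (S k x)) * cwgt x) /\
    lebr (fun x => cre (fD f x * cconj (S k x)) * cwgt x) = \sum_(s < k) cre (hcomp mu f s y).
  elim: k => [|k [IH1 IH2]].
    (* The empty sum is written as a multiple of an integrable function, to reuse scaling for its
       integrability and its integral. *)
    have E x : cre (fD f x * cconj (S 0%N x)) * cwgt x = 0 * h 0%N x.
      by rewrite /S big_ord0 conj0 mulr0 !mul0r.
    split; first by apply: (eq_cint (fun x => esym (E x))); apply: cintZ; exact: (ch 0%N).1.
    by rewrite (eq_lebr E) lebrZ ?big_ord0 ?mul0r//; exact: (ch 0%N).1.
  have E x : cre (fD f x * cconj (S k.+1 x)) * cwgt x = cre (fD f x * cconj (S k x)) * cwgt x + h k x.
    by rewrite /S big_ord_recr /= conjD mulrDr creD mulrDl.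
  split; first by apply: (eq_cint (fun x => esym (E x))); apply: cintD => //; exact: (ch k).1.
  by rewrite (eq_lebr E) lebrD ?IH2 ?(ch k).2 ?big_ord_recr//; exact: (ch k).1.
pose T k x := fD K x - S k x.
have gT k : cgoodc (T k).
  move=> d U u mu'; rewrite /T; under eq_fun do rewrite -mulN1r.
  by apply: cmfunD; [exact: gK | apply: cmfunM; [exact: cmfun_cst | exact: gS]].
have nT k : (lebC (fun x => (abs2 (T k x) * cwgt x)%:E) <= (A * q ^+ (2 * k))%:E)%E by exact: HA.
have iabs (G : 'rV[C]_N -> C) : cgoodc G -> (lebC (fun x => (abs2 (G x) * cwgt x)%:E) < +oo)%E ->
    cint (fun x => abs2 (G x) * cwgt x).
  move=> mG iG; split; first by apply: crgoodM => //; exact: crgood_abs2.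
  rewrite (@eq_lebC _ _ _ (fun x => (abs2 (G x) * cwgt x)%:E))// => x.
  by rewrite (ger0_norm (aw_ge0 alpha mu0 nu1 _ _)).
have iT k : cint (fun x => abs2 (T k x) * cwgt x).
  by apply: iabs => //; apply: le_lt_trans (nT k) (ltry _).
have iF : cint (fun x => abs2 (fD f x) * cwgt x) by exact: iabs.
have lT k : lebr (fun x => abs2 (T k x) * cwgt x) <= A * q ^+ (2 * k).
  rewrite lebr_ge0; last by move=> x; exact: aw_ge0.
  rewrite -lee_fin fineK//; rewrite ge0_fin_numE; first exact: le_lt_trans (nT k) (ltry _).
  by apply: lebC_ge0 => x; exact: aw_ge0.
set F := lebr (fun x => abs2 (fD f x) * cwgt x).
have iTc k : cint (fun x => cre (fD f x * cconj (T k x)) * cwgt x).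
  apply: cint_creM => //; [exact: cgoodc_conj | by move=> x; exact: cwgt_ge0 |].
  rewrite (@eq_lebC _ _ _ (fun x => (abs2 (T k x) * cwgt x)%:E)); last by move=> x; rewrite abs2_conj.
  exact: le_lt_trans (nT k) (ltry _).
(* The tail has squared norm at most [A q ^ (2 k)]; weighting the arithmetic-geometric inequality by
   [q ^ k] makes both of its terms of order [q ^ k]. *)
have bT k : `|lebr (fun x => cre (fD f x * cconj (T k x)) * cwgt x)| <= (F + A) / 2 * q ^+ k.
  have qk : 0 < q ^+ k by exact: exprn_gt0.
  pose D x := q ^+ k / 2 * (abs2 (fD f x) * cwgt x) + (q ^+ k)^-1 / 2 * (abs2 (T k x) * cwgt x).
  have iD : cint D by apply: cintD; exact: cintZ.
  have D0 x : 0 <= D x.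
    by apply: addr_ge0; apply: mulr_ge0; rewrite ?divr_ge0 ?invr_ge0 ?(ltW qk) ?(aw_ge0 alpha mu0 nu1).
  have lD : lebr D <= (F + A) / 2 * q ^+ k.
    rewrite lebrD; [|exact: cintZ|exact: cintZ].
    rewrite !lebrZ//.
    apply: (@le_trans _ _ (q ^+ k / 2 * F + (q ^+ k)^-1 / 2 * (A * q ^+ (2 * k)))).
      by rewrite lerD2l ler_wpM2l ?divr_ge0 ?invr_ge0 ?(ltW qk).
    rewrite mul2n -addnn exprD le_eqVlt; apply/orP; left; apply/eqP; move: (q ^+ k) qk => t t0.
    by field; rewrite gt_eqF.
  apply: le_trans lD; rewrite -lee_fin; apply: le_trans (lebr_norm (iTc k)) _.
  rewrite lebr_ge0// fineK; last first.
    rewrite ge0_fin_numE; last by apply: lebC_ge0 => x; rewrite lee_fin.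
    by apply: le_lt_trans iD.2; rewrite le_eqVlt; apply/orP; left; apply/eqP; apply: eq_lebC => x; rewrite ger0_norm.
  apply: le_lebC.
  - by apply: crgoodE; apply: crgood_norm; exact: (iTc k).1.
  - exact: crgoodE iD.1.
  - by move=> x; rewrite lee_fin.
  - move=> x; have w0 := cwgt_ge0 alpha mu0 nu1 x.
    have := @abs_creM_le R (q ^+ k) (fD f x) (cconj (T k x)) qk; rewrite abs2_conj => H.
    rewrite lee_fin normrM (ger0_norm w0) /D; move: (cwgt x) w0 => w w0.
    by rewrite !mulrA -mulrDl ler_wpM2r.
have Lk k : lebr (fun x => cre (fD f x * cconj (fD K x)) * cwgt x) =
    \sum_(s < k) cre (hcomp mu f s y) + lebr (fun x => cre (fD f x * cconj (T k x)) * cwgt x).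
  rewrite -(cS k).2 -lebrD; [|exact: (cS k).1|exact: iTc].
  apply: eq_lebr => x; rewrite -mulrDl -creD -mulrDr -conjD /T; congr (cre (_ * cconj _) * _); ring.
have [B [rho [B0 r1 HB]]] := hcomp_taylor mu0 hf Dy.
have r0 : 0 < rho by exact: lt_trans ltr01 r1.
have ri1 : rho^-1 < 1 by rewrite invf_lt1.
(* The bounds are used at [k + 1], to match the number of terms in [hcomp_taylor]; hence the extra
   factors [q] and [rho ^-1] in the constants. *)
apply: (@geometric_eq _ _ q rho^-1 ((F + A) / 2 * q) (B / rho)) => //; try exact: ltW.
  by rewrite invr_ge0 ltW.
move=> k; rewrite (Lk k.+1) addrAC -cre_sum -creB [leRHS]addrC.
apply: le_trans (ler_normD _ _) _; apply: lerD; last by rewrite -mulrA -exprS; exact: bT.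
rewrite -mulrA -exprS exprVn; apply: le_trans (cabs_re _) _.
by rewrite cabsB; exact: HB.
Qed.

(** The imaginary part of [f] is the real part of [- i f], which belongs to the same space with the
    same norm. *)
Lemma repr_KK (f : 'rV[C]_N -> C) y : inH mu nu alpha f -> inD y ->
  f y = innerH mu nu alpha f (fun x => KK x y).
Proof.
move=> [hf nf] Dy; rewrite normH2_fD in nf.
pose f' x := - ii * f x.
have hf' : holo_on f' (@Dnm R n m mu).
  move=> p Dp; apply: (differentiable_cdiff (g := fun c => - ii * c)) (hf p Dp) _.
  by apply: cdiffM; [exact: cdiff_cst | exact: cdiff_id].
have E x : fD f' x = - ii * fD f x by rewrite /fD /f'; case: ifP => //; rewrite mulr0.
have ai : abs2 (- ii : C) = 1 by rewrite /abs2 !cE /=; ring.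
have nf' : (lebC (fun x => (abs2 (fD f' x) * cwgt x)%:E) < +oo)%E.
  by rewrite (@eq_lebC _ _ _ (fun x => (abs2 (fD f x) * cwgt x)%:E))// => x; rewrite E abs2M ai mul1r.
have cI (z : C) : cre (- ii * z) = cim z by rewrite !cE /=; ring.
rewrite innerH_fD; apply: eqC; first by rewrite /= repr_re.
rewrite [RHS]/= -[LHS]cI -[_ * f y]/(f' y) -(repr_re hf' nf' Dy).
by apply: eq_lebr => x; rewrite E -mulrA cI.
Qed.

End Reproducing.

Theorem theorem2p6 (R : realType) (n m : nat) (mu nu alpha : R)
  (hn : (1 <= n)%N) (hm : (1 <= m)%N) (hmu : 0 < mu) (hnu : -1 < nu)
  (halpha : (m + n)%:R < alpha) :
  exists K : 'rV[C R]_(n + m) -> 'rV[C R]_(n + m) -> C R,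
    is_repr_kernel mu nu alpha K /\
    forall p, Dnm mu p -> kformula_is mu nu alpha p (K p p).
Proof.
exists (KK mu nu alpha); split; last by move=> p /inDP Dp; exact: kformula_KK.
split=> [y /inDP Dy|f hf y /inDP Dy]; first exact: inH_KK.
exact: repr_KK.
Qed.
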